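(* Let $q\in[1,\infty)$, $T\in\mathcal K_q$, and $b\in\mathrm{BMO}$. Then there exists a positive constant $C$ such that, for any $f\in H_1^b$, $$\|[T,b](f)\|_{L^q}\le C\|f\|_{H_1^b}.$$
   Context: $\mathbb Z_+=\{0,1,2,\dots\}$. $(\Omega,\mathcal F,\mathbb P)$ is a complete probability space and $(\mathcal F_n)_{n\in\mathbb Z_+}$ is an increasing sequence of sub-$\sigma$-algebras of $\mathcal F$ with $\mathcal F=\sigma(\bigcup_n\mathcal F_n)$ and $\mathcal F_0=\{\emptyset,\Omega\}$; $\mathbb E_n$ is the conditional expectation given $\mathcal F_n$, $\mathbb E_{-1}:=0$. For a martingale $f=(f_n)$: $f_{-1}:=0$, $d_nf:=f_n-f_{n-1}$, $S(f):=(\sum_{n\ge0}|d_nf|^2)^{1/2}$, $s(f):=(|d_0f|^2+\sum_{n\ge1}\mathbb E_{n-1}|d_nf|^2)^{1/2}$. An $L^1$ function $f$ is identified with the martingale $(\mathbb E_n f)_n$. $H_1$: martingales with $\|f\|_{H_1}:=\|S(f)\|_{L^1}<\infty$. $\mathrm{BMO}$: martingales with $\|f\|_{\mathrm{BMO}_p}:=\sup_{n\in\mathbb Z_+}\|\mathbb E_n(|f-f_{n-1}|^p)\|_{L^\infty}^{1/p}<\infty$ (equivalent norms for all $p\in[1,\infty)$). $\|f\|_{L^{q,\infty}}:=\sup_{t>0}t\,[\mathbb P(|f|>t)]^{1/q}$. Sublinear operator: $|T(\alpha f+\beta g)|\le|\alpha||Tf|+|\beta||Tg|$ for all functions $f,g$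 and scalars $\alpha,\beta$. Commutator: for $f\in L^2$, $b\in\mathrm{BMO}$ and $x\in\Omega$, $[T,b](f)(x):=T(bf-b(x)f)(x)$ (if $T$ is linear, $[T,b](f)=T(bf)-bT(f)$; in particular $[\mathbb E_n,b](f)=\mathbb E_n(bf)-b\,\mathbb E_n(f)$); for $f\in H_1$ it is defined by continuity from the dense subspace $L^2$. $H_1^b$: martingales $f$ (in $H_1$) with $\|f\|_{H_1^b}:=\|f\|_{H_1}\|b\|_{\mathrm{BMO}}+\big\|\sup_{n\in\mathbb Z_+}|[\mathbb E_n,b](f)|\big\|_{L^1}<\infty$. Simple $(s,\infty)$-atom with respect to $n\in\mathbb Z_+$ and $A\in\mathcal F_n$: measurable $a$ with $\mathbb E_n(a)=0$, $\operatorname{supp}(a)\subset A$, $\|s(a)\|_{L^\infty}\le\mathbb P(A)^{-1}$. Martingale jump with respect to $n\in\mathbb Z_+$: an $\mathcal F_n$-measurable $g\in L^1$ with $\mathbb E_{n-1}(g)=0$. $\mathcal K_q$: the set of all continuous sublinear operators $T$ on $L^2$ such that (i) $T$ is bounded from $H_1$ to $L^q$; (ii) $T$ is bounded from $L^1$ to $L^{q,\infty}$; (iii) for every simple $(s,\infty)$-atom $a$ with respect to some $n\in\mathbb Z_+$ and every $b\in\mathrm{BMO}$, $\|(b-b_{n-1})T(a)\|_{L^q}\le C\|b\|_{\mathrm{BMO}}$ and $\|[T,b_{n-1}](a)\|_{L^q}\le C\|b\|_{\mathrm{BMO}}$; (iv) for every martingale jump $g$ with respect to some $n\in\mathbb Z_+$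 and every $b\in\mathrm{BMO}$, $\|(b-b_{n-1})T(g)\|_{L^q}\le C\|g\|_{L^1}\|b\|_{\mathrm{BMO}}$ and $\|[T,b_{n-1}](g)\|_{L^q}\le C\|g\|_{L^1}\|b\|_{\mathrm{BMO}}$; here $C>0$ is independent of $a,g,b$. *)

(* Defs.v *)
From HB Require Import structures.
From mathcomp Require Import all_boot all_order all_algebra.
From mathcomp Require Import all_classical all_reals all_analysis measurable_realfun.

Set Implicit Arguments.
Unset Strict Implicit.
Unset Printing Implicit Defensive.

Import Order.TTheory GRing.Theory Num.Theory.
Import numFieldNormedType.Exports.

Local Open Scope classical_set_scope.
Local Open Scope ring_scope.

                                                                             
                                 

Section defs.
Context {d : measure_display} {Om : measurableType d} {R : realType}.
Variable P : probability Om R.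

                                                     
Definition measurable_wrt (G : set (set Om)) {d' : measure_display}
    {S : measurableType d'} (g : Om -> S) : Prop :=
  forall B : set S, measurable B -> G (g @^-1` B).

Section condexp.
Variable G : set (set Om).

                                                                       
                                                                     
Definition is_condexp (f g : Om -> \bar R) : Prop :=
  measurable_wrt G g /\
  (forall A, G A -> \int[P]_(x in A) g x = \int[P]_(x in A) f x)%E.

Definition condexp (f : Om -> \bar R) : Om -> \bar R :=
  xget (cst 0%E) [set g | is_condexp f g].

End condexp.

Variable F : nat -> set (set Om).

Definition filtration : Prop :=
  [/\ forall n, sigma_algebra setT (F n) /\ F n `<=` measurable,
      forall n, F n `<=` F n.+1,
      F 0%N = [set set0; setT] &
      (measurable : set (set Om)) = <<s \bigcup_n F n >>].

Definition E (n : nat) (f : Om -> R) : Om -> R :=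
  fun x => fine (condexp (F n) (EFin \o f) x).

                                                                           
Definition prev (f : nat -> Om -> R) (n : nat) : Om -> R :=
  if n is m.+1 then f m else cst 0.

                                        
Definition Eprev (n : nat) (f : Om -> R) : Om -> R := prev (E ^~ f) n.

Definition martingale (f : nat -> Om -> R) : Prop :=
  forall n, [/\ measurable_wrt (F n) (f n),
                f n \in Lfun P 1%E &
                E n (f n.+1) = f n %[ae P]].

Definition mdiff (f : nat -> Om -> R) (n : nat) : Om -> R :=
  fun x => f n x - prev f n x.

Definition square_fun (f : nat -> Om -> R) : Om -> \bar R :=
  fun x => ((\sum_(0 <= n <oo) ((mdiff f n x) ^+ 2)%:E) `^ 2^-1)%E.

Definition cond_square_fun (f : nat -> Om -> R) : Om -> \bar R :=
  fun x => ((((mdiff f 0 x) ^+ 2)%:E +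
    \sum_(0 <= n <oo)
       condexp (F n) (fun y => ((mdiff f n.+1 y) ^+ 2)%:E) x) `^ 2^-1)%E.

Definition H1_norm (f : nat -> Om -> R) : \bar R := 'N[P]_1[square_fun f]%E.

Definition mart (f : Om -> R) : nat -> Om -> R := fun n => E n f.

Definition H1 (f : nat -> Om -> R) : Prop :=
  martingale f /\ (H1_norm f < +oo)%E.

Definition BMO_norm (p : R) (b : Om -> R) : \bar R :=
  ereal_sup [set ('N[P]_+oo[condexp (F n)
       (fun x => (`|b x - Eprev n b x| `^ p)%:E)] `^ p^-1)%E | n in setT].

Definition BMO (p : R) (b : Om -> R) : Prop :=
  b \in Lfun P 1%E /\ (BMO_norm p b < +oo)%E.

Definition Lq_norm (q : R) (h : Om -> R) : \bar R := 'N[P]_q%:E[EFin \o h]%E.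

Definition weak_norm (q : R) (h : Om -> R) : \bar R :=
  ereal_sup [set (t%:E * (P [set x | (t < `|h x|)%R]) `^ q^-1)%E
            | t in [set t : R | 0 < t]].

Definition cvg_in_probability (h_ : nat -> Om -> R) (h : Om -> R) : Prop :=
  forall e : R, 0 < e ->
    (fun k => P [set x | e <= `|h_ k x - h x|]) @ \oo --> (0 : \bar R)%E.

                                                                                
Definition operator (T : (Om -> R) -> (Om -> R)) : Prop :=
  (forall f, f \in Lfun P 1%E -> measurable_fun setT (T f)) /\
  (forall f g, f \in Lfun P 1%E -> g \in Lfun P 1%E ->
     f = g %[ae P] -> T f = T g %[ae P]).

Definition sublinear (T : (Om -> R) -> (Om -> R)) : Prop :=
  forall (a c : R) (f g : Om -> R), f \in Lfun P 1%E -> g \in Lfun P 1%E ->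
  {ae P, forall x, `|T (fun y => a * f y + c * g y) x|
                   <= `|a| * `|T f x| + `|c| * `|T g x| }.

Definition L2_continuous (T : (Om -> R) -> (Om -> R)) : Prop :=
  (forall f, f \in Lfun P 2%:E -> T f \in Lfun P 2%:E) /\
  (forall (f_ : nat -> Om -> R) f,
     (forall k, f_ k \in Lfun P 2%:E) -> f \in Lfun P 2%:E ->
     (fun k => Lq_norm 2 (f_ k \- f)) @ \oo --> (0 : \bar R)%E ->
     (fun k => Lq_norm 2 (T (f_ k) \- T f)) @ \oo --> (0 : \bar R)%E).

                                                                          
                                                                           
                                                                               
                                                                               
                                                                           
                                                                              
                                                                     
                               
Definition is_abs_commutator_L2 (T : (Om -> R) -> (Om -> R))
    (b f h : Om -> R) : Prop :=
  measurable_fun setT h /\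
  exists Phi : R -> Om -> R,
    [/\ forall c, {ae P, forall x,
          Phi c x = `|T (fun y => b y * f y - c * f y) x| },
        {ae P, forall x, continuous (fun c => Phi c x)} &
        {ae P, forall x, h x = Phi (b x) x}].

                                                                              
                                                                            
                                                                 
Definition is_abs_commutator (T : (Om -> R) -> (Om -> R)) (b : Om -> R)
    (f : nat -> Om -> R) (h : Om -> R) : Prop :=
  measurable_fun setT h /\
  exists (g h_ : nat -> Om -> R),
    [/\ forall k, g k \in Lfun P 2%:E,
        (fun k => H1_norm (fun n => f n \- mart (g k) n)) @ \oo
           --> (0 : \bar R)%E,
        forall k, is_abs_commutator_L2 T b (g k) (h_ k) &
        cvg_in_probability h_ h].

                                                        
Definition commutator_max (e : nat -> Om -> R) : Om -> \bar R :=
  fun x => ereal_sup [set (`|e n x|)%:E | n in setT].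

Definition H1b_norm (p : R) (b : Om -> R) (f e : nat -> Om -> R) : \bar R :=
  (H1_norm f * BMO_norm p b + 'N[P]_1[commutator_max e])%E.

Definition H1b (p : R) (b : Om -> R) (f e : nat -> Om -> R) : Prop :=
  [/\ H1 f, forall n, is_abs_commutator (E n) b f (e n) &
      (H1b_norm p b f e < +oo)%E].

Definition simple_atom (n : nat) (A : set Om) (a : Om -> R) : Prop :=
  [/\ F n A, a \in Lfun P 1%E, E n a = cst 0 %[ae P],
      {ae P, forall x, a x != 0 -> A x} &
      ('N[P]_+oo[cond_square_fun (mart a)] <= (P A)^-1)%E].

Definition jump (n : nat) (g : Om -> R) : Prop :=
  [/\ measurable_wrt (F n) g,
      g \in Lfun P 1%E & Eprev n g = cst 0 %[ae P]].

Definition bounded_H1_Lq (q : R) (T : (Om -> R) -> (Om -> R)) : Prop :=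
  exists2 C : R, 0 < C & forall f, f \in Lfun P 1%E -> H1 (mart f) ->
    (Lq_norm q (T f) <= C%:E * H1_norm (mart f))%E.

Definition bounded_L1_weakLq (q : R) (T : (Om -> R) -> (Om -> R)) : Prop :=
  exists2 C : R, 0 < C & forall f, f \in Lfun P 1%E ->
    (weak_norm q (T f) <= C%:E * Lq_norm 1 f)%E.

Definition atom_condition (p q : R) (T : (Om -> R) -> (Om -> R)) (C : R) : Prop :=
  forall n A a b, simple_atom n A a -> BMO p b ->
  (Lq_norm q (fun x => (b x - Eprev n b x) * T a x)%R
     <= C%:E * BMO_norm p b)%E /\
  (forall h, is_abs_commutator_L2 T (Eprev n b) a h ->
     (Lq_norm q h <= C%:E * BMO_norm p b)%E).

Definition jump_condition (p q : R) (T : (Om -> R) -> (Om -> R)) (C : R) : Prop :=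
  forall n g b, jump n g -> BMO p b ->
  (Lq_norm q (fun x => (b x - Eprev n b x) * T g x)%R
     <= C%:E * Lq_norm 1 g * BMO_norm p b)%E /\
  (forall h, is_abs_commutator T (Eprev n b) (mart g) h ->
     (Lq_norm q h <= C%:E * Lq_norm 1 g * BMO_norm p b)%E).

                                                                             
                                                                              
                                                             
Definition class_K (p q : R) (T : (Om -> R) -> (Om -> R)) : Prop :=
  [/\ operator T, sublinear T & L2_continuous T] /\
  [/\ bounded_H1_Lq q T, bounded_L1_weakLq q T &
      exists2 C : R, 0 < C & atom_condition p q T C /\ jump_condition p q T C].

End defs.

(* Main.v *)
From HB Require Import structures.
Require Import Defs.
From mathcomp Require Import all_boot all_order all_algebra.
From mathcomp Require Import all_classical all_reals all_analysis measurable_realfun ess_sup_inf.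
From mathcomp Require Import ring lra.

(* Put [Pi g = sum_k d_k g * d_k b]. For a bounded [F_N]-measurable [g] the commutator is
   [T (b g - b(x) g) (x)], bounded by [|T (Pi g)|] plus [|T (b g - Pi g - b(x) g) (x)|].

   The second term is subadditive in [g]. If [g] is an atom or a jump with respect to [n],
   then [b g - Pi g = b_(n-1) g + err] where, by John-Nirenberg, [err] lies in H_1 with the
   right norm; the term is thus controlled by the H_1-L^q bound and the two estimates
   defining K_q. Davis' decomposition writes [g] as a sum of jumps and atoms whose sizes
   add up to a multiple of the H_1 norm of [g].

   By Fefferman's inequality [Pi] is continuous from H_1 to L^1; let [p] be the limit of
   [Pi g] along [g -> f]. As [E_n (Pi g) = [E_n, b] g + (b - E_n b) E_n g + Pi_n g], the
   maximal function of [p] is at most [sup_n |[E_n, b] f|] plus terms bounded by the BMO norm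
   of [b] times the H_1 norm of [f]. By Davis' inequality [p] is in H_1, so [T p] is in L^q.

   The passage from [g] to [f] is made by convergence in probability, using a version of
   [|T (b g - c g)|] which is Lipschitz in [c] at every point. *)

Set Implicit Arguments.
Unset Strict Implicit.
Unset Printing Implicit Defensive.

Import Order.TTheory GRing.Theory Num.Theory.
Import numFieldNormedType.Exports.

Local Open Scope classical_set_scope.
Local Open Scope ring_scope.

(** * Integrable functions on a probability space *)

Section measurable_comparisons.
Context {d : measure_display} {T : measurableType d} {R : realType}.
Implicit Types f g : T -> R.

(** The obstacle is that the [H_1] norm of [g] controls neither the [L^1] nor the [H_1] norm of
    [b g]. Subtracting the paraproduct leaves a part that the test conditions on atoms and jumps can
    see; the paraproduct is the one term that calls on the maximal commutator. Since [q >= 1],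
    bounds on single atoms and jumps are summed by Minkowski.

    Bounded [F_N]-measurable functions are convenient because their martingales stop at [N]:
    paraproducts are finite sums, products with [b] are integrable, and the product rule is an
    identity. Davis' and Doob's inequalities come from pathwise inequalities that contain a
    martingale transform of mean zero. Summations against [b] rest on one recursion at level [4 B],
    the source of the constant 57. Here [B] is any positive upper bound of the norm of [b]: the norm
    may vanish while the proofs divide by [B], and at the very end [B] is sent to the norm.

    As [b(x)] varies with [x], the null sets attached to each parameter [c] have to be merged into a
    single one; this is what forces a version that is regular in [c]. *)

Lemma meas_max f g : measurable_fun setT f -> measurable_fun setT g ->
  measurable_fun setT (fun x => Num.max (f x) (g x)).
Proof. exact: measurable_maxr. Qed.

Lemma meas_le_set f g : measurable_fun setT f -> measurable_fun setT g ->
  measurable [set x | f x <= g x].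
Proof.
move=> mf mg; have := measurable_fun_ler mf mg measurableT (Y := [set true]).
by move=> /(_ I); rewrite setTI; congr measurable; apply/seteqP; split=> x /=.
Qed.

Lemma meas_lt_set f g : measurable_fun setT f -> measurable_fun setT g ->
  measurable [set x | f x < g x].
Proof.
move=> mf mg; have := measurable_fun_ltr mf mg measurableT (Y := [set true]).
by move=> /(_ I); rewrite setTI; congr measurable; apply/seteqP; split=> x /=.
Qed.

(** The identity [x^-1 = x (|x|^(-1))^2] reduces the claim to real powers of [|x|]; at 0 the factor
    [x] makes the right-hand side vanish, in accordance with [0^-1 = 0]. *)
Lemma measurable_inv : measurable_fun setT (@GRing.inv R).
Proof.
rewrite (_ : GRing.inv = fun x : R => x * (`|x| `^ (-1)) ^+ 2).
  apply: measurable_funM => //; apply: measurable_funX.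
  by apply: (@measurableT_comp _ _ _ _ _ _ (@powR R ^~ (-1))) => //; exact: measurableT_comp.
apply/funext => x; have [->|x0] := eqVneq x 0; first by rewrite invr0 mul0r.
rewrite powR_inv1// exprVn real_normK ?num_real//.
by rewrite expr2 invfM mulrA divff// mul1r.
Qed.

End measurable_comparisons.

Section expectation.
Context {d : measure_display} {Om : measurableType d} {R : realType}.
Variable P : probability Om R.
Implicit Types f g : Om -> R.

Definition itg f := P.-integrable setT (EFin \o f).
(** [fine] turns an infinite integral into 0, so linearity and monotonicity are stated for
    integrable functions. *)
Definition Ex f : R := fine (\int[P]_x (f x)%:E)%E.
(** Boundedness almost everywhere only, so that conditional expectations, which are defined up to
    null sets, preserve it. *)
Definition bdd f :=
  measurable_fun setT f /\ exists M : R, {ae P, forall x, `|f x| <= M}.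

Lemma aeE U (f g : Om -> U) : (f = g %[ae P]) <-> {ae P, forall x, f x = g x}.
Proof.
split; first by apply: filterS => x; exact.
by apply: filterS => x fg _.
Qed.

Lemma itg_meas f : itg f -> measurable_fun setT f.
Proof. by move=> /integrableP[/measurable_EFinP]. Qed.

Lemma itgP f : itg f <-> measurable_fun setT f /\ (\int[P]_x `|f x|%:E < +oo)%E.
Proof.
split=> [/integrableP[/measurable_EFinP mf fi]|[mf fi]]; first by split.
by apply/integrableP; split => //; exact/measurable_EFinP.
Qed.

Lemma itg_le f g : measurable_fun setT f -> itg g ->
  {ae P, forall x, `|f x| <= g x} -> itg f.
Proof.
move=> mf /itgP[mg ig] fg; apply/itgP; split => //.
apply: le_lt_trans ig; apply: ae_ge0_le_integral => //.
- exact/measurable_EFinP/measurableT_comp.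
- exact/measurable_EFinP/measurableT_comp.
- apply: filterS fg => x fg _; rewrite lee_fin (le_trans fg)//.
  exact: ler_norm.
Qed.

Lemma itg_cst c : itg (cst c).
Proof.
exact: finite_measure_integrable_cst.
Qed.

Lemma itgD f g : itg f -> itg g -> itg (fun x => f x + g x).
Proof. by move=> fi gi; have := integrableD measurableT fi gi. Qed.

Lemma itgN f : itg f -> itg (fun x => - f x).
Proof. by move=> fi; have := integrableN fi. Qed.

Lemma itgB f g : itg f -> itg g -> itg (fun x => f x - g x).
Proof. by move=> fi gi; apply: itgD => //; exact: itgN. Qed.

Lemma itgZ c f : itg f -> itg (fun x => c * f x).
Proof. by move=> fi; have := integrableZl measurableT c fi. Qed.

Lemma itg_abs f : itg f -> itg (fun x => `|f x|).
Proof. by move=> fi; have := integrable_abse fi. Qed.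

Lemma itg_sum (I : Type) (s : seq I) (Q : pred I) (f : I -> Om -> R) :
  (forall i, Q i -> itg (f i)) -> itg (fun x => \sum_(i <- s | Q i) f i x).
Proof.
move=> fi; elim: s => [|i s IH].
  by under eq_fun do rewrite big_nil; exact: itg_cst.
under eq_fun do rewrite big_cons.
have [Qi|//] := boolP (Q i); exact: itgD (fi _ Qi) IH.
Qed.

Lemma bdd_itg f : bdd f -> itg f.
Proof.
move=> [mf [M fM]]; exact: (@itg_le _ (cst M)) (itg_cst M) fM.
Qed.

Lemma bdd_meas f : bdd f -> measurable_fun setT f. Proof. by case. Qed.

Lemma itgM f g : bdd f -> itg g -> itg (fun x => f x * g x).
Proof.
move=> [mf [M fM]] gi.
apply: (@itg_le _ (fun x => `|M| * `|g x|)).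
- by apply: measurable_funM => //; exact: itg_meas.
- exact/itgZ/itg_abs.
- apply: filterS fM => x fM; rewrite normrM ler_wpM2r// (le_trans fM)//.
  exact: ler_norm.
Qed.

Lemma bdd_le f g : measurable_fun setT f -> bdd g ->
  {ae P, forall x, `|f x| <= `|g x|} -> bdd f.
Proof.
move=> mf [_ [M gM]] fg; split => //; exists M.
by apply: filterS2 fg gM => x; exact: le_trans.
Qed.

Lemma bdd_cst c : bdd (cst c).
Proof. by split => //; exists `|c|; exact: aeW. Qed.

Lemma bddD f g : bdd f -> bdd g -> bdd (fun x => f x + g x).
Proof.
move=> [mf [M fM]] [mg [N gN]]; split; first exact: measurable_funD.
exists (M + N); apply: filterS2 fM gN => x fM gN.
by rewrite (le_trans (ler_normD _ _))// lerD.
Qed.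

Lemma bddM f g : bdd f -> bdd g -> bdd (fun x => f x * g x).
Proof.
move=> [mf [M fM]] [mg [N gN]]; split; first exact: measurable_funM.
exists (M * N); apply: filterS2 fM gN => x fM gN.
by rewrite normrM ler_pM.
Qed.

Lemma bddZ c f : bdd f -> bdd (fun x => c * f x).
Proof. by move=> fb; exact: bddM (bdd_cst c) fb. Qed.

Lemma bddN f : bdd f -> bdd (fun x => - f x).
Proof.
move=> [mf [M fM]]; split; first exact: measurable_funN.
by exists M; apply: filterS fM => x; rewrite normrN.
Qed.

Lemma bddB f g : bdd f -> bdd g -> bdd (fun x => f x - g x).
Proof. by move=> fb gb; apply: bddD => //; exact: bddN. Qed.

Lemma bddX n f : bdd f -> bdd (fun x => f x ^+ n).
Proof.
move=> fb; elim: n => [|n IH].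
  by under eq_fun do rewrite expr0; exact: bdd_cst.
by under eq_fun do rewrite exprS; exact: bddM.
Qed.

Lemma bdd_abs f : bdd f -> bdd (fun x => `|f x|).
Proof.
move=> fb; apply: bdd_le (fb) _; last by apply: aeW => x; rewrite normr_id.
by apply: measurableT_comp => //; exact: bdd_meas.
Qed.

Lemma bdd_sum (I : Type) (s : seq I) (Q : pred I) (f : I -> Om -> R) :
  (forall i, Q i -> bdd (f i)) -> bdd (fun x => \sum_(i <- s | Q i) f i x).
Proof.
move=> fi; elim: s => [|i s IH].
  by under eq_fun do rewrite big_nil; exact: bdd_cst.
under eq_fun do rewrite big_cons.
have [Qi|//] := boolP (Q i); exact: bddD (fi _ Qi) IH.
Qed.

Lemma bdd_sqrt f : bdd f -> bdd (fun x => Num.sqrt (f x)).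
Proof.
move=> fb; apply: (@bdd_le _ (fun x => 1 + `|f x|)).
- exact: measurableT_comp (continuous_measurable_fun (@sqrt_continuous R)) (bdd_meas fb).
- by apply: bddD; [exact: bdd_cst|exact: bdd_abs].
- apply: aeW => x.
  rewrite [leLHS]ger0_norm ?sqrtr_ge0// [leRHS]ger0_norm ?addr_ge0//.
  have [f0|f0] := lerP 0 (f x); last by rewrite ler0_sqrtr ?(ltW f0)// addr_ge0.
  have := sqr_sqrtr f0; have := sqrtr_ge0 (f x).
  by move: (ler_norm (f x)); nra.
Qed.

Lemma bdd_indic A : measurable A -> bdd (\1_A : Om -> R).
Proof.
move=> mA; split; first exact: measurable_indic.
by exists 1; apply: aeW => x; rewrite indicE; case: (_ \in _); rewrite /= ?normr1 ?normr0.
Qed.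

Lemma Ex_fin f : itg f -> (\int[P]_x (f x)%:E = (Ex f)%:E)%E.
Proof. by move=> fi; rewrite /Ex fineK//; exact: integrable_fin_num. Qed.

Lemma ExD f g : itg f -> itg g -> Ex (fun x => f x + g x) = Ex f + Ex g.
Proof. by move=> fi gi; exact: RintegralD. Qed.

Lemma ExB f g : itg f -> itg g -> Ex (fun x => f x - g x) = Ex f - Ex g.
Proof. by move=> fi gi; exact: RintegralB. Qed.

Lemma ExZ c f : itg f -> Ex (fun x => c * f x) = c * Ex f.
Proof. by move=> fi; exact: RintegralZl. Qed.

Lemma Ex_cst c : Ex (cst c) = c.
Proof. transitivity (c * fine (P setT)); first exact: Rintegral_cst.
by rewrite probability_setT mulr1. Qed.

Lemma Ex_sum (I : Type) (s : seq I) (Q : pred I) (f : I -> Om -> R) :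
  (forall i, Q i -> itg (f i)) ->
  Ex (fun x => \sum_(i <- s | Q i) f i x) = \sum_(i <- s | Q i) Ex (f i).
Proof.
move=> fi; elim: s => [|i s IH].
  by under [in LHS]eq_fun do rewrite big_nil; rewrite big_nil; exact: Ex_cst.
under [in LHS]eq_fun do rewrite big_cons.
rewrite big_cons; have [Qi|//] := boolP (Q i).
by rewrite ExD ?IH//; [exact: fi|exact: itg_sum].
Qed.

Lemma Ex_ae f g : measurable_fun setT f -> measurable_fun setT g ->
  {ae P, forall x, f x = g x} -> Ex f = Ex g.
Proof.
move=> mf mg fg; rewrite /Ex; congr fine.
apply: ae_eq_integral => //; try exact/measurable_EFinP.
by apply: filterS fg => x -> _.
Qed.

Lemma Ex_le f g : itg f -> itg g -> {ae P, forall x, f x <= g x} -> Ex f <= Ex g.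
Proof.
move=> fi gi fg.
(* Monotonicity of the integral asks for an inequality at every point, so [g] is replaced by
   [max (f, g)], which equals it almost everywhere. *)
rewrite (@Ex_ae g (fun x => Num.max (f x) (g x))); last 3 first.
- exact: itg_meas.
- by apply: meas_max; exact: itg_meas.
- by apply: filterS fg => x /max_idPr ->.
apply: le_Rintegral => //.
- apply: (itg_le _ (itgD (itg_abs fi) (itg_abs gi))).
    by apply: meas_max; [exact: itg_meas fi|exact: itg_meas gi].
  by apply: aeW => x; rewrite /Num.max; case: ifP => _; rewrite ?lerDl ?lerDr.
- by move=> x _; rewrite le_max lexx.
Qed.

Lemma Ex_ge0 f : itg f -> {ae P, forall x, 0 <= f x} -> 0 <= Ex f.
Proof.
by move=> fi f0; rewrite -(Ex_cst 0); apply: Ex_le => //; exact: itg_cst.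
Qed.

Lemma Ex_norm f : itg f -> `|Ex f| <= Ex (fun x => `|f x|).
Proof. by move=> fi; exact: le_normr_Rintegral. Qed.

Definition Pr (A : set Om) : R := fine (P A).

Lemma Pr_fin A : measurable A -> (P A = (Pr A)%:E)%E.
Proof. by move=> mA; rewrite /Pr fineK// fin_num_measure. Qed.

Lemma Pr_setT : Pr setT = 1.
Proof. by rewrite /Pr probability_setT. Qed.

Lemma Pr_ge0 A : 0 <= Pr A.
Proof. exact: fine_ge0. Qed.

Lemma Ex_indic A : measurable A -> Ex (\1_A : Om -> R) = Pr A.
Proof. by move=> mA; rewrite /Ex integral_indic// setIT. Qed.

Lemma Ex_set A f : measurable A -> measurable_fun setT f ->
  Ex (fun x => \1_A x * f x) = fine (\int[P]_(x in A) (f x)%:E)%E.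
Proof.
move=> mA mf; rewrite /Ex [in RHS]integral_mkcond; congr fine.
apply: eq_integral => x _; rewrite patchE indicE; case: ifPn => xA /=.
  by rewrite mul1r.
by rewrite mul0r.
Qed.

Lemma Pr_le A B : measurable A -> measurable B -> A `<=` B -> Pr A <= Pr B.
Proof.
by move=> mA mB AB; rewrite -lee_fin -!Pr_fin// le_measure// inE.
Qed.

Lemma Pr_eq0_ae A : measurable A -> Pr A = 0 -> {ae P, forall x, ~ A x}.
Proof.
move=> mA A0; exists A; split => //; first by rewrite Pr_fin// A0.
by move=> x /= /contrapT.
Qed.

Lemma Ex0_ae f : itg f -> {ae P, forall x, 0 <= f x} -> Ex f <= 0 ->
  {ae P, forall x, f x = 0}.
Proof.
move=> fi f0 fle; have /itgP[mf _] := fi.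
have E0 : Ex (fun x => `|f x|) = 0.
  rewrite -(@Ex_ae f) => //.
  - by apply/eqP; rewrite eq_le fle Ex_ge0.
  - exact: measurableT_comp.
  - by apply: filterS f0 => x /ger0_norm ->.
have : (\int[P]_x `|(f x)%:E| = 0)%E by rewrite (Ex_fin (itg_abs fi)) E0.
move=> /ae_eq_integral_abs H; have := H measurableT.
have mf' : measurable_fun setT (EFin \o f) by exact/measurable_EFinP.
by move=> /(_ mf'); apply: filterS => x /(_ I) [].
Qed.

Lemma markov_Ex f c : itg f -> {ae P, forall x, 0 <= f x} -> 0 < c ->
  c * Pr [set x | c <= f x] <= Ex f.
Proof.
move=> fi f0 c0; have mf := itg_meas fi.
have mA : measurable [set x | c <= f x].
  exact: meas_le_set.
rewrite -Ex_indic// -ExZ; last exact/bdd_itg/bdd_indic.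
apply: Ex_le => //; first exact/itgZ/bdd_itg/bdd_indic.
apply: filterS f0 => x f0; rewrite indicE.
by case: (boolP (x \in _)) => /= [|_]; rewrite ?mulr0// inE /= mulr1.
Qed.

End expectation.
#[global] Hint Resolve Pr_ge0 : core.

(** * Conditional expectation *)

Section sub_sigma_algebra.
Context {d : measure_display} {Om : measurableType d} {R : realType}.
Variable P : probability Om R.
Variable G : set (set Om).
Hypotheses (saG : sigma_algebra setT G) (GM : G `<=` measurable).
Implicit Types f g : Om -> R.

Definition mfunG (f : Om -> R) :=
  measurable_fun (setT : set (g_sigma_algebraType G)) f.

Lemma measG : (measurable : set (set (g_sigma_algebraType G))) = G.
Proof. exact: sigma_algebra_id. Qed.

Lemma measurable_wrtP d' (S : measurableType d') (f : Om -> S) :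
  measurable_wrt G f <-> measurable_fun (setT : set (g_sigma_algebraType G)) f.
Proof.
split=> [mf _ B mB|mf B mB]; first by rewrite setTI measG; exact: mf.
by rewrite -measG -[_ @^-1` _]setTI; exact: mf.
Qed.

(** The identity, read as a measurable map onto the coarser space; the image of [P] under it is the
    restriction of [P] to [G]. *)
Definition to_sub : Om -> g_sigma_algebraType G := id.

Lemma measurable_to_sub : measurable_fun setT to_sub.
Proof. by move=> _ B; rewrite measG setTI => /GM. Qed.

Lemma mfunG_meas f : mfunG f -> measurable_fun setT f.
Proof.
move=> mf _ B mB; apply: GM; rewrite -measG.
exact: (mf measurableT B mB).
Qed.

Lemma G_le_set f g : mfunG f -> mfunG g -> G [set x | f x <= g x].
Proof. by move=> mf mg; rewrite -measG; exact: meas_le_set. Qed.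

Lemma G_lt_set f g : mfunG f -> mfunG g -> G [set x | f x < g x].
Proof. by move=> mf mg; rewrite -measG; exact: meas_lt_set. Qed.

Lemma mfunG_indic A : G A -> mfunG (\1_A : Om -> R).
Proof. by rewrite -measG => mA; exact: measurable_indic. Qed.

#[local] HB.instance Definition _ :=
  isMeasurableFun.Build _ _ _ _ to_sub measurable_to_sub.

Let Q := distribution P to_sub.

(** Radon-Nikodym on the coarse space: the charge that sends [A] to the integral of [f] over [A],
    restricted to [G], is dominated by the restriction [Q] of [P], and its density is
    [G]-measurable. *)
Lemma condexp_exists f : itg P f -> exists2 g : Om -> R, mfunG g /\ itg P g &
  forall A, G A -> (\int[P]_(x in A) (g x)%:E = \int[P]_(x in A) (f x)%:E)%E.
Proof.
move=> fi.
pose nu := pushforward (induced_charge fi)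
  to_sub.
have dom : nu `<< Q.
  apply/null_content_dominatesP => /= A; rewrite measG => GA QA.
  apply: null_set_integral => //; first exact: GM.
  exact/measurable_funTS/measurable_EFinP/(itg_meas fi).
pose h0 := Radon_Nikodym nu Q; pose h := h0 measurable_to_sub.
have hi : Q.-integrable setT h by exact: Radon_Nikodym_integrable.
have hE A : G A -> (\int[Q]_(x in A) h x = \int[P]_(x in A) (f x)%:E)%E.
  by move=> GA; rewrite -Radon_Nikodym_integral//= measG.
have hfin x : h x \is a fin_num by exact: Radon_Nikodym_fin_num.
pose g : Om -> R := fun x => fine (h x).
have gh : EFin \o g = h by apply/funext => x /=; rewrite fineK.
have mg : mfunG g.
  by apply/measurable_EFinP; rewrite -/(EFin \o g) gh; exact: measurable_int hi.
have mh : measurable_fun setT (h : Om -> \bar R).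
  by rewrite -gh; exact/measurable_EFinP/mfunG_meas.
have hPi : P.-integrable setT h.
  apply/integrableP; split => //.
  move/integrableP : hi => [mhG]; apply: le_lt_trans.
  rewrite /Q /distribution ge0_integral_pushforward//.
  exact: measurableT_comp.
exists g; first by split => //; rewrite /itg gh.
move=> A GA; rewrite -hE//; have -> : (fun x => (g x)%:E) = h by rewrite -gh.
rewrite (integral_pushforward measurable_to_sub)//.
- exact: measurable_int hi.
- by apply: (integrableS measurableT _ _ hPi) => //; exact: GM.
- by rewrite measG.
Qed.

Lemma integral_to_sub (h : Om -> \bar R) A :
  measurable_fun (setT : set (g_sigma_algebraType G)) h ->
  P.-integrable setT h -> G A ->
  (\int[Q]_(x in A) h x = \int[P]_(x in A) h x)%E.
Proof.
move=> mh hi GA; rewrite (integral_pushforward measurable_to_sub)//.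
- by apply: (integrableS measurableT _ _ hi) => //; exact: GM.
- by rewrite measG.
Qed.

(** [is_condexp] asks for no integrability. It follows by taking for [A] the set [{h >= 0}] and its
    complement, both in [G]: there the integrals of [h] equal the finite ones of [f]. *)
Lemma is_condexp_itg f (h : Om -> \bar R) : itg P f ->
  is_condexp P G (EFin \o f) h -> P.-integrable setT h.
Proof.
move=> fi [/measurable_wrtP mhG hE].
have mh : measurable_fun setT (h : Om -> \bar R).
  move=> _ B mB; apply: GM; rewrite -measG; exact: (mhG measurableT B mB).
pose A := [set x | (0 <= h x)%E].
have GA : G A.
  rewrite -measG -[A]setTI.
  have := mhG measurableT `[0%E, +oo[%classic.
  by rewrite preimage_itvcy; apply; exact: emeasurable_itv.
have GA' : G (~` A) by rewrite -setTD; case: saG => _ + _; exact.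
have mA := GM GA; have mA' := GM GA'.
apply/integrableP; split => //.
rewrite -(setUv A) ge0_integral_setU//; last 2 first.
- exact/measurable_funTS/measurableT_comp.
- exact/disj_setPCl.
apply: lte_add_pinfty.
  rewrite (_ : integral _ _ _ = \int[P]_(x in A) h x)%E; last first.
    by apply: eq_integral => x /[!inE] xA; rewrite gee0_abs.
  rewrite hE//; have : (\int[P]_(x in A) (f x)%:E)%E \is a fin_num.
    exact/integrable_fin_num/(integrableS measurableT mA _ fi).
  by rewrite fin_numE ltey => /andP[].
rewrite (_ : integral _ _ _ = - \int[P]_(x in ~` A) h x)%E; last first.
  rewrite -[RHS]/(- integral _ _ _)%E.
  under [in RHS]eq_integral do rewrite -[h _]oppeK.
  rewrite integral_ge0N ?oppeK; last first.
    by move=> x /negP; rewrite -ltNge oppe_ge0 => /ltW.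
  apply: eq_integral => x /[!inE] /negP; rewrite -ltNge => /ltW hx.
  by rewrite lee0_abs.
rewrite hE//; have : (\int[P]_(x in ~` A) (f x)%:E)%E \is a fin_num.
  exact/integrable_fin_num/(integrableS measurableT mA' _ fi).
by rewrite -fin_numN fin_numE ltey => /andP[].
Qed.

Definition CE f : Om -> R := fun x => fine (condexp P G (EFin \o f) x).

(** [condexp] is an arbitrary choice among all versions, infinite values allowed. It is compared
    with the Radon-Nikodym version, from which it differs only on a null set. *)
Lemma CE_spec f : itg P f ->
  [/\ mfunG (CE f), itg P (CE f),
    forall A, G A -> Ex P (fun x => \1_A x * CE f x) = Ex P (fun x => \1_A x * f x) &
    {ae P, forall x, condexp P G (EFin \o f) x = (CE f x)%:E}].
Proof.
move=> fi; have [g [mg gi] gE] := condexp_exists fi.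
have icg : is_condexp P G (EFin \o f) (EFin \o g).
  by split => //; apply/measurable_wrtP/measurable_EFinP.
set h := condexp P G (EFin \o f).
have ich : [set g | is_condexp P G (EFin \o f) g] h by apply: xgetPex; exists (EFin \o g).
have hi := is_condexp_itg fi ich.
case: (ich) => /measurable_wrtP mhG hE.
have hg : {ae Q, forall x, setT x -> h x = (EFin \o g) x}.
  apply: (@integral_ae_eq _ (g_sigma_algebraType G) _ Q setT measurableT
    (EFin \o g) h) => //.
  - apply: (integrable_pushforward measurable_to_sub) => //.
  - exact/measurable_EFinP.
  - move=> A _; rewrite measG => GA; rewrite !integral_to_sub//.
      by rewrite hE// gE.
    exact/measurable_EFinP.
have {}hg : {ae P, forall x, h x = (g x)%:E}.
  case: hg => N [mN N0 hN]; exists N; split.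
  - by apply: GM; rewrite -measG.
  - exact: N0.
  - by move=> x xN; apply: hN => xN'; apply: xN; exact: xN'.
have mCE : mfunG (CE f) by exact: measurableT_comp (@fine_measurable R setT measurableT) mhG.
have CEg : {ae P, forall x, CE f x = g x}.
  by apply: filterS hg => x; rewrite /CE -/h => ->.
have mg' := mfunG_meas mg; have mCE' := mfunG_meas mCE.
have CEi : itg P (CE f).
  apply: (itg_le mCE' (itg_abs gi)).
  by apply: filterS CEg => x ->.
split => //.
- move=> A GA; have mA := GM GA.
  rewrite (@Ex_ae _ _ _ P _ (fun x => \1_A x * g x)).
  - by rewrite !Ex_set ?gE//; exact: itg_meas fi.
  - exact: measurable_funM.
  - exact: measurable_funM.
  - by apply: filterS CEg => x ->.
- by apply: filterS hg => x; rewrite /CE -/h => ->.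
Qed.

(** Test on [A = {g < f}], which lies in [G]: there [f - g] is positive with integral at most 0, so
    [A] is null. *)
Lemma cond_le_ae f g : mfunG f -> mfunG g -> itg P f -> itg P g ->
  (forall A, G A -> Ex P (fun x => \1_A x * f x) <= Ex P (fun x => \1_A x * g x)) ->
  {ae P, forall x, f x <= g x}.
Proof.
move=> mf mg fi gi fg; pose A := [set x | g x < f x].
have GA : G A by exact: G_lt_set.
have bA := bdd_indic P (GM GA).
have i1 := itgM bA fi; have i2 := itgM bA gi.
have D0 : {ae P, forall x, 0 <= \1_A x * f x - \1_A x * g x}.
  apply: aeW => x; rewrite -mulrBr indicE.
  case: (boolP (x \in A)) => [|_]; last by rewrite mul0r.
  by rewrite inE /A /= mul1r subr_ge0 => /ltW.
have Dle : Ex P (fun x => \1_A x * f x - \1_A x * g x) <= 0.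
  by rewrite ExB// subr_le0 fg.
have H := Ex0_ae (itgB i1 i2) D0 Dle.
apply: filterS H => x; rewrite -mulrBr indicE.
case: (boolP (x \in A)) => [|/negP xA _].
  by rewrite inE /A /= mul1r => _ /eqP; rewrite subr_eq0 => /eqP ->.
by rewrite leNgt; apply/negP => ?; apply: xA; rewrite inE.
Qed.

(** The sum counts the integers in [1..n] that are at most [y]: it is the integer part of [y],
    capped at [n]. *)
Lemma layer_cake_count (n : nat) (y : R) : 0 <= y ->
  let s := \sum_(i < n) ((i.+1)%:R <= y)%R%:R in
  s <= y /\ (y <= n%:R -> y <= s + 1).
Proof.
move=> y0; elim: n => [|n [IH1 IH2]] /=.
  by rewrite big_ord0; split => // /le_trans; apply; rewrite add0r.
have sn : \sum_(i < n) ((i.+1)%:R <= y)%R%:R <= n%:R :> R.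
  rewrite -[X in _ <= X%:R]card_ord -sumr_const; apply: ler_sum => i _.
  by case: (lerP i.+1%:R y) => _ //=; exact: ler01.
rewrite big_ord_recr /=; case: (lerP n.+1%:R y) => yn /=.
  split; first by rewrite (le_trans _ yn)// -[n.+1%:R]natr1 lerD2r.
  move=> yn'; rewrite (eq_bigr (fun=> 1)); last first.
    move=> i _; rewrite (le_trans _ yn)// ler_nat.
    by rewrite ltnS ltnW.
  rewrite sumr_const card_ord (le_trans yn')// -[n.+1%:R]natr1; lra.
rewrite addr0; split => // yn'.
have [|ny] := lerP y n%:R; first exact: IH2.
rewrite (eq_bigr (fun=> 1)); last first.
  move=> i _; rewrite (le_trans _ (ltW ny))// ler_nat; exact: ltn_ord.
by rewrite sumr_const card_ord (le_trans yn')// -[n.+1%:R]natr1.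
Qed.

(* The weight is replaced by a Riemann sum of its level sets. *)
Lemma cond_le_weight (phi X Y : Om -> R) :
  mfunG phi -> bdd P phi -> {ae P, forall x, 0 <= phi x} ->
  itg P X -> itg P Y ->
  (forall A, G A -> Ex P (fun x => \1_A x * X x) <= Ex P (fun x => \1_A x * Y x)) ->
  Ex P (fun x => phi x * X x) <= Ex P (fun x => phi x * Y x).
Proof.
move=> mphi bphi phi0 Xi Yi XY.
case: (bphi) => _ [M0 phiM].
have [K MK] : exists K : nat, {ae P, forall x, phi x <= K%:R}.
  exists (Num.truncn `|M0|).+1; apply: filterS phiM => x.
  move=> /(le_trans (ler_norm _)) /le_trans; apply.
  by rewrite (le_trans (ler_norm _))// ltW// truncnS_gt.
pose ph (m : nat) (x : Om) : R :=
  m.+1%:R^-1 * \sum_(i < m.+1 * K) \1_[set y | (i.+1)%:R <= m.+1%:R * phi y] x.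
have Gi m (i : nat) : G [set y | (i.+1)%:R <= m.+1%:R * phi y].
  apply: G_le_set; first exact: measurable_cst.
  exact: measurable_funM (measurable_cst _) mphi.
have bph m : bdd P (ph m).
  by apply/bddZ/bdd_sum => i _; exact/bdd_indic/GM.
have phE m : {ae P, forall x, `|phi x - ph m x| <= m.+1%:R^-1}.
  apply: filterS2 phi0 MK => x x0 xK.
  have m0 : 0 < m.+1%:R :> R by rewrite ltr0n.
  have y0 : 0 <= m.+1%:R * phi x by rewrite mulr_ge0// ltW.
  have [/= s1 s2] := @layer_cake_count (m.+1 * K) _ y0.
  have {}s2 : m.+1%:R * phi x <= \sum_(i < m.+1 * K) ((i.+1)%:R <= m.+1%:R * phi x)%R%:R + 1.
    by apply: s2; rewrite natrM ler_pM2l.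
  rewrite /ph (eq_bigr (fun i : 'I_(m.+1 * K) => ((i.+1)%:R <= m.+1%:R * phi x)%R%:R)).
    set s := \sum_(i < _) _ in s1 s2 *.
    have -> : phi x - m.+1%:R^-1 * s = (m.+1%:R * phi x - s) / m.+1%:R.
      by rewrite mulrBl mulrAC divff ?gt_eqF// mul1r mulrC.
    rewrite normrM normfV (ger0_norm (ltW m0)) ler_pdivrMr//.
    by rewrite mulVf ?gt_eqF// ler_norml; lra.
  by move=> i _; rewrite indicE; congr (nat_of_bool _)%:R; apply/idP/idP; rewrite inE.
have phXY m : Ex P (fun x => ph m x * X x) <= Ex P (fun x => ph m x * Y x).
  have expand Z : itg P Z -> Ex P (fun x => ph m x * Z x) =
      m.+1%:R^-1 * \sum_(i < m.+1 * K)
        Ex P (fun x => \1_[set y | (i.+1)%:R <= m.+1%:R * phi y] x * Z x).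
    move=> Zi; rewrite -Ex_sum; last by move=> i _; apply: itgM => //; exact/bdd_indic/GM.
    rewrite -ExZ; last by apply: itg_sum => i _; apply: itgM => //; exact/bdd_indic/GM.
    by congr (Ex P _); apply/funext => x; rewrite /ph -mulrA mulr_suml.
  rewrite !expand// ler_wpM2l// ?invr_ge0//.
  by apply: ler_sum => i _; exact: XY.
have err m Z : itg P Z ->
    `|Ex P (fun x => phi x * Z x) - Ex P (fun x => ph m x * Z x)|
      <= m.+1%:R^-1 * Ex P (fun x => `|Z x|).
  move=> Zi; have i1 := itgM bphi Zi; have i2 := itgM (bph m) Zi.
  rewrite -ExB// (le_trans (Ex_norm (itgB i1 i2)))// -ExZ; last exact: itg_abs.
  apply: Ex_le; [exact/itg_abs/itgB|exact/itgZ/itg_abs|].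
  by apply: filterS (phE m) => x H; rewrite -mulrBl normrM ler_wpM2r.
rewrite leNgt; apply/negP => lt.
set a := Ex P (fun x => phi x * X x) in lt err.
set b := Ex P (fun x => phi x * Y x) in lt err.
set c := Ex P (fun x => `|X x|) + Ex P (fun x => `|Y x|).
have c0 : 0 <= c by rewrite addr_ge0// Ex_ge0//; [exact: itg_abs|exact: aeW|exact: itg_abs|exact: aeW].
(* Large enough for the discretisation error [c / (m + 1)] to fall below the supposed gap
   [a - b]. *)
pose m := Num.truncn (c / (a - b)).
have ab : 0 < a - b by rewrite subr_gt0.
have m0 : 0 < m.+1%:R :> R by rewrite ltr0n.
have small : m.+1%:R^-1 * c < a - b.
  by rewrite mulrC ltr_pdivrMr// mulrC -ltr_pdivrMr//; exact: truncnS_gt.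
rewrite /c mulrDr in small.
have := err m X Xi; have := err m Y Yi; rewrite !ler_norml.
move=> /andP[] h1 _ /andP[] _ h2; move: (phXY m) h1 h2 small; rewrite -/a -/b.
set u := Ex P _; set v := Ex P _; set x := _ * _; set y := _ * _; lra.
Qed.

End sub_sigma_algebra.

Section conditional_expectation.
Context {d : measure_display} {Om : measurableType d} {R : realType}.
Variable P : probability Om R.
Variable F : nat -> set (set Om).
Hypothesis Ffil : filtration F.
Implicit Types f g phi : Om -> R.
Local Notation E := (E P F).
Local Notation Ex := (Ex P).
Local Notation itg := (itg P).
Local Notation bdd := (bdd P).

Definition mF n f := mfunG (F n) f.

Lemma saF n : sigma_algebra setT (F n).
Proof. by case: Ffil => + _ _ _ => /(_ n)[]. Qed.

Lemma FM n : F n `<=` measurable.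
Proof. by case: Ffil => + _ _ _ => /(_ n)[]. Qed.

Lemma F_mono n m : (n <= m)%N -> F n `<=` F m.
Proof.
case: Ffil => _ FS _ _ nm.
rewrite -(subnKC nm); elim: (m - n)%N => [|k IH]; first by rewrite addn0.
by rewrite addnS => A /IH; exact: FS.
Qed.

Lemma F_setT n : F n setT.
Proof. by case: (saF n) => F0 + _ => /(_ _ F0); rewrite setD0. Qed.

Lemma F_setI n A B : F n A -> F n B -> F n (A `&` B).
Proof. by rewrite -(measG (saF n)) => *; exact: measurableI. Qed.

Lemma mF_mono n m f : (n <= m)%N -> mF n f -> mF m f.
Proof.
move=> nm mf _ B mB; rewrite (measG (saF m)); apply: (F_mono nm).
by rewrite -(measG (saF n)); exact: mf.
Qed.

Lemma mF_meas n f : mF n f -> measurable_fun setT f.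
Proof. exact: (mfunG_meas (saF n) (@FM n)). Qed.

Lemma mF_cst n c : mF n (cst c). Proof. exact: measurable_cst. Qed.
Lemma mFD n f g : mF n f -> mF n g -> mF n (fun x => f x + g x).
Proof. exact: measurable_funD. Qed.
Lemma mFB n f g : mF n f -> mF n g -> mF n (fun x => f x - g x).
Proof. exact: measurable_funB. Qed.
Lemma mFM n f g : mF n f -> mF n g -> mF n (fun x => f x * g x).
Proof. exact: measurable_funM. Qed.
Lemma mFX n k f : mF n f -> mF n (fun x => f x ^+ k).
Proof. exact: measurable_funX. Qed.
Lemma mF_abs n f : mF n f -> mF n (fun x => `|f x|).
Proof. by move=> mf; exact: measurableT_comp. Qed.
Lemma mF_max n f g : mF n f -> mF n g -> mF n (fun x => Num.max (f x) (g x)).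
Proof. exact: meas_max. Qed.
Lemma mF_sqrt n f : mF n f -> mF n (fun x => Num.sqrt (f x)).
Proof.
exact: measurableT_comp (continuous_measurable_fun (@sqrt_continuous R)).
Qed.
Lemma mF_indic n A : F n A -> mF n (\1_A : Om -> R).
Proof. exact: mfunG_indic (saF n) _. Qed.
Lemma mF_inv n f : mF n f -> mF n (fun x => (f x)^-1).
Proof. by move=> mf; exact: measurableT_comp measurable_inv mf. Qed.

Lemma mF_sum n (I : Type) (s : seq I) (Q : pred I) (f : I -> Om -> R) :
  (forall i, Q i -> mF n (f i)) -> mF n (fun x => \sum_(i <- s | Q i) f i x).
Proof.
move=> fi; elim: s => [|i s IH].
  by under eq_fun do rewrite big_nil; exact: mF_cst.
under eq_fun do rewrite big_cons.
have [Qi|//] := boolP (Q i); exact: mFD (fi _ Qi) IH.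
Qed.

Lemma F_le_set n f g : mF n f -> mF n g -> F n [set x | f x <= g x].
Proof. exact: (G_le_set (saF n)). Qed.

Lemma F_lt_set n f g : mF n f -> mF n g -> F n [set x | f x < g x].
Proof. exact: (G_lt_set (saF n)). Qed.

Lemma E_meas n f : itg f -> mF n (E n f).
Proof. by move=> /(CE_spec (saF n) (@FM n))[]. Qed.

Lemma E_itg n f : itg f -> itg (E n f).
Proof. by move=> /(CE_spec (saF n) (@FM n))[]. Qed.

Lemma E_set n f A : itg f -> F n A ->
  Ex (fun x => \1_A x * E n f x) = Ex (fun x => \1_A x * f x).
Proof. by move=> /(CE_spec (saF n) (@FM n))[_ _ + _]; exact. Qed.

Lemma E_condexp n f : itg f ->
  {ae P, forall x, condexp P (F n) (EFin \o f) x = (E n f x)%:E}.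
Proof. by move=> /(CE_spec (saF n) (@FM n))[]. Qed.

Lemma indT f : (fun x => \1_(setT : set Om) x * f x) = f.
Proof. by apply/funext => x; rewrite indicT mul1r. Qed.

Lemma E_Ex n f : itg f -> Ex (E n f) = Ex f.
Proof. by move=> fi; rewrite -[E n f]indT E_set ?indT//; exact: F_setT. Qed.

Lemma itg_ind A f : measurable A -> itg f -> itg (fun x => \1_A x * f x).
Proof. by move=> mA; apply: itgM; exact: bdd_indic. Qed.

Lemma E_leP n f g : itg f -> mF n g -> itg g ->
  (forall A, F n A -> Ex (fun x => \1_A x * f x) <= Ex (fun x => \1_A x * g x)) ->
  {ae P, forall x, E n f x <= g x}.
Proof.
move=> fi mg gi fg.
apply: (cond_le_ae (saF n) (@FM n)) => //; [exact: E_meas|exact: E_itg|].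
by move=> A FA; rewrite E_set//; exact: fg.
Qed.

Lemma E_geP n f g : itg f -> mF n g -> itg g ->
  (forall A, F n A -> Ex (fun x => \1_A x * g x) <= Ex (fun x => \1_A x * f x)) ->
  {ae P, forall x, g x <= E n f x}.
Proof.
move=> fi mg gi fg.
apply: (cond_le_ae (saF n) (@FM n)) => //; [exact: E_meas|exact: E_itg|].
by move=> A FA; rewrite E_set//; exact: fg.
Qed.

Lemma E_uniq n f g : itg f -> mF n g -> itg g ->
  (forall A, F n A -> Ex (fun x => \1_A x * f x) = Ex (fun x => \1_A x * g x)) ->
  {ae P, forall x, E n f x = g x}.
Proof.
move=> fi mg gi fg.
have h1 : {ae P, forall x, E n f x <= g x} by apply: E_leP => // A /fg ->.
have h2 : {ae P, forall x, g x <= E n f x} by apply: E_geP => // A /fg ->.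
by apply: filterS2 h1 h2 => x h1 h2; apply/eqP; rewrite eq_le h1.
Qed.

Lemma E_le n f g : itg f -> itg g -> {ae P, forall x, f x <= g x} ->
  {ae P, forall x, E n f x <= E n g x}.
Proof.
move=> fi gi fg; apply: E_leP => //; [exact: E_meas|exact: E_itg|move=> A FA].
rewrite E_set//; have mA := FM FA.
apply: Ex_le; [exact: itg_ind|exact: itg_ind|].
by apply: filterS fg => x; rewrite indicE; exact: ler_wpM2l.
Qed.

Lemma E_id n f : mF n f -> itg f -> {ae P, forall x, E n f x = f x}.
Proof. by move=> mf fi; exact: E_uniq. Qed.

Lemma E_cst n c : {ae P, forall x, E n (cst c) x = c}.
Proof. by have := E_id (mF_cst c) (itg_cst P c). Qed.

(** Equality at every point: the sets of versions among which [condexp] chooses are the same set, so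
    the chosen function is the same. *)
Lemma E_ae n f g : itg f -> itg g -> {ae P, forall x, f x = g x} -> E n f = E n g.
Proof.
move=> fi gi fg; rewrite /Defs.E /condexp.
have -> // : [set h | is_condexp P (F n) (EFin \o f) h] =
          [set h | is_condexp P (F n) (EFin \o g) h].
have fgA A : F n A ->
    (\int[P]_(x in A) (EFin \o f) x = \int[P]_(x in A) (EFin \o g) x)%E.
  move=> /FM mA; apply: ae_eq_integral => //.
  - exact/measurable_funTS/measurable_EFinP/(itg_meas fi).
  - exact/measurable_funTS/measurable_EFinP/(itg_meas gi).
  - by apply: filterS fg => x /= ->.
apply/seteqP; split => h /= [mh hE]; split => // A FA; rewrite hE ?fgA//.
Qed.

Lemma E_add n f g : itg f -> itg g ->
  {ae P, forall x, E n (fun x => f x + g x) x = E n f x + E n g x}.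
Proof.
move=> fi gi; have Ef := E_itg n fi; have Eg := E_itg n gi.
apply: E_uniq; [exact: itgD|apply: mFD; exact: E_meas|exact: itgD|].
move=> A FA; have mA := FM FA.
rewrite (_ : (fun x => _) = (fun x => \1_A x * f x + \1_A x * g x)); last first.
  by apply/funext => x; rewrite mulrDr.
rewrite (_ : (fun x => \1_A x * (E n f x + _)) =
    (fun x => \1_A x * E n f x + \1_A x * E n g x)); last first.
  by apply/funext => x; rewrite mulrDr.
by rewrite !ExD ?E_set//; exact: itg_ind.
Qed.

Lemma E_scale n c f : itg f ->
  {ae P, forall x, E n (fun x => c * f x) x = c * E n f x}.
Proof.
move=> fi; have Ef := E_itg n fi.
apply: E_uniq; [exact: itgZ|apply: mFM; [exact: mF_cst|exact: E_meas]|exact: itgZ|].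
move=> A FA; have mA := FM FA.
under eq_fun do rewrite mulrCA; under [in RHS]eq_fun do rewrite mulrCA.
by rewrite !ExZ ?E_set//; exact: itg_ind.
Qed.

Lemma E_opp n f : itg f -> {ae P, forall x, E n (fun x => - f x) x = - E n f x}.
Proof.
move=> fi; apply: filterS (E_scale n (-1) fi) => x; rewrite mulN1r => <-.
by congr (E n _ x); apply/funext => y; rewrite mulN1r.
Qed.

Lemma E_sub n f g : itg f -> itg g ->
  {ae P, forall x, E n (fun x => f x - g x) x = E n f x - E n g x}.
Proof.
move=> fi gi; apply: filterS2 (E_add n fi (itgN gi)) (E_opp n gi) => x.
by move=> -> ->.
Qed.

Lemma E_sum n (I : Type) (s : seq I) (Q : pred I) (f : I -> Om -> R) :
  (forall i, Q i -> itg (f i)) ->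
  {ae P, forall x, E n (fun x => \sum_(i <- s | Q i) f i x) x
    = \sum_(i <- s | Q i) E n (f i) x}.
Proof.
move=> fi; elim: s => [|i s IH].
  apply: filterS (E_cst n 0) => x; rewrite big_nil => {2}<-.
  by congr (E n _ x); apply/funext => y; rewrite big_nil.
have [Qi|Qi] := boolP (Q i); last first.
  apply: filterS IH => x; rewrite big_cons (negbTE Qi) => <-.
  by congr (E n _ x); apply/funext => y; rewrite big_cons (negbTE Qi).
apply: filterS2 (E_add n (fi _ Qi) (itg_sum s fi)) IH => x.
rewrite big_cons Qi => + <- => <-.
by congr (E n _ x); apply/funext => y; rewrite big_cons Qi.
Qed.

Lemma E_tower n m f : (n <= m)%N -> itg f ->
  {ae P, forall x, E n (E m f) x = E n f x}.
Proof.
move=> nm fi; apply: E_uniq; [exact: E_itg|exact: E_meas|exact: E_itg|].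
by move=> A FA; rewrite !E_set//; exact: F_mono FA.
Qed.

Lemma E_le_cst n f M : itg f -> {ae P, forall x, f x <= M} ->
  {ae P, forall x, E n f x <= M}.
Proof.
move=> fi fM; have := E_le n fi (itg_cst P M) fM.
by move=> H; apply: filterS2 H (E_cst n M) => x + <-.
Qed.

Lemma E_ge_cst n f M : itg f -> {ae P, forall x, M <= f x} ->
  {ae P, forall x, M <= E n f x}.
Proof.
move=> fi fM; have := E_le n (itg_cst P M) fi fM.
by move=> H; apply: filterS2 H (E_cst n M) => x + <-.
Qed.

Lemma E_norm_cst n f M : itg f -> {ae P, forall x, `|f x| <= M} ->
  {ae P, forall x, `|E n f x| <= M}.
Proof.
move=> fi fM.
have h1 : {ae P, forall x, E n f x <= M}.
  by apply: E_le_cst => //; apply: filterS fM => x /ler_normlP[].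
have h2 : {ae P, forall x, - M <= E n f x}.
  by apply: E_ge_cst => //; apply: filterS fM => x /ler_normlP[]; rewrite lerNl.
by apply: filterS2 h1 h2 => x h1 h2; rewrite ler_norml h2.
Qed.

Lemma E_norm n f : itg f ->
  {ae P, forall x, `|E n f x| <= E n (fun x => `|f x|) x}.
Proof.
move=> fi; have afi := itg_abs fi.
have h1 : {ae P, forall x, f x <= `|f x|} by apply: aeW => x; exact: ler_norm.
have h2 : {ae P, forall x, - f x <= `|f x|}.
  by apply: aeW => x; rewrite -normrN; exact: ler_norm.
apply: filterS3 (E_le n fi afi h1) (E_le n (itgN fi) afi h2) (E_opp n fi) => x.
by move=> a + e; rewrite e => c; rewrite ler_norml a andbT lerNl.
Qed.

Lemma E_L1 n f : itg f -> Ex (fun x => `|E n f x|) <= Ex (fun x => `|f x|).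
Proof.
move=> fi; have afi := itg_abs fi; rewrite -(E_Ex n afi).
apply: Ex_le; [exact/itg_abs/E_itg|exact: E_itg|exact: E_norm].
Qed.

Lemma E_bdd n f : bdd f -> bdd (E n f).
Proof.
move=> fb; have fi := bdd_itg fb; split; first exact: mF_meas (E_meas fi).
by case: fb => _ [M fM]; exists M; exact: E_norm_cst.
Qed.

Lemma E_weight_le n phi X Y : mF n phi -> bdd phi ->
  {ae P, forall x, 0 <= phi x} -> itg X -> itg Y ->
  (forall A, F n A -> Ex (fun x => \1_A x * X x) <= Ex (fun x => \1_A x * Y x)) ->
  Ex (fun x => phi x * X x) <= Ex (fun x => phi x * Y x).
Proof. exact: (cond_le_weight (saF n) (@FM n)). Qed.

Lemma Ex_pull n phi f : mF n phi -> bdd phi -> itg f ->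
  Ex (fun x => phi x * E n f x) = Ex (fun x => phi x * f x).
Proof.
move=> mphi bphi fi; have Ef := E_itg n fi.
case: (bphi) => _ [M phiM].
(* Comparison with weights needs a nonnegative weight, so [phi] is shifted by its bound; the shift
   is removed by [E_Ex]. *)
pose psi x := phi x + M.
have mpsi : mF n psi by apply: mFD => //; exact: mF_cst.
have bpsi : bdd psi by apply: bddD => //; exact: bdd_cst.
have psi0 : {ae P, forall x, 0 <= psi x}.
  by apply: filterS phiM => x; rewrite ler_norml => /andP[+ _]; rewrite /psi; lra.
have key : Ex (fun x => psi x * E n f x) = Ex (fun x => psi x * f x).
  apply/eqP; rewrite eq_le; apply/andP; split.
    by apply: (E_weight_le mpsi) => // A FA; rewrite E_set.
  by apply: (E_weight_le mpsi) => // A FA; rewrite E_set.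
have expand Z : itg Z ->
    Ex (fun x => psi x * Z x) = Ex (fun x => phi x * Z x) + M * Ex Z.
  move=> Zi; rewrite -ExZ// -ExD//; [|exact: itgM|exact: itgZ].
  by congr Ex; apply/funext => x; rewrite /psi mulrDl.
by move: key; rewrite !expand// E_Ex// => /addIr.
Qed.

Lemma E_pull n phi f : mF n phi -> bdd phi -> itg f ->
  {ae P, forall x, E n (fun x => phi x * f x) x = phi x * E n f x}.
Proof.
move=> mphi bphi fi; apply: E_uniq.
- exact: itgM.
- by apply: mFM => //; exact: E_meas.
- by apply: itgM => //; exact: E_itg.
- move=> A FA; have mA := FM FA.
  have mp : mF n (fun x => \1_A x * phi x) by apply: mFM => //; exact: mF_indic.
  have bp : bdd (fun x => \1_A x * phi x) by apply: bddM => //; exact: bdd_indic.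
  under eq_fun do rewrite mulrA; under [in RHS]eq_fun do rewrite mulrA.
  by rewrite (Ex_pull mp).
Qed.

End conditional_expectation.

(** * Davis and Doob inequalities *)

Section pathwise.
Context {R : realType}.
Implicit Types x : nat -> R.

Definition rmax x k : R := \big[Num.max/0]_(j < k.+1) `|x j|.
Definition incr x k : R := if k is j.+1 then x k - x j else x 0%N.
Definition qvar x k : R := \sum_(j < k.+1) incr x j ^+ 2.

Lemma rmax0 x : rmax x 0 = `|x 0%N|.
Proof. by rewrite /rmax big_ord_recl big_ord0 /=; apply/max_idPl. Qed.

Lemma bigmax_recr (f : nat -> R) n :
  \big[Num.max/0]_(j < n.+1) `|f j| = Num.max (\big[Num.max/0]_(j < n) `|f j|) `|f n|.
Proof.
elim: n f => [|n IH] f.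
  rewrite big_ord_recl !big_ord0 /=.
  by rewrite [LHS](_ : _ = `|f 0%N|) ?[RHS](_ : _ = `|f 0%N|)//; [apply/max_idPr|apply/max_idPl].
rewrite big_ord_recl (IH (fun j => f j.+1)) [in RHS]big_ord_recl /= maxA.
by congr (Num.max (Num.max _ _) _); apply: eq_bigr.
Qed.

Lemma rmaxS x k : rmax x k.+1 = Num.max (rmax x k) `|x k.+1|.
Proof. exact: bigmax_recr. Qed.

Lemma rmax_ge x k : `|x k| <= rmax x k.
Proof. by case: k => [|k]; rewrite ?rmax0// rmaxS le_max lexx orbT. Qed.

Lemma rmax_ge0 x k : 0 <= rmax x k.
Proof. exact: le_trans (rmax_ge x k). Qed.

Lemma rmax_leS x k : rmax x k <= rmax x k.+1.
Proof. by rewrite rmaxS le_max lexx. Qed.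

Lemma rmax_mono x j k : (j <= k)%N -> rmax x j <= rmax x k.
Proof.
move=> /subnKC <-; elim: (k - j)%N => [|n IH]; first by rewrite addn0.
by rewrite addnS (le_trans IH)// rmax_leS.
Qed.

Lemma rmax_lub x k c : 0 <= c -> (forall j, (j <= k)%N -> `|x j| <= c) ->
  rmax x k <= c.
Proof.
move=> c0 xc; elim: k xc => [|k IH] xc; first by rewrite rmax0 xc.
by rewrite rmaxS ge_max xc// IH// => j jk; apply: xc; exact: leqW.
Qed.

Lemma qvar0 x : qvar x 0 = x 0%N ^+ 2.
Proof. by rewrite /qvar big_ord_recl big_ord0 addr0. Qed.

Lemma qvarS x k : qvar x k.+1 = qvar x k + (x k.+1 - x k) ^+ 2.
Proof. by rewrite /qvar big_ord_recr. Qed.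

Lemma qvar_ge0 x k : 0 <= qvar x k.
Proof. by apply: sumr_ge0 => j _; exact: sqr_ge0. Qed.

Lemma qvar_rmax0 x k : rmax x k = 0 -> qvar x k = 0.
Proof.
elim: k => [|k IH].
  by rewrite rmax0 qvar0 => /normr0_eq0 ->; rewrite expr0n.
move=> m0; have mk : rmax x k = 0.
  by apply/eqP; rewrite eq_le rmax_ge0 andbT -m0 rmax_leS.
have /normr0_eq0 xk : `|x k| = 0.
  by apply/eqP; rewrite eq_le normr_ge0 andbT -mk rmax_ge.
have /normr0_eq0 xk1 : `|x k.+1| = 0.
  by apply/eqP; rewrite eq_le normr_ge0 andbT -m0 rmax_ge.
by rewrite qvarS IH// xk xk1 subrr expr0n addr0.
Qed.

(** One step of a functional that decreases up to a martingale increment. As [q + (z - y)^2 - z^2 =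
    q - y^2 - 2 y (z - y)], both sides agree while the maximum does not change; when it rises to
    [|z|], the gain comes from [(s' - s)^2 <= (z - y)^2]. If [s = 0], then [y = q = 0] and the
    right-hand side is 0 by the convention on division. *)
Lemma square_fun_max_step (y z s s' q : R) : `|y| <= s -> 0 <= q ->
  (s = 0 -> q = 0) -> s' = Num.max s `|z| ->
  (q + (z - y) ^+ 2 - z ^+ 2 - 2 * s' ^+ 2) / s'
    <= (q - y ^+ 2 - 2 * s ^+ 2) / s - 2 * (y / s * (z - y)).
Proof.
move=> ys q0 sq s'E.
have s0 : 0 <= s := le_trans (normr_ge0 _) ys.
have ss' : s <= s' by rewrite s'E le_max lexx.
have zs' : `|z| <= s' by rewrite s'E le_max lexx orbT.
have [se0|sn0] := eqVneq s 0.
  have y0 : y = 0 by apply/normr0_eq0/eqP; rewrite eq_le normr_ge0 andbT -se0.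
  rewrite [leRHS](_ : _ = 0); last by rewrite se0 y0 invr0 mulr0 !mul0r mulr0 subrr.
  rewrite (_ : _ + _ - _ - _ = - (2 * s' ^+ 2)); last by rewrite y0 (sq se0); ring.
  rewrite mulNr oppr_le0; apply: mulr_ge0; first by rewrite mulr_ge0 ?sqr_ge0.
  by rewrite invr_ge0 (le_trans s0).
have sp : 0 < s by rewrite lt_neqAle eq_sym sn0.
have sp' : 0 < s' by exact: lt_le_trans ss'.
have -> : (q - y ^+ 2 - 2 * s ^+ 2) / s - 2 * (y / s * (z - y)) =
  (q + y ^+ 2 - 2 * y * z - 2 * s ^+ 2) / s by field.
rewrite ler_pdivrMr// mulrAC ler_pdivlMr//.
have [zs|zs] := leP `|z| s.
  have -> : s' = s by rewrite s'E; apply/max_idPl.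
  nra.
have {}s'E : s' = `|z| by rewrite s'E; apply/max_idPr/ltW.
have : z ^+ 2 = s' ^+ 2 by rewrite s'E real_normK// num_real.
have : (s' - s) <= `|z - y|.
  by rewrite s'E (le_trans _ (lerB_dist _ _))// lerD2l lerN2.
have : (z - y) ^+ 2 = `|z - y| ^+ 2 by rewrite real_normK// num_real.
set w := `|z - y| => wE wge zE.
have w2 : (s' - s) ^+ 2 <= w ^+ 2 by rewrite ler_sqr ?nnegrE ?subr_ge0// normr_ge0.
have key : 0 <= q + y ^+ 2 - 2 * y * z + 2 * s * s' by nra.
nra.
Qed.

Lemma square_fun_le_max x N :
  Num.sqrt (qvar x N) <=
    2 * rmax x N - \sum_(k < N) x k / rmax x k * (x k.+1 - x k).
Proof.
have U k : (qvar x k - x k ^+ 2 - 2 * rmax x k ^+ 2) / rmax x k <=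
    - 2 * \sum_(j < k) x j / rmax x j * (x j.+1 - x j).
  elim: k => [|k IH].
    rewrite big_ord0 mulr0 qvar0 subrr sub0r mulNr oppr_le0.
    by rewrite mulr_ge0 ?invr_ge0 ?rmax_ge0// mulr_ge0// sqr_ge0.
  rewrite big_ord_recr /= mulrDr qvarS.
  apply: le_trans (square_fun_max_step (rmax_ge x k) (qvar_ge0 x k)
    (@qvar_rmax0 x k) (rmaxS x k)) _.
  by move: IH; set t := _ / _ * _; lra.
have := U N; set s := rmax x N; set q := qvar x N; set S := \sum_(_ < _) _ => UN.
have [s0|sn0] := eqVneq s 0.
  move: UN; rewrite s0 invr0 mulr0 /q (qvar_rmax0 s0) sqrtr0; lra.
have sp : 0 < s by rewrite lt_neqAle eq_sym sn0 rmax_ge0.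
have xs : x N ^+ 2 <= s ^+ 2.
  by rewrite -[x N ^+ 2]real_normK ?num_real// ler_sqr ?nnegrE ?rmax_ge// ltW.
have qE : Num.sqrt q ^+ 2 = q by rewrite sqr_sqrtr// qvar_ge0.
have r0 := sqrtr_ge0 q; set r := Num.sqrt q in qE r0 *.
move: UN; rewrite ler_pdivrMr// -qE => UN.
(* [2 r s <= r^2 + s^2] turns the quadratic bound into a linear one after division by [s]. *)
have : 2 * r * s <= s * (4 * s - 2 * S) by have := sqr_ge0 (r - s); nra.
by rewrite mulrC ler_pM2l//; lra.
Qed.

(** The functional for the reverse inequality, built on [f = max (s, 2 r)]. When [f'] equals [2 r'],
    its growth is paid by the term [- 4 r]; when the maximum rises to [|z|], [z^2 = f'^2] and
    [r' <= f'/2] give [z^2 - r'^2 >= 3/4 f'^2], which is the origin of 3/4. *)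
Lemma max_square_fun_step (y z s s' r r' f f' : R) : `|y| <= s -> 0 <= r -> 0 <= r' ->
  r' ^+ 2 = r ^+ 2 + (z - y) ^+ 2 -> s' = Num.max s `|z| ->
  f = Num.max s (2 * r) -> f' = Num.max s' (2 * r') ->
  (z ^+ 2 - r' ^+ 2) / f' + 3 / 4 * f' - 4 * r'
   <= (y ^+ 2 - r ^+ 2) / f + 3 / 4 * f - 4 * r + 2 * y / f * (z - y).
Proof.
move=> ys r0 r'0 r'E s'E fE f'E0.
have s0 : 0 <= s := le_trans (normr_ge0 _) ys.
have ss' : s <= s' by rewrite s'E le_max lexx.
have zs' : `|z| <= s' by rewrite s'E le_max lexx orbT.
have rr' : r <= r'.
  by rewrite -ler_sqr ?nnegrE// r'E lerDl sqr_ge0.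
have fs : s <= f by rewrite fE le_max lexx.
have fr : 2 * r <= f by rewrite fE le_max lexx orbT.
have ff' : f <= f'.
  by rewrite fE f'E0 ge_max !le_max ss' /= ler_pM2l// rr' orbT.
have [fe0|fn0] := eqVneq f 0.
  have re0 : r = 0 by lra.
  have y0 : y = 0 by apply/normr0_eq0/eqP; rewrite eq_le normr_ge0 andbT -fe0 (le_trans ys).
  have rz : r' = `|z|.
    apply/eqP; rewrite -(eqrXn2 (ltn0Sn 1)) ?normr_ge0// r'E re0 y0 subr0.
    by rewrite real_normK ?num_real// expr0n add0r.
  have se0 : s = 0 by apply/eqP; rewrite eq_le s0 andbT -fe0.
  have -> : f' = 2 * r'.
    rewrite f'E0 s'E se0 rz.
    have -> : Num.max 0 `|z| = `|z| by apply/max_idPr.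
    by apply/max_idPr; rewrite mulr2n mulrDl mul1r lerDl.
  rewrite fe0 y0 re0 invr0 !mulr0 mul0r.
  have -> : z ^+ 2 = r' ^+ 2 by rewrite rz real_normK// num_real.
  rewrite subrr mul0r; lra.
have fp : 0 < f by rewrite lt_neqAle eq_sym fn0 (le_trans s0).
have fp' : 0 < f' by exact: lt_le_trans ff'.
have fn0' : f' != 0 by rewrite gt_eqF.
pose Q := z ^+ 2 - r' ^+ 2.
have QE : Q = y ^+ 2 + 2 * y * (z - y) - r ^+ 2 by rewrite /Q r'E; ring.
suff H : (f' - f) * (3 / 4 * (f * f') - Q) <= 4 * (r' - r) * (f * f').
  have -> : (y ^+ 2 - r ^+ 2) / f + 3 / 4 * f - 4 * r + 2 * y / f * (z - y) =
     Q / f + 3 / 4 * f - 4 * r by rewrite QE; field.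
  rewrite -/Q -(ler_pM2r (mulr_gt0 fp fp')).
  have -> : (Q / f' + 3 / 4 * f' - 4 * r') * (f * f') =
     Q * f + (3 / 4 * f' - 4 * r') * (f * f') by field.
  have -> : (Q / f + 3 / 4 * f - 4 * r) * (f * f') =
     Q * f' + (3 / 4 * f - 4 * r) * (f * f') by field.
  nra.
have ffp : 0 < f * f' by rewrite mulr_gt0.
have rhs0 : 0 <= 4 * (r' - r) * (f * f').
  by apply: mulr_ge0; [apply: mulr_ge0 => //; rewrite subr_ge0|exact: ltW].
have [sr|rs] := leP s' (2 * r').
  have f'E : f' = 2 * r' by rewrite f'E0; apply/max_idPr.
  have f'f : f' - f <= 2 * (r' - r) by rewrite f'E; lra.
  have zy : `|z - y| <= r'.
    rewrite -ler_sqr ?nnegrE// real_normK ?num_real// r'E lerDr; exact: sqr_ge0.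
  have yzy : `|y * (z - y)| <= f * r'.
    by rewrite normrM ler_pM// (le_trans ys).
  have Qge : - (5 / 4) * (f * f') <= Q.
    move: yzy; rewrite ler_norml => /andP[yzy _].
    have : r ^+ 2 <= f * f' / 4 by nra.
    rewrite QE; have := sqr_ge0 y; rewrite f'E; nra.
  have h1 : 3 / 4 * (f * f') - Q <= 2 * (f * f') by lra.
  have : (f' - f) * (3 / 4 * (f * f') - Q) <= (f' - f) * (2 * (f * f')).
    by rewrite ler_wpM2l// subr_ge0.
  nra.
have f'E : f' = s' by rewrite f'E0; apply/max_idPl/ltW.
have [zs|zs] := leP `|z| s.
  have s'e : s' = s by rewrite s'E; apply/max_idPl.
  have : f' = f by apply/eqP; rewrite eq_le ff' andbT f'E s'e.
  by move=> f'f; rewrite {1}f'f subrr mul0r.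
have {}s'E : s' = `|z| by rewrite s'E; apply/max_idPr/ltW.
have zE : z ^+ 2 = f' ^+ 2 by rewrite f'E s'E real_normK// num_real.
have Qge : 3 / 4 * f' ^+ 2 <= Q.
  rewrite /Q zE; have : r' ^+ 2 <= f' ^+ 2 / 4 by rewrite f'E; nra.
  lra.
have h1 : 3 / 4 * (f * f') - Q <= 0 by nra.
have : (f' - f) * (3 / 4 * (f * f') - Q) <= 0.
  by rewrite mulr_ge0_le0// subr_ge0.
by move/le_trans; apply.
Qed.

Lemma max_le_square_fun x N :
  3 / 4 * rmax x N <= 9 / 2 * Num.sqrt (qvar x N) +
    \sum_(k < N) 2 * x k / Num.max (rmax x k) (2 * Num.sqrt (qvar x k)) * (x k.+1 - x k).
Proof.
pose f k := Num.max (rmax x k) (2 * Num.sqrt (qvar x k)).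
have L k : (x k ^+ 2 - Num.sqrt (qvar x k) ^+ 2) / f k + 3 / 4 * f k - 4 * Num.sqrt (qvar x k)
    <= \sum_(j < k) 2 * x j / f j * (x j.+1 - x j).
  elim: k => [|k IH].
    rewrite big_ord0 /f rmax0 qvar0 sqrtr_sqr real_normK ?num_real// subrr mul0r add0r.
    have -> : Num.max `|x 0%N| (2 * `|x 0%N|) = 2 * `|x 0%N|.
      by apply/max_idPr; rewrite mulr2n mulrDl mul1r lerDl.
    have := normr_ge0 (x 0%N); lra.
  rewrite big_ord_recr /=.
  have qE : Num.sqrt (qvar x k.+1) ^+ 2 =
      Num.sqrt (qvar x k) ^+ 2 + (x k.+1 - x k) ^+ 2.
    by rewrite !sqr_sqrtr ?qvar_ge0// qvarS.
  apply: le_trans (max_square_fun_step (rmax_ge x k) (sqrtr_ge0 _)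
    (sqrtr_ge0 _) qE (rmaxS x k) erefl erefl) _.
  by rewrite lerD2r.
have := L N; set S := \sum_(_ < _) _.
have fs : rmax x N <= f N by rewrite le_max lexx.
have fr : 2 * Num.sqrt (qvar x N) <= f N by rewrite le_max lexx orbT.
have r0 := sqrtr_ge0 (qvar x N); set r := Num.sqrt _ in r0 fr *.
move=> LN; have [fe0|fn0] := eqVneq (f N) 0.
  move: LN; rewrite fe0 invr0 mulr0; move: fs fr; rewrite fe0; have := rmax_ge0 x N; lra.
have fp : 0 < f N by rewrite lt_neqAle eq_sym fn0 (le_trans (rmax_ge0 x N)).
(* [f >= 2 r] gives [- r^2 / f >= - r/2]; together with [4 r] this makes 9/2. *)
have : - (r / 2) <= (x N ^+ 2 - r ^+ 2) / f N.
  by rewrite ler_pdivlMr//; have := sqr_ge0 (x N); nra.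
lra.
Qed.

(** With [w = sg(y) (z - y)] one has [|y| + w <= |z|], the pathwise form of the submartingale
    property of the absolute value. *)
Lemma doob_step (y z s s' : R) : `|y| <= s -> s' = Num.max s `|z| ->
  2 * s' * (s' - 2 * `|z|) <= 2 * s * (s - 2 * `|y|) - 4 * (s * Num.sg y * (z - y)).
Proof.
move=> ys s'E; have s0 : 0 <= s := le_trans (normr_ge0 _) ys.
have : `|y| + Num.sg y * (z - y) <= `|z|.
  rewrite mulrBr -normrEsg addrCA subrr addr0.
  rewrite (le_trans (ler_norm _))// normrM.
  by rewrite normr_sg -{2}[`|z|]mul1r ler_wpM2r//; case: (_ == _); rewrite /= ?ler01.
set w := Num.sg y * (z - y) => h.
have -> : s * Num.sg y * (z - y) = s * w by rewrite mulrA.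
have [zs|zs] := leP `|z| s.
  have -> : s' = s by rewrite s'E; apply/max_idPl.
  nra.
have -> : s' = `|z| by rewrite s'E; apply/max_idPr/ltW.
have : 0 <= (`|z| - s) ^+ 2 by exact: sqr_ge0.
nra.
Qed.

Lemma max_sqr_le x N :
  rmax x N ^+ 2 <= 4 * x N ^+ 2 -
    4 * \sum_(k < N) rmax x k * Num.sg (x k) * (x k.+1 - x k).
Proof.
have V k : 2 * rmax x k * (rmax x k - 2 * `|x k|) <=
    - 4 * \sum_(j < k) rmax x j * Num.sg (x j) * (x j.+1 - x j).
  elim: k => [|k IH].
    by rewrite big_ord0 mulr0 rmax0; have := normr_ge0 (x 0%N); nra.
  rewrite big_ord_recr /= [leRHS]mulrDr.
  apply: le_trans (doob_step (rmax_ge x k) (rmaxS x k)) _.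
  by move: IH; set t := _ * _ * (_ - _); lra.
have := V N; set S := \sum_(_ < _) _.
have := real_normK (num_real (x N)).
have : 0 <= (rmax x N - 2 * `|x N|) ^+ 2 by exact: sqr_ge0.
nra.
Qed.

Lemma sqrtD_le (a b : R) : 0 <= a -> 0 <= b ->
  Num.sqrt (a + b) <= Num.sqrt a + Num.sqrt b.
Proof.
move=> a0 b0; rewrite -ler_sqr ?nnegrE ?addr_ge0 ?sqrtr_ge0//.
rewrite sqrrD !sqr_sqrtr ?addr_ge0//.
have : 0 <= Num.sqrt a * Num.sqrt b by rewrite mulr_ge0 ?sqrtr_ge0.
lra.
Qed.

End pathwise.

(** * Square functions, running maxima and the [H_1] norm *)

Section square_function.
Context {d : measure_display} {Om : measurableType d} {R : realType}.
Variable P : probability Om R.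
Implicit Types X : nat -> Om -> R.
Local Notation Ex := (Ex P).
Local Notation itg := (itg P).
Local Notation bdd := (bdd P).

Definition SQ X N x : R := Num.sqrt (qvar (X^~ x) N).
Definition MX X N x : R := rmax (X^~ x) N.

Lemma SQ_ge0 X N x : 0 <= SQ X N x. Proof. exact: sqrtr_ge0. Qed.
Lemma MX_ge0 X N x : 0 <= MX X N x. Proof. exact: rmax_ge0. Qed.

Lemma mdiffE X n x : mdiff X n x = incr (X^~ x) n.
Proof. by case: n => [|n] //=; rewrite /mdiff subr0. Qed.

Lemma SQE X N x : SQ X N x = Num.sqrt (\sum_(j < N.+1) mdiff X j x ^+ 2).
Proof. by rewrite /SQ /qvar; congr Num.sqrt; apply: eq_bigr => i _; rewrite mdiffE. Qed.

Lemma sqrt_sum_sqr_le (I : Type) (s : seq I) (f : I -> R) :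
  Num.sqrt (\sum_(i <- s) f i ^+ 2) <= \sum_(i <- s) `|f i|.
Proof.
elim: s => [|i s IH]; first by rewrite !big_nil sqrtr0.
rewrite !big_cons (le_trans (sqrtD_le _ _)) ?sqr_ge0 ?sumr_ge0//.
  by move=> *; exact: sqr_ge0.
by rewrite sqrtr_sqr lerD2l.
Qed.

Lemma SQ_le_sum X N x : SQ X N x <= \sum_(j < N.+1) `|mdiff X j x|.
Proof. by rewrite SQE; exact: sqrt_sum_sqr_le. Qed.

Lemma SQ_mono X n m x : (n <= m)%N -> SQ X n x <= SQ X m x.
Proof.
move=> /subnKC <-; elim: (m - n)%N => [|k IH]; first by rewrite addn0.
rewrite addnS (le_trans IH)// ler_sqrt ?qvar_ge0// qvarS lerDl.
exact: sqr_ge0.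
Qed.

Lemma prev_itg X n : (forall k, itg (X k)) -> itg (Defs.prev X n).
Proof. by move=> Xi; case: n => [|n] /=; [exact: itg_cst|exact: Xi]. Qed.

Lemma prev_bdd X n : (forall k, bdd (X k)) -> bdd (Defs.prev X n).
Proof. by move=> Xi; case: n => [|n] /=; [exact: bdd_cst|exact: Xi]. Qed.

Lemma mdiff_itg X n : (forall k, itg (X k)) -> itg (mdiff X n).
Proof. by move=> Xi; apply: itgB => //; exact: prev_itg. Qed.

Lemma mdiff_bdd X n : (forall k, bdd (X k)) -> bdd (mdiff X n).
Proof. by move=> Xi; apply: bddB => //; exact: prev_bdd. Qed.

Lemma mdiff_meas X n : (forall k, measurable_fun setT (X k)) ->
  measurable_fun setT (mdiff X n).
Proof. by move=> mX; apply: measurable_funB => //; case: n. Qed.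

Lemma SQ_meas X N : (forall k, measurable_fun setT (X k)) ->
  measurable_fun setT (SQ X N).
Proof.
move=> mX; rewrite (_ : SQ X N =
    (fun x => Num.sqrt (\sum_(j < N.+1) mdiff X j x ^+ 2))); last first.
  by apply/funext => x; exact: SQE.
apply: measurableT_comp (continuous_measurable_fun (@sqrt_continuous R)) _.
by apply: measurable_sum => j; apply: measurable_funX; exact: mdiff_meas.
Qed.

Lemma SQ_itg X N : (forall k, itg (X k)) -> itg (SQ X N).
Proof.
move=> Xi; apply: (@itg_le _ _ _ _ _ (fun x => \sum_(j < N.+1) `|mdiff X j x|)).
- by apply: SQ_meas => k; exact: itg_meas (Xi k).
- by apply: itg_sum => i _; apply: itg_abs; exact: mdiff_itg.
- by apply: aeW => x; rewrite ger0_norm ?SQ_ge0//; exact: SQ_le_sum.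
Qed.

Lemma SQ_bdd X N : (forall k, bdd (X k)) -> bdd (SQ X N).
Proof.
move=> Xi; apply: (@bdd_le _ _ _ _ _ (fun x => \sum_(j < N.+1) `|mdiff X j x|)).
- by apply: SQ_meas => k; exact: bdd_meas (Xi k).
- by apply: bdd_sum => i _; apply: bdd_abs; exact: mdiff_bdd.
- apply: aeW => x; rewrite ger0_norm ?SQ_ge0// ger0_norm ?sumr_ge0//.
  exact: SQ_le_sum.
Qed.

Lemma MX_meas X N : (forall k, measurable_fun setT (X k)) ->
  measurable_fun setT (MX X N).
Proof.
move=> mX; elim: N => [|N IH].
  rewrite (_ : MX X 0 = fun x => `|X 0%N x|); first exact: measurableT_comp.
  by apply/funext => x; rewrite /MX rmax0.
rewrite (_ : MX X N.+1 = fun x => Num.max (MX X N x) `|X N.+1 x|).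
  by apply: meas_max => //; exact: measurableT_comp.
by apply/funext => x; rewrite /MX rmaxS.
Qed.

Lemma MX_le_sum X N x : MX X N x <= \sum_(j < N.+1) `|X j x|.
Proof.
apply: rmax_lub => [|j jN]; first exact: sumr_ge0.
by rewrite (bigD1 (Ordinal (jN : (j < N.+1)%N)))//= lerDl sumr_ge0.
Qed.

Lemma MX_itg X N : (forall k, itg (X k)) -> itg (MX X N).
Proof.
move=> Xi; apply: (@itg_le _ _ _ _ _ (fun x => \sum_(j < N.+1) `|X j x|)).
- by apply: MX_meas => k; exact: itg_meas (Xi k).
- by apply: itg_sum => i _; apply: itg_abs.
- by apply: aeW => x; rewrite ger0_norm ?MX_ge0//; exact: MX_le_sum.
Qed.

Lemma MX_bdd X N : (forall k, bdd (X k)) -> bdd (MX X N).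
Proof.
move=> Xi; apply: (@bdd_le _ _ _ _ _ (fun x => \sum_(j < N.+1) `|X j x|)).
- by apply: MX_meas => k; exact: bdd_meas (Xi k).
- by apply: bdd_sum => i _; apply: bdd_abs.
- apply: aeW => x; rewrite ger0_norm ?MX_ge0// ger0_norm ?sumr_ge0//.
  exact: MX_le_sum.
Qed.

Lemma partial_square_fun X N x :
  ((\sum_(0 <= n < N.+1) ((mdiff X n x) ^+ 2)%:E) `^ 2^-1)%E = (SQ X N x)%:E.
Proof.
rewrite sumEFin poweR_EFin powR12_sqrt; last by apply: sumr_ge0 => *; exact: sqr_ge0.
by rewrite SQE big_mkord.
Qed.

(** Replaces the extended-real series by finite sums: the power 1/2 is increasing, and if the
    partial roots have a finite limit [M], every partial sum is at most [M^2]. *)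
Lemma square_fun_lim X x : square_fun X x = limn (fun N => (SQ X N x)%:E).
Proof.
have nd : {homo (fun N => (SQ X N x)%:E) : n m / (n <= m)%N >-> (n <= m)%E}.
  by move=> n m nm; rewrite lee_fin; exact: SQ_mono.
have cv := ereal_nondecreasing_is_cvgn nd.
have t0 n : (0 <= n)%N -> true -> (0 <= ((mdiff X n x) ^+ 2)%:E)%E.
  by move=> _ _; rewrite lee_fin sqr_ge0.
have cs := is_cvg_nneseries t0.
apply/eqP; rewrite eq_le; apply/andP; split; last first.
  apply: lime_le => //; apply: nearW => N.
  rewrite -partial_square_fun /square_fun.
  apply: gt0_ler_poweR; rewrite ?invr_ge0// ?in_itv/= ?leey ?andbT.
  - by apply: sume_ge0 => i _; rewrite lee_fin sqr_ge0.
  - by apply: nneseries_ge0 => i *; exact: t0.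
  - exact: nneseries_lim_ge.
set l := limn _.
have lN N : ((SQ X N x)%:E <= l)%E.
  rewrite /l (cvg_lim _ (ereal_nondecreasing_cvgn nd))//.
  by apply: ereal_sup_ubound; exists N.
case: l lN => [M lN| _|lN]; [|exact: leey|by have := lN 0%N].
have M0 : 0 <= M by have := lN 0%N; rewrite lee_fin; exact: le_trans (SQ_ge0 _ _ _).
have -> : M%:E = (((M ^+ 2)%:E) `^ 2^-1)%E.
  by rewrite poweR_EFin powR12_sqrt ?sqr_ge0// sqrtr_sqr ger0_norm.
apply: gt0_ler_poweR; rewrite ?invr_ge0// ?in_itv/= ?leey ?andbT ?lee_fin ?sqr_ge0//.
  by apply: nneseries_ge0 => i *; exact: t0.
apply: lime_le => //; apply: nearW => -[|N].
  by rewrite big_nil lee_fin sqr_ge0.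
rewrite sumEFin lee_fin big_mkord; have := lN N; rewrite lee_fin SQE => H.
rewrite -[leLHS]sqr_sqrtr; last by apply: sumr_ge0 => *; exact: sqr_ge0.
by rewrite ler_sqr ?nnegrE// sqrtr_ge0.
Qed.

Lemma H1_normE X : (forall k, measurable_fun setT (X k)) ->
  (H1_norm P X = limn (fun N => \int[P]_x (SQ X N x)%:E))%E.
Proof.
move=> mX; rewrite /H1_norm Lnorm1.
rewrite (eq_integral (fun x => limn (fun N => (SQ X N x)%:E))); last first.
  by move=> x _; rewrite gee0_abs ?poweR_ge0// square_fun_lim.
apply: monotone_convergence => //.
- by move=> N; apply/measurable_EFinP; exact: SQ_meas.
- by move=> N x _; rewrite lee_fin SQ_ge0.
- by move=> x _ n m nm; rewrite lee_fin; exact: SQ_mono.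
Qed.

Lemma SQ_int_nd X : (forall k, measurable_fun setT (X k)) ->
  {homo (fun N => \int[P]_x (SQ X N x)%:E)%E : n m / (n <= m)%N >-> (n <= m)%E}.
Proof.
move=> mX n m nm; apply: ge0_le_integral => //.
- by move=> x _; rewrite lee_fin SQ_ge0.
- by apply/measurable_EFinP; exact: SQ_meas.
- by apply/measurable_EFinP; exact: SQ_meas.
- by move=> x _; rewrite lee_fin; exact: SQ_mono.
Qed.

Lemma Ex_SQ_le_H1 X N : (forall k, itg (X k)) -> ((Ex (SQ X N))%:E <= H1_norm P X)%E.
Proof.
move=> Xi; have mX k := itg_meas (Xi k); rewrite H1_normE//.
rewrite -Ex_fin; last exact: SQ_itg.
rewrite (cvg_lim _ (ereal_nondecreasing_cvgn (SQ_int_nd mX)))//.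
by apply: ereal_sup_ubound; exists N.
Qed.

Lemma H1_norm_le X K : (forall k, itg (X k)) -> (forall N, Ex (SQ X N) <= K) ->
  (H1_norm P X <= K%:E)%E.
Proof.
move=> Xi XK; have mX k := itg_meas (Xi k); rewrite H1_normE//.
apply: lime_le; first exact/ereal_nondecreasing_is_cvgn/SQ_int_nd.
by apply: nearW => N; rewrite Ex_fin ?lee_fin//; exact: SQ_itg.
Qed.

Lemma H1_norm_ge0 X : (0 <= H1_norm P X)%E. Proof. exact: Lnorm_ge0. Qed.

(** A constant 2 in place of Minkowski's inequality in [l^2], from [(a + c)^2 <= 4 (a^2 + c^2)];
    constants need not be sharp. *)
Lemma SQ_quasi_triangle X Y Z N x :
  (forall k, X k x = Y k x + Z k x) -> SQ X N x <= 2 * (SQ Y N x + SQ Z N x).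
Proof.
move=> XYZ; rewrite !SQE.
set a := \sum_(j < N.+1) mdiff Y j x ^+ 2; set b := \sum_(j < N.+1) mdiff Z j x ^+ 2.
have a0 : 0 <= a by apply: sumr_ge0 => *; exact: sqr_ge0.
have b0 : 0 <= b by apply: sumr_ge0 => *; exact: sqr_ge0.
apply: (@le_trans _ _ (Num.sqrt (4 * (a + b)))).
  rewrite ler_sqrt ?mulr_ge0 ?addr_ge0// /a /b -big_split/= mulr_sumr.
  apply: ler_sum => j _.
  have -> : mdiff X j x = mdiff Y j x + mdiff Z j x.
    by rewrite /mdiff; case: (j : nat) => [|k] /=; rewrite !XYZ; ring.
  by have := sqr_ge0 (mdiff Y j x - mdiff Z j x); nra.
rewrite sqrtrM// (_ : 4 = 2 ^+ 2 :> R); last by rewrite -natrX.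
by rewrite sqrtr_sqr ger0_norm// ler_pM2l// sqrtD_le.
Qed.

End square_function.

(** * From pathwise inequalities to expectations *)

Section martingale_inequalities.
Context {d : measure_display} {Om : measurableType d} {R : realType}.
Variable P : probability Om R.
Variable F : nat -> set (set Om).
Hypothesis Ffil : filtration F.
Implicit Types X : nat -> Om -> R.
Local Notation E := (E P F).
Local Notation Ex := (Ex P).
Local Notation itg := (itg P).
Local Notation bdd := (bdd P).
Local Notation mF := (mF F).

Definition is_mart X := forall k, [/\ mF k (X k), itg (X k) &
  {ae P, forall x, E k (X k.+1) x = X k x}].

Lemma mart_is_mart f : itg f -> is_mart (mart P F f).
Proof.
move=> fi k; split; [exact: E_meas|exact: E_itg|exact: E_tower].
Qed.

Lemma mF_MX X N : (forall k, mF k (X k)) -> mF N (MX X N).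
Proof.
move=> mX; elim: N => [|N IH].
  rewrite (_ : MX X 0 = fun x => `|X 0%N x|); first exact: mF_abs.
  by apply/funext => x; rewrite /MX rmax0.
rewrite (_ : MX X N.+1 = fun x => Num.max (MX X N x) `|X N.+1 x|).
  by apply: mF_max; [exact: (mF_mono Ffil (leqnSn N))|exact: mF_abs].
by apply/funext => x; rewrite /MX rmaxS.
Qed.

Lemma mF_mdiff X N k : (forall k, mF k (X k)) -> (k <= N)%N -> mF N (mdiff X k).
Proof.
move=> mX kN; apply: mFB; first exact: (mF_mono Ffil kN).
case: k kN => [|k] kN /=; first exact: mF_cst.
by apply: (mF_mono Ffil _ (mX k)); exact: ltnW.
Qed.

Lemma mF_SQ X N : (forall k, mF k (X k)) -> mF N (SQ X N).
Proof.
move=> mX; rewrite (_ : SQ X N =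
    (fun x => Num.sqrt (\sum_(j < N.+1) mdiff X j x ^+ 2))); last first.
  by apply/funext => x; exact: SQE.
apply: mF_sqrt; apply: mF_sum => j _; apply: mFX.
by apply: mF_mdiff => //; rewrite -ltnS.
Qed.

Lemma mart_diff_orth X k h : is_mart X -> mF k h -> bdd h ->
  Ex (fun x => h x * (X k.+1 x - X k x)) = 0.
Proof.
move=> mX mh bh; have [mk ik ek] := mX k; have [_ ik1 _] := mX k.+1.
have -> : (fun x => h x * (X k.+1 x - X k x)) = (fun x => h x * X k.+1 x - h x * X k x).
  by apply/funext => x; rewrite mulrBr.
rewrite ExB; [|exact: itgM|exact: itgM].
rewrite -(Ex_pull Ffil mh bh ik1).
apply/eqP; rewrite subr_eq0; apply/eqP.
have m1 : measurable_fun setT h by exact: bdd_meas bh.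
apply: Ex_ae.
- by apply: measurable_funM => //; exact: itg_meas (E_itg Ffil k ik1).
- by apply: measurable_funM => //; exact: itg_meas ik.
- by apply: filterS ek => x ->.
Qed.

Lemma mart_transform_Ex X N (h : nat -> Om -> R) : is_mart X ->
  (forall k, mF k (h k)) -> (forall k, bdd (h k)) ->
  itg (fun x => \sum_(k < N) h k x * (X k.+1 x - X k x)) /\
  Ex (fun x => \sum_(k < N) h k x * (X k.+1 x - X k x)) = 0.
Proof.
move=> mX mh bh.
have ii k : itg (fun x => h k x * (X k.+1 x - X k x)).
  by apply: itgM => //; apply: itgB; [case: (mX k.+1)|case: (mX k)].
split; first by apply: itg_sum.
by rewrite Ex_sum// big1// => k _; exact: mart_diff_orth.
Qed.

(** The transform coefficients [X_k / MX_k] are [F_k]-measurable and bounded by 1, so the sum in the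
    pathwise inequality has mean zero for merely integrable [X]. *)
Lemma davis_square_le_max X N : is_mart X -> Ex (SQ X N) <= 2 * Ex (MX X N).
Proof.
move=> mX; have Xi k : itg (X k) by case: (mX k).
have Xm k : mF k (X k) by case: (mX k).
pose h k x := X k x / MX X k x.
have mh k : mF k (h k) by apply: mFM => //; apply: mF_inv; exact: mF_MX.
have bh k : bdd (h k).
  split; first exact: mF_meas (mh k).
  exists 1; apply: aeW => x; rewrite /h normrM normfV (ger0_norm (MX_ge0 _ _ _)).
  have [->|M0] := eqVneq (MX X k x) 0; first by rewrite invr0 mulr0.
  rewrite ler_pdivrMr ?mul1r; first exact: (rmax_ge (X^~ x)).
  by rewrite lt_neqAle eq_sym M0 MX_ge0.
have [ti t0] := mart_transform_Ex N mX mh bh.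
have -> : 2 * Ex (MX X N) =
    Ex (fun x => 2 * MX X N x - \sum_(k < N) h k x * (X k.+1 x - X k x)).
  by rewrite ExB ?t0 ?subr0 ?ExZ//; [exact: MX_itg|apply: itgZ; exact: MX_itg].
apply: Ex_le; [exact: SQ_itg|apply: itgB => //; apply: itgZ; exact: MX_itg|].
by apply: aeW => x; exact: (square_fun_le_max (X^~ x)).
Qed.

(** The coefficients of the transform are now bounded by 2, and the constant is
    [(9/2) / (3/4) = 6]. *)
Lemma davis_max_le_square X N : is_mart X -> Ex (MX X N) <= 6 * Ex (SQ X N).
Proof.
move=> mX; have Xi k : itg (X k) by case: (mX k).
have Xm k : mF k (X k) by case: (mX k).
pose f k x := Num.max (MX X k x) (2 * SQ X k x).
pose h k x := 2 * X k x / f k x.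
have f0 k x : 0 <= f k x by rewrite le_max MX_ge0.
have mf k : mF k (f k).
  by apply: mF_max; [exact: mF_MX|apply: mFM; [exact: mF_cst|exact: mF_SQ]].
have mh k : mF k (h k).
  by apply: mFM; [apply: mFM => //; exact: mF_cst|exact: mF_inv].
have bh k : bdd (h k).
  split; first exact: mF_meas (mh k).
  exists 2; apply: aeW => x; rewrite /h normrM normfV (ger0_norm (f0 _ _)).
  have [->|M0] := eqVneq (f k x) 0; first by rewrite invr0 mulr0.
  rewrite ler_pdivrMr ?normrM ?(ger0_norm (_ : 0 <= 2))//.
    rewrite ler_pM2l// (le_trans (rmax_ge (X^~ x) k))//.
    by rewrite /f le_max lexx.
  by rewrite lt_neqAle eq_sym M0 f0.
have [ti t0] := mart_transform_Ex N mX mh bh.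
have : Ex (fun x => 3 / 4 * MX X N x) <= Ex (fun x => 9 / 2 * SQ X N x +
    \sum_(k < N) h k x * (X k.+1 x - X k x)).
  apply: Ex_le; [apply: itgZ; exact: MX_itg|apply: itgD => //; apply: itgZ; exact: SQ_itg|].
  by apply: aeW => x; exact: (max_le_square_fun (X^~ x)).
rewrite ExD ?t0 ?ExZ//; [|exact: SQ_itg|exact: MX_itg|apply: itgZ; exact: SQ_itg].
lra.
Qed.

(** The transform coefficient is the running maximum times a sign; it is bounded because [X] is. *)
Lemma doob_max X N : is_mart X -> (forall k, bdd (X k)) ->
  Ex (fun x => MX X N x ^+ 2) <= 4 * Ex (fun x => X N x ^+ 2).
Proof.
move=> mX Xb; have Xi k : itg (X k) by case: (mX k).
have Xm k : mF k (X k) by case: (mX k).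
pose h k x := MX X k x * Num.sg (X k x).
(* In this form the sign inherits [F_k]-measurability from the inverse. *)
have sgE (y : R) : Num.sg y = y / `|y|.
  have [->|y0] := eqVneq y 0; first by rewrite sgr0 mul0r.
  by rewrite {2}[y]numEsg mulfK// normr_eq0.
have mh k : mF k (h k).
  apply: mFM; first exact: mF_MX.
  under eq_fun do rewrite sgE.
  by apply: mFM => //; apply: mF_inv; exact: mF_abs.
have bh k : bdd (h k).
  apply: (@bdd_le _ _ _ _ _ (MX X k)); [exact: mF_meas (mh k)|exact: MX_bdd|].
  apply: aeW => x; rewrite /h normrM -{2}[`|MX _ _ _|]mulr1 ler_wpM2l//.
  by rewrite normr_sg; case: (_ == _).
have [ti t0] := mart_transform_Ex N mX mh bh.
have i1 : itg (fun x => MX X N x ^+ 2) by apply/bdd_itg/bddX; exact: MX_bdd.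
have i2 : itg (fun x => X N x ^+ 2) by apply/bdd_itg/bddX.
have -> : 4 * Ex (fun x => X N x ^+ 2) = Ex (fun x => 4 * X N x ^+ 2 -
    4 * \sum_(k < N) h k x * (X k.+1 x - X k x)).
  rewrite ExB ?ExZ ?t0 ?mulr0 ?subr0//; exact: itgZ.
apply: Ex_le => //; first by apply: itgB; exact: itgZ.
by apply: aeW => x; exact: (max_sqr_le (X^~ x)).
Qed.

End martingale_inequalities.

(** * Martingales of bounded mean oscillation *)

Section bmo.
Context {d : measure_display} {Om : measurableType d} {R : realType}.
Variable P : probability Om R.
Variable F : nat -> set (set Om).
Hypothesis Ffil : filtration F.
Local Notation E := (E P F).
Local Notation Eprev := (Eprev P F).
Local Notation Ex := (Ex P).
Local Notation Pr := (Pr P).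
Local Notation itg := (itg P).
Local Notation bdd := (bdd P).
Local Notation mF := (mF F).
Implicit Types b f : Om -> R.

Lemma integral_cst_prob (c : \bar R) : (\int[P]_x c = c)%E.
Proof.
transitivity (c * P setT)%E; first exact: integral_cst.
by rewrite probability_setT mule1.
Qed.

Lemma EprevS n b : Eprev n.+1 b = E n b. Proof. by []. Qed.

Lemma Eprev_itg n b : itg b -> itg (Eprev n b).
Proof. by case: n => [|n] bi; [exact: itg_cst|exact: E_itg]. Qed.

Lemma mF_Eprev n m b : itg b -> (n <= m.+1)%N -> mF m (Eprev n b).
Proof.
case: n => [|n] bi nm; first exact: mF_cst.
by apply: (mF_mono Ffil (n := n)) => //; exact: E_meas.
Qed.

(* The value [E 0 b] does not involve any regularity: [F 0] is trivial, so the
   conditional expectation of a non-integrable nonnegative function is the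
   constant [+oo], and the [n = 0] term of the norm controls [b] in [L^p]. *)
Lemma condexp_trivial (f : Om -> \bar R) :
  is_condexp P (F 0) f (condexp P (F 0) f).
Proof.
suff ex : [set g | is_condexp P (F 0) f g] (cst (\int[P]_x f x)%E).
  have : [set g | is_condexp P (F 0) f g] (condexp P (F 0) f); last by [].
  by apply: xgetPex; exists (cst (\int[P]_x f x)%E).
split.
  move=> C mC; rewrite preimage_cst; case: ifP => _; first exact: F_setT.
  by case: (saF Ffil 0).
case: Ffil => _ _ -> _ A [->|->]; first by rewrite !integral_set0.
exact: integral_cst_prob.
Qed.

Lemma powRD_le (p a c : R) : 1 <= p -> 0 <= a -> 0 <= c ->
  (a + c) `^ p <= 2 `^ p * (a `^ p + c `^ p).
Proof.
move=> p1 a0 c0; have p0 : 0 <= p by rewrite (le_trans _ p1).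
wlog ac : a c a0 c0 / a <= c => [H|].
  have [|/ltW] := leP a c; first exact: H.
  by rewrite addrC [a `^ _ + _]addrC; exact: H.
apply: (@le_trans _ _ ((2 * c) `^ p)).
  by apply: ge0_ler_powR => //; rewrite ?nnegrE ?addr_ge0 ?mulr_ge0//; lra.
by rewrite powRM// ler_pM2l ?powR_gt0// lerDr powR_ge0.
Qed.

(** Young's inequality with second factor 1; [p = 1] has no finite conjugate exponent and is treated
    apart. *)
Lemma powR_young (p t : R) : 1 <= p -> 0 <= t -> p * t <= t `^ p + (p - 1).
Proof.
move=> p1 t0; have [->|pn1] := eqVneq p 1; first by rewrite powRr1//; lra.
have p1' : 1 < p by rewrite lt_neqAle eq_sym pn1.
have p0 : 0 < p by lra.
have pm : 0 < p - 1 by lra.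
have q0 : 0 < p / (p - 1) by rewrite divr_gt0.
have pq : p^-1 + (p / (p - 1))^-1 = 1.
  by rewrite invf_div; field; rewrite ?gt_eqF.
have := conjugate_powR t0 (ler01) p0 q0 pq.
rewrite mulr1 powR1 invf_div => H.
have -> : t `^ p + (p - 1) = p * (t `^ p / p + 1 * ((p - 1) / p)).
  by field; rewrite gt_eqF.
by rewrite ler_pM2l.
Qed.

Section bmo_norm.
Variables (p B : R) (b : Om -> R).
Hypotheses (p1 : 1 <= p) (B0 : 0 < B) (bi : itg b).
Hypothesis (bB : (BMO_norm P F p b <= B%:E)%E).

Let p0 : 0 < p. Proof. exact: lt_le_trans p1. Qed.
Let pn0 : p != 0. Proof. by rewrite gt_eqF. Qed.

Lemma bmo_condexp_le n :
  {ae P, forall x, (`|condexp P (F n) (fun x => (`|b x - Eprev n b x| `^ p)%:E) x|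
    <= (B `^ p)%:E)%E}.
Proof.
set h := condexp _ _ _.
have : (('N[P]_+oo[h] `^ p^-1) <= B%:E)%E.
  by apply: le_trans bB; apply: ereal_sup_ubound; exists n.
move=> H; have {}H : ('N[P]_+oo[h] <= (B `^ p)%:E)%E.
  have N0 := Lnorm_ge0 P +oo%E h.
  rewrite -[leLHS]poweRe1// -(mulVf pn0) poweRrM -poweR_EFin.
  apply: gt0_ler_poweR => //; first exact: ltW.
    by rewrite in_itv/= poweR_ge0 leey.
  by rewrite in_itv/= lee_fin ltW// leey.
have P0 : (0 < P setT)%E by rewrite probability_setT lte01.
by move: H; rewrite unlock /= ifT//= => /ess_supP; apply: filterS => x.
Qed.

Lemma bmo_Lp : itg (fun x => `|b x| `^ p).
Proof.
have mb : measurable_fun setT b := itg_meas bi.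
have mp : measurable_fun setT (fun x => `|b x| `^ p).
  by apply: (@measurableT_comp _ _ _ _ _ _ (@powR R ^~ p)) => //; exact: measurableT_comp.
apply/itgP; split => //.
under eq_integral do rewrite ger0_norm ?powR_ge0//.
have [mh hE] := condexp_trivial (fun x => (`|b x - Eprev 0 b x| `^ p)%:E).
have FT : F 0 setT by exact: F_setT.
have := hE _ FT; set h := condexp _ _ _ in mh hE *.
rewrite [X in _ = X -> _](eq_integral (fun x => (`|b x| `^ p)%:E)); last first.
  by move=> x _; rewrite /Defs.Eprev /= subr0.
move=> <-; have {}mh : measurable_fun setT h.
  by move=> _ C mC; rewrite setTI; apply: (FM Ffil); exact: mh.
apply: (@le_lt_trans _ _ (\int[P]_x `|h x|)%E).
  apply: le_trans (lee_abs _) _; exact: le_abse_integral.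
apply: (@le_lt_trans _ _ (\int[P]_x (B `^ p)%:E)%E).
  apply: ae_ge0_le_integral => //.
  - exact: measurableT_comp.
  - by move=> x _; rewrite lee_fin powR_ge0.
  - by apply: filterS (bmo_condexp_le 0) => x.
by rewrite integral_cst_prob ltry.
Qed.

(** The passage from exponent [p] to exponent 1, on sets of [F_n]. Boundedness of [Eprev n b] makes
    [|b - b_(n-1)|^p] integrable, so that the [condexp] in the norm is a genuine conditional
    expectation. *)
Lemma bmo_set_of_bdd n A : bdd (Eprev n b) -> F n A ->
  Ex (fun x => \1_A x * `|b x - Eprev n b x|) <= B * Pr A.
Proof.
move=> bp FA; have mA := FM Ffil FA.
have mpow (g : Om -> R) : measurable_fun setT g -> measurable_fun setT (fun x => `|g x| `^ p).
  move=> mg; apply: (@measurableT_comp _ _ _ _ _ _ (@powR R ^~ p)) => //.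
  exact: measurableT_comp.
pose g x := `|b x - Eprev n b x|.
have bpi := bdd_itg bp.
have gi : itg g by apply: itg_abs; exact: itgB.
have gp : itg (fun x => g x `^ p).
  case: (bp) => mbp [M bpM].
  apply: (@itg_le _ _ _ _ _ (fun x => 2 `^ p * (`|b x| `^ p + `|M| `^ p))).
  - by apply: mpow; apply: measurable_funB => //; exact: itg_meas bi.
  - by apply: itgZ; apply: itgD; [exact: bmo_Lp|exact: itg_cst].
  apply: filterS bpM => x bpM; rewrite ger0_norm ?powR_ge0//.
  apply: le_trans (powRD_le p1 _ _) => //.
  have g0 : 0 <= g x := normr_ge0 _.
  apply: ge0_ler_powR; rewrite ?nnegrE ?addr_ge0// ?(ltW p0)//.
  by rewrite /g (le_trans (ler_normB _ _))// lerD2l (le_trans bpM)// ler_norm.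
have Egp : {ae P, forall x, E n (fun x => g x `^ p) x <= B `^ p}.
  apply: filterS2 (bmo_condexp_le n) (E_condexp Ffil n gp) => x.
  rewrite -/(g _) => + e; rewrite (_ : (fun x => _) = EFin \o (fun x => g x `^ p))//.
  by rewrite e lee_fin => /(le_trans (ler_norm _)).
have h1 : Ex (fun x => \1_A x * g x `^ p) <= B `^ p * Pr A.
  rewrite -(E_set Ffil gp FA) -Ex_indic// -ExZ; last exact/bdd_itg/bdd_indic.
  apply: Ex_le; first by apply: itg_ind => //; exact: E_itg.
    exact/itgZ/bdd_itg/bdd_indic.
  by apply: filterS Egp => x; rewrite mulrC; exact: ler_wpM2r.
(* Young's inequality [p t <= t^p + p - 1] with [t = g / B] avoids Hölder. *)
have h2 : Ex (fun x => \1_A x * (p * (g x / B))) <=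
    Ex (fun x => (B `^ p)^-1 * (\1_A x * g x `^ p) + (p - 1) * \1_A x).
  apply: Ex_le.
  - apply: itg_ind => //; apply: itgZ; rewrite /= (_ : (fun x => _) = fun x => B^-1 * g x).
      exact: itgZ.
    by apply/funext => x; rewrite mulrC.
  - apply: itgD; first by apply: itgZ; exact: itg_ind.
    exact/itgZ/bdd_itg/bdd_indic.
  apply: aeW => x.
  have -> : (B `^ p)^-1 * (\1_A x * g x `^ p) + (p - 1) * \1_A x =
    \1_A x * ((B `^ p)^-1 * g x `^ p + (p - 1)) by ring.
  have gB0 : 0 <= g x / B by rewrite divr_ge0 ?normr_ge0 ?ltW.
  have -> : (B `^ p)^-1 * g x `^ p = (g x / B) `^ p.
    rewrite powRM ?invr_ge0 ?normr_ge0 ?ltW// mulrC; congr (_ * _).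
    apply: (mulfI (lt0r_neq0 (powR_gt0 p B0))).
    by rewrite divff ?gt_eqF ?powR_gt0// -powRM ?invr_ge0 ?(ltW B0)// divff ?gt_eqF// powR1.
  by rewrite ler_wpM2l// powR_young.
have iA : itg (\1_A : Om -> R) by exact/bdd_itg/bdd_indic.
have iAg := itg_ind mA gi; have iAgp := itg_ind mA gp.
move: h2; rewrite ExD ?(ExZ _ iAgp) ?(ExZ _ iA) ?Ex_indic//; [|exact: itgZ|exact: itgZ].
rewrite (_ : (fun x => _) = fun x => p / B * (\1_A x * g x)); last first.
  by apply/funext => x; ring.
rewrite (ExZ _ iAg).
set I := Ex (fun x => \1_A x * g x) => h2.
have Bp : 0 < B `^ p by rewrite powR_gt0.
have h3 : (B `^ p)^-1 * Ex (fun x => \1_A x * g x `^ p) <= Pr A.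
  by rewrite mulrC ler_pdivrMr// mulrC.
have : p / B * I <= p * Pr A by lra.
by rewrite -mulrA ler_pM2l// mulrC ler_pdivrMr// mulrC.
Qed.

(** Induction on [n]: if [b_(n-1)] is bounded, then [|d_n b| <= E_n |b - b_(n-1)| <= B], and [b_n]
    is bounded as well. Apart from the test conditions on [T], later sections know the BMO norm
    through these three facts only, and the exponent [p] is gone. *)
Lemma bmo_basic n : [/\ bdd (E n b),
  {ae P, forall x, `|mdiff (mart P F b) n x| <= B} &
  forall A, F n A -> Ex (fun x => \1_A x * `|b x - Eprev n b x|) <= B * Pr A].
Proof.
have step m : bdd (Eprev m b) -> [/\ bdd (E m b),
    {ae P, forall x, `|mdiff (mart P F b) m x| <= B} &
    forall A, F m A -> Ex (fun x => \1_A x * `|b x - Eprev m b x|) <= B * Pr A].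
  move=> bp; have bA A : F m A -> Ex (fun x => \1_A x * `|b x - Eprev m b x|) <= B * Pr A.
    exact: bmo_set_of_bdd.
  have bpi := bdd_itg bp.
  have dB : {ae P, forall x, `|mdiff (mart P F b) m x| <= B}.
    have di := itgB bi bpi; have adi := itg_abs di.
    have h1 : {ae P, forall x, E m (fun x => `|b x - Eprev m b x|) x <= B}.
      apply: (E_leP Ffil adi) => [||A FA]; [exact: mF_cst|exact: itg_cst|].
      rewrite (_ : (fun x => \1_A x * cst B x) = fun x => B * \1_A x); last first.
        by apply/funext => x; rewrite mulrC.
      have mA := FM Ffil FA.
      by rewrite ExZ ?Ex_indic ?bA//; exact/bdd_itg/bdd_indic.
    have h2 : {ae P, forall x, E m (Eprev m b) x = Eprev m b x}.
      by apply: E_id => //; exact: mF_Eprev.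
    apply: filterS2 (filterI (E_norm Ffil m di) (E_sub Ffil m bi bpi)) (filterI h1 h2) => x.
    move=> [n1 e1] [l1 e2]; rewrite /mdiff /mart -[Defs.prev _ _ _]/(Eprev m b x).
    by rewrite -e2 -e1 (le_trans n1).
  split => //.
  apply: (@bdd_le _ _ _ _ _ (fun x => B + `|Eprev m b x|)).
  - exact: itg_meas (E_itg Ffil m bi).
  - by apply: bddD; [exact: bdd_cst|exact: bdd_abs].
  - apply: filterS dB => x dB; rewrite [leRHS]ger0_norm ?addr_ge0 ?(ltW B0)//.
    rewrite -lerBlDr (le_trans (lerB_dist _ _))//.
suff H m : bdd (Eprev m b) by exact: step.
elim: m => [|m IH]; first exact: bdd_cst.
by have [] := step _ IH.
Qed.

End bmo_norm.
End bmo.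

(** * First passage of a path above a level *)

Section first_passage.
Context {R : realType}.
Implicit Types y : nat -> R.

Definition rmax_prev y j : R := if j is i.+1 then rmax y i else 0.

(** [rmax_prev] is 0 at index 0, so for [lam >= 0] this marks the first index at which [|y_j|]
    exceeds [lam]. *)
Definition passage y (lam : R) j : bool := (rmax_prev y j <= lam) && (lam < rmax y j).

Lemma sum_passage_le1 y lam m : 0 <= lam ->
  \sum_(j < m.+1) (passage y lam j)%:R <= 1 :> R.
Proof.
move=> l0; suff -> : \sum_(j < m.+1) (passage y lam j)%:R = (lam < rmax y m)%R%:R :> R.
  by case: (_ < rmax y m); rewrite ?ler01.
elim: m => [|m IH].
  by rewrite big_ord_recl big_ord0 addr0 /passage /= l0.
rewrite big_ord_recr /= IH /passage /=.
have := rmax_leS y m.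
case: (leP (rmax y m) lam) => [h1 _|h1 h2] /=; first by rewrite add0r.
by rewrite addr0 (lt_le_trans h1 h2).
Qed.

(** If [j] is the first passage, then [|y_j| <= lam + B], and later values differ from [y_j] by at
    most the maximum [r] of the restarted path; then [(a + r)^2 <= 2 a^2 + 2 r^2]. For [j = m]
    nothing is left to restart, whence the value 0. *)
Lemma first_passage y (B lam : R) m : 0 <= B -> 0 <= lam -> `|y 0%N| <= B ->
  (forall j, `|y j.+1 - y j| <= B) ->
  rmax y m ^+ 2 <= lam ^+ 2 + \sum_(j < m.+1) (passage y lam j)%:R *
    (2 * (lam + B) ^+ 2 +
     2 * (if (j < m)%N then rmax (fun i => y (j.+1 + i)%N - y j) (m - j.+1) else 0) ^+ 2).
Proof.
move=> B0 l0 y0 dy.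
have term0 (j : nat) : 0 <= (passage y lam j)%:R * (2 * (lam + B) ^+ 2 +
     2 * (if (j < m)%N then rmax (fun i => y (j.+1 + i)%N - y j) (m - j.+1) else 0) ^+ 2).
  by rewrite mulr_ge0// addr_ge0// mulr_ge0// sqr_ge0.
have [ml|lm] := leP (rmax y m) lam.
  rewrite ler_wpDr ?sumr_ge0// ler_sqr ?nnegrE ?rmax_ge0//.
have exj : exists j, lam < rmax y j by exists m.
pose j := ex_minn exj.
have lj : lam < rmax y j by rewrite /j; case: ex_minnP.
have jmin i : lam < rmax y i -> (j <= i)%N by rewrite /j; case: ex_minnP => ? _; exact.
have jm : (j <= m)%N by exact: jmin.
have small i : (i < j)%N -> `|y i| <= lam.
  move=> ij; rewrite (le_trans (rmax_ge y i))// leNgt; apply/negP => /jmin.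
  by rewrite leqNgt ij.
have pj : passage y lam j.
  rewrite /passage lj andbT; case Ej : j => [|i] //=.
  by rewrite leNgt; apply/negP => /jmin; rewrite Ej ltnn.
have yj : `|y j| <= lam + B.
  case Ej : j => [|i]; first by rewrite (le_trans y0)// lerDr.
  have -> : y i.+1 = y i + (y i.+1 - y i) by rewrite addrC subrK.
  by rewrite (le_trans (ler_normD _ _))// lerD// small// Ej.
set r := if (j < m)%N then rmax (fun i => y (j.+1 + i)%N - y j) (m - j.+1) else 0.
have r0 : 0 <= r by rewrite /r; case: ifP => // _; exact: rmax_ge0.
have bound : rmax y m <= (lam + B) + r.
  apply: rmax_lub => [|i im]; first by rewrite !addr_ge0.
  case: (ltngtP i j) => [ij|ji|->].
  - by rewrite (le_trans (small _ ij))// -addrA lerDl addr_ge0.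
  - have -> : y i = y j + (y i - y j) by rewrite addrC subrK.
    rewrite (le_trans (ler_normD _ _))// lerD//.
    have jm' : (j < m)%N by exact: leq_trans im.
    rewrite /r jm'; pose z i := y (j.+1 + i)%N - y j.
    have -> : y i - y j = z (i - j.+1)%N by rewrite /z subnKC.
    rewrite (le_trans (rmax_ge z _))//; apply: rmax_mono.
    exact: leq_sub2r.
  - by rewrite (le_trans yj)// lerDl.
have : rmax y m ^+ 2 <= 2 * (lam + B) ^+ 2 + 2 * r ^+ 2.
  have : rmax y m ^+ 2 <= ((lam + B) + r) ^+ 2.
    by rewrite ler_sqr ?nnegrE ?rmax_ge0 ?addr_ge0.
  have := sqr_ge0 (lam + B - r); nra.
move/le_trans; apply.
have -> : 2 * (lam + B) ^+ 2 + 2 * r ^+ 2 =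
    (passage y lam j)%:R * (2 * (lam + B) ^+ 2 + 2 * r ^+ 2) by rewrite pj mul1r.
rewrite (bigD1 (Ordinal (jm : (j < m.+1)%N)))//= -/r.
set t := _%:R * _; rewrite addrCA lerDl addr_ge0 ?sqr_ge0// sumr_ge0//.
Qed.

End first_passage.

(** * The John-Nirenberg inequality in [L^2] *)

Section john_nirenberg.
Context {d : measure_display} {Om : measurableType d} {R : realType}.
Variable P : probability Om R.
Variable F : nat -> set (set Om).
Hypothesis Ffil : filtration F.
Local Notation E := (E P F).
Local Notation Eprev := (Eprev P F).
Local Notation Ex := (Ex P).
Local Notation Pr := (Pr P).
Local Notation itg := (itg P).
Local Notation bdd := (bdd P).
Local Notation mF := (mF F).
Variables (B : R) (b : Om -> R).
Hypotheses (B0 : 0 < B) (bi : itg b).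
Hypothesis bbasic : forall n, [/\ bdd (E n b),
  {ae P, forall x, `|mdiff (mart P F b) n x| <= B} &
  forall A, F n A -> Ex (fun x => \1_A x * `|b x - Eprev n b x|) <= B * Pr A].

Definition oscillation n j : Om -> R := fun x => E (n + j) b x - Eprev n b x.

Lemma E_b_bdd n : bdd (E n b). Proof. by case: (bbasic n). Qed.

Lemma Eprev_b_bdd n : bdd (Eprev n b).
Proof. by case: n => [|n]; [exact: bdd_cst|exact: E_b_bdd]. Qed.

Lemma osc_bdd n j : bdd (oscillation n j).
Proof. by apply: bddB; [exact: E_b_bdd|exact: Eprev_b_bdd]. Qed.

Lemma mF_osc n j : mF (n + j) (oscillation n j).
Proof.
apply: mFB; first exact: E_meas.
by apply: mF_Eprev => //; rewrite ltnW// ltnS leq_addr.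
Qed.

Lemma mF_MX_osc n m : mF (n + m) (MX (oscillation n) m).
Proof.
elim: m => [|m IH].
  rewrite (_ : MX (oscillation n) 0 = fun x => `|oscillation n 0 x|); first exact: mF_abs (@mF_osc n 0).
  by apply/funext => x; rewrite /MX rmax0.
rewrite (_ : MX (oscillation n) m.+1 = fun x => Num.max (MX (oscillation n) m x) `|oscillation n m.+1 x|).
  apply: mF_max; last exact: mF_abs (@mF_osc n m.+1).
  by apply: (mF_mono Ffil _ IH); rewrite addnS.
by apply/funext => x; rewrite /MX rmaxS.
Qed.

Lemma osc_step n j x : oscillation n j.+1 x - oscillation n j x = mdiff (mart P F b) (n + j).+1 x.
Proof. by rewrite /oscillation addnS /mdiff /mart /=; ring. Qed.

Lemma osc0 n x : oscillation n 0 x = mdiff (mart P F b) n x.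
Proof. by rewrite /oscillation addn0. Qed.

Lemma osc_L1 n j A : F (n + j)%N A ->
  Ex (fun x => \1_A x * `|oscillation n j x|) <= Ex (fun x => \1_A x * `|b x - Eprev n b x|).
Proof.
move=> FA; have mA := FM Ffil FA.
have bpi := bdd_itg (Eprev_b_bdd n).
have di := itgB bi bpi; have adi := itg_abs di.
rewrite -(E_set Ffil adi FA); apply: Ex_le.
- apply: itg_ind => //; exact/itg_abs/bdd_itg/osc_bdd.
- by apply: itg_ind => //; exact: E_itg.
have mp : mF (n + j) (Eprev n b) by apply: mF_Eprev => //; rewrite ltnW// ltnS leq_addr.
apply: filterS3 (E_norm Ffil (n + j) di) (E_sub Ffil (n + j) bi bpi) (E_id Ffil mp bpi) => x.
by move=> h e1 e2; rewrite ler_wpM2l// /oscillation -[in leLHS]e2 -e1.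
Qed.

Let lam : R := 4 * B.

Let stop n j : set Om :=
  [set x | rmax_prev (oscillation n ^~ x) j <= lam] `&` [set x | lam < MX (oscillation n) j x].

Let stopF n j : F (n + j)%N (stop n j).
Proof.
apply: (F_setI Ffil); last exact: (F_lt_set Ffil (mF_cst _) (@mF_MX_osc n j)).
apply: (F_le_set Ffil _ (mF_cst _)).
case: j => [|j] /=; first exact: mF_cst.
by apply: (mF_mono Ffil _ (@mF_MX_osc n j)); rewrite addnS.
Qed.

Let stopE n j x : \1_(stop n j) x = (passage (oscillation n ^~ x) lam j)%:R :> R.
Proof.
rewrite indicE; congr (nat_of_bool _)%:R; apply/idP/idP.
  by rewrite inE => -[/= h1 h2]; rewrite /passage h1.
by rewrite /passage => /andP[h1 h2]; rewrite inE.
Qed.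

(** Strong induction on [m]. After the first passage above [4 B], an event of probability at most
    [Pr A / 4], the path restarts as the oscillation from time [n + j + 1] with fewer steps left.
    The constant solves [C = 16 + (2 * 25 + 2 C) / 4]. *)
Lemma john_nirenberg m n A : F n A ->
  Ex (fun x => \1_A x * MX (oscillation n) m x ^+ 2) <= 57 * B ^+ 2 * Pr A.
Proof.
elim/ltn_ind: m n A => m IH n A FA; have mA := FM Ffil FA.
have mAS (j : nat) : F (n + j)%N (A `&` stop n j).
  apply: (F_setI Ffil) => //; apply: (F_mono Ffil _ FA); exact: leq_addr.
have mS (j : nat) := FM Ffil (mAS j).
have l0 : 0 <= lam by rewrite mulr_ge0// ltW.
pose r (j : nat) x := if (j < m)%N then MX (oscillation (n + j).+1) (m - j.+1) x else 0.
have rb j : bdd (r j).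
  rewrite /r; case: (j < m)%N; last exact: bdd_cst.
  by apply: MX_bdd => k; exact: osc_bdd.
have path : {ae P, forall x, MX (oscillation n) m x ^+ 2 <= lam ^+ 2 +
    \sum_(j < m.+1) \1_(stop n j) x * (2 * (lam + B) ^+ 2 + 2 * r j x ^+ 2)}.
  have dB : {ae P, forall x, forall k, `|mdiff (mart P F b) k x| <= B}.
    by apply/ae_foralln => k; case: (bbasic k).
  apply: filterS dB => x dB.
  have := @first_passage R (oscillation n ^~ x) B lam m (ltW B0) l0.
  rewrite osc0 => /(_ (dB n)) H.
  apply: le_trans (H _) _; first by move=> j; rewrite osc_step.
  rewrite lerD2l; apply: ler_sum => j _; rewrite stopE ler_wpM2l// lerD2l.
  suff -> : (if (j < m)%N then rmax (fun i => oscillation n (j.+1 + i) x - oscillation n j x) (m - j.+1) else 0)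
    = r j x by [].
  rewrite /r; case: ifP => // _; rewrite /MX; congr rmax; apply/funext => i.
  by rewrite /oscillation addSn addnS -addSn addnA EprevS; ring.
have iA : itg (\1_A : Om -> R) by exact/bdd_itg/bdd_indic.
have bS (j : nat) : bdd (\1_(A `&` stop n j) : Om -> R) by exact: bdd_indic.
have bt (j : nat) : bdd (fun x => 2 * (lam + B) ^+ 2 + 2 * r j x ^+ 2).
  by apply: bddD; [exact: bdd_cst|apply: bddZ; exact: bddX].
have bterm (j : nat) : bdd (fun x => \1_(A `&` stop n j) x * (2 * (lam + B) ^+ 2 + 2 * r j x ^+ 2)).
  exact: bddM.
have step1 : Ex (fun x => \1_A x * MX (oscillation n) m x ^+ 2) <=
    Ex (fun x => lam ^+ 2 * \1_A x +
    \sum_(j < m.+1) \1_(A `&` stop n j) x * (2 * (lam + B) ^+ 2 + 2 * r j x ^+ 2)).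
  apply: Ex_le.
  - apply: itg_ind => //; apply/bdd_itg/bddX/MX_bdd => k; exact: osc_bdd.
  - apply: itgD; first exact: itgZ.
    by apply: itg_sum => j _; exact: bdd_itg.
  apply: filterS path => x H.
  apply: (le_trans (ler_wpM2l _ H)); first by [].
  rewrite mulrDr mulrC lerD2l mulr_sumr ler_sum// => j _.
  by rewrite indicI mulrA.
apply: (le_trans step1); rewrite ExD; last 2 first.
- exact: itgZ.
- by apply: itg_sum => j _; exact: bdd_itg.
rewrite Ex_sum; last by move=> j _; exact: bdd_itg.
rewrite ExZ// Ex_indic//.
have step2 (j : 'I_m.+1) :
    Ex (fun x => \1_(A `&` stop n j) x * (2 * (lam + B) ^+ 2 + 2 * r j x ^+ 2)) <=
    (2 * (lam + B) ^+ 2 + 2 * (57 * B ^+ 2)) * Pr (A `&` stop n j).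
  have -> : (fun x => \1_(A `&` stop n j) x * (2 * (lam + B) ^+ 2 + 2 * r j x ^+ 2)) =
    (fun x => 2 * (lam + B) ^+ 2 * \1_(A `&` stop n j) x +
        2 * (\1_(A `&` stop n j) x * r j x ^+ 2)).
    by apply/funext => x; ring.
  have ib := bdd_itg (bS j).
  have ir : itg (fun x => \1_(A `&` stop n j) x * r j x ^+ 2).
    by apply/bdd_itg/bddM => //; exact: bddX.
  rewrite ExD; [|exact: itgZ|exact: itgZ].
  rewrite !ExZ// Ex_indic// [leRHS]mulrDl lerD2l -mulrA ler_pM2l//.
  rewrite /r; case: (boolP (j < m)%N) => jm.
    by apply: IH; [rewrite ltn_subLR ?addSn ?ltnS ?leq_addl|exact: (F_mono Ffil (leqnSn _))].
  rewrite (_ : (fun x => _) = cst 0); last first.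
    by apply/funext => x; rewrite expr0n mulr0.
  by rewrite Ex_cst; apply: mulr_ge0; [rewrite mulr_ge0 ?sqr_ge0|exact: Pr_ge0].
(* Chebyshev in [L^1]: on the disjoint passage sets [|b_(n+j) - b_(n-1)| >= 4 B], while
   [|b - b_(n-1)|] has integral at most [B Pr A] over [A]. *)
have stops : \sum_(j < m.+1) Pr (A `&` stop n j) <= Pr A / 4.
  have gi : itg (fun x => `|b x - Eprev n b x|).
    by apply: itg_abs; apply: itgB => //; exact/bdd_itg/Eprev_b_bdd.
  have h (j : 'I_m.+1) : lam * Pr (A `&` stop n j) <=
      Ex (fun x => \1_(A `&` stop n j) x * `|b x - Eprev n b x|).
    apply: le_trans (osc_L1 (mAS j)); rewrite -Ex_indic// -ExZ; last exact: bdd_itg.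
    apply: Ex_le.
    - by apply: itgZ; exact: bdd_itg.
    - by apply: itg_ind => //; exact/itg_abs/bdd_itg/osc_bdd.
    apply: aeW => x; rewrite indicI /= mulrCA -!mulrA ler_wpM2l//.
    rewrite stopE; case: (boolP (passage _ _ _)); last by rewrite !mul0r mulr0.
    rewrite mul1r mulr1 /passage => /andP[hp hl].
    have [j0|] := leP lam `|oscillation n j x|; first by [].
    move=> ol; exfalso; move: hl; rewrite ltNge => /negP; apply.
    case: (j : nat) hp ol => [|i] /= hp ol; first by rewrite rmax0 ltW.
    by rewrite rmaxS ge_max hp ltW.
  have : lam * (\sum_(j < m.+1) Pr (A `&` stop n j)) <= B * Pr A.
    rewrite mulr_sumr; apply: le_trans (ler_sum _ (fun j _ => h j)) _.
    rewrite -Ex_sum; last by move=> j _; exact: itg_ind.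
    have [_ _ bA] := bbasic n; apply: le_trans (bA _ FA).
    apply: Ex_le.
    - by apply: itg_sum => j _; exact: itg_ind.
    - exact: itg_ind.
    apply: aeW => x; rewrite -mulr_suml ler_wpM2r//.
    rewrite (eq_bigr (fun j : 'I_m.+1 => \1_A x * (passage (oscillation n ^~ x) lam j)%:R)).
      by rewrite -mulr_sumr -[leRHS]mulr1 ler_wpM2l// sum_passage_le1.
    by move=> j _; rewrite indicI /= stopE.
  rewrite -[lam]/(4 * B) => H.
  have {}H : 4 * (\sum_(j < m.+1) Pr (A `&` stop n j)) <= Pr A.
    by rewrite -(ler_pM2l B0) mulrCA mulrA.
  lra.
apply: (@le_trans _ _ (lam ^+ 2 * Pr A + \sum_(j < m.+1)
    (2 * (lam + B) ^+ 2 + 2 * (57 * B ^+ 2)) * Pr (A `&` stop n j))).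
  by rewrite lerD2l; apply: ler_sum => j _.
rewrite -mulr_sumr; set S := \sum_(_ < _) _ in stops *.
have : (2 * (lam + B) ^+ 2 + 2 * (57 * B ^+ 2)) * S <=
    (2 * (lam + B) ^+ 2 + 2 * (57 * B ^+ 2)) * (Pr A / 4).
  by rewrite ler_wpM2l// addr_ge0// mulr_ge0 ?sqr_ge0// mulr_ge0// sqr_ge0.
move=> H; apply: (le_trans (lerD (lexx (lam ^+ 2 * Pr A)) H)).
rewrite le_eqVlt; apply/orP; left; apply/eqP; rewrite /lam; by field.
Qed.

(** From [2 B M <= M^2 + B^2]; the constant is [(57 + 1) / 2]. *)
Lemma john_nirenberg1 m n A : F n A ->
  Ex (fun x => \1_A x * MX (oscillation n) m x) <= 29 * B * Pr A.
Proof.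
move=> FA; have mA := FM Ffil FA; have H := john_nirenberg m FA.
have bM : bdd (MX (oscillation n) m) by apply: MX_bdd => k; exact: osc_bdd.
have bA := bdd_indic P mA.
have i2 : itg (fun x => \1_A x * MX (oscillation n) m x ^+ 2).
  by apply/bdd_itg/bddM => //; exact: bddX.
have i1 : itg (fun x => \1_A x * MX (oscillation n) m x) by apply/bdd_itg/bddM.
have : Ex (fun x => 2 * B * (\1_A x * MX (oscillation n) m x)) <=
    Ex (fun x => \1_A x * MX (oscillation n) m x ^+ 2 + B ^+ 2 * \1_A x).
  apply: Ex_le; first exact: itgZ.
    by apply: itgD => //; apply: itgZ => //; exact: bdd_itg.
  apply: aeW => x; have : 0 <= \1_A x * (MX (oscillation n) m x - B) ^+ 2 :> R.
    by rewrite mulr_ge0// sqr_ge0.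
  by nra.
rewrite ExD//; last by apply: itgZ; exact: bdd_itg.
rewrite !ExZ//; last exact: bdd_itg.
rewrite Ex_indic// => H2.
rewrite -(ler_pM2l (_ : 0 < 2 * B)) ?mulr_gt0//.
apply: (le_trans H2); apply: (@le_trans _ _ (57 * B ^+ 2 * Pr A + B ^+ 2 * Pr A)).
  by rewrite lerD2r.
rewrite le_eqVlt; apply/orP; left; apply/eqP; ring.
Qed.

(** Orthogonality of martingale increments over [A], a set known at time [n]: the integral of the
    squared oscillation equals that of the sum of squares. *)
Lemma bmo_square m n A : F n A ->
  Ex (fun x => \1_A x * \sum_(j < m.+1) mdiff (mart P F b) (n + j) x ^+ 2)
    <= 57 * B ^+ 2 * Pr A.
Proof.
move=> FA; have mA := FM Ffil FA; have bA := bdd_indic P mA.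
have bd k : bdd (mdiff (mart P F b) k) by apply: mdiff_bdd => i; exact: E_b_bdd.
suff <- : Ex (fun x => \1_A x * oscillation n m x ^+ 2) =
    Ex (fun x => \1_A x * \sum_(j < m.+1) mdiff (mart P F b) (n + j) x ^+ 2).
  apply: le_trans (john_nirenberg m FA); apply: Ex_le.
  - by apply/bdd_itg/bddM => //; apply: bddX; exact: osc_bdd.
  - by apply/bdd_itg/bddM => //; apply/bddX/MX_bdd => k; exact: osc_bdd.
  apply: aeW => x; rewrite ler_wpM2l// -[oscillation n m x ^+ 2]real_normK ?num_real//.
  by rewrite ler_sqr ?nnegrE ?MX_ge0//; exact: (rmax_ge (oscillation n ^~ x)).
elim: m => [|m IH].
  congr Ex; apply/funext => x.
  by rewrite big_ord_recl big_ord0 addr0 /= addn0 osc0.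
have -> : (fun x => \1_A x * oscillation n m.+1 x ^+ 2) = (fun x =>
   \1_A x * oscillation n m x ^+ 2 + (2 * (\1_A x * oscillation n m x) *
     (E (n + m).+1 b x - E (n + m) b x)
     + \1_A x * mdiff (mart P F b) (n + m.+1) x ^+ 2)).
  by apply/funext => x; rewrite /oscillation !addnS /mdiff /mart /=; ring.
have bo := osc_bdd n m.
have bh : bdd (fun x => 2 * (\1_A x * oscillation n m x)) by apply/bddZ/bddM.
have mh : mF (n + m) (fun x => 2 * (\1_A x * oscillation n m x)).
  apply: mFM; first exact: mF_cst.
  apply: mFM; last exact: mF_osc.
  by apply: (mF_indic Ffil); apply: (F_mono Ffil _ FA); exact: leq_addr.
have bE : bdd (fun x => E (n + m).+1 b x - E (n + m) b x).
  by apply: bddB; exact: E_b_bdd.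
have b1 : bdd (fun x => \1_A x * oscillation n m x ^+ 2) by apply: bddM => //; exact: bddX.
have b2 := bddM bh bE.
have b3 : bdd (fun x => \1_A x * mdiff (mart P F b) (n + m.+1) x ^+ 2).
  by apply: bddM => //; exact: bddX.
rewrite ExD; [|exact: bdd_itg|by apply/bdd_itg/bddD].
rewrite ExD; [|exact: bdd_itg|exact: bdd_itg].
have := mart_diff_orth Ffil (mart_is_mart Ffil bi) mh bh; rewrite /mart => ->.
rewrite add0r IH -ExD//; [|by apply/bdd_itg/bddM => //; apply: bdd_sum => *; exact: bddX|exact: bdd_itg].
by congr Ex; apply/funext => x; rewrite [in RHS]big_ord_recr /= mulrDr.
Qed.

End john_nirenberg.

(** * Convergence in probability *)

Section lp_and_measure.
Context {d : measure_display} {Om : measurableType d} {R : realType}.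
Variable P : probability Om R.
Local Notation Ex := (Ex P).
Local Notation Pr := (Pr P).
Local Notation itg := (itg P).
Local Notation bdd := (bdd P).
Local Notation Lq := (Lq_norm P).
Implicit Types f g Y Z : Om -> R.

Lemma powR_root_le (q t x : R) : 0 < q -> 0 <= t -> 0 <= x -> t <= x `^ q ->
  t `^ q^-1 <= x.
Proof.
move=> q0 t0 x0 tx.
have -> : x = (x `^ q) `^ q^-1 by rewrite -powRrM divff ?gt_eqF// powRr1.
have iq0 : 0 <= q^-1 by rewrite invr_ge0 ltW.
exact: (ge0_ler_powR iq0 t0 (powR_ge0 x q) tx).
Qed.

Lemma powR_le_root (q t x : R) : 0 < q -> 0 <= t -> 0 <= x -> t `^ q^-1 <= x ->
  t <= x `^ q.
Proof.
move=> q0 t0 x0 tx.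
have -> : t = (t `^ q^-1) `^ q by rewrite -powRrM mulVf ?gt_eqF// powRr1.
exact: (ge0_ler_powR (ltW q0) (powR_ge0 _ _) x0 tx).
Qed.

Lemma Lfun1P f : f \in Lfun P 1%E <-> itg f.
Proof. exact: Lfun1_integrable. Qed.

(** Monotone convergence along [min (Y, m)]. Integrability of [Y] comes out as a conclusion. *)
Lemma itg_truncP Y (K : R) : measurable_fun setT Y -> (forall x, 0 <= Y x) ->
  (forall m : nat, Ex (fun x => Num.min (Y x) m%:R) <= K) ->
  itg Y /\ Ex Y <= K.
Proof.
move=> mY Y0 H.
pose g (m : nat) x := Num.min (Y x) m%:R.
have mg m : measurable_fun setT (g m) by apply: measurable_minr.
have g0 m x : 0 <= g m x by rewrite le_min Y0 ler0n.
have gi m : itg (g m).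
  apply: (itg_le (mg m) (itg_cst P m%:R)).
  by apply: aeW => x; rewrite ger0_norm// ge_min lexx orbT.
have lim : (\int[P]_x (Y x)%:E <= K%:E)%E.
  have -> : (\int[P]_x (Y x)%:E = \int[P]_x limn (fun m => (g m x)%:E))%E.
    apply: eq_integral => x _; apply/esym/cvg_lim => //.
    apply: cvg_near_cst; exists (Num.truncn (Y x)).+1 => // m /= mY'.
    congr EFin; apply/min_idPl; rewrite ltW// (lt_le_trans (truncnS_gt _))//.
    by rewrite ler_nat.
  rewrite monotone_convergence//; last 3 first.
  - by move=> m; apply/measurable_EFinP.
  - by move=> m x _; rewrite lee_fin.
  - move=> x _ n m nm; rewrite lee_fin /g le_min !ge_min lexx /=.
    by rewrite ler_nat nm orbT.
  apply: lime_le; last by apply: nearW => m; rewrite Ex_fin ?lee_fin//; exact: H.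
  apply: ereal_nondecreasing_is_cvgn => n m nm; apply: ge0_le_integral => //.
  - by move=> x _; rewrite lee_fin.
  - by apply/measurable_EFinP.
  - by apply/measurable_EFinP.
  - move=> x _; rewrite lee_fin /g le_min !ge_min lexx /=.
    by rewrite ler_nat nm orbT.
have Yi : itg Y.
  apply/itgP; split => //; under eq_integral do rewrite ger0_norm//.
  by apply: le_lt_trans lim _; rewrite ltry.
by split => //; rewrite -lee_fin -Ex_fin.
Qed.

Lemma Lq_norm1 f : itg f -> Lq 1 f = (Ex (fun x => `|f x|))%:E.
Proof. by move=> fi; rewrite /Lq_norm Lnorm1 -Ex_fin//; exact: itg_abs. Qed.

Lemma Lq_normE q f : 0 < q ->
  Lq q f = ((\int[P]_x (`|f x| `^ q)%:E) `^ q^-1)%E.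
Proof. by move=> q0; rewrite /Lq_norm unlock. Qed.

Lemma pow_meas q f : measurable_fun setT f ->
  measurable_fun setT (fun x => `|f x| `^ q).
Proof.
move=> mf; apply: (@measurableT_comp _ _ _ _ _ _ (@powR R ^~ q)) => //.
exact: measurableT_comp.
Qed.

Lemma Lq_le q f g : 0 < q -> measurable_fun setT f -> measurable_fun setT g ->
  {ae P, forall x, `|f x| <= `|g x|} -> (Lq q f <= Lq q g)%E.
Proof.
move=> q0 mf mg fg; rewrite (Lq_normE f q0) (Lq_normE g q0).
have pos (h : Om -> R) : (0 <= \int[P]_x (`|h x| `^ q)%:E)%E.
  by apply: integral_ge0 => x _; rewrite lee_fin powR_ge0.
have le_int : (\int[P]_x (`|f x| `^ q)%:E <= \int[P]_x (`|g x| `^ q)%:E)%E.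
  apply: ae_ge0_le_integral => //.
  - exact/measurable_EFinP/(pow_meas q).
  - exact/measurable_EFinP/(pow_meas q).
  - by apply: filterS fg => x fg _; rewrite lee_fin ge0_ler_powR ?nnegrE ?(ltW q0).
apply: gt0_ler_poweR => //; first by rewrite invr_ge0 ltW.
  by rewrite in_itv/= pos leey.
by rewrite in_itv/= pos leey.
Qed.

Lemma Lq_add q f g : 1 <= q -> measurable_fun setT f -> measurable_fun setT g ->
  (Lq q (fun x => f x + g x)%R <= Lq q f + Lq q g)%E.
Proof. by move=> q1 mf mg; exact: minkowski_EFin. Qed.

Lemma Lq_scale q c f : 0 < q -> measurable_fun setT f ->
  Lq q (fun x => c * f x) = (`|c|%:E * Lq q f)%E.
Proof.
move=> q0 mf; rewrite !Lq_normE//.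
have -> : (\int[P]_x (`|c * f x| `^ q)%:E = (`|c| `^ q)%:E * \int[P]_x (`|f x| `^ q)%:E)%E.
  rewrite -ge0_integralZl//.
  - by apply: eq_integral => x _; rewrite -EFinM normrM powRM.
  - exact/measurable_EFinP/(pow_meas q).
rewrite poweRM ?lee_fin ?powR_ge0//; last first.
  by apply: integral_ge0 => x _; rewrite lee_fin powR_ge0.
by rewrite poweR_EFin -powRrM divff ?gt_eqF// powRr1.
Qed.

Lemma Lq_cst q c : 0 < q -> Lq q (cst c) = `|c|%:E.
Proof.
move=> q0; rewrite Lq_normE// [X in (X `^ _)%E](_ : _ = (`|c| `^ q)%:E).
  by rewrite poweR_EFin -powRrM divff ?gt_eqF// powRr1.
by have := Ex_fin (itg_cst P (`|c| `^ q)); rewrite Ex_cst.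
Qed.

Lemma Lq_indic q A : 0 < q -> measurable A -> Lq q (\1_A : Om -> R) = (Pr A `^ q^-1)%:E.
Proof.
move=> q0 mA; rewrite Lq_normE// -poweR_EFin; congr (_ `^ _)%E.
rewrite -Ex_indic// -Ex_fin; last exact/bdd_itg/bdd_indic.
apply: eq_integral => x _; rewrite indicE; case: (x \in A) => /=.
  by rewrite normr1 powR1.
by rewrite normr0 powR0// gt_eqF.
Qed.

(** Reduces to truncation of the [q]-th power through [min (Y^q, m) = min (Y, m^(1/q))^q]. *)
Lemma Lq_trunc q Y (K : R) : 1 <= q -> 0 <= K -> measurable_fun setT Y ->
  (forall x, 0 <= Y x) ->
  (forall M : R, 0 <= M -> (Lq q (fun x => Num.min (Y x) M) <= K%:E)%E) ->
  (Lq q Y <= K%:E)%E.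
Proof.
move=> q1 K0 mY Y0 H; have q0 : 0 < q by exact: lt_le_trans q1.
have mYq : measurable_fun setT (fun x => Y x `^ q).
  rewrite (_ : (fun x => _) = fun x => `|Y x| `^ q); first exact: pow_meas.
  by apply/funext => x; rewrite ger0_norm.
have [Yi YK] : itg (fun x => Y x `^ q) /\ Ex (fun x => Y x `^ q) <= K `^ q.
  apply: itg_truncP => // [x|m]; first exact: powR_ge0.
  have M0 : 0 <= m%:R `^ q^-1 :> R by exact: powR_ge0.
  have minE x : Num.min (Y x `^ q) m%:R = (Num.min (Y x) (m%:R `^ q^-1)) `^ q.
    have mE : m%:R = (m%:R `^ q^-1) `^ q :> R.
      by rewrite -powRrM mulVf ?gt_eqF// powRr1.
    rewrite {1}mE; have [YM|MY] := leP (Y x) (m%:R `^ q^-1).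
      by apply/min_idPl; rewrite ge0_ler_powR ?nnegrE ?(ltW q0).
    by apply/min_idPr; rewrite ge0_ler_powR ?nnegrE ?(ltW q0)// ltW.
  under eq_fun do rewrite minE.
  have := H _ M0; rewrite Lq_normE//.
  rewrite (eq_integral (fun x => ((Num.min (Y x) (m%:R `^ q^-1)) `^ q)%:E)); last first.
    by move=> x _; rewrite ger0_norm// le_min Y0.
  have ii : itg (fun x => (Num.min (Y x) (m%:R `^ q^-1)) `^ q).
    under eq_fun do rewrite -minE.
    apply: (itg_le _ (itg_cst P m%:R)); first exact: measurable_minr.
    apply: aeW => x; rewrite ger0_norm ?ge_min ?lexx ?orbT//.
    by rewrite le_min powR_ge0 ler0n.
  rewrite Ex_fin// poweR_EFin lee_fin => H2.
  have E0 : 0 <= Ex (fun x => (Num.min (Y x) (m%:R `^ q^-1)) `^ q).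
    by apply: Ex_ge0 => //; apply: aeW => x; exact: powR_ge0.
  exact: powR_le_root.
rewrite Lq_normE//.
rewrite (eq_integral (fun x => (Y x `^ q)%:E)); last by move=> x _; rewrite ger0_norm.
rewrite Ex_fin// poweR_EFin lee_fin.
have E0 : 0 <= Ex (fun x => Y x `^ q).
  by apply: Ex_ge0 => //; apply: aeW => x; exact: powR_ge0.
exact: powR_root_le.
Qed.

(* Fatou's lemma for convergence in probability, without subsequences:
   truncate [Y] at level [M] and pay [M] on the exceptional event. *)
Lemma Lq_le_in_prob q Y (K : R) : 1 <= q -> 0 <= K -> measurable_fun setT Y ->
  (forall x, 0 <= Y x) ->
  (forall e : R, 0 < e -> exists Z, [/\ measurable_fun setT Z, forall x, 0 <= Z x,
     (Lq q Z <= (K + e)%:E)%E & Pr [set x | Z x + e < Y x] <= e]) ->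
  (Lq q Y <= K%:E)%E.
Proof.
move=> q1 K0 mY Y0 H; have q0 : 0 < q by exact: lt_le_trans q1.
apply: Lq_trunc => // M M0; apply/lee_addgt0Pr => dl dl0.
(* The first bound keeps the two shifts by [e] within [2 dl / 3]; the second makes [M e^(1/q)], the
   cost of the bad event, at most [dl / 3]. *)
pose e := Num.min (dl / 3) ((dl / (3 * (M + 1))) `^ q).
have dM0 : 0 < dl / (3 * (M + 1)) by rewrite divr_gt0// mulr_gt0// ltr_wpDl.
have e0 : 0 < e by rewrite lt_min divr_gt0// powR_gt0.
have ed : e <= dl / 3 by rewrite ge_min lexx.
have em : e <= (dl / (3 * (M + 1))) `^ q by rewrite ge_min lexx orbT.
have [Z [mZ Z0 ZK Ybad]] := H e e0.
have mbad : measurable [set x | Z x + e < Y x].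
  by apply: meas_lt_set => //; exact: measurable_funD.
set bad := [set x | _] in Ybad mbad.
apply: (@le_trans _ _ (Lq q (fun x => Z x + (cst e x + M * \1_bad x)))).
  apply: Lq_le => //.
  - exact: measurable_minr.
  - by apply: measurable_funD => //; apply: measurable_funD => //; apply: measurable_funM.
  apply: aeW => x.
  rewrite !ger0_norm ?le_min ?Y0 ?addr_ge0 ?mulr_ge0 ?(ltW e0)//=.
  rewrite indicE; case: (boolP (x \in bad)) => [_|xb] /=.
    by rewrite mulr1 ge_min orbC addrA ler_wpDl// addr_ge0// ltW.
  rewrite mulr0 addr0 ge_min; apply/orP; left.
  by rewrite leNgt; apply/negP => xb'; move/negP: xb; apply; rewrite inE.
apply: le_trans (Lq_add q1 mZ _) _.
  by apply: measurable_funD => //; apply: measurable_funM.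
have h1 : (Lq q (fun x => cst e x + M * \1_bad x)%R <= (dl / 3 + dl / 3)%:E)%E.
  apply: le_trans (Lq_add q1 _ _) _ => //; first exact: measurable_funM.
  rewrite EFinD Lq_cst// Lq_scale// Lq_indic// leeD//.
    by rewrite lee_fin ger0_norm// ltW.
  rewrite -EFinM lee_fin ger0_norm//.
  apply: (@le_trans _ _ (M * (dl / (3 * (M + 1))))).
    rewrite ler_wpM2l//.
    apply: powR_root_le => //; [exact: ltW|exact: le_trans em].
  rewrite mulrA ler_pdivrMr ?mulr_gt0 ?ltr_wpDl//.
  by rewrite (_ : dl / 3 * (3 * (M + 1)) = dl * (M + 1)); [nra|field].
apply: le_trans (leeD ZK h1) _; rewrite -EFinD lee_fin; lra.
Qed.

(** Continuity at 0 from [L^1] to convergence in probability. The weak-type bound of [T] and the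
    [L^1] contraction of [E n] both give it, so both commutators share one theory. *)
Definition meas_continuous (T : (Om -> R) -> Om -> R) := forall t e : R,
  0 < t -> 0 < e -> exists2 dl : R, 0 < dl & forall f, itg f ->
    Ex (fun x => `|f x|) <= dl -> Pr [set x | t < `|T f x|] <= e.

Lemma weak_meas_continuous q T : 0 < q -> operator P T -> bounded_L1_weakLq P q T ->
  meas_continuous T.
Proof.
move=> q0 [Tm _] [C C0 TC] t e t0 e0.
exists (t * (e `^ q^-1) / C); first by rewrite divr_gt0// mulr_gt0// powR_gt0.
move=> f fi fd; have fL : f \in Lfun P 1%E by exact/Lfun1P.
have mT := Tm _ fL.
have mA : measurable [set x | t < `|T f x|].
  by apply: meas_lt_set => //; exact: measurableT_comp.
set A := [set x | _] in mA *.
have : (t%:E * (P A) `^ q^-1 <= C%:E * Lq 1 f)%E.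
  by apply: le_trans (TC _ fL); apply: ereal_sup_ubound; exists t.
rewrite Lq_norm1// Pr_fin// poweR_EFin -!EFinM lee_fin => H.
have {}H : t * Pr A `^ q^-1 <= t * e `^ q^-1.
  by apply: (le_trans H); rewrite mulrC -ler_pdivlMr.
rewrite ler_pM2l// in H.
rewrite leNgt; apply/negP => eA; move: H; rewrite leNgt => /negP; apply.
by rewrite gt0_ltr_powR ?invr_gt0// ?nnegrE ?(ltW e0)// (le_trans (ltW e0))// ltW.
Qed.

Lemma tail_small f (e : R) : measurable_fun setT f -> 0 < e ->
  exists2 M : R, 0 < M & Pr [set x | M < `|f x|] <= e.
Proof.
move=> mf e0.
pose A (n : nat) := [set x | n%:R < `|f x|].
have mA n : measurable (A n) by apply: meas_lt_set => //; exact: measurableT_comp.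
have cap0 : \bigcap_n A n = set0.
  apply/seteqP; split => // x Ax; have := Ax (Num.truncn `|f x|).+1 I.
  by rewrite /A /= ltNge ltW// truncnS_gt.
have nd : {homo A : n m / (n <= m)%N >-> (m <= n)%O}.
  by move=> n m nm; apply/subsetPset => x; rewrite /A /=; apply: le_lt_trans; rewrite ler_nat.
have : P (A n) @[n --> \oo] --> P (\bigcap_n A n).
  apply: nonincreasing_cvg_mu => //; last exact: bigcapT_measurable.
  by rewrite (le_lt_trans (probability_le1 _ _))// ltry.
rewrite cap0 measure0 => /fine_cvgP[_] /cvgrPdist_lt /(_ _ e0)[N _ HN].
exists (N.+1%:R); first by rewrite ltr0n.
have := HN N.+1 (leqnSn N); rewrite /= sub0r normrN => /ltW.
exact: le_trans (ler_norm _).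
Qed.

Lemma Pr_U A C : measurable A -> measurable C -> Pr (A `|` C) <= Pr A + Pr C.
Proof.
move=> mA mC; rewrite -lee_fin EFinD -!Pr_fin//; last exact: measurableU.
exact: measureU2.
Qed.

Lemma ae_meas_le A C : measurable A -> measurable C ->
  {ae P, forall x, A x -> C x} -> Pr A <= Pr C.
Proof.
move=> mA mC AC; rewrite -!Ex_indic//.
apply: Ex_le; [exact/bdd_itg/bdd_indic|exact/bdd_itg/bdd_indic|].
apply: filterS AC => x AC; rewrite !indicE.
case: (boolP (x \in A)) => [|_] /=; last by [].
by rewrite inE => /AC /mem_set ->.
Qed.

End lp_and_measure.

(** * Density of bounded [F_N]-measurable functions *)

Section density.
Context {d : measure_display} {Om : measurableType d} {R : realType}.
Variable P : probability Om R.
Variable F : nat -> set (set Om).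
Hypothesis Ffil : filtration F.
Local Notation E := (E P F).
Local Notation Ex := (Ex P).
Local Notation Pr := (Pr P).
Local Notation itg := (itg P).
Local Notation bdd := (bdd P).
Local Notation mF := (mF F).
Implicit Types f g u : Om -> R.

Definition L2 f := measurable_fun setT f /\ itg (fun x => f x ^+ 2).

Lemma bdd_L2 f : bdd f -> L2 f.
Proof. by move=> fb; split; [exact: bdd_meas fb|exact/bdd_itg/bddX]. Qed.

Lemma L2_itg f : L2 f -> itg f.
Proof.
move=> [mf fi]; apply: (itg_le mf (itgD (itg_cst P 1) fi)).
apply: aeW => x /=; rewrite -(real_normK (num_real (f x))).
by have := sqr_ge0 (`|f x| - 1); have := sqr_ge0 (`|f x|); nra.
Qed.

Lemma L2D f g : L2 f -> L2 g -> L2 (fun x => f x + g x).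
Proof.
move=> [mf fi] [mg gi]; split; first exact: measurable_funD.
apply: (itg_le _ (itgD (itgZ 2 fi) (itgZ 2 gi))).
  by apply: measurable_funX; exact: measurable_funD.
apply: aeW => x; rewrite ger0_norm ?sqr_ge0//.
by have := sqr_ge0 (f x - g x); nra.
Qed.

Lemma L2Z c f : L2 f -> L2 (fun x => c * f x).
Proof.
move=> [mf fi]; split; first exact: measurable_funM.
by under eq_fun do rewrite exprMn; exact: itgZ.
Qed.

Lemma L2B f g : L2 f -> L2 g -> L2 (fun x => f x - g x).
Proof.
move=> hf hg; have := L2D hf (L2Z (-1) hg).
by under eq_fun do rewrite mulN1r.
Qed.

Lemma L2_mul_itg f g : L2 f -> L2 g -> itg (fun x => f x * g x).
Proof.
move=> [mf fi] [mg gi]; apply: (itg_le _ (itgD fi gi)).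
  exact: measurable_funM.
apply: aeW => x; rewrite ler_norml; apply/andP; split.
  by have := sqr_ge0 (f x + g x); have := sqr_ge0 (f x); have := sqr_ge0 (g x); nra.
by have := sqr_ge0 (f x - g x); have := sqr_ge0 (f x); have := sqr_ge0 (g x); nra.
Qed.

Lemma Ex_sqrD f g : L2 f -> L2 g -> Ex (fun x => (f x + g x) ^+ 2) <=
  2 * Ex (fun x => f x ^+ 2) + 2 * Ex (fun x => g x ^+ 2).
Proof.
move=> hf hg; have [_ h] := L2D hf hg; case: hf hg => [_ fi] [_ gi].
rewrite -!ExZ// -ExD; [|exact: itgZ|exact: itgZ].
apply: Ex_le => //; first by apply: itgD; exact: itgZ.
by apply: aeW => x; have := sqr_ge0 (f x - g x); nra.
Qed.

Lemma Lfun2P f : f \in Lfun P 2%:E <-> L2 f.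
Proof.
split=> [fL|[mf fi]].
  split; last exact: Lfun2_integrable_sqr.
  by move: fL; rewrite inE => /andP[/[!inE]].
apply/andP; split; rewrite inE//= /finite_norm unlock /= poweR_lty//.
rewrite (eq_integral (fun x => (f x ^+ 2)%:E)).
  by rewrite Ex_fin ?ltry.
by move=> x _; rewrite /= powR_mulrn// real_normK// num_real.
Qed.

Definition approxL2 f := L2 f /\ forall e : R, 0 < e ->
  exists N u, [/\ bdd u, mF N u & Ex (fun x => (f x - u x) ^+ 2) <= e].

Lemma approx_lim f : L2 f -> (forall e : R, 0 < e -> exists g, approxL2 g /\
  Ex (fun x => (f x - g x) ^+ 2) <= e) -> approxL2 f.
Proof.
move=> f2 H; split=> // e e0.
have e4 : 0 < e / 4 by rewrite divr_gt0.
have [g [[g2 ga] fg]] := H _ e4; have [N [u [bu mu gu]]] := ga _ e4.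
exists N, u; split => //.
rewrite (_ : (fun x => _) = fun x => ((f x - g x) + (g x - u x)) ^+ 2); last first.
  by apply/funext => x; rewrite addrA subrK.
apply: le_trans (Ex_sqrD _ _) _; [exact: L2B|apply: L2B => //; exact: bdd_L2|lra].
Qed.

Lemma approx_add f g : approxL2 f -> approxL2 g -> approxL2 (fun x => f x + g x).
Proof.
move=> [f2 fa] [g2 ga]; split; first exact: L2D.
move=> e e0; have e4 : 0 < e / 4 by rewrite divr_gt0.
have [N [u [bu mu fu]]] := fa _ e4; have [M [v [bv mv gv]]] := ga _ e4.
exists (maxn N M), (fun x => u x + v x); split; first exact: bddD.
  by apply: mFD; [exact: (mF_mono Ffil (leq_maxl _ _))|exact: (mF_mono Ffil (leq_maxr _ _))].
rewrite (_ : (fun x => _) = fun x => ((f x - u x) + (g x - v x)) ^+ 2); last first.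
  by apply/funext => x; congr (_ ^+ 2); ring.
by apply: le_trans (Ex_sqrD _ _) _; [apply: L2B => //; exact: bdd_L2|apply: L2B => //; exact: bdd_L2|lra].
Qed.

Lemma approx_nice N u : bdd u -> mF N u -> approxL2 u.
Proof.
move=> bu mu; split; first exact: bdd_L2.
move=> e e0; exists N, u; split => //.
rewrite (_ : (fun x => _) = cst 0) ?Ex_cst ?ltW//.
by apply/funext => x; rewrite subrr expr0n.
Qed.

Lemma approx_scale c f : approxL2 f -> approxL2 (fun x => c * f x).
Proof.
move=> [f2 fa]; split; first exact: L2Z.
move=> e e0; have c0 : 0 < c ^+ 2 + 1 by rewrite ltr_wpDl// sqr_ge0.
have [N [u [bu mu fu]]] := fa _ (divr_gt0 e0 c0).
exists N, (fun x => c * u x); split; first exact: bddZ.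
  by apply: mFM => //; exact: mF_cst.
rewrite (_ : (fun x => _) = fun x => c ^+ 2 * (f x - u x) ^+ 2); last first.
  by apply/funext => x; rewrite -mulrBr exprMn.
rewrite ExZ; last by have [] := L2B f2 (bdd_L2 bu).
apply: (@le_trans _ _ (c ^+ 2 * (e / (c ^+ 2 + 1)))).
  by rewrite ler_wpM2l// sqr_ge0.
by rewrite mulrA ler_pdivrMr// mulrC ler_pM2l//; lra.
Qed.

Lemma approx_sum (n : nat) (f : nat -> Om -> R) :
  (forall i, approxL2 (f i)) -> approxL2 (fun x => \sum_(i < n) f i x).
Proof.
move=> fa; elim: n => [|n IH].
  under eq_fun do rewrite big_ord0.
  exact: (@approx_nice 0 _ (bdd_cst P 0) (mF_cst _)).
by under eq_fun do rewrite big_ord_recr /=; exact: approx_add.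
Qed.

Definition approx_set (A : set Om) := measurable A /\ forall e : R, 0 < e ->
  exists N C, F N C /\ Ex (fun x => (\1_A x - \1_C x) ^+ 2) <= e.

Lemma approx_setU A B : approx_set A -> approx_set B -> approx_set (A `|` B).
Proof.
move=> [mA hA] [mB hB]; split; first exact: measurableU.
move=> e e0; have e2 : 0 < e / 2 by rewrite divr_gt0.
have [N [C [FC AC]]] := hA _ e2; have [M [D [FD BD]]] := hB _ e2.
have FC' := F_mono Ffil (leq_maxl N M) FC.
have FD' := F_mono Ffil (leq_maxr N M) FD.
have mC := FM Ffil FC; have mD := FM Ffil FD.
exists (maxn N M), (C `|` D); split.
  by rewrite -(measG (saF Ffil (maxn N M))); apply: measurableU; rewrite measG//; exact: saF Ffil _.
have b2 X Y : measurable X -> measurable Y -> itg (fun x => (\1_X x - \1_Y x : R) ^+ 2).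
  by move=> mX mY; apply/bdd_itg/bddX/bddB; exact: bdd_indic.
have mAB := measurableU _ _ mA mB; have mCD := measurableU _ _ mC mD.
apply: (@le_trans _ _ (Ex (fun x => (\1_A x - \1_C x) ^+ 2 + (\1_B x - \1_D x) ^+ 2))).
  apply: Ex_le; [exact: b2|by apply: itgD; exact: b2|].
  apply: aeW => x; rewrite !indicE !in_setU.
  by case: (x \in A); case: (x \in B); case: (x \in C); case: (x \in D) => /=; lra.
by rewrite ExD; [lra|exact: b2|exact: b2].
Qed.

Lemma approx_set_F n A : F n A -> approx_set A.
Proof.
move=> FA; split; first exact: FM FA.
move=> e e0; exists n, A; split => //.
rewrite (_ : (fun x => _) = cst 0) ?Ex_cst ?ltW//.
by apply/funext => x; rewrite subrr expr0n.
Qed.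

(** The approximable sets contain every [F_n] and form a sigma-algebra, hence are all measurable
    sets. For a countable union, a finite partial union is within [e / 4] in probability and is
    approximated in turn. *)
Lemma approx_set_all A : measurable A -> approx_set A.
Proof.
case: (Ffil) => _ _ _ -> ; apply; split; last first.
  by move=> B [n _ FB]; exact: approx_set_F FB.
split.
- by apply: (@approx_set_F 0); case: (saF Ffil 0).
- move=> B [mB hB]; rewrite setTD; split; first exact: measurableC.
  move=> e e0; have [N [C [FC BC]]] := hB _ e0.
  exists N, (~` C); split; first by rewrite -setTD; case: (saF Ffil N) => _ + _; exact.
  rewrite (_ : (fun x => _) = (fun x => (\1_B x - \1_C x) ^+ 2))//.
  apply/funext => x; rewrite !indicE !in_setC.
  by case: (x \in B); case: (x \in C) => /=; lra.
move=> A' hA'; have mA' i : measurable (A' i) by case: (hA' i).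
have mU : measurable (\bigcup_k A' k) by exact: bigcup_measurable.
split => // e e0.
have hU n : approx_set (\big[setU/set0]_(i < n) A' i).
  elim: n => [|n IH]; first by rewrite big_ord0; apply: (@approx_set_F 0); case: (saF Ffil 0).
  by rewrite big_ord_recr /=; exact: approx_setU.
have mUn n : measurable (\big[setU/set0]_(i < n) A' i) by case: (hU n).
have cvU : P (\big[setU/set0]_(i < n.+1) A' i) @[n --> \oo] --> P (\bigcup_k A' k).
  rewrite -(bigcup_bigsetU_bigcup A').
  apply: (@nondecreasing_cvg_mu _ _ _ P (fun n => \big[setU/set0]_(i < n.+1) A' i)) => //.
    by rewrite bigcup_bigsetU_bigcup.
  move=> i j ij; apply/subsetPset; rewrite -!bigcup_mkord.
  by move=> x [k /= ki Ax]; exists k => //=; exact: leq_trans ij.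
have e4 : 0 < e / 4 by rewrite divr_gt0.
move: cvU; rewrite (Pr_fin P mU) => /fine_cvgP[_] /cvgrPdist_lt /(_ _ e4)[N _ /(_ N (leqnn N)) HN].
set U := \bigcup_k _ in mU HN *; set V := \big[setU/set0]_(i < N.+1) A' i in HN.
have VU : V `<=` U by rewrite /V -bigcup_mkord => x [k _ Ax]; exists k.
have mV : measurable V := mUn N.+1.
have [M [C [FC VC]]] := (hU N.+1).2 _ e4.
exists M, C; split => //; have mC := FM Ffil FC.
have L2i X : measurable X -> L2 (\1_X : Om -> R) by move=> mX; exact/bdd_L2/bdd_indic.
rewrite (_ : (fun x => _) = fun x => ((\1_U x - \1_V x) + (\1_V x - \1_C x)) ^+ 2); last first.
  by apply/funext => x; rewrite addrA subrK.
apply: le_trans (Ex_sqrD _ _) _; [by apply: L2B; exact: L2i|by apply: L2B; exact: L2i|].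
have -> : Ex (fun x => (\1_U x - \1_V x) ^+ 2) = Pr U - Pr V.
  rewrite -!Ex_indic// -ExB; [|exact/bdd_itg/bdd_indic|exact/bdd_itg/bdd_indic].
  congr Ex; apply/funext => x; rewrite !indicE.
  case: (boolP (x \in V)) => xV; last by case: (x \in U) => /=; lra.
  have -> : x \in U by rewrite inE; apply: VU; rewrite inE in xV.
  by rewrite /= subrr expr0n.
have : Pr U - Pr V <= e / 4 by rewrite ltW// (le_lt_trans (ler_norm _) HN).
move: VC; lra.
Qed.

Lemma approx_indic A : measurable A -> approxL2 (\1_A : Om -> R).
Proof.
move=> mA; split; first exact/bdd_L2/bdd_indic.
move=> e e0; have [N [C [FC AC]]] := (approx_set_all mA).2 _ e0.
exists N, (\1_C); split => //; first exact/bdd_indic/(FM Ffil FC).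
exact: mF_indic.
Qed.

Lemma layer_cake_approx (K m : nat) (y : R) : 0 <= y -> y <= K%:R ->
  `|y - m.+1%:R^-1 * \sum_(i < m.+1 * K) ((i.+1)%:R <= m.+1%:R * y)%R%:R| <= m.+1%:R^-1.
Proof.
move=> y0 yK; have m0 : 0 < m.+1%:R :> R by rewrite ltr0n.
have y0' : 0 <= m.+1%:R * y by rewrite mulr_ge0// ltW.
have [/= s1 s2] := @layer_cake_count R (m.+1 * K) _ y0'.
have {}s2 := s2 (_ : _ <= (m.+1 * K)%:R).
rewrite natrM ler_pM2l// in s2; have {}s2 := s2 yK.
set s := \sum_(i < _) _ in s1 s2 *.
have -> : y - m.+1%:R^-1 * s = (m.+1%:R * y - s) / m.+1%:R.
  by rewrite mulrBl mulrAC divff ?gt_eqF// mul1r mulrC.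
rewrite normrM normfV (ger0_norm (ltW m0)) ler_pdivrMr//.
by rewrite mulVf ?gt_eqF// ler_norml; lra.
Qed.

Lemma approx_bounded f (K : nat) : measurable_fun setT f ->
  (forall x, 0 <= f x) -> (forall x, f x <= K%:R) -> approxL2 f.
Proof.
move=> mf f0 fK.
have bf : bdd f.
  by split => //; exists K%:R; apply: aeW => x; rewrite ger0_norm.
apply: approx_lim => [|e e0]; first exact: bdd_L2.
pose m := Num.truncn (e^-1).
have m0 : 0 < m.+1%:R :> R by rewrite ltr0n.
have m1 : 1 <= m.+1%:R :> R by rewrite ler1n.
have me : m.+1%:R^-1 <= e.
  by rewrite -[leRHS]invrK lef_pV2 ?posrE ?invr_gt0// ltW// truncnS_gt.
have mA (i : nat) : measurable [set x | (i.+1)%:R <= m.+1%:R * f x].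
  by apply: meas_le_set => //; exact: measurable_funM.
pose g (x : Om) : R := m.+1%:R^-1 * \sum_(i < m.+1 * K) \1_[set x | (i.+1)%:R <= m.+1%:R * f x] x.
have ga : approxL2 g.
  apply: approx_scale.
  apply: (@approx_sum _ (fun i => \1_[set x | (i.+1)%:R <= m.+1%:R * f x])) => i.
  exact: approx_indic.
exists g; split => //.
have fg x : `|f x - g x| <= m.+1%:R^-1.
  rewrite /g (eq_bigr (fun i : 'I_(m.+1 * K) => ((i.+1)%:R <= m.+1%:R * f x)%R%:R)).
    exact: layer_cake_approx.
  by move=> i _; rewrite indicE; congr (nat_of_bool _)%:R; apply/idP/idP; rewrite inE.
rewrite -[leRHS](Ex_cst P); apply: Ex_le; [|exact: itg_cst|].
  by have [] := L2B (bdd_L2 bf) ga.1.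
apply: aeW => x /=; apply: le_trans me.
rewrite -[_ ^+ 2]real_normK ?num_real//.
have i1 : m.+1%:R^-1 <= 1 :> R by rewrite invf_le1.
have i0 : 0 <= m.+1%:R^-1 :> R by rewrite invr_ge0 ltW.
apply: (@le_trans _ _ (m.+1%:R^-1 ^+ 2)); first by rewrite ler_sqr ?nnegrE ?fg.
by rewrite expr2 ler_piMl.
Qed.

Definition clip (M : R) f : Om -> R := fun x => Num.max (- M) (Num.min (f x) M).

Lemma clip_meas M f : measurable_fun setT f -> measurable_fun setT (clip M f).
Proof. by move=> mf; apply: meas_max => //; exact: measurable_minr. Qed.

Lemma clip_norm M f x : 0 <= M -> `|clip M f x| <= M.
Proof.
move=> M0; rewrite /clip ler_norml ge_max le_max lexx ge_min lexx orbT andbT/=.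
lra.
Qed.

Lemma clip_bdd M f : 0 <= M -> measurable_fun setT f -> bdd (clip M f).
Proof.
move=> M0 mf; split; first exact: clip_meas.
by exists M; apply: aeW => x; exact: clip_norm.
Qed.

Lemma clip_err M f x : 0 <= M -> `|f x - clip M f x| = `|f x| - Num.min `|f x| M.
Proof.
move=> M0; rewrite /clip.
have [fM|fM] := leP `|f x| M.
  move: (fM); rewrite ler_norml => /andP[h1 h2].
  rewrite (_ : Num.min (f x) M = f x); last by apply/min_idPl.
  rewrite (_ : Num.max (- M) (f x) = f x); last by apply/max_idPr.
  by rewrite !subrr normr0.
have [f0|f0] := leP 0 (f x).
  rewrite ger0_norm// in fM *.
  rewrite (_ : Num.min (f x) M = M); last by apply/min_idPr/ltW.
  rewrite (_ : Num.max (- M) M = M); last by apply/max_idPr; lra.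
  by rewrite ger0_norm// subr_ge0 ltW.
rewrite ltr0_norm// in fM *.
rewrite (_ : Num.min (f x) M = f x); last by apply/min_idPl; lra.
rewrite (_ : Num.max (- M) (f x) = - M); last by apply/max_idPl; lra.
by rewrite opprK ler0_norm; lra.
Qed.

(** By contradiction: if every error exceeds [e], each truncation of [|f|] has expectation at most
    that of [|f|] minus [e], and then so has [|f|] itself. *)
Lemma clip_L1 f (e : R) : itg f -> 0 < e ->
  exists m : nat, Ex (fun x => `|f x - clip m%:R f x|) <= e.
Proof.
move=> fi e0; have mf := itg_meas fi.
apply: contrapT => H.
suff [_] : itg (fun x => `|f x|) /\ Ex (fun x => `|f x|) <= Ex (fun x => `|f x|) - e.
  lra.
apply: itg_truncP => //.
- exact: measurableT_comp.
- move=> m; rewrite leNgt; apply/negP => lt; apply: H; exists m.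
  under eq_fun do rewrite clip_err//.
  have i1 := itg_abs fi.
  have i2 : itg (fun x => Num.min `|f x| m%:R).
    apply: (itg_le _ i1); first by apply: measurable_minr => //; exact: measurableT_comp.
    by apply: aeW => x; rewrite ger0_norm ?ge_min ?lexx// le_min normr_ge0 ler0n.
  rewrite ExB//; lra.
Qed.

Lemma clip_L2 f (e : R) : L2 f -> 0 < e ->
  exists m : nat, Ex (fun x => (f x - clip m%:R f x) ^+ 2) <= e.
Proof.
move=> [mf fi] e0.
apply: contrapT => H.
suff [_] : itg (fun x => f x ^+ 2) /\ Ex (fun x => f x ^+ 2) <= Ex (fun x => f x ^+ 2) - e.
  lra.
apply: itg_truncP.
- exact: measurable_funX.
- by move=> x; exact: sqr_ge0.
- move=> m; rewrite leNgt; apply/negP => lt; apply: H; exists m.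
  have i2 : itg (fun x => Num.min (f x ^+ 2) m%:R).
    apply: (itg_le _ fi); first by apply: measurable_minr => //; exact: measurable_funX.
    by apply: aeW => x; rewrite ger0_norm ?ge_min ?lexx// le_min sqr_ge0 ler0n.
  apply: (@le_trans _ _ (Ex (fun x => f x ^+ 2 - Num.min (f x ^+ 2) m%:R))); last first.
    rewrite ExB//; lra.
  have bc : bdd (clip m%:R f) by exact: clip_bdd.
  apply: Ex_le; [by have [] := L2B (conj mf fi) (bdd_L2 bc)|exact: itgB|].
  apply: aeW => x; rewrite -[leLHS]real_normK ?num_real// clip_err//.
  rewrite -[f x ^+ 2]real_normK ?num_real//.
  (* [m] is an integer, so [m <= m^2]; this lets clipping [f] at height [m] be compared with
     truncating [f^2] at height [m]. *)
  have mm : m%:R <= m%:R ^+ 2 :> R.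
    by rewrite -natrX ler_nat; case: (m) => // k; rewrite -mulnn leq_pmulr.
  have m0 : 0 <= m%:R :> R by [].
  have f0 := normr_ge0 (f x); set t := `|f x| in f0 *.
  have [tm|tm] := leP t m%:R.
    rewrite subrr expr0n/= subr_ge0 ge_min lexx//.
  have : Num.min (t ^+ 2) m%:R <= m%:R by rewrite ge_min lexx orbT.
  nra.
Qed.

Lemma approx_L2_all f : L2 f -> approxL2 f.
Proof.
move=> f2; apply: approx_lim => // e e0.
have [m fm] := clip_L2 f2 e0; exists (clip m%:R f); split => //.
have mc := clip_meas m%:R f2.1.
have -> : clip m%:R f = fun x => (clip m%:R f x + m%:R) + cst (- m%:R) x.
  by apply/funext => x; rewrite /= addrK.
apply: approx_add.
  apply: (@approx_bounded _ (m + m)).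
  - exact: measurable_funD.
  - move=> x; have := @clip_norm m%:R f x (ler0n _ _); rewrite ler_norml; lra.
  - move=> x; have := @clip_norm m%:R f x (ler0n _ _); rewrite ler_norml natrD; lra.
exact: (@approx_nice 0 _ (bdd_cst P _) (mF_cst _)).
Qed.

Lemma Ex_abs_le_sqr f (e : R) : L2 f -> 0 < e ->
  Ex (fun x => f x ^+ 2) <= e ^+ 2 -> Ex (fun x => `|f x|) <= e.
Proof.
move=> f2 e0 H; have fi := L2_itg f2; have afi := itg_abs fi.
have : Ex (fun x => 2 * e * `|f x|) <= Ex (fun x => f x ^+ 2 + cst (e ^+ 2) x).
  apply: Ex_le; [exact: itgZ|by apply: itgD; [exact: f2.2|exact: itg_cst]|].
  apply: aeW => x /=; rewrite -[f x ^+ 2]real_normK ?num_real//.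
  by have := sqr_ge0 (`|f x| - e); nra.
rewrite ExZ// ExD; [|exact: f2.2|exact: itg_cst].
rewrite Ex_cst => H2; rewrite -(ler_pM2l (_ : 0 < 2 * e)) ?mulr_gt0//.
by rewrite (le_trans H2)//; nra.
Qed.

Lemma approx_L1 f (e : R) : itg f -> 0 < e ->
  exists N u, [/\ bdd u, mF N u & Ex (fun x => `|f x - u x|) <= e].
Proof.
move=> fi e0; have e2 : 0 < e / 2 by rewrite divr_gt0.
have [m fm] := clip_L1 fi e2.
have bc : bdd (clip m%:R f) by apply: clip_bdd => //; exact: itg_meas fi.
have [_ ca] := approx_L2_all (bdd_L2 bc).
have e22 : 0 < (e / 2) ^+ 2 by rewrite exprn_gt0.
have [N [u [bu mu cu]]] := ca _ e22.
exists N, u; split => //.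
have c2 := L2B (bdd_L2 bc) (bdd_L2 bu).
have h := Ex_abs_le_sqr c2 e2 cu.
have i1 := itgB fi (bdd_itg bc); have i2 := L2_itg c2.
apply: (@le_trans _ _ (Ex (fun x => `|f x - clip m%:R f x| + `|clip m%:R f x - u x|))).
  apply: Ex_le.
  - by apply/itg_abs/itgB => //; exact: bdd_itg.
  - by apply: itgD; exact: itg_abs.
  - by apply: aeW => x; rewrite -[f x - u x](subrKA (clip m%:R f x)) ler_normD.
rewrite ExD; [lra|exact: itg_abs|exact: itg_abs].
Qed.

Lemma E_cvg_L1 f (e : R) : itg f -> 0 < e ->
  exists N, Ex (fun x => `|f x - E N f x|) <= e.
Proof.
move=> fi e0; have e2 : 0 < e / 2 by rewrite divr_gt0.
have [N [u [bu mu fu]]] := approx_L1 fi e2.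
have ui := bdd_itg bu; have fui := itgB fi ui.
exists N; apply: (@le_trans _ _ (Ex (fun x => `|f x - u x| + `|E N (fun x => f x - u x) x|))).
  apply: Ex_le.
  - by apply/itg_abs/itgB => //; exact: E_itg.
  - by apply: itgD; apply: itg_abs => //; exact: E_itg.
  apply: filterS2 (E_sub Ffil N fi ui) (E_id Ffil mu ui) => x -> ->.
  rewrite -[f x - E N f x](subrKA (u x)) (le_trans (ler_normD _ _))//.
  by rewrite lerD2l distrC.
rewrite ExD; [|exact: itg_abs|by apply/itg_abs/E_itg].
by have := E_L1 Ffil N fui; lra.
Qed.

(** John-Nirenberg from time 0 on the whole space bounds [E N b] in [L^2] uniformly in [N]; the
    bound passes to [b] by Fatou's lemma in probability. *)
Lemma bmo_L2 (B : R) b : 0 < B -> itg b -> (forall n, [/\ bdd (E n b),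
    {ae P, forall x, `|mdiff (mart P F b) n x| <= B} &
    forall A, F n A -> Ex (fun x => \1_A x * `|b x - Eprev P F n b x|) <= B * Pr A]) ->
  L2 b.
Proof.
move=> B0 bi bb; have mb := itg_meas bi.
have C0 : 0 <= 57 * B ^+ 2 by rewrite mulr_ge0 ?sqr_ge0.
have EN N : Ex (fun x => E N b x ^+ 2) <= 57 * B ^+ 2.
  have FT : F 0 setT by exact: F_setT.
  have := john_nirenberg Ffil B0 bi bb N FT.
  rewrite indT => H.
  have -> : 57 * B ^+ 2 = 57 * B ^+ 2 * Pr setT.
    by rewrite Pr_setT mulr1.
  apply: le_trans H; apply: Ex_le.
  - by apply/bdd_itg/bddX; case: (bb N).
  - by apply/bdd_itg/bddX/MX_bdd => k; exact: (osc_bdd bb).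
  apply: aeW => x; rewrite -[leLHS]real_normK ?num_real// ler_sqr ?nnegrE ?MX_ge0//.
  by have := rmax_ge (oscillation P F b 0 ^~ x) N; rewrite {1}/oscillation add0n subr0.
suff : (Lq_norm P 2 (fun x => `|b x|%R) <= (Num.sqrt (57 * B ^+ 2))%:E)%E.
  move=> H; apply/Lfun2P; apply/andP; split; rewrite inE//= /finite_norm.
  rewrite (le_lt_trans _ (ltry (Num.sqrt (57 * B ^+ 2))))//.
  by apply: le_trans H; apply: Lq_le => //; [exact: measurableT_comp|apply: aeW => x; rewrite normr_id].
apply: Lq_le_in_prob => [||||e e0].
- by rewrite ler1n.
- exact: sqrtr_ge0.
- exact: measurableT_comp.
- by move=> x; exact: normr_ge0.
have e2 : 0 < e ^+ 2 by rewrite exprn_gt0.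
have [N bN] := E_cvg_L1 bi e2.
have mEN : measurable_fun setT (E N b) := itg_meas (E_itg Ffil N bi).
exists (fun x => `|E N b x|); split => //; first exact: measurableT_comp.
  rewrite Lq_normE// (eq_integral (fun x => (E N b x ^+ 2)%:E)); last first.
    by move=> x _; rewrite normr_id powR_mulrn// real_normK// num_real.
  have b2 : itg (fun x => E N b x ^+ 2) by apply/bdd_itg/bddX; case: (bb N).
  rewrite Ex_fin// poweR_EFin powR12_sqrt; last first.
    by apply: Ex_ge0 => //; apply: aeW => x; exact: sqr_ge0.
  by rewrite lee_fin ler_wpDr ?(ltW e0)// ler_wsqrtr.
have mA : measurable [set x | e <= `|b x - E N b x|].
  by apply: meas_le_set => //; apply: measurableT_comp => //; exact: measurable_funB.
have i1 := itg_abs (itgB bi (E_itg Ffil N bi)).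
apply: (@le_trans _ _ (Pr [set x | e <= `|b x - E N b x|])).
  apply: Pr_le => //.
    apply: meas_lt_set; last exact: measurableT_comp.
    by apply: measurable_funD => //; exact: measurableT_comp.
  move=> x /= H; have := lerB_dist (b x) (E N b x); lra.
rewrite -(ler_pM2l e0) -expr2; apply: le_trans bN; apply: markov_Ex => //.
exact: aeW.
Qed.

End density.

(** * A regular version of the commutator *)

Section dense_sequence.
Context {R : realType}.

(** An enumeration of the rationals; indices that code none are sent to 0. *)
Definition ratq (j : nat) : R := ratr (odflt 0%R (unpickle j : option rat)).

Lemma ratq_dense (c e : R) : 0 < e -> exists j, `|c - ratq j| < e.
Proof.
move=> e0; have H : c - e < c + e by lra.
have [r] := rat_in_itvoo H; rewrite in_itv /= => /andP[h1 h2].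
exists (pickle r); rewrite /ratq pickleK /=.
by rewrite ltr_norml; lra.
Qed.

(** The form in which inequalities between Lipschitz functions of [c] pass from rational to real
    parameters. *)
Lemma ratq_le (a b c L : R) : (forall j, a <= b + `|c - ratq j| * L) -> a <= b.
Proof.
move=> H; apply/ler_addgt0Pr => e e0.
have e1 : 0 < e / (`|L| + 1) by rewrite divr_gt0// ltr_wpDl.
have [j hj] := ratq_dense c e1.
apply: (le_trans (H j)); rewrite lerD2l.
apply: (@le_trans _ _ (`|c - ratq j| * (`|L| + 1))).
  by rewrite ler_wpM2l// (le_trans (ler_norm _))// lerDl.
by rewrite -ler_pdivlMr ?ltr_wpDl// ltW.
Qed.

End dense_sequence.

(** * [T (u - c g)] as a function of the parameter [c] *)

Section commutator_field.
Context {d : measure_display} {Om : measurableType d} {R : realType}.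
Variable P : probability Om R.
Local Notation itg := (itg P).
Implicit Types u g v k : Om -> R.
Variable T : (Om -> R) -> Om -> R.
Hypotheses (Top : operator P T) (Tsub : sublinear P T).

Lemma T_meas f : itg f -> measurable_fun setT (T f).
Proof. by move=> fi; apply: Top.1; exact/Lfun1P. Qed.

Lemma T_ae f g : itg f -> itg g -> {ae P, forall x, f x = g x} ->
  {ae P, forall x, T f x = T g x}.
Proof.
move=> fi gi fg; have := Top.2 f g; rewrite !Lfun1P => /(_ fi gi).
by move=> H; apply: (aeE P (T f) (T g)).1; apply: H; exact: (aeE P f g).2.
Qed.

Lemma T_lin (a c : R) f g : itg f -> itg g ->
  {ae P, forall x, `|T (fun y => a * f y + c * g y) x| <= `|a| * `|T f x| + `|c| * `|T g x|}.
Proof. by move=> fi gi; apply: Tsub; exact/Lfun1P. Qed.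

Lemma T_add f g : itg f -> itg g ->
  {ae P, forall x, `|T (fun y => f y + g y) x| <= `|T f x| + `|T g x|}.
Proof.
move=> fi gi; apply: filterS (T_lin 1 1 fi gi) => x.
by under eq_fun do rewrite !mul1r; rewrite normr1 !mul1r.
Qed.

Lemma T_scale c f : itg f -> {ae P, forall x, `|T (fun y => c * f y) x| <= `|c| * `|T f x|}.
Proof.
move=> fi; apply: filterS (T_lin c 0 fi fi) => x.
by under eq_fun do rewrite mul0r addr0; rewrite normr0 mul0r addr0.
Qed.

Lemma T_opp f : itg f -> {ae P, forall x, `|T (fun y => - f y) x| <= `|T f x|}.
Proof.
move=> fi; apply: filterS (T_scale (-1) fi) => x.
by under eq_fun do rewrite mulN1r; rewrite normrN1 mul1r.
Qed.

Lemma T_zero f : itg f -> {ae P, forall x, f x = 0} -> {ae P, forall x, T f x = 0}.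
Proof.
move=> fi f0; have i0 : itg (fun y => 0 * f y) by exact: itgZ.
have e : {ae P, forall x, f x = 0 * f x} by apply: filterS f0 => x ->; rewrite mulr0.
apply: filterS2 (T_ae fi i0 e) (T_scale 0 fi) => x ->.
by rewrite normr0 mul0r normr_le0 => /eqP.
Qed.

Definition field_term u g j c x : R :=
  `|T (fun y => u y - ratq j * g y) x| + `|c - ratq j| * `|T g x|.

(* A version of [|T (u - c g) x|] that is Lipschitz in [c] at every point [x]. *)
Definition field u g c x : R := inf (range (fun j => field_term u g j c x)).

Lemma field_term_ge0 u g j c x : 0 <= field_term u g j c x.
Proof. by rewrite addr_ge0// mulr_ge0. Qed.

Lemma field_has_inf u g c x : has_inf (range (fun j => field_term u g j c x)).
Proof.
split; first by exists (field_term u g 0 c x); exists 0%N.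
by exists 0 => _ [j _ <-]; exact: field_term_ge0.
Qed.

Lemma field_le_term u g j c x : field u g c x <= field_term u g j c x.
Proof. by apply: ge_inf; [exact: (field_has_inf u g c x).2|exists j]. Qed.

Lemma field_ge u g c x a : (forall j, a <= field_term u g j c x) -> a <= field u g c x.
Proof.
by move=> H; apply: lb_le_inf; [exact: (field_has_inf u g c x).1|move=> _ [j _ <-]].
Qed.

Lemma field_ge0 u g c x : 0 <= field u g c x.
Proof. by apply: field_ge => j; exact: field_term_ge0. Qed.

Lemma field_lip u g c c' x : field u g c x <= field u g c' x + `|c - c'| * `|T g x|.
Proof.
rewrite -lerBlDr; apply: field_ge => j; rewrite lerBlDr.
apply: (le_trans (field_le_term u g j c x)).
rewrite /field_term -addrA lerD2l -mulrDl ler_wpM2r//.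
by rewrite [leRHS]addrC -[c - ratq j](subrKA c') ler_normD.
Qed.

(** Sublinearity yields the Lipschitz bound only off a null set that depends on [c] and [c'];
    [field] is built to remove this dependence. *)
Lemma T_field_lip u g c c' : itg u -> itg g ->
  {ae P, forall x, `|T (fun y => u y - c * g y) x| <=
    `|T (fun y => u y - c' * g y) x| + `|c - c'| * `|T g x|}.
Proof.
move=> ui gi; have i1 : itg (fun y => u y - c' * g y) by apply: itgB => //; exact: itgZ.
apply: filterS (T_lin 1 (c' - c) i1 gi) => x.
rewrite normr1 mul1r distrC; congr (`|T _ x| <= _).
by apply/funext => y; ring.
Qed.

Lemma fieldE u g c : itg u -> itg g ->
  {ae P, forall x, field u g c x = `|T (fun y => u y - c * g y) x|}.
Proof.
move=> ui gi.
have h1 : {ae P, forall x, forall j, `|T (fun y => u y - c * g y) x| <=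
    `|T (fun y => u y - ratq j * g y) x| + `|c - ratq j| * `|T g x|}.
  by apply/ae_foralln => j; exact: T_field_lip.
have h2 : {ae P, forall x, forall j, `|T (fun y => u y - ratq j * g y) x| <=
    `|T (fun y => u y - c * g y) x| + `|ratq j - c| * `|T g x|}.
  by apply/ae_foralln => j; exact: T_field_lip.
apply: filterS2 h1 h2 => x h1 h2; apply/eqP; rewrite eq_le; apply/andP; split.
  apply: (@ratq_le _ _ _ c (2 * `|T g x|)) => j.
  apply: (le_trans (field_le_term u g j c x)); rewrite /field_term.
  have := h2 j; rewrite distrC; lra.
exact: field_ge.
Qed.

Lemma fieldE_ratq u g : itg u -> itg g ->
  {ae P, forall x, forall j, field u g (ratq j) x = `|T (fun y => u y - ratq j * g y) x|}.
Proof. by move=> ui gi; apply/ae_foralln => j; exact: fieldE. Qed.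

(** Only countably many null sets are discarded: subadditivity holds at rational parameters and
    extends to all real [c] by the Lipschitz bound. Hence [c] may be replaced by [b x]
    afterwards. *)
Lemma field_add u g v k : itg u -> itg g -> itg v -> itg k ->
  {ae P, forall x, forall c, field (fun y => u y + v y) (fun y => g y + k y) c x <=
     field u g c x + field v k c x}.
Proof.
move=> ui gi vi ki.
have h : {ae P, forall x, forall j,
    `|T (fun y => (u y + v y) - ratq j * (g y + k y)) x| <=
    `|T (fun y => u y - ratq j * g y) x| + `|T (fun y => v y - ratq j * k y) x|}.
  apply/ae_foralln => j.
  have i1 : itg (fun y => u y - ratq j * g y) by apply: itgB => //; exact: itgZ.
  have i2 : itg (fun y => v y - ratq j * k y) by apply: itgB => //; exact: itgZ.
  apply: filterS (T_add i1 i2) => x; congr (`|T _ x| <= _).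
  by apply/funext => y; ring.
apply: filterS3 (filterI h (fieldE_ratq (itgD ui vi) (itgD gi ki)))
  (fieldE_ratq ui gi) (fieldE_ratq vi ki) => x [h0 h1] h2 h3 c.
set gk := fun y => g y + k y in h1 *; set uv := fun y => u y + v y in h1 *.
apply: (@ratq_le _ _ _ c (`|T gk x| + `|T g x| + `|T k x|)) => j.
have a1 := field_lip uv gk c (ratq j) x.
have a2 := field_lip u g (ratq j) c x; have a3 := field_lip v k (ratq j) c x.
rewrite (distrC (ratq j) c) in a2 a3.
rewrite h2 in a2; rewrite h3 in a3; rewrite h1 in a1.
move: (h0 j) a1 a2 a3.
set t := `|c - ratq j|; nra.
Qed.

Lemma field_cst0 u g : itg u -> itg g ->
  {ae P, forall x, field u g 0 x = `|T u x|}.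
Proof.
move=> ui gi; apply: filterS (fieldE 0 ui gi) => x ->.
by under eq_fun do rewrite mul0r subr0.
Qed.

Lemma field_bound u g : itg u -> itg g ->
  {ae P, forall x, forall c, field u g c x <= `|T u x| + `|c| * `|T g x|}.
Proof.
move=> ui gi; apply: filterS (field_cst0 ui gi) => x h c.
by have := field_lip u g c 0 x; rewrite h subr0.
Qed.

Lemma field_ae u g u' g' : itg u -> itg g -> itg u' -> itg g' ->
  {ae P, forall x, u x = u' x} -> {ae P, forall x, g x = g' x} ->
  {ae P, forall x, forall c, field u g c x = field u' g' c x}.
Proof.
move=> ui gi ui' gi' uu gg.
have h : {ae P, forall x, forall j,
    T (fun y => u y - ratq j * g y) x = T (fun y => u' y - ratq j * g' y) x}.
  apply/ae_foralln => j.
  apply: (T_ae (itgB ui (itgZ (ratq j) gi)) (itgB ui' (itgZ (ratq j) gi'))).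
  by apply: filterS2 uu gg => x -> ->.
apply: filterS2 h (T_ae gi gi' gg) => x h1 h2 c.
rewrite /field (_ : (fun j => field_term u g j c x) =
  (fun j => field_term u' g' j c x))//; apply/funext => j.
by rewrite /field_term h1 h2.
Qed.

Lemma field_diff u g u' g' : itg u -> itg g -> itg u' -> itg g' ->
  {ae P, forall x, forall c, `|field u g c x - field u' g' c x| <=
     `|T (fun y => u y - u' y) x| + `|c| * `|T (fun y => g y - g' y) x|}.
Proof.
move=> ui gi ui' gi'.
have du := itgB ui ui'; have dg := itgB gi gi'.
have du' := itgB ui' ui; have dg' := itgB gi' gi.
have e1 := field_add du dg ui' gi'; have e2 := field_add du' dg' ui gi.
have o1 : {ae P, forall x, `|T (fun y => u' y - u y) x| <= `|T (fun y => u y - u' y) x|}.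
  by apply: filterS (T_opp du) => x; under eq_fun do rewrite opprB.
have o2 : {ae P, forall x, `|T (fun y => g' y - g y) x| <= `|T (fun y => g y - g' y) x|}.
  by apply: filterS (T_opp dg) => x; under eq_fun do rewrite opprB.
apply: filterS3 (filterI e1 e2) (filterI o1 o2)
  (filterI (field_bound du dg) (field_bound du' dg')) => x [f1 f2] [p1 p2] [b1 b2] c.
move: (f1 c) (f2 c) (b1 c) (b2 c).
have -> : (fun y => u y - u' y + u' y) = u by apply/funext => y; rewrite subrK.
have -> : (fun y => g y - g' y + g' y) = g by apply/funext => y; rewrite subrK.
have -> : (fun y => u' y - u y + u y) = u' by apply/funext => y; rewrite subrK.
have -> : (fun y => g' y - g y + g y) = g' by apply/funext => y; rewrite subrK.
have pc : `|c| * `|T (fun y => g' y - g y) x| <= `|c| * `|T (fun y => g y - g' y) x|.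
  by rewrite ler_wpM2l.
by move=> *; rewrite ler_norml; lra.
Qed.

(** An infimum of countably many measurable functions, even after a measurable function is
    substituted for [c]. *)
Lemma field_meas u g r : itg u -> itg g -> measurable_fun setT r ->
  measurable_fun setT (fun x => field u g (r x) x).
Proof.
move=> ui gi mr.
have -> : (fun x => field u g (r x) x) =
    (fun x => infs ((fun j y => field_term u g j (r y) y) ^~ x) 0).
  apply/funext => x; rewrite /field /infs; congr inf.
  by apply/seteqP; split => _ [j _ <-]; exists j.
apply: measurable_fun_infs => [x _|j].
  by exists 0 => _ [j _ <-]; exact: field_term_ge0.
apply: measurable_funD.
  apply: measurableT_comp => //; apply: T_meas.
  by apply: itgB => //; exact: itgZ.
apply: measurable_funM; apply: measurableT_comp => //; last exact: T_meas.
exact: measurable_funB.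
Qed.

Lemma field_continuous u g x : continuous (fun c => field u g c x).
Proof.
move=> c; apply/cvgrPdist_le => e e0.
have L0 : 0 < `|T g x| + 1 by rewrite ltr_wpDl.
have e1 : 0 < e / (`|T g x| + 1) by rewrite divr_gt0.
near=> c'.
have cc : `|c - c'| <= e / (`|T g x| + 1).
  by near: c'; apply: cvgr_dist_le => //; exact: cvg_id.
have a1 := field_lip u g c c' x; have a2 := field_lip u g c' c x.
rewrite (distrC c' c) in a2.
have : `|c - c'| * `|T g x| <= e.
  apply: (@le_trans _ _ (`|c - c'| * (`|T g x| + 1))); first by rewrite ler_wpM2l// lerDl.
  by rewrite -ler_pdivlMr.
rewrite ler_norml; lra.
Unshelve. all: by end_near.
Qed.

Lemma field_unique u g (Phi : R -> Om -> R) : itg u -> itg g ->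
  (forall c, {ae P, forall x, Phi c x = `|T (fun y => u y - c * g y) x|}) ->
  {ae P, forall x, continuous (fun c => Phi c x)} ->
  {ae P, forall x, forall c, Phi c x = field u g c x}.
Proof.
move=> ui gi PhiE Phic.
have h : {ae P, forall x, forall j, Phi (ratq j) x = field u g (ratq j) x}.
  apply/ae_foralln => j; apply: filterS2 (PhiE (ratq j)) (fieldE (ratq j) ui gi) => x.
  by move=> -> ->.
apply: filterS2 h Phic => x hx cx c.
apply/eqP; rewrite -subr_eq0 -normr_le0; apply/ler_addgt0Pr => e e0; rewrite add0r.
have e2 : 0 < e / 2 by rewrite divr_gt0.
have := cx c => /cvgrPdist_le /(_ _ e2) /nbhs_ballP[dl /= dl0 Hdl].
have := @field_continuous u g x c => /cvgrPdist_le /(_ _ e2) /nbhs_ballP[dl' /= dl0' Hdl'].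
have H : 0 < Num.min dl dl' by rewrite lt_min dl0.
have [j] := ratq_dense c H; rewrite lt_min => /andP[j1 j2].
have := Hdl (ratq j) j1; have := Hdl' (ratq j) j2 => /= b1 b2.
have -> : Phi c x - field u g c x = (Phi c x - Phi (ratq j) x) -
    (field u g c x - field u g (ratq j) x) by rewrite hx; ring.
by rewrite (le_trans (ler_normB _ _))//; lra.
Qed.

Lemma abs_commutator_L2P b g h : itg (fun y => b y * g y) -> itg g ->
  is_abs_commutator_L2 P T b g h ->
  measurable_fun setT h /\
  {ae P, forall x, h x = field (fun y => b y * g y) g (b x) x}.
Proof.
move=> bgi gi [mh [Phi [PhiE Phic hE]]]; split => //.
apply: filterS2 (field_unique bgi gi PhiE Phic) hE => x e ->; exact: e.
Qed.

Lemma field_abs_commutator_L2 b g : itg (fun y => b y * g y) -> itg g ->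
  measurable_fun setT b ->
  is_abs_commutator_L2 P T b g (fun x => field (fun y => b y * g y) g (b x) x).
Proof.
move=> bgi gi mb; split; first exact: field_meas.
exists (field (fun y => b y * g y) g); split.
- by move=> c; exact: fieldE.
- by apply: aeW => x; exact: field_continuous.
- exact: aeW.
Qed.

End commutator_field.

(** * [E n] as a sublinear operator *)

Section conditional_expectation_operator.
Context {d : measure_display} {Om : measurableType d} {R : realType}.
Variable P : probability Om R.
Variable F : nat -> set (set Om).
Hypothesis Ffil : filtration F.

Lemma E_operator n : operator P (E P F n).
Proof.
split=> [f /Lfun1P fi|f g /Lfun1P fi /Lfun1P gi /aeE fg].
  exact: itg_meas (E_itg Ffil n fi).
by apply/aeE; apply: aeW => x; rewrite (E_ae Ffil n fi gi fg).
Qed.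

Lemma E_lin n (a c : R) f g : itg P f -> itg P g ->
  {ae P, forall x, E P F n (fun y => a * f y + c * g y) x = a * E P F n f x + c * E P F n g x}.
Proof.
move=> fi gi.
apply: filterS3 (E_add Ffil n (itgZ a fi) (itgZ c gi)) (E_scale Ffil n a fi)
  (E_scale Ffil n c gi) => x -> -> -> //.
Qed.

Lemma E_sublinear n : sublinear P (E P F n).
Proof.
move=> a c f g /Lfun1P fi /Lfun1P gi; apply: filterS (E_lin n a c fi gi) => x ->.
by rewrite (le_trans (ler_normD _ _))// !normrM.
Qed.

Lemma E_meas_continuous n : meas_continuous P (E P F n).
Proof.
move=> t e t0 e0; exists (t * e); first exact: mulr_gt0.
move=> f fi fd; have Ei := E_itg Ffil n fi; have aEi := itg_abs Ei.
have mE := itg_meas aEi.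
have E0 : {ae P, forall x, 0 <= `|E P F n f x|} by exact: aeW.
have := markov_Ex aEi E0 t0; move=> H.
have H2 := le_trans H (le_trans (E_L1 Ffil n fi) fd).
rewrite ler_pM2l// in H2; apply: le_trans H2; apply: Pr_le.
- exact: meas_lt_set.
- exact: meas_le_set.
- by move=> x /= /ltW.
Qed.

End conditional_expectation_operator.

(** * The paraproduct *)

Section paraproduct.
Context {d : measure_display} {Om : measurableType d} {R : realType}.
Variable P : probability Om R.
Variable F : nat -> set (set Om).
Hypothesis Ffil : filtration F.
Local Notation E := (E P F).
Local Notation Eprev := (Eprev P F).
Local Notation mart := (mart P F).
Local Notation Ex := (Ex P).
Local Notation Pr := (Pr P).
Local Notation itg := (itg P).
Local Notation bdd := (bdd P).
Local Notation mF := (mF F).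
Implicit Types f g u : Om -> R.

Lemma mart_bdd g k : bdd g -> bdd (mart g k).
Proof. exact: E_bdd. Qed.

Lemma dmart_bdd g k : bdd g -> bdd (mdiff (mart g) k).
Proof. by move=> gb; apply: mdiff_bdd => j; exact: mart_bdd. Qed.

Lemma mF_mart g k : itg g -> mF k (mart g k).
Proof. by move=> gi; exact: E_meas. Qed.

Lemma mF_dmart g k N : itg g -> (k <= N)%N -> mF N (mdiff (mart g) k).
Proof. by move=> gi kN; apply: mF_mdiff => // j; exact: mF_mart. Qed.

Lemma mart_sub f g k : itg f -> itg g ->
  {ae P, forall x, mart (fun x => f x - g x) k x = mart f k x - mart g k x}.
Proof. exact: E_sub. Qed.

Lemma dmart_add f g k : itg f -> itg g ->
  {ae P, forall x, mdiff (mart (fun x => f x + g x)) k x =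
     mdiff (mart f) k x + mdiff (mart g) k x}.
Proof.
move=> fi gi; rewrite /mdiff /Defs.mart.
case: k => [|k] /=.
  by apply: filterS (E_add Ffil 0 fi gi) => x ->; rewrite !subr0.
by apply: filterS2 (E_add Ffil k.+1 fi gi) (E_add Ffil k fi gi) => x -> ->; ring.
Qed.

Lemma dmart_scale c f k : itg f ->
  {ae P, forall x, mdiff (mart (fun x => c * f x)) k x = c * mdiff (mart f) k x}.
Proof.
move=> fi; rewrite /mdiff /Defs.mart; case: k => [|k] /=.
  by apply: filterS (E_scale Ffil 0 c fi) => x ->; rewrite !subr0.
by apply: filterS2 (E_scale Ffil k.+1 c fi) (E_scale Ffil k c fi) => x -> ->; ring.
Qed.

Lemma mart_stop g N k : mF N g -> itg g -> (N <= k)%N ->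
  {ae P, forall x, mart g k x = g x}.
Proof. by move=> mg gi Nk; apply: E_id => //; exact: (mF_mono Ffil Nk). Qed.

Lemma dmart_stop g N k : mF N g -> itg g -> (N < k)%N ->
  {ae P, forall x, mdiff (mart g) k x = 0}.
Proof.
move=> mg gi; case: k => // k Nk.
apply: filterS2 (mart_stop mg gi (leqW Nk)) (mart_stop mg gi Nk) => x h1 h2.
by rewrite /mdiff /= h1 h2 subrr.
Qed.

Variables (B : R) (b : Om -> R).
Hypotheses (B0 : 0 < B) (bi : itg b).
Hypothesis bbasic : forall n, [/\ bdd (E n b),
  {ae P, forall x, `|mdiff (mart b) n x| <= B} &
  forall A, F n A -> Ex (fun x => \1_A x * `|b x - Eprev n b x|) <= B * Pr A].

Lemma db_bdd k : bdd (mdiff (mart b) k).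
Proof. by apply: mdiff_bdd => j; case: (bbasic j). Qed.

Lemma bmo_square_sum N n A : F n A -> (n <= N)%N ->
  Ex (fun x => \1_A x * \sum_(k < N.+1 | (n <= k)%N) mdiff (mart b) k x ^+ 2)
    <= 57 * B ^+ 2 * Pr A.
Proof.
move=> FA nN; have := bmo_square Ffil B0 bi bbasic (N - n) FA.
apply: le_trans; rewrite le_eqVlt; apply/orP; left; apply/eqP.
congr Ex; apply/funext => x; congr (_ * _).
rewrite -(big_mkord xpredT (fun j => mdiff (mart b) (n + j) x ^+ 2)).
rewrite -(big_geq_mkord n N.+1 xpredT (fun k => mdiff (mart b) k x ^+ 2)).
rewrite -{1}[n]add0n big_addn subSn//.
by apply: eq_bigr => i _; rewrite addnC.
Qed.

Definition paraproduct N g x : R := \sum_(k < N.+1) mdiff (mart g) k x * mdiff (mart b) k x.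
Definition abs_paraproduct N g x : R := \sum_(k < N.+1) `|mdiff (mart g) k x| * `|mdiff (mart b) k x|.
Local Notation Pi := paraproduct.
Local Notation absPi := abs_paraproduct.

Lemma Pi_bdd N g : bdd g -> bdd (Pi N g).
Proof. by move=> gb; apply: bdd_sum => k _; apply: bddM; [exact: dmart_bdd|exact: db_bdd]. Qed.

Lemma absPi_bdd N g : bdd g -> bdd (absPi N g).
Proof.
move=> gb; apply: bdd_sum => k _; apply: bddM; apply: bdd_abs.
  exact: dmart_bdd.
exact: db_bdd.
Qed.

Lemma mF_Pi N g : itg g -> mF N (Pi N g).
Proof.
move=> gi; apply: mF_sum => k _; apply: mFM; apply: mF_dmart => //; rewrite -ltnS//.
Qed.

Lemma Pi_le_abs N g x : `|Pi N g x| <= absPi N g x.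
Proof.
apply: (le_trans (ler_norm_sum _ _ _)); apply: ler_sum => k _.
by rewrite normrM.
Qed.

Lemma PiS N g x : Pi N.+1 g x = Pi N g x + mdiff (mart g) N.+1 x * mdiff (mart b) N.+1 x.
Proof. by rewrite /paraproduct big_ord_recr. Qed.

Lemma Pi_add N f g : itg f -> itg g ->
  {ae P, forall x, Pi N (fun x => f x + g x) x = Pi N f x + Pi N g x}.
Proof.
move=> fi gi.
have h : {ae P, forall x, forall k, mdiff (mart (fun x => f x + g x)) k x =
     mdiff (mart f) k x + mdiff (mart g) k x}.
  by apply/ae_foralln => k; exact: dmart_add.
apply: filterS h => x h; rewrite /paraproduct -big_split/=; apply: eq_bigr => k _.
by rewrite h mulrDl.
Qed.

Lemma Pi_scale N c f : itg f ->
  {ae P, forall x, Pi N (fun x => c * f x) x = c * Pi N f x}.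
Proof.
move=> fi.
have h : {ae P, forall x, forall k, mdiff (mart (fun x => c * f x)) k x =
     c * mdiff (mart f) k x}.
  by apply/ae_foralln => k; exact: dmart_scale.
apply: filterS h => x h; rewrite /paraproduct mulr_sumr; apply: eq_bigr => k _.
by rewrite h mulrA.
Qed.

Lemma Pi_ae N f g : itg f -> itg g -> {ae P, forall x, f x = g x} -> Pi N f = Pi N g.
Proof.
move=> fi gi fg; have e k : mart f k = mart g k by exact: E_ae.
apply/funext => x; apply: eq_bigr => k _; congr (_ * _).
by rewrite /mdiff; case: (k : nat) => [|j] /=; rewrite !e.
Qed.

Lemma Pi_stop N M g : mF N g -> itg g -> (N <= M)%N ->
  {ae P, forall x, Pi M g x = Pi N g x}.
Proof.
move=> mg gi /subnKC <-; elim: (M - N)%N => [|j IH].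
  by rewrite addn0; exact: aeW.
rewrite addnS; apply: filterS2 IH (@dmart_stop g N (N + j).+1 mg gi _) => [x e z|].
  by rewrite PiS z mul0r addr0.
by rewrite ltnS leq_addr.
Qed.

(* The square function is summed by parts against the BMO oscillation. *)
Lemma fefferman N g : bdd g ->
  Ex (absPi N g) <= 30 * B * Ex (SQ (mart g) N).
Proof.
move=> gb; have gi := bdd_itg gb.
pose S k := SQ (mart g) k.
pose Sp k : Om -> R := if k is j.+1 then S j else cst 0.
pose D k x := S k x - Sp k x.
have bm j : bdd (mart g j) by exact: mart_bdd.
have bS k : bdd (S k) by exact: SQ_bdd.
have bSp k : bdd (Sp k) by case: k => [|k]; [exact: bdd_cst|exact: bS].
have bD k : bdd (D k) by exact: bddB.
have mS k : mF k (S k) by apply: mF_SQ => // j; exact: mF_mart.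
have mD k : mF k (D k).
  apply: mFB; first exact: mS.
  by case: k => [|k]; [exact: mF_cst|exact: (mF_mono Ffil (leqnSn k))].
have D0 k x : 0 <= D k x.
  rewrite subr_ge0; case: k => [|k] /=; first exact: SQ_ge0.
  exact: SQ_mono.
have Sp0 k x : 0 <= Sp k x by case: k => [|k] //=; exact: SQ_ge0.
have SE k x : S k x = \sum_(i < k.+1) D i x.
  elim: k => [|k IH]; first by rewrite big_ord_recl big_ord0 addr0 /D subr0.
  by rewrite big_ord_recr /= -IH /D /= addrC subrK.
have sqE k x : mdiff (mart g) k x ^+ 2 = S k x ^+ 2 - Sp k x ^+ 2.
  have q0 j : 0 <= \sum_(i < j.+1) mdiff (mart g) i x ^+ 2.
    by apply: sumr_ge0 => *; exact: sqr_ge0.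
  rewrite /S SQE sqr_sqrtr//; case: k => [|k] /=.
    by rewrite big_ord_recl big_ord0 addr0 expr0n subr0.
  by rewrite /S SQE sqr_sqrtr// [X in _ = X - _]big_ord_recr /= addrAC subrr add0r.
pose osq i x := \sum_(k < N.+1 | (i <= k)%N) mdiff (mart b) k x ^+ 2.
have bo i : bdd (osq i) by apply: bdd_sum => k _; apply: bddX; exact: db_bdd.
have path x : absPi N g x <= B * S N x + (2 * B)^-1 * \sum_(i < N.+1) D i x * osq i x.
  (* With [a = |d_k g|], [c = |d_k b|] and [s = S_k]: [a^2 = S_k^2 - S_(k-1)^2 <= 2 s D_k], combined
     with [2 (B a) (s c) <= (B a)^2 + (s c)^2]. *)
  have step k : `|mdiff (mart g) k x| * `|mdiff (mart b) k x| <=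
      B * D k x + (2 * B)^-1 * (S k x * mdiff (mart b) k x ^+ 2).
    have S0 : 0 <= S k x := SQ_ge0 _ _ _.
    have := sqE k x; have := D0 k x; have := Sp0 k x.
    rewrite -(real_normK (num_real (mdiff (mart g) k x))).
    rewrite -(real_normK (num_real (mdiff (mart b) k x))) /D.
    have a0 := normr_ge0 (mdiff (mart g) k x).
    have c0 := normr_ge0 (mdiff (mart b) k x).
    move: (S k x) (Sp k x) `|mdiff (mart g) k x| `|mdiff (mart b) k x| S0 a0 c0.
    move=> s t a c s0 a0 c0 t0 st e.
    rewrite -(ler_pM2l (_ : 0 < 2 * B)) ?mulr_gt0//.
    rewrite mulrDr [2 * B * ((2 * B)^-1 * _)]mulrA divff ?gt_eqF ?mulr_gt0// mul1r.
    have [s_eq0|sn0] := eqVneq s 0.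
      have a_eq0 : a = 0.
        apply/eqP; rewrite -sqrf_eq0 e s_eq0; apply/eqP.
        have -> : t = 0 by lra.
        by rewrite subrr.
      rewrite a_eq0 s_eq0 !mul0r mulr0 addr0.
      have -> : t = 0 by lra.
      by rewrite subrr !mulr0.
    have sp : 0 < s by rewrite lt_neqAle eq_sym sn0.
    rewrite -(ler_pM2l sp).
    have h1 : a ^+ 2 <= 2 * s * (s - t) by rewrite e; nra.
    have : 2 * (B * a) * (s * c) <= (B * a) ^+ 2 + (s * c) ^+ 2.
      by have := sqr_ge0 (B * a - s * c); lra.
    have : B ^+ 2 * a ^+ 2 <= B ^+ 2 * (2 * s * (s - t)) by rewrite ler_wpM2l// sqr_ge0.
    nra.
  apply: (@le_trans _ _ (\sum_(k < N.+1) (B * D k x +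
      (2 * B)^-1 * (S k x * mdiff (mart b) k x ^+ 2)))).
    by apply: ler_sum => k _; exact: step.
  rewrite big_split/= -mulr_sumr -SE lerD2l -mulr_sumr ler_wpM2l//.
    by rewrite invr_ge0 mulr_ge0// ltW.
  rewrite le_eqVlt; apply/orP; left; apply/eqP.
  rewrite /osq; under [RHS]eq_bigr do rewrite mulr_sumr.
  rewrite (exchange_big_dep xpredT)//=; apply: eq_bigr => k _.
  rewrite SE mulr_suml.
  rewrite -(big_mkord xpredT (fun i => D i x * mdiff (mart b) k x ^+ 2)).
  rewrite (big_nat_widen 0 k.+1 N.+1)//= big_mkord.
  by apply: eq_bigl => i; rewrite ltnS.
have i1 : itg (fun x => \sum_(i < N.+1) D i x * osq i x).
  by apply: itg_sum => i _; exact: bdd_itg (bddM (bD i) (bo i)).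
have bA := absPi_bdd N gb.
have iS : itg (S N) := bdd_itg (bS N).
have : Ex (absPi N g) <= Ex (fun x => B * S N x + (2 * B)^-1 * \sum_(i < N.+1) D i x * osq i x).
  by apply: Ex_le; [exact: bdd_itg|exact: itgD (itgZ B iS) (itgZ _ i1)|exact: aeW].
rewrite (ExD (itgZ B iS) (itgZ _ i1)).
rewrite (ExZ _ iS) (ExZ _ i1) .
have sumE : Ex (fun x => \sum_(i < N.+1) D i x * osq i x) =
    \sum_(i < N.+1) Ex (fun x => D i x * osq i x).
  by rewrite Ex_sum// => i _; exact: bdd_itg (bddM (bD i) (bo i)).
rewrite sumE.
(* [D i] is nonnegative and [F_i]-measurable, hence a weight for the square function of [b] from [i]
   on, whose integral over sets of [F_i] is at most [57 B^2] times their probability. *)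
have term (i : 'I_N.+1) : Ex (fun x => D i x * osq i x) <= 57 * B ^+ 2 * Ex (D i).
  rewrite -ExZ; last exact: bdd_itg.
  have -> : (fun x => 57 * B ^+ 2 * D i x) = (fun x => D i x * cst (57 * B ^+ 2) x).
    by apply/funext => x; rewrite mulrC.
  apply: (E_weight_le Ffil (n := i)) => //.
  - exact: aeW.
  - exact: bdd_itg.
  - exact: itg_cst.
  move=> A FA; apply: (le_trans (bmo_square_sum FA _)); first by rewrite -ltnS.
  have mA := FM Ffil FA.
  have -> : (fun x => \1_A x * cst (57 * B ^+ 2) x) = (fun x => 57 * B ^+ 2 * \1_A x).
    by apply/funext => x; rewrite mulrC.
  by rewrite ExZ ?Ex_indic//; exact/bdd_itg/bdd_indic.
have sumD : \sum_(i < N.+1) Ex (D i) = Ex (S N).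
  rewrite -Ex_sum; last by move=> i _; exact: bdd_itg.
  by congr Ex; apply/funext => x; rewrite SE.
move/le_trans; apply.
(* This gives [57/2]; adding the term [B Ex (S N)] makes [29.5 B], rounded up to [30 B]. *)
have : (2 * B)^-1 * \sum_(i < N.+1) Ex (fun x => D i x * osq i x) <= 57 / 2 * B * Ex (S N).
  apply: (@le_trans _ _ ((2 * B)^-1 * \sum_(i < N.+1) (57 * B ^+ 2 * Ex (D i)))).
    rewrite ler_wpM2l ?invr_ge0 ?mulr_ge0 ?(ltW B0)//.
    by apply: ler_sum => i _; exact: term.
  rewrite -mulr_sumr sumD le_eqVlt; apply/orP; left; apply/eqP; field.
  by rewrite gt_eqF.
have S0 : 0 <= Ex (S N) by apply: Ex_ge0 => //; apply: aeW => x; exact: SQ_ge0.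
have : 0 <= B * Ex (S N) by rewrite mulr_ge0// ltW.
rewrite -/(S N); lra.
Qed.

Lemma bu_itg u : bdd u -> itg (fun x => b x * u x).
Proof. by move=> ub; under eq_fun do rewrite mulrC; exact: itgM. Qed.

Lemma E_Pi_ge N u m : bdd u -> mF N u -> (N <= m)%N ->
  {ae P, forall x, E m (Pi N u) x = E m (fun x => b x * u x) x - E m b x * E m u x + Pi N u x}.
Proof.
move=> ub mu Nm; have ui := bdd_itg ub.
have mum := mF_mono Ffil Nm mu.
have mPi := mF_mono Ffil Nm (@mF_Pi N u ui).
have bPi := bdd_itg (Pi_bdd N ub).
have e1 := E_id Ffil mPi bPi; have e2 := E_id Ffil mum ui.
have e3 := E_pull Ffil mum ub bi.
apply: filterS3 e1 e2 e3 => x -> -> e.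
have -> : E m (fun x => b x * u x) x = E m (fun x => u x * b x) x.
  by congr (E m _ x); apply/funext => y; rewrite mulrC.
by rewrite e mulrC subrr add0r.
Qed.

(* Product rule: [b_m u_m] minus its bracket is a martingale plus the two
   remaining paraproducts, so [E_m (bu) - b_m u_m] is a tail of the bracket. *)
Lemma E_Pi_le N u m : bdd u -> mF N u -> (m <= N)%N ->
  {ae P, forall x, E m (Pi N u) x = E m (fun x => b x * u x) x - E m b x * E m u x + Pi m u x}.
Proof.
move=> ub mu mN; have ui := bdd_itg ub; have bui := bu_itg ub.
have bPi := Pi_bdd N ub.
(* Descending induction on [m] from [N], with [m] written as [N - j]. *)
rewrite -(subKn mN); have : (N - m <= N)%N by exact: leq_subr.
elim: (N - m)%N => [_|j IH jN].
  by rewrite subn0; exact: E_Pi_ge.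
have {}IH := IH (ltnW jN).
have Ek : (N - j)%N = (N - j.+1).+1 by rewrite subnSK.
rewrite Ek in IH; move: (N - j.+1)%N IH => k IH.
have bEb n : bdd (E n b) by case: (bbasic n).
have bEu n : bdd (E n u) by exact: E_bdd.
have bP n := Pi_bdd n ub.
have iEbu := E_itg Ffil k.+1 bui.
have ib n := bdd_itg (bEb n). have iu n := bdd_itg (bEu n).
pose X := fun x => E k b x * E k.+1 u x; pose Y := fun x => E k u x * E k.+1 b x.
pose Z := fun x => E k b x * E k u x.
have bX : bdd X by exact: bddM.
have bY : bdd Y by exact: bddM.
have bZ : bdd Z by exact: bddM.
have mZ : mF k Z by apply: mFM; exact: E_meas.
(* [X], [Y] and [Z] all have conditional expectation [Z] at time [k], so [X + Y - Z] contributes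
   exactly the product [E k b * E k u]. *)
have rhsE : E k (E k.+1 (Pi N u)) = E k (fun x => E k.+1 (fun x => b x * u x) x -
    ((X x + Y x) - Z x) + Pi k u x).
  apply: (E_ae Ffil).
  - exact/E_itg/bdd_itg.
  - apply: itgD; last exact: bdd_itg.
    by apply: itgB => //; apply/bdd_itg/bddB => //; exact: bddD.
  apply: filterS IH => x ->; rewrite PiS /mdiff /= /X /Y /Z /Defs.mart; ring.
have t1 := E_tower Ffil (leqnSn k) (bdd_itg bPi).
have t2 := E_tower Ffil (leqnSn k) bui.
have iXYZ : itg (fun x => X x + Y x - Z x) by apply/bdd_itg/bddB => //; exact: bddD.
have a1 := E_add Ffil k (itgB iEbu iXYZ) (bdd_itg (bP k)).
have a2 := E_sub Ffil k iEbu iXYZ.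
have a3 := E_sub Ffil k (itgD (bdd_itg bX) (bdd_itg bY)) (bdd_itg bZ).
have a4 := E_add Ffil k (bdd_itg bX) (bdd_itg bY).
have p1 := E_pull Ffil (E_meas Ffil bi) (bEb k) (iu k.+1).
have p2 := E_pull Ffil (E_meas Ffil ui) (bEu k) (ib k.+1).
have p3 := E_id Ffil mZ (bdd_itg bZ).
have p4 := E_id Ffil (@mF_Pi k u ui) (bdd_itg (bP k)).
have u1 := E_tower Ffil (leqnSn k) ui.
have u2 := E_tower Ffil (leqnSn k) bi.
apply: filterS3 (filterI (filterI t1 t2) (filterI a1 a2))
  (filterI (filterI a3 a4) (filterI p1 p2)) (filterI (filterI p3 p4) (filterI u1 u2)) => x.
move=> [[h1 h2] [h3 h4]] [[h5 h6] [h7 h8]] [[h9 h10] [h11 h12]].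
rewrite -h1 rhsE h3 h4 h5 h6 h2 h7 h8 h9 h10 h11 h12 /Z; ring.
Qed.

(** Arranged so that the supremum over [m] can be taken: [absPi N u] does not depend on [m], and the
    middle term has an integrable maximal function. *)
Lemma E_Pi_bound N u m : bdd u -> mF N u ->
  {ae P, forall x, `|E m (Pi N u) x| <=
     `|E m (fun x => b x * u x) x - b x * E m u x| +
     (`|(b x - E m b x) * E m u x| + absPi N u x)}.
Proof.
move=> ub mu; have [mN|Nm] := leqP m N.
  apply: filterS (E_Pi_le ub mu mN) => x ->.
  have Pia : `|Pi m u x| <= absPi N u x.
    apply: (le_trans (Pi_le_abs _ _ _)); rewrite /abs_paraproduct.
    rewrite -(big_mkord xpredT (fun k => `|mdiff (mart u) k x| * `|mdiff (mart b) k x|)).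
    rewrite -[leRHS](big_mkord xpredT (fun k => `|mdiff (mart u) k x| * `|mdiff (mart b) k x|)).
    by rewrite (@big_cat_nat _ _ _ m.+1 0 N.+1)//= lerDl sumr_ge0// => *; rewrite mulr_ge0.
  set w := E m (fun x => _) x.
  have -> : w - E m b x * E m u x + Pi m u x =
    (w - b x * E m u x) + ((b x - E m b x) * E m u x + Pi m u x) by ring.
  rewrite (le_trans (ler_normD _ _))// lerD2l (le_trans (ler_normD _ _))// lerD2l//.
apply: filterS (E_Pi_ge ub mu (ltnW Nm)) => x ->.
set w := E m (fun x => _) x.
have -> : w - E m b x * E m u x + Pi N u x =
  (w - b x * E m u x) + ((b x - E m b x) * E m u x + Pi N u x) by ring.
rewrite (le_trans (ler_normD _ _))// lerD2l (le_trans (ler_normD _ _))// lerD2l//.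
exact: Pi_le_abs.
Qed.

(** The maximal function of [g] is the sum of its increments [D_i], which are [F_i]-measurable
    weights. For [i <= m <= M], [|b - E m b|] is at most [Y_i], whose integral over a set of [F_i]
    is at most [(1 + 29) B] times its probability; Davis' inequality contributes the factor 6. *)
Lemma max_bmo_mart M g : bdd g ->
  Ex (MX (fun m x => (b x - E m b x) * E m g x) M) <= 180 * B * Ex (SQ (mart g) M).
Proof.
move=> gb; have gi := bdd_itg gb.
pose G k := MX (mart g) k.
pose Gp k : Om -> R := if k is j.+1 then G j else cst 0.
pose D k x := G k x - Gp k x.
have bm j : bdd (mart g j) by exact: mart_bdd.
have bG k : bdd (G k) by exact: MX_bdd.
have bGp k : bdd (Gp k) by case: k => [|k]; [exact: bdd_cst|exact: bG].
have bD k : bdd (D k) by exact: bddB.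
have mG k : mF k (G k) by apply: mF_MX => // j; exact: mF_mart.
have mD k : mF k (D k).
  apply: mFB; first exact: mG.
  by case: k => [|k]; [exact: mF_cst|exact: (mF_mono Ffil (leqnSn k))].
have D0 k x : 0 <= D k x.
  rewrite subr_ge0; case: k => [|k] /=; first exact: MX_ge0.
  exact: rmax_leS.
have GE k x : G k x = \sum_(i < k.+1) D i x.
  elim: k => [|k IH]; first by rewrite big_ord_recl big_ord0 addr0 /D subr0.
  by rewrite big_ord_recr /= -IH /D /= addrC subrK.
pose Y n x := `|b x - E n b x| + MX (oscillation P F b n.+1) M x.
have bO n : bdd (MX (oscillation P F b n.+1) M) by apply: MX_bdd => k; exact: (osc_bdd bbasic).
have iY n : itg (Y n).
  apply: itgD; last exact: bdd_itg.
  by apply: itg_abs; apply: itgB => //; exact: E_itg.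
have Y0 n x : 0 <= Y n x by rewrite addr_ge0// MX_ge0.
have Xi m : itg (fun x => (b x - E m b x) * E m g x).
  under eq_fun do rewrite mulrC; apply: itgM; first exact: bm.
  by apply: itgB => //; exact: E_itg.
have path x : MX (fun m x => (b x - E m b x) * E m g x) M x <= \sum_(i < M.+1) D i x * Y i x.
  apply: rmax_lub => [|m mM]; first by apply: sumr_ge0 => i _; rewrite mulr_ge0.
  rewrite normrM; apply: (@le_trans _ _ (`|b x - E m b x| * G m x)).
    by rewrite ler_wpM2l//; exact: (rmax_ge (mart g ^~ x)).
  rewrite GE mulr_sumr.
  rewrite -(big_mkord xpredT (fun i => `|b x - E m b x| * D i x)).
  rewrite -[leRHS](big_mkord xpredT (fun i => D i x * Y i x)).
  rewrite (@big_cat_nat _ _ _ m.+1 0 M.+1)//=.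
  rewrite ler_wpDr//; first by apply: sumr_ge0 => i _; rewrite mulr_ge0.
  rewrite big_nat [leRHS]big_nat; apply: ler_sum => i /andP[_ im].
  rewrite mulrC ler_wpM2l// /Y.
  move: im; rewrite ltnS leq_eqVlt => /predU1P[->|im].
    by rewrite lerDl MX_ge0.
  rewrite -[b x - E m b x](subrKA (E i b x)) (le_trans (ler_normD _ _))// lerD2l distrC.
  have -> : E m b x - E i b x = oscillation P F b i.+1 (m - i.+1) x by rewrite /oscillation subnKC.
  apply: (le_trans (rmax_ge (oscillation P F b i.+1 ^~ x) _)); apply: rmax_mono.
  by rewrite (leq_trans (leq_subr _ _)).
have iS : itg (fun x => \sum_(i < M.+1) D i x * Y i x).
  by apply: itg_sum => i _; exact: itgM.
apply: (@le_trans _ _ (Ex (fun x => \sum_(i < M.+1) D i x * Y i x))).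
  apply: Ex_le => //; [exact: MX_itg|exact: aeW].
rewrite Ex_sum; last by move=> i _; exact: itgM.
have term (i : 'I_M.+1) : Ex (fun x => D i x * Y i x) <= 30 * B * Ex (D i).
  rewrite -ExZ; last exact: bdd_itg.
  have -> : (fun x => 30 * B * D i x) = (fun x => D i x * cst (30 * B) x).
    by apply/funext => x; rewrite mulrC.
  apply: (E_weight_le Ffil (n := i)) => //.
  - exact: aeW.
  - exact: itg_cst.
  move=> A FA; have mA := FM Ffil FA.
  have FA' := F_mono Ffil (leqnSn i) FA.
  have -> : (fun x => \1_A x * cst (30 * B) x) = (fun x => 30 * B * \1_A x).
    by apply/funext => x; rewrite mulrC.
  rewrite ExZ ?Ex_indic//; last exact/bdd_itg/bdd_indic.
  have -> : (fun x => \1_A x * Y i x) = (fun x => \1_A x * `|b x - Eprev i.+1 b x| +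
      \1_A x * MX (oscillation P F b i.+1) M x).
    by apply/funext => x; rewrite -mulrDr.
  have i1 : itg (fun x => \1_A x * `|b x - Eprev i.+1 b x|).
    by apply: itg_ind => //; apply: itg_abs; apply: itgB => //; exact: E_itg.
  rewrite ExD//; last by apply: itg_ind => //; exact: bdd_itg.
  have [_ _ h1] := bbasic i.+1; have {}h1 := h1 _ FA'.
  have h2 := john_nirenberg1 Ffil B0 bi bbasic M FA'.
  move: (lerD h1 h2) => /le_trans; apply.
  by rewrite le_eqVlt; apply/orP; left; apply/eqP; ring.
apply: (@le_trans _ _ (\sum_(i < M.+1) 30 * B * Ex (D i))).
  by apply: ler_sum => i _; exact: term.
rewrite -mulr_sumr -Ex_sum; last by move=> i _; exact: bdd_itg.
have -> : Ex (fun x => \sum_(i < M.+1) D i x) = Ex (G M).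
  by congr Ex; apply/funext => x; rewrite GE.
have := davis_max_le_square Ffil M (mart_is_mart Ffil gi).
have B30 : 0 <= 30 * B by rewrite mulr_ge0// ltW.
by move/(ler_wpM2l B30)/le_trans; apply; rewrite mulrA ler_wpM2r//;
  [apply: Ex_ge0; [exact/bdd_itg/SQ_bdd|apply: aeW => x; exact: SQ_ge0]|lra].
Qed.

End paraproduct.

(** * Atoms and jumps *)

Section atom_and_jump_estimates.
Context {d : measure_display} {Om : measurableType d} {R : realType}.
Variable P : probability Om R.
Variable F : nat -> set (set Om).
Hypothesis Ffil : filtration F.
Local Notation E := (E P F).
Local Notation Eprev := (Eprev P F).
Local Notation mart := (mart P F).
Local Notation Ex := (Ex P).
Local Notation Pr := (Pr P).
Local Notation itg := (itg P).
Local Notation bdd := (bdd P).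
Local Notation mF := (mF F).
Implicit Types f g u : Om -> R.
Variables (B : R) (b : Om -> R).
Hypotheses (B0 : 0 < B) (bi : itg b).
Hypothesis bbasic : forall n, [/\ bdd (E n b),
  {ae P, forall x, `|mdiff (mart b) n x| <= B} &
  forall A, F n A -> Ex (fun x => \1_A x * `|b x - Eprev n b x|) <= B * Pr A].
Local Notation Pi := (paraproduct P F b).
Local Notation absPi := (abs_paraproduct P F b).
Local Notation osc := (oscillation P F b).

(** Davis' inequality reduces an [H_1] bound to an integrable majorant of the martingale up to time
    [M], at the cost of a factor 2; the majorant may depend on [M]. *)
Lemma H1_mart_le V K N : itg V -> (forall M, (N <= M)%N -> exists W, [/\ itg W, Ex W <= K &
    forall m, (m <= M)%N -> {ae P, forall x, `|E m V x| <= W x}]) ->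
  (H1_norm P (mart V) <= (2 * K)%:E)%E.
Proof.
move=> Vi H; apply: H1_norm_le => [k|M]; first exact: E_itg.
have [W [Wi WK WM]] := H (maxn M N) (leq_maxr _ _).
have hW : {ae P, forall x, forall m, (m <= M)%N -> `|E m V x| <= W x}.
  apply/ae_foralln => m; have [mM|mM] := leqP m M; last exact: aeW.
  by apply: filterS (WM m (leq_trans mM (leq_maxl _ _))) => x h _.
apply: (le_trans (davis_square_le_max Ffil M (mart_is_mart Ffil Vi))).
rewrite ler_pM2l//; apply: le_trans WK; apply: Ex_le => //.
  by apply: MX_itg => k; exact: E_itg.
apply: filterS hW => x hW; apply: rmax_lub => [|j jM]; last exact: hW.
exact: le_trans (hW 0%N (leq0n _)).
Qed.

Definition bmo_err N n u : Om -> R := fun x => (b x - Eprev n b x) * u x - Pi N u x.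

Lemma bmo_err_itg N n u : bdd u -> itg (bmo_err N n u).
Proof.
move=> ub; apply: itgB; last by apply: bdd_itg; exact: Pi_bdd bbasic _ _ ub.
by under eq_fun do rewrite mulrC; apply: itgM => //; apply: itgB => //; exact: Eprev_itg.
Qed.

(** [E m (b u)] occurs in both parts and cancels. What remains involves only [b_m - b_(n-1)], which
    John-Nirenberg controls, and a partial paraproduct. *)
Lemma E_bmo_err N n u m : bdd u -> mF N u -> (n <= m)%N ->
  {ae P, forall x, E m (bmo_err N n u) x = osc n (m - n) x * E m u x - Pi (minn m N) u x}.
Proof.
move=> ub mu nm; have ui := bdd_itg ub; have bui := bu_itg bi ub.
have bPi := Pi_bdd Ffil bbasic N ub.
have bp := Eprev_b_bdd bbasic n.
have mp : mF m (Eprev n b) by apply: mF_Eprev => //; exact: leqW.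
have iep : itg (fun x => Eprev n b x * u x) by exact: itgM.
have e0 : E m (bmo_err N n u) = E m (fun x => b x * u x - Eprev n b x * u x - Pi N u x).
  by congr (E m _); apply/funext => x; rewrite /bmo_err mulrBl.
have e1 := E_sub Ffil m (itgB bui iep) (bdd_itg bPi).
have e2 := E_sub Ffil m bui iep.
have e3 := E_pull Ffil mp bp ui.
have e4 : {ae P, forall x, E m (Pi N u) x =
    E m (fun x => b x * u x) x - E m b x * E m u x + Pi (minn m N) u x}.
  case: leqP => mN; first exact: (E_Pi_le Ffil bi bbasic ub mu mN).
  exact: (E_Pi_ge Ffil bi bbasic ub mu (ltnW mN)).
apply: filterS3 (filterI e1 e2) e3 e4 => x [h1 h2] h3 h4.
rewrite e0 h1 h2 h3 h4 /oscillation subnKC//; ring.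
Qed.

Lemma E_bmo_err_lt N n u m : bdd u -> (m <= n)%N ->
  {ae P, forall x, E n (bmo_err N n u) x = 0} ->
  {ae P, forall x, E m (bmo_err N n u) x = 0}.
Proof.
move=> ub mn H; have Vi := bmo_err_itg N n ub.
have e : E m (E n (bmo_err N n u)) = E m (cst 0).
  by apply: (E_ae Ffil) => //; [exact: E_itg|exact: itg_cst].
apply: filterS2 (E_tower Ffil mn Vi) (E_cst P Ffil m 0) => x <-.
by rewrite e.
Qed.

Lemma Ex_mart_sqr u M : bdd u -> Ex (fun x => E M u x ^+ 2) =
  Ex (fun x => \sum_(k < M.+1) mdiff (mart u) k x ^+ 2).
Proof.
move=> ub; have ui := bdd_itg ub.
have bE k : bdd (E k u) by exact: E_bdd.
have bd k : bdd (mdiff (mart u) k) by exact: dmart_bdd.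
have b2 k : bdd (fun y => mdiff (mart u) k y ^+ 2) by exact: bddX.
elim: M => [|M IH].
  congr Ex; apply/funext => x.
  by rewrite big_ord_recl big_ord0 addr0 /mdiff /Defs.mart /= subr0.
have -> : (fun x => \sum_(k < M.+2) mdiff (mart u) k x ^+ 2) =
  (fun x => \sum_(k < M.+1) mdiff (mart u) k x ^+ 2 + mdiff (mart u) M.+1 x ^+ 2).
  by apply/funext => x; rewrite big_ord_recr.
have bs : bdd (fun x => \sum_(k < M.+1) mdiff (mart u) k x ^+ 2).
  by apply: bdd_sum => k _; exact: b2.
rewrite (ExD (bdd_itg bs) (bdd_itg (b2 M.+1))) -IH.
have -> : (fun x => E M.+1 u x ^+ 2) = (fun x => E M u x ^+ 2 +
   (2 * E M u x * (E M.+1 u x - E M u x) + mdiff (mart u) M.+1 x ^+ 2)).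
  by apply/funext => x; rewrite /mdiff /Defs.mart /=; ring.
have bh : bdd (fun x => 2 * E M u x) by exact: bddZ.
have mh : mF M (fun x => 2 * E M u x) by apply: mFM; [exact: mF_cst|exact: E_meas].
have bD : bdd (fun x => E M.+1 u x - E M u x) by exact: bddB.
have bX := bddX 2 (bE M).
rewrite (ExD (bdd_itg bX) (bdd_itg (bddD (bddM bh bD) (b2 M.+1)))).
rewrite (ExD (bdd_itg (bddM bh bD)) (bdd_itg (b2 M.+1))).
by have := mart_diff_orth Ffil (mart_is_mart Ffil ui) mh bh; rewrite /Defs.mart => ->; rewrite add0r.
Qed.

(** An atom before normalisation: [(L Pr A)^-1 u] is a simple atom, and keeping the height [L] apart
    allows [Pr A = 0]. The sum omits [d_0 u], which vanishes because [E n u] does. *)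
Definition pre_atom N n A (L : R) u := [/\ (n <= N)%N, F n A & 0 < L] /\
  [/\ bdd u, mF N u, forall x, u x = \1_A x * u x,
     {ae P, forall x, E n u x = 0} &
     {ae P, forall x, \sum_(k < N) E k (fun y => mdiff (mart u) k.+1 y ^+ 2) x
        <= L ^+ 2 * \1_A x}].

Section pre_atom_estimates.
Variables (N n : nat) (A : set Om) (L : R) (u : Om -> R).
Hypothesis ua : pre_atom N n A L u.

Let nN : (n <= N)%N. Proof. by case: ua => -[]. Qed.
Let FA : F n A. Proof. by case: ua => -[]. Qed.
Let L0 : 0 < L. Proof. by case: ua => -[]. Qed.
Let ub : bdd u. Proof. by case: ua => _ []. Qed.
Let mu : mF N u. Proof. by case: ua => _ []. Qed.
Let uA : forall x, u x = \1_A x * u x. Proof. by case: ua => _ []. Qed.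
Let Enu : {ae P, forall x, E n u x = 0}. Proof. by case: ua => _ []. Qed.
Let ui : itg u. Proof. exact: bdd_itg ub. Qed.
Let mA : measurable A. Proof. exact: FM FA. Qed.
Let bE k : bdd (E k u). Proof. exact: E_bdd. Qed.
Let bd k : bdd (mdiff (mart u) k). Proof. exact: dmart_bdd. Qed.

Lemma atom_E0 k : (k <= n)%N -> {ae P, forall x, E k u x = 0}.
Proof.
move=> kn; have e : E k (E n u) = E k (cst 0).
  by apply: (E_ae Ffil) => //; [exact: E_itg|exact: itg_cst].
apply: filterS2 (E_tower Ffil kn ui) (E_cst P Ffil k 0) => x <-.
by rewrite e.
Qed.

Lemma atom_d0 k : (k <= n)%N -> {ae P, forall x, mdiff (mart u) k x = 0}.
Proof.
case: k => [|k] kn.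
  by apply: filterS (atom_E0 kn) => x h; rewrite /mdiff /Defs.mart /= h subr0.
apply: filterS2 (atom_E0 kn) (atom_E0 (ltnW kn)) => x h1 h2.
by rewrite /mdiff /Defs.mart /= h1 h2 subr0.
Qed.

Lemma atom_E_supp k : (n <= k)%N -> {ae P, forall x, E k u x = \1_A x * E k u x}.
Proof.
move=> nk; have mi : mF k (\1_A : Om -> R).
  by apply: (mF_indic Ffil); exact: F_mono FA.
apply: filterS (E_pull Ffil mi (bdd_indic P mA) ui) => x <-.
by congr (E k _ x); apply/funext => y; exact: uA.
Qed.

Lemma atom_d_supp k : (n < k)%N ->
  {ae P, forall x, mdiff (mart u) k x = \1_A x * mdiff (mart u) k x}.
Proof.
case: k => // k nk.
apply: filterS2 (atom_E_supp (leqW nk)) (atom_E_supp nk) => x h1 h2.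
by rewrite /mdiff /Defs.mart /= {1}h1 {1}h2 mulrBr.
Qed.

Lemma atom_energy : Ex (fun x => \sum_(k < N.+1) mdiff (mart u) k x ^+ 2) <= L ^+ 2 * Pr A.
Proof.
have b2 k : bdd (fun y => mdiff (mart u) k y ^+ 2) by exact: bddX.
rewrite Ex_sum; last by move=> k _; exact: bdd_itg.
rewrite big_ord_recl /=.
have -> : Ex (fun x => mdiff (mart u) 0 x ^+ 2) = 0.
  rewrite -(Ex_cst P 0); apply: Ex_ae => //; first exact: bdd_meas (b2 0%N).
  by apply: filterS (atom_d0 (leq0n _)) => x ->; rewrite expr0n.
rewrite add0r.
have -> : \sum_(k < N) Ex (fun x => mdiff (mart u) (bump 0 k) x ^+ 2) =
    Ex (fun x => \sum_(k < N) E k (fun y => mdiff (mart u) k.+1 y ^+ 2) x).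
  rewrite Ex_sum; last by move=> k _; apply: E_itg => //; exact: bdd_itg.
  by apply: eq_bigr => k _; rewrite (E_Ex Ffil k (bdd_itg (b2 k.+1))).
rewrite -Ex_indic// -ExZ; last exact/bdd_itg/bdd_indic.
apply: Ex_le; [|exact/itgZ/bdd_itg/bdd_indic|by case: ua => _ []].
by apply: itg_sum => k _; apply: E_itg => //; exact: bdd_itg.
Qed.

Lemma atom_max_sqr M : (N <= M)%N ->
  Ex (fun x => MX (mart u) M x ^+ 2) <= 4 * (L ^+ 2 * Pr A).
Proof.
move=> NM; apply: (le_trans (doob_max Ffil M (mart_is_mart Ffil ui) bE)).
rewrite ler_pM2l//; apply: le_trans atom_energy.
rewrite (_ : Ex (fun x => mart u M x ^+ 2) = Ex (fun x => E N u x ^+ 2)); last first.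
  apply: Ex_ae; [exact: bdd_meas (bddX 2 (bE M))|exact: bdd_meas (bddX 2 (bE N))|].
  apply: filterS2 (mart_stop Ffil mu ui NM) (mart_stop Ffil mu ui (leqnn N)) => x.
  by rewrite /Defs.mart => -> ->.
by rewrite Ex_mart_sqr.
Qed.

(** [a c <= B/(2 L) a^2 + L/(2 B) c^2] balances the energy [L^2 Pr A] of [u] against [57 B^2 Pr A]
    for [b] on [A]; [29 = (1 + 57) / 2]. *)
Lemma atom_absPi : Ex (absPi N u) <= 29 * (L * B * Pr A).
Proof.
have bab := absPi_bdd Ffil bbasic N ub.
have db k := db_bdd bbasic k.
have h0 : {ae P, forall x, forall k, (k <= n)%N -> mdiff (mart u) k x = 0}.
  apply/ae_foralln => k; have [kn|kn] := leqP k n; last exact: aeW.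
  by apply: filterS (atom_d0 kn) => x.
have h1 : {ae P, forall x, forall k, (n < k)%N -> mdiff (mart u) k x = \1_A x * mdiff (mart u) k x}.
  apply/ae_foralln => k; have [kn|kn] := leqP k n; first exact: aeW.
  by apply: filterS (atom_d_supp kn) => x.
have bs1 : bdd (fun x => \sum_(k < N.+1) mdiff (mart u) k x ^+ 2).
  by apply: bdd_sum => k _; exact: bddX.
have bs2 : bdd (fun x => \1_A x * \sum_(k < N.+1 | (n <= k)%N) mdiff (mart b) k x ^+ 2).
  by apply: bddM; [exact: bdd_indic|apply: bdd_sum => k _; exact: bddX].
have BL : 0 < B / L by rewrite divr_gt0.
have LB : 0 < L / B by rewrite divr_gt0.
have : Ex (absPi N u) <= Ex (fun x => B / L / 2 * \sum_(k < N.+1) mdiff (mart u) k x ^+ 2 +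
    L / B / 2 * (\1_A x * \sum_(k < N.+1 | (n <= k)%N) mdiff (mart b) k x ^+ 2)).
  apply: Ex_le; [exact: bdd_itg|exact: itgD (itgZ _ (bdd_itg bs1)) (itgZ _ (bdd_itg bs2))|].
  apply: filterS2 h0 h1 => x h0 h1.
  apply: (@le_trans _ _ (\sum_(k < N.+1) (B / L / 2 * mdiff (mart u) k x ^+ 2 +
    L / B / 2 * (\1_A x * (if (n <= k)%N then mdiff (mart b) k x ^+ 2 else 0))))); last first.
    by rewrite big_split/= [X in _ * (_ * X)]big_mkcond/= -!mulr_sumr.
  apply: ler_sum => k _.
  have [kn|kn] := leqP k n.
    rewrite h0// normr0 mul0r expr0n mulr0 add0r.
    apply: mulr_ge0; first by rewrite divr_ge0// ltW.
    by apply: mulr_ge0 => //; case: ifP => // _; exact: sqr_ge0.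
  rewrite (ltnW kn) {1}h1// normrM.
  have -> : mdiff (mart u) k x ^+ 2 = \1_A x * mdiff (mart u) k x ^+ 2.
    by rewrite {1}h1// indicE; case: (x \in A); rewrite /= ?mul1r ?mul0r ?expr0n.
  rewrite [`|\1_A x|]ger0_norm//.
  have -> : B / L / 2 * (\1_A x * mdiff (mart u) k x ^+ 2) +
    L / B / 2 * (\1_A x * mdiff (mart b) k x ^+ 2) =
    \1_A x * (B / L / 2 * mdiff (mart u) k x ^+ 2 + L / B / 2 * mdiff (mart b) k x ^+ 2) by ring.
  rewrite -[leLHS]mulrA; apply: ler_wpM2l => //.
  rewrite -(real_normK (num_real (mdiff (mart u) k x))).
  rewrite -(real_normK (num_real (mdiff (mart b) k x))).
  set a := `|mdiff (mart u) k x|; set c := `|mdiff (mart b) k x|.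
  have : 0 <= (B * a - L * c) ^+ 2 by exact: sqr_ge0.
  move=> H; rewrite -subr_ge0.
  have -> : B / L / 2 * a ^+ 2 + L / B / 2 * c ^+ 2 - a * c = (B * a - L * c) ^+ 2 / (2 * L * B).
    by field; rewrite !gt_eqF.
  by rewrite divr_ge0 ?sqr_ge0// ?mulr_ge0// ltW.
rewrite (ExD (itgZ _ (bdd_itg bs1)) (itgZ _ (bdd_itg bs2))).
rewrite (ExZ _ (bdd_itg bs1)) (ExZ _ (bdd_itg bs2)).
have h2 := bmo_square_sum Ffil B0 bi bbasic FA nN.
move/le_trans; apply.
have k1 := ler_wpM2l (ltW (divr_gt0 BL (ltr0Sn R 1))) atom_energy.
have k2 := ler_wpM2l (ltW (divr_gt0 LB (ltr0Sn R 1))) h2.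
apply: (le_trans (lerD k1 k2)); rewrite le_eqVlt; apply/orP; left; apply/eqP.
by field; rewrite !gt_eqF.
Qed.

(** The majorant is the product of the maximal functions of [b - b_(n-1)] and of [u] on [A], plus
    [absPi]. With the same weights the product costs [57/2 + 4/2 = 61/2]; adding 29 stays below 60,
    and Davis' inequality doubles it. *)
Lemma atom_H1_err : (H1_norm P (mart (bmo_err N n u)) <= (120 * (L * B * Pr A))%:E)%E.
Proof.
have -> : 120 * (L * B * Pr A) = 2 * (60 * (L * B * Pr A)) by ring.
apply: (@H1_mart_le _ _ N); first exact: bmo_err_itg.
move=> M NM.
have bO : bdd (MX (osc n) M) by apply: MX_bdd => k; exact: (osc_bdd bbasic).
have bU : bdd (MX (mart u) M) by apply: MX_bdd => k; exact: bE.
have bA := bdd_indic P mA.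
have bab := absPi_bdd Ffil bbasic N ub.
exists (fun x => \1_A x * MX (osc n) M x * MX (mart u) M x + absPi N u x); split.
- exact/bdd_itg/bddD/bab/bddM/bU/bddM.
- rewrite (ExD (bdd_itg (bddM (bddM bA bO) bU)) (bdd_itg bab)).
  have b1 : bdd (fun x => \1_A x * MX (osc n) M x ^+ 2) by apply: bddM => //; exact: bddX.
  have b2 : bdd (fun x => MX (mart u) M x ^+ 2) by exact: bddX.
  have BL : 0 < B / L by rewrite divr_gt0.
  have LB : 0 < L / B by rewrite divr_gt0.
  have : Ex (fun x => \1_A x * MX (osc n) M x * MX (mart u) M x) <=
      Ex (fun x => L / B / 2 * (\1_A x * MX (osc n) M x ^+ 2) + B / L / 2 * MX (mart u) M x ^+ 2).
    apply: Ex_le; [exact: bdd_itg (bddM (bddM bA bO) bU)|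
      exact: itgD (itgZ _ (bdd_itg b1)) (itgZ _ (bdd_itg b2))|].
    apply: aeW => x; rewrite indicE; case: (x \in A) => /=; last first.
      by rewrite !mul0r mulr0 add0r mulr_ge0 ?sqr_ge0// divr_ge0// ltW.
    rewrite !mul1r; set a := MX _ _ _; set c := MX _ _ _; rewrite -subr_ge0.
    have -> : L / B / 2 * a ^+ 2 + B / L / 2 * c ^+ 2 - a * c = (B * c - L * a) ^+ 2 / (2 * L * B).
      by field; rewrite !gt_eqF.
    by rewrite divr_ge0 ?sqr_ge0// ?mulr_ge0// ltW.
  rewrite (ExD (itgZ _ (bdd_itg b1)) (itgZ _ (bdd_itg b2))).
  rewrite (ExZ _ (bdd_itg b1)) (ExZ _ (bdd_itg b2)) => h.
  have k1 := ler_wpM2l (ltW (divr_gt0 LB (ltr0Sn R 1))) (john_nirenberg Ffil B0 bi bbasic M FA).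
  have k2 := ler_wpM2l (ltW (divr_gt0 BL (ltr0Sn R 1))) (atom_max_sqr NM).
  have h2 := le_trans h (lerD k1 k2).
  apply: (le_trans (lerD h2 atom_absPi)).
  have LBP : 0 <= L * B * Pr A by rewrite mulr_ge0 ?Pr_ge0// mulr_ge0// ltW.
  have -> : L / B / 2%:R * (57 * B ^+ 2 * Pr A) + B / L / 2%:R * (4 * (L ^+ 2 * Pr A)) =
    61 / 2 * (L * B * Pr A) by field; rewrite !gt_eqF.
  lra.
(* Before time [n] the martingale of the error vanishes, because [E n u = 0] and [d_k u = 0] for
   [k <= n]. *)
move=> m mM; have [mn|nm] := ltnP m n.
  apply: filterS (E_bmo_err_lt (N := N) ub (ltnW mn) _) => [x ->|].
    rewrite normr0 addr_ge0 ?mulr_ge0 ?MX_ge0//.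
    by apply: sumr_ge0 => k _; rewrite mulr_ge0.
  have h0 : {ae P, forall x, forall k, (k <= n)%N -> mdiff (mart u) k x = 0}.
    apply/ae_foralln => k; have [kn|kn] := leqP k n; last exact: aeW.
    by apply: filterS (atom_d0 kn) => x.
  apply: filterS3 (E_bmo_err ub mu (leqnn n)) Enu h0 => x -> -> h0.
  rewrite mulr0 sub0r /paraproduct big1 ?oppr0// => k _; rewrite h0 ?mul0r//.
  by apply: (leq_trans _ (geq_minl n N)); rewrite -ltnS.
apply: filterS2 (E_bmo_err ub mu nm) (atom_E_supp nm) => x -> hs.
rewrite hs (le_trans (ler_normB _ _))// lerD//.
  rewrite normrM normrM (ger0_norm (_ : 0 <= \1_A x))// mulrCA mulrA.
  rewrite ler_pM ?mulr_ge0// ?ler_wpM2l//.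
    apply: (le_trans (rmax_ge (osc n ^~ x) _)); apply: rmax_mono.
    by rewrite (leq_trans (leq_subr _ _)).
  by apply: (le_trans (rmax_ge (mart u ^~ x) m)); exact: rmax_mono.
apply: (le_trans (Pi_le_abs P F b _ _ _)); rewrite /abs_paraproduct.
rewrite -(big_mkord xpredT (fun k => `|mdiff (mart u) k x| * `|mdiff (mart b) k x|)).
rewrite -[leRHS](big_mkord xpredT (fun k => `|mdiff (mart u) k x| * `|mdiff (mart b) k x|)).
rewrite [leRHS](@big_cat_nat _ _ _ (minn m N).+1 0 N.+1)//= ?ltnS ?geq_minr//.
by rewrite lerDl sumr_ge0// => *; rewrite mulr_ge0.
Qed.

End pre_atom_estimates.

(** A jump has the single difference [d_n u = u], so its paraproduct [u d_n b] cancels the step of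
    [b] at time [n]. What is left is [(b_m - b_n) u], and [|u|] is an [F_n]-measurable weight for
    John-Nirenberg from [n + 1] on. *)
Lemma jump_H1_err N n u : (n <= N)%N -> bdd u -> mF n u ->
  {ae P, forall x, Eprev n u x = 0} ->
  (H1_norm P (mart (bmo_err N n u)) <= (58 * (B * Ex (fun x => `|u x|)))%:E)%E.
Proof.
move=> nN ub mu up; have ui := bdd_itg ub.
have muN := mF_mono Ffil nN mu.
have h0 : {ae P, forall x, forall k, k != n -> mdiff (mart u) k x = 0}.
  apply/ae_foralln => k; case: (ltngtP k n) => [kn|kn|->]; last exact: aeW.
    have z j : (j < n)%N -> {ae P, forall x, E j u x = 0}.
      case: (n) up => // n' up jn.
      have e : E j (E n' u) = E j (cst 0).
        by apply: (E_ae Ffil) => //; [exact: E_itg|exact: itg_cst].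
      apply: filterS2 (E_tower Ffil (jn : (j <= n')%N) ui) (E_cst P Ffil j 0) => x <-.
      by rewrite e.
    case: k kn => [|k] kn.
      by apply: filterS (z _ kn) => x h _; rewrite /mdiff /Defs.mart /= h subr0.
    apply: filterS2 (z _ kn) (z _ (ltnW kn)) => x h1 h2 _.
    by rewrite /mdiff /Defs.mart /= h1 h2 subr0.
  by apply: filterS (dmart_stop Ffil mu ui kn) => x.
have hn : {ae P, forall x, mdiff (mart u) n x = u x}.
  apply: filterS2 up (E_id Ffil mu ui) => x h1 h2.
  by rewrite /mdiff -[Defs.prev _ _ _]/(Eprev n u x) h1 /Defs.mart h2 subr0.
have PiE j : (n <= j)%N -> {ae P, forall x, Pi j u x = u x * mdiff (mart b) n x}.
  move=> nj; apply: filterS2 h0 hn => x h0 hn.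
  rewrite /paraproduct (bigD1 (Ordinal (nj : (n < j.+1)%N)))//= hn big1 ?addr0//.
  by move=> k kn; rewrite h0 ?mul0r.
have key m : (n <= m)%N -> {ae P, forall x, E m (bmo_err N n u) x =
    (E m b x - E n b x) * u x}.
  move=> nm; have mm := E_id Ffil (mF_mono Ffil nm mu) ui.
  have nmN : (n <= minn m N)%N by rewrite leq_min nm.
  apply: filterS3 (E_bmo_err ub muN nm) mm (PiE _ nmN) => x -> -> ->.
  by rewrite /oscillation subnKC// /mdiff -[Defs.prev _ _ _]/(Eprev n b x) /Defs.mart; ring.
have -> : 58 * (B * Ex (fun x => `|u x|)) = 2 * (29 * B * Ex (fun x => `|u x|)) by ring.
apply: (@H1_mart_le _ _ N); first exact: bmo_err_itg.
move=> M NM.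
have bO : bdd (MX (osc n.+1) M) by apply: MX_bdd => k; exact: (osc_bdd bbasic).
have bau := bdd_abs ub.
exists (fun x => `|u x| * MX (osc n.+1) M x); split.
- exact: bdd_itg (bddM bau bO).
- rewrite -ExZ; last exact: bdd_itg.
  have -> : (fun x => 29 * B * `|u x|) = (fun x => `|u x| * cst (29 * B) x).
    by apply/funext => x; rewrite mulrC.
  apply: (E_weight_le Ffil (n := n)) => //; [exact: mF_abs|exact: aeW|exact: bdd_itg|exact: itg_cst|].
  move=> A FA; have mA := FM Ffil FA.
  have -> : (fun x => \1_A x * cst (29 * B) x) = (fun x => 29 * B * \1_A x).
    by apply/funext => x; rewrite mulrC.
  rewrite ExZ ?Ex_indic//; last exact/bdd_itg/bdd_indic.
  exact: john_nirenberg1 (F_mono Ffil (leqnSn n) FA).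
move=> m mM; have [mn|nm] := ltnP m n.
  apply: filterS (E_bmo_err_lt (N := N) ub (ltnW mn) _) => [x ->|].
    by rewrite normr0 mulr_ge0// MX_ge0.
  by apply: filterS (key _ (leqnn n)) => x ->; rewrite subrr mul0r.
apply: filterS (key _ nm) => x ->; rewrite normrM mulrC ler_wpM2l//.
move: nm; rewrite leq_eqVlt => /predU1P[->|nm]; first by rewrite subrr normr0 MX_ge0.
have -> : E m b x - E n b x = osc n.+1 (m - n.+1) x by rewrite /oscillation subnKC.
apply: (le_trans (rmax_ge (osc n.+1 ^~ x) _)); apply: rmax_mono.
by rewrite (leq_trans (leq_subr _ _)).
Qed.

End atom_and_jump_estimates.

(** * Commutator estimates on atoms and jumps *)

Section atoms_and_jumps_commutator.
Context {d : measure_display} {Om : measurableType d} {R : realType}.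
Variable P : probability Om R.
Variable F : nat -> set (set Om).
Hypothesis Ffil : filtration F.
Local Notation E := (E P F).
Local Notation Eprev := (Eprev P F).
Local Notation mart := (mart P F).
Local Notation Ex := (Ex P).
Local Notation Pr := (Pr P).
Local Notation itg := (itg P).
Local Notation bdd := (bdd P).
Local Notation mF := (mF F).
Local Notation Lq := (Lq_norm P).
Implicit Types f g u V : Om -> R.
Variables (q : R) (T : (Om -> R) -> Om -> R).
Hypotheses (q1 : 1 <= q) (Top : operator P T) (Tsub : sublinear P T).

Let q0 : 0 < q. Proof. exact: lt_le_trans q1. Qed.

Lemma field_scale u g l : 0 <= l -> itg u -> itg g ->
  {ae P, forall x, forall c, field T (fun y => l * u y) (fun y => l * g y) c x <= l * field T u g c x}.
Proof.
move=> l0 ui gi.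
have h : {ae P, forall x, forall j, `|T (fun y => l * u y - ratq j * (l * g y)) x| <=
    l * `|T (fun y => u y - ratq j * g y) x|}.
  apply/ae_foralln => j; have i1 := itgB ui (itgZ (ratq j) gi).
  apply: filterS (T_scale Tsub l i1) => x; rewrite (ger0_norm l0); congr (`|T _ x| <= _).
  by apply/funext => y; ring.
apply: filterS3 h (fieldE_ratq Tsub (itgZ l ui) (itgZ l gi)) (fieldE_ratq Tsub ui gi) => x.
move=> h0 h1 h2 c; set lu := fun y => l * u y in h1 *; set lg := fun y => l * g y in h1 *.
apply: (@ratq_le _ _ _ c (`|T lg x| + l * `|T g x|)) => j.
have a1 := field_lip T lu lg c (ratq j) x.
have a2 := field_lip T u g (ratq j) c x.
rewrite (distrC (ratq j) c) in a2.
rewrite h1 in a1; have := h0 j; rewrite -h2 => a3.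
have := ler_wpM2l l0 a2; move: a1 a3.
rewrite -/lu -/lg; set t := `|c - ratq j|; nra.
Qed.

Variables (C1 : R).
Hypothesis C10 : 0 <= C1.
Hypothesis TH1 : forall f, f \in Lfun P 1%E -> H1 P F (mart f) ->
    (Lq q (T f) <= C1%:E * H1_norm P (mart f))%E.

Lemma mart_martingale f : itg f -> martingale P F (mart f).
Proof.
move=> fi n; split.
- by apply/(measurable_wrtP (saF Ffil n)); exact: E_meas.
- by apply/Lfun1P; exact: E_itg.
- by apply/aeE; exact: E_tower.
Qed.

Lemma H1_T V K : itg V -> (H1_norm P (mart V) <= K%:E)%E ->
  (Lq q (T V) <= (C1 * K)%:E)%E.
Proof.
move=> Vi VK; have VH : H1 P F (mart V).
  by split; [exact: mart_martingale|exact: le_lt_trans VK (ltry _)].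
apply: (le_trans (TH1 _ VH)); first exact/Lfun1P.
by rewrite EFinM; apply: lee_wpmul2l => //; rewrite lee_fin.
Qed.

Variables (B p C2 : R) (b : Om -> R).
Hypotheses (B0 : 0 < B) (bi : itg b) (C20 : 0 <= C2).
Hypotheses (bBMO : BMO P F p b) (bB : (BMO_norm P F p b <= B%:E)%E).
Hypothesis bbasic : forall n, [/\ bdd (E n b),
  {ae P, forall x, `|mdiff (mart b) n x| <= B} &
  forall A, F n A -> Ex (fun x => \1_A x * `|b x - Eprev n b x|) <= B * Pr A].
Hypotheses (Tatom : atom_condition P F p q T C2) (Tjump : jump_condition P F p q T C2).
Local Notation Pi := (paraproduct P F b).

(** Stated with a majorant, so that sums are handled by adding majorants with Minkowski's inequality
    while the field is subadditive only almost everywhere. *)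
Definition dominated_comm N g (K : R) := exists Rr : Om -> R,
  [/\ measurable_fun setT Rr, forall x, 0 <= Rr x, (Lq q Rr <= K%:E)%E &
   {ae P, forall x, field T (fun y => b y * g y - Pi N g y) g (b x) x <= Rr x}].

Lemma bu_Pi_itg N g : bdd g -> itg (fun y => b y * g y - Pi N g y).
Proof.
by move=> gb; apply: itgB; [exact: bu_itg|apply: bdd_itg; exact: Pi_bdd bbasic _ _ gb].
Qed.

Lemma dominated_le N g K L : K <= L -> dominated_comm N g K -> dominated_comm N g L.
Proof.
move=> KL [Rr [h1 h2 h3 h4]]; exists Rr; split => //.
by apply: le_trans h3 _; rewrite lee_fin.
Qed.

Lemma dominated_ae N g g' K : bdd g -> bdd g' -> {ae P, forall x, g x = g' x} ->
  dominated_comm N g K -> dominated_comm N g' K.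
Proof.
move=> gb gb' gg [Rr [h1 h2 h3 h4]]; exists Rr; split => //.
have e : {ae P, forall x, b x * g x - Pi N g x = b x * g' x - Pi N g' x}.
  by apply: filterS (gg) => x ->; rewrite (Pi_ae Ffil b N (bdd_itg gb) (bdd_itg gb') gg).
apply: filterS2 h4 (field_ae Top (bu_Pi_itg N gb) (bdd_itg gb) (bu_Pi_itg N gb')
  (bdd_itg gb') e gg) => x h4 e'.
by rewrite -e'.
Qed.

Lemma dominated_add N f g K L : bdd f -> bdd g ->
  dominated_comm N f K -> dominated_comm N g L ->
  dominated_comm N (fun x => f x + g x) (K + L).
Proof.
move=> fb gb [S [S1 S2 S3 S4]] [U [U1 U2 U3 U4]].
have fi := bdd_itg fb; have gi := bdd_itg gb.
exists (fun x => S x + U x); split.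
- exact: measurable_funD.
- by move=> x; rewrite addr_ge0.
- by apply: (le_trans (Lq_add P q1 S1 U1)); rewrite EFinD; exact: leeD.
have i1 := bu_Pi_itg N fb; have i2 := bu_Pi_itg N gb.
have ii := bu_Pi_itg N (bddD fb gb).
have e : {ae P, forall x, b x * (f x + g x) - Pi N (fun x => f x + g x) x =
    (b x * f x - Pi N f x) + (b x * g x - Pi N g x)}.
  by apply: filterS (Pi_add Ffil b N fi gi) => x ->; ring.
have r : {ae P, forall x, f x + g x = f x + g x} by exact: aeW.
have h1 := field_ae Top ii (itgD fi gi) (itgD i1 i2) (itgD fi gi) e r.
have h2 := field_add Tsub i1 fi i2 gi.
apply: filterS2 (filterI h1 h2) (filterI S4 U4) => x [e1 e2] [e3 e4].
by rewrite e1 (le_trans (e2 _))// lerD.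
Qed.

Lemma dominated0 N g : bdd g -> {ae P, forall x, g x = 0} -> dominated_comm N g 0.
Proof.
move=> gb g0; exists (cst 0); split => //; first by rewrite Lq_cst// normr0.
have gi := bdd_itg gb; have ii := bu_Pi_itg N gb.
have i0 := itg_cst P (0 : R).
have e : {ae P, forall x, b x * g x - Pi N g x = cst 0 x}.
  have z : {ae P, forall x, (0 : R) * g x = g x}.
    by apply: filterS g0 => x ->; rewrite mulr0.
  have zi := itgZ 0 gi.
  have z2 := Pi_scale Ffil b N 0 gi.
  rewrite -(Pi_ae Ffil b N zi gi z).
  by apply: filterS2 z2 g0 => x -> ->; rewrite mulr0 mul0r subrr.
apply: filterS3 (field_bound Tsub ii gi) (T_zero Top Tsub ii e) (T_zero Top Tsub gi g0).
by move=> x /(_ (b x)) h h1 h2; rewrite h1 h2 normr0 mulr0 addr0 in h.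
Qed.

Lemma dominated_sum N (I : Type) (s : seq I) (g : I -> Om -> R) (K : I -> R) :
  (forall i, bdd (g i)) -> (forall i, dominated_comm N (g i) (K i)) ->
  dominated_comm N (fun x => \sum_(i <- s) g i x) (\sum_(i <- s) K i).
Proof.
move=> gb gK; elim: s => [|i s IH].
  rewrite big_nil; apply: dominated0; first by under eq_fun do rewrite big_nil; exact: bdd_cst.
  by apply: aeW => x; rewrite big_nil.
rewrite big_cons; under eq_fun do rewrite big_cons.
apply: dominated_add => //; apply: bdd_sum => *; exact: gb.
Qed.

(* [b u - Pi u = Eprev n b u + bmo_err], and [T] of the last term is under control by [H1]. *)
Lemma dominated_split N n u (h : Om -> R) (K1 K2 K3 : R) : bdd u -> mF N u ->
  measurable_fun setT h -> (forall x, 0 <= h x) ->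
  {ae P, forall x, field T (fun y => Eprev n b y * u y) u (Eprev n b x) x <= h x} ->
  (Lq q h <= K1%:E)%E ->
  (Lq q (fun x => (b x - Eprev n b x) * T u x)%R <= K2%:E)%E ->
  (H1_norm P (mart (bmo_err P F b N n u)) <= K3%:E)%E ->
  dominated_comm N u (K1 + K2 + C1 * K3).
Proof.
move=> ub mu mh h0 hh hK1 hK2 hK3; have ui := bdd_itg ub.
have mb := itg_meas bi.
have bE := Eprev_b_bdd bbasic n.
have iEu : itg (fun y => Eprev n b y * u y) by exact: itgM.
have ierr := bmo_err_itg Ffil bi bbasic N n ub.
have mT := T_meas Top ui; have mTe := T_meas Top ierr.
have m2 : measurable_fun setT (fun x => (b x - Eprev n b x) * T u x).
  by apply: measurable_funM => //; apply: measurable_funB => //; exact: bdd_meas bE.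
exists (fun x => h x + `|(b x - Eprev n b x) * T u x| + `|T (bmo_err P F b N n u) x|).
split.
- apply: measurable_funD; last exact: measurableT_comp.
  by apply: measurable_funD => //; exact: measurableT_comp.
- by move=> x; rewrite !addr_ge0.
- have m3 : measurable_fun setT (fun x => h x + `|(b x - Eprev n b x) * T u x|).
    by apply: measurable_funD => //; exact: measurableT_comp.
  have m4 : measurable_fun setT (fun x => `|(b x - Eprev n b x) * T u x|) by exact: measurableT_comp.
  have m5 : measurable_fun setT (fun x => `|T (bmo_err P F b N n u) x|) by exact: measurableT_comp.
  apply: (le_trans (Lq_add P q1 m3 m5)); rewrite [leRHS]EFinD; apply: leeD.
    apply: (le_trans (Lq_add P q1 mh m4)); rewrite [leRHS]EFinD; apply: leeD => //.
    apply: le_trans hK2; apply: Lq_le => //.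
    by apply: aeW => x; rewrite normr_id.
  apply: le_trans (H1_T ierr hK3); apply: Lq_le => //.
  by apply: aeW => x; rewrite normr_id.
have i0 := itg_cst P (0 : R).
have ae1 : {ae P, forall x, b x * u x - Pi N u x = Eprev n b x * u x + bmo_err P F b N n u x}.
  by apply: aeW => x; rewrite /bmo_err; ring.
have ae2 : {ae P, forall x, u x = u x + cst 0 x} by apply: aeW => x; rewrite addr0.
have h1 := field_ae Top (bu_Pi_itg N ub) ui (itgD iEu ierr) (itgD ui i0) ae1 ae2.
have h2 := field_add Tsub iEu ui ierr i0.
have h3 := field_bound Tsub ierr i0.
have h4 : {ae P, forall x, T (cst 0) x = 0} by apply: T_zero => //; exact: aeW.
apply: filterS3 (filterI h1 h2) (filterI h3 h4) hh => x [e1 e2] [e3 e4] e5.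
rewrite e1; apply: (le_trans (e2 _)).
(* Moving the parameter from [b x] to [Eprev n b x] costs [|(b - b_(n-1)) T u|], the other quantity
   in the test conditions. *)
have e6 := field_lip T (fun y => Eprev n b y * u y) u (b x) (Eprev n b x) x.
have := e3 (b x); rewrite e4 normr0 mulr0 addr0 => e7.
rewrite -normrM in e6; lra.
Qed.

Lemma L2_bddM u v : bdd u -> bdd v -> itg (fun y => u y * v y).
Proof. by move=> ub vb; exact/bdd_itg/bddM. Qed.

Lemma jump_dominated N n u : (n <= N)%N -> bdd u -> mF n u ->
  {ae P, forall x, Eprev n u x = 0} ->
  dominated_comm N u ((2 * C2 + 58 * C1) * (B * Ex (fun x => `|u x|))).
Proof.
move=> nN ub mu up; have ui := bdd_itg ub.
have bE := Eprev_b_bdd bbasic n.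
have ju : jump P F n u.
  by split; [exact/(measurable_wrtP (saF Ffil n))|exact/Lfun1P|exact/aeE].
have [h1 h2] := Tjump ju bBMO.
have iEu := L2_bddM bE ub.
pose h := fun x => field T (fun y => Eprev n b y * u y) u (Eprev n b x) x.
have hc2 := field_abs_commutator_L2 Top Tsub iEu ui (bdd_meas bE).
(* The condition on jumps speaks of commutators obtained as [H_1] limits; as [u] is bounded,
   constant sequences are admissible approximations. *)
have hc : is_abs_commutator P F T (Eprev n b) (mart u) h.
  split; first by case: hc2.
  exists (fun=> u), (fun=> h); split => //.
  - by move=> _; apply/Lfun2P; exact: bdd_L2.
  - rewrite (_ : (fun k => _) = cst 0%E); first exact: cvg_cst.
    apply/funext => k; apply/eqP; rewrite eq_le H1_norm_ge0 andbT.
    have z : (fun n => mart u n \- mart u n) = (fun _ => cst 0).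
      by apply/funext => j; apply/funext => x /=; rewrite subrr.
    rewrite z; apply: H1_norm_le => [j|M]; first exact: itg_cst.
    rewrite (_ : SQ _ _ = cst 0) ?Ex_cst//; apply/funext => x.
    rewrite SQE big1 ?sqrtr0// => j _.
    by rewrite /mdiff; case: (j : nat) => /= *; rewrite subrr expr0n.
  - move=> e e0; rewrite (_ : (fun k => _) = cst 0%E); first exact: cvg_cst.
    apply/funext => k; rewrite (_ : [set x | _] = set0) ?measure0//.
    by apply/seteqP; split => x //=; rewrite subrr normr0 leNgt e0.
have {}h2 := h2 _ hc.
have ae0 : 0 <= Ex (fun x => `|u x|) by apply: Ex_ge0 => //; [exact: itg_abs|exact: aeW].
have bd : (C2%:E * Lq 1 u * BMO_norm P F p b <= (C2 * (B * Ex (fun x => `|u x|)%R))%:E)%E.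
  rewrite Lq_norm1// -EFinM.
  have -> : C2 * (B * Ex (fun x => `|u x|)) = C2 * Ex (fun x => `|u x|) * B by ring.
  by rewrite [leRHS]EFinM; apply: lee_wpmul2l => //; rewrite lee_fin mulr_ge0.
have -> : (2 * C2 + 58 * C1) * (B * Ex (fun x => `|u x|)) =
  C2 * (B * Ex (fun x => `|u x|)) + C2 * (B * Ex (fun x => `|u x|)) +
   C1 * (58 * (B * Ex (fun x => `|u x|))) by ring.
apply: (@dominated_split N n u h) => //.
- exact: mF_mono nN mu.
- by case: hc.
- by move=> x; exact: field_ge0.
- exact: aeW.
- exact: le_trans h2 bd.
- exact: le_trans h1 bd.
- exact: jump_H1_err.
Qed.

(** The series in the conditional square function ends at [N], where the martingale stops, and its
    extended-valued terms are the real ones almost everywhere; [l L = (Pr A)^-1] then gives the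
    size. *)
Lemma scaled_simple_atom N n A L u : pre_atom P F N n A L u -> 0 < Pr A ->
  simple_atom P F n A (fun x => (L * Pr A)^-1 * u x).
Proof.
move=> ua PA0; case: (ua) => -[nN FA L0] [ub mu uA Enu en].
have ui := bdd_itg ub; set l := (L * Pr A)^-1.
have l0 : 0 < l by rewrite invr_gt0 mulr_gt0.
have ai := itgZ l ui; have mA := FM Ffil FA.
split => //.
- exact/Lfun1P.
- by apply/aeE; apply: filterS2 Enu (E_scale Ffil n l ui) => x + -> => ->; rewrite mulr0.
- apply: aeW => x; rewrite uA indicE; case: (boolP (x \in A)) => [xA _|_]; first by rewrite -inE.
  by rewrite mul0r mulr0 eqxx.
have bd k : bdd (fun y => mdiff (mart u) k y ^+ 2) by apply: bddX; exact: dmart_bdd.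
set a := fun x => l * u x in ai *.
have bda k : bdd (fun y => mdiff (mart a) k y ^+ 2) by apply: bddX; apply: dmart_bdd => //; exact: bddZ.
have hE k : {ae P, forall x, condexp P (F k) (fun y => ((mdiff (mart a) k.+1 y) ^+ 2)%:E) x =
    (l ^+ 2 * E k (fun y => mdiff (mart u) k.+1 y ^+ 2) x)%:E}.
  have e : E k (fun y => mdiff (mart a) k.+1 y ^+ 2) =
     E k (fun y => l ^+ 2 * mdiff (mart u) k.+1 y ^+ 2).
    apply: (E_ae Ffil); [exact: bdd_itg|exact/itgZ/bdd_itg|].
    by apply: filterS (dmart_scale Ffil l k.+1 ui) => x ->; rewrite exprMn.
  apply: filterS2 (E_condexp Ffil k (bdd_itg (bda k.+1)))
    (E_scale Ffil k (l ^+ 2) (bdd_itg (bd k.+1))) => x h1 h2.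
  by rewrite [LHS]h1 e h2.
have hN k : (N <= k)%N -> {ae P, forall x, E k (fun y => mdiff (mart u) k.+1 y ^+ 2) x = 0}.
  move=> Nk; have e : E k (fun y => mdiff (mart u) k.+1 y ^+ 2) = E k (cst 0).
    apply: (E_ae Ffil); [exact: bdd_itg|exact: itg_cst|].
    by apply: filterS (dmart_stop Ffil mu ui (Nk : (N < k.+1)%N)) => x ->; rewrite expr0n.
  by rewrite e; exact: E_cst.
have h0 : {ae P, forall x, mdiff (mart a) 0 x = 0}.
  apply: filterS2 (dmart_scale Ffil l 0 ui) (atom_d0 Ffil ua (leq0n n)) => x -> ->.
  by rewrite mulr0.
have E0 : {ae P, forall x, forall k, 0 <= E k (fun y => mdiff (mart u) k.+1 y ^+ 2) x}.
  apply/ae_foralln => k; apply: (E_ge_cst Ffil) => //; first exact: bdd_itg.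
  by apply: aeW => x; exact: sqr_ge0.
have hE' : {ae P, forall x, forall k, condexp P (F k) (fun y => ((mdiff (mart a) k.+1 y) ^+ 2)%:E) x =
    (l ^+ 2 * E k (fun y => mdiff (mart u) k.+1 y ^+ 2) x)%:E} by apply/ae_foralln.
have hN' : {ae P, forall x, forall k, (N <= k)%N -> E k (fun y => mdiff (mart u) k.+1 y ^+ 2) x = 0}.
  apply/ae_foralln => k; have [Nk|Nk] := leqP N k; last exact: aeW.
  by apply: filterS (hN _ Nk) => x.
have -> : ((P A)^-1)%E = ((Pr A)^-1)%:E.
  by rewrite (Pr_fin P mA) inver gt_eqF.
have key : {ae P, forall x, (cond_square_fun P F (mart a) x <= ((Pr A)^-1)%:E)%E}.
  apply: filterS3 (filterI hE' hN') (filterI h0 E0) en => x [e1 e2] [e3 e4] e5.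
  rewrite /cond_square_fun e3 expr0n add0e (@nneseries_split _ _ 0 N); last first.
    by move=> k _; rewrite e1 lee_fin mulr_ge0// sqr_ge0.
  rewrite [X in (_ + X)%E]eseries0 ?adde0; last first.
    by move=> k Nk _; rewrite e1 e2// mulr0.
  rewrite add0n (eq_bigr (fun k => (l ^+ 2 * E k (fun y => mdiff (mart u) k.+1 y ^+ 2) x)%:E)); last first.
    by move=> k _; rewrite e1.
  rewrite sumEFin poweR_EFin powR12_sqrt; last first.
    by apply: sumr_ge0 => k _; rewrite mulr_ge0// sqr_ge0.
  rewrite lee_fin -mulr_sumr big_mkord.
  rewrite -[leRHS]ger0_norm ?invr_ge0 ?Pr_ge0// -sqrtr_sqr ler_sqrt ?sqr_ge0//.
  apply: (@le_trans _ _ (l ^+ 2 * L ^+ 2)).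
    rewrite ler_wpM2l ?sqr_ge0// (le_trans e5)// ler_piMr ?sqr_ge0//.
  by rewrite -exprMn /l invfM mulrAC mulVf ?gt_eqF// mul1r.
have P0 : (0 < P setT)%E by rewrite probability_setT lte01.
rewrite unlock /= ifT//; apply/ess_supP; apply: filterS key => x h /=.
by rewrite gee0_abs// /cond_square_fun poweR_ge0.
Qed.

Lemma atom_dominated N n A L u : pre_atom P F N n A L u ->
  dominated_comm N u ((2 * C2 + 120 * C1) * (B * (L * Pr A))).
Proof.
move=> ua; case: (ua) => -[nN FA L0] [ub mu uA Enu en].
have ui := bdd_itg ub; have mA := FM Ffil FA.
(* Normalisation is impossible on a null set, but then [u = 0] almost everywhere. *)
have := Pr_ge0 P A; rewrite le_eqVlt => /predU1P[PA0|PA0].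
  rewrite -PA0 !mulr0; apply: dominated0 => //.
  apply: filterS (Pr_eq0_ae mA (esym PA0)) => x xA.
  by rewrite uA indicE memNset// mul0r.
have sa := scaled_simple_atom ua PA0.
have [h1 h2] := Tatom sa bBMO.
set l := (L * Pr A)^-1 in sa h1 h2; set a := fun x => l * u x in sa h1 h2.
have LP0 : 0 < L * Pr A by rewrite mulr_gt0.
have ab : bdd a by exact: bddZ.
have ai := bdd_itg ab.
have bE := Eprev_b_bdd bbasic n.
have iEa := L2_bddM bE ab.
have mb := itg_meas bi; have mE := bdd_meas bE.
have hc := field_abs_commutator_L2 Top Tsub iEa ai mE.
have {}h2 := h2 _ hc.
set h := fun x => _ in h2.
have mh : measurable_fun setT h by case: hc.
have ua' : {ae P, forall x, u x = L * Pr A * a x}.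
  by apply: aeW => x; rewrite /a /l mulVKf ?gt_eqF.
have bd : (C2%:E * BMO_norm P F p b <= (C2 * B)%:E)%E.
  by rewrite EFinM; apply: lee_wpmul2l => //; rewrite lee_fin.
have -> : (2 * C2 + 120 * C1) * (B * (L * Pr A)) =
  L * Pr A * (C2 * B) + L * Pr A * (C2 * B) + C1 * (120 * (L * B * Pr A)) by ring.
apply: (@dominated_split N n u (fun x => L * Pr A * h x)) => //.
- exact: measurable_funM.
- by move=> x; rewrite mulr_ge0 ?(ltW LP0)//; exact: field_ge0.
- have iLa := itgZ (L * Pr A) ai; have iLE := itgZ (L * Pr A) iEa.
  have iEu := L2_bddM bE ub.
  have e : {ae P, forall x, Eprev n b x * u x = L * Pr A * (Eprev n b x * a x)}.
    by apply: filterS ua' => x ->; ring.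
  have f1 := field_ae Top iEu ui iLE iLa e ua'.
  apply: filterS2 f1 (field_scale (ltW LP0) iEa ai) => x -> ; exact.
- rewrite Lq_scale// ger0_norm ?(ltW LP0)// [leRHS]EFinM; apply: lee_wpmul2l.
    by rewrite lee_fin ltW.
  exact: le_trans h2 bd.
- have mT := T_meas Top ai; have mTu := T_meas Top ui.
  apply: (@le_trans _ _ (Lq q (fun x => L * Pr A * ((b x - Eprev n b x) * T a x))%R)).
    apply: Lq_le => //.
    - by apply: measurable_funM => //; exact: measurable_funB.
    - by apply: measurable_funM => //; apply: measurable_funM => //; exact: measurable_funB.
    apply: filterS2 (T_ae Top ui (itgZ (L * Pr A) ai) ua') (T_scale Tsub (L * Pr A) ai) => x -> t.
    by rewrite !normrM in t *; rewrite [leRHS]mulrCA ler_wpM2l.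
  rewrite Lq_scale//; last by apply: measurable_funM => //; exact: measurable_funB.
  rewrite ger0_norm ?(ltW LP0)// [leRHS]EFinM; apply: lee_wpmul2l.
    by rewrite lee_fin ltW.
  exact: le_trans h1 bd.
- exact: atom_H1_err.
Qed.

End atoms_and_jumps_commutator.

(** * Davis' decomposition *)

Section dyadic_levels.
Context {R : realType}.
Implicit Types (c Q : nat -> R) (t q l : R).

(** Partial sums increase, so once a term is dropped all later nonzero terms are dropped too; the
    kept terms form a partial sum that is at most [l]. *)
Lemma capped_sum c l m : (forall k, 0 <= c k) -> 0 <= l ->
  \sum_(k < m) (if \sum_(i < k.+1) c i <= l then c k else 0) <= l.
Proof.
move=> c0 l0; suff : \sum_(k < m) (if \sum_(i < k.+1) c i <= l then c k else 0) <= l /\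
  \sum_(k < m) (if \sum_(i < k.+1) c i <= l then c k else 0) <= \sum_(i < m) c i by case.
elim: m => [|m [IH1 IH2]]; first by rewrite !big_ord0.
rewrite big_ord_recr /=; case: ifP => h.
  rewrite big_ord_recr /= in h *; split; [apply: le_trans h|]; exact: lerD.
by rewrite addr0; split => //; rewrite big_ord_recr /= ler_wpDr.
Qed.

(** A geometric sum is at most twice its largest term, here less than [2 q]. *)
Lemma dyadic_sum_le t q m : 0 < t -> 0 <= q ->
  \sum_(j < m) (if 2 ^+ j * t < q then 2 ^+ j.+1 * t else 0) <= 4 * q.
Proof.
move=> t0 q0; elim: m => [|m IH]; first by rewrite big_ord0 mulr_ge0.
rewrite big_ord_recr /=; case: ifP => h; last by rewrite addr0.
have : \sum_(j < m) (if 2 ^+ j * t < q then 2 ^+ j.+1 * t else 0) <= 2 * (2 ^+ m * t).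
  apply: (@le_trans _ _ (2 * ((2 ^+ m - 1) * t))); last by nra.
  elim: (m) => [|k IHk]; first by rewrite big_ord0 expr0 subrr mul0r mulr0.
  rewrite big_ord_recr /=; have tk : 0 <= 2 ^+ k * t by rewrite mulr_ge0// ltW.
  move: IHk; case: ifP => _ => [|]; rewrite !exprS; nra.
rewrite exprS; lra.
Qed.

(** An increasing sequence crosses a level at most once; the differences of indicators telescope. *)
Lemma level_count Q l k N : (forall n, Q n <= Q n.+1) -> Q 0%N <= l -> (k <= N)%N ->
  \sum_(n < N) (if (Q n <= l) && (l < Q n.+1) then ((n < k)%N)%:R else 0)
    = (l < Q k)%R%:R :> R.
Proof.
move=> Qm Q0 kN.
have -> : \sum_(n < N) (if (Q n <= l) && (l < Q n.+1) then ((n < k)%N)%:R else 0) =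
   \sum_(n < N | (n < k)%N) ((l < Q n.+1)%R%:R - (l < Q n)%R%:R) :> R.
  rewrite [RHS]big_mkcond; apply: eq_bigr => n _; case: (ltnP n k) => nk; last by case: ifP.
  rewrite leNgt; have := Qm n; case: (ltP l (Q n)) => h1; case: (ltP l (Q n.+1)) => h2 /=.
  - by rewrite subrr.
  - by move=> h; have := lt_le_trans (le_lt_trans h2 h1) h; rewrite ltxx.
  - by rewrite subr0.
  - by rewrite subrr.
rewrite -(big_ord_widen N (fun n => (l < Q n.+1)%R%:R - (l < Q n)%R%:R) kN).
elim: (k) => [|j IH]; first by rewrite big_ord0 ltNge Q0.
by rewrite big_ord_recr /= IH addrC subrK.
Qed.

(** A partition of unity that makes the stopped pieces add up: either [Q k] is below the bottom
    level, or it lies in exactly one band [L_j < Q k <= L_(j+1)], and then exactly one [n < k] is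
    the time at which [L_j] is crossed. *)
Lemma level_decomposition Q t k N m : (forall n, Q n <= Q n.+1) -> Q 0%N = 0 -> 0 < t ->
  (k <= N)%N -> Q k <= (2 ^+ m * t) ^+ 2 ->
  (Q k <= t ^+ 2)%R%:R + \sum_(j < m) \sum_(n < N)
    (if (Q n <= (2 ^+ j * t) ^+ 2) && ((2 ^+ j * t) ^+ 2 < Q n.+1) then
      ((n < k)%N && (Q k <= (2 ^+ j.+1 * t) ^+ 2))%:R else 0) = 1 :> R.
Proof.
move=> Qm Q0 t0 kN Qk; pose L j := (2 ^+ j * t) ^+ 2.
have L_le j : L j <= L j.+1.
  rewrite /L ler_sqr ?nnegrE ?mulr_ge0 ?(ltW t0)//.
  by rewrite ler_pM2r// exprS ler_peMl// ler1n.
have -> : \sum_(j < m) \sum_(n < N)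
    (if (Q n <= (2 ^+ j * t) ^+ 2) && ((2 ^+ j * t) ^+ 2 < Q n.+1) then
      ((n < k)%N && (Q k <= (2 ^+ j.+1 * t) ^+ 2))%:R else 0) =
    \sum_(j < m) ((L j < Q k)%R%:R - (L j.+1 < Q k)%R%:R) :> R.
  apply: eq_bigr => j _.
  have L0 : Q 0%N <= L j by rewrite Q0 sqr_ge0.
  have h := level_count Qm L0 kN.
  transitivity ((Q k <= L j.+1)%R%:R * (L j < Q k)%R%:R : R).
    rewrite -h mulr_sumr; apply: eq_bigr => n _; rewrite -/(L j) -/(L j.+1).
    by case: ifP => _; [rewrite -mulnb natrM mulrC|rewrite mulr0].
  have h3 := L_le j; rewrite leNgt.
  case: (ltP (L j.+1) (Q k)) => h1; case: (ltP (L j) (Q k)) => h2 /=.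
  - by rewrite mul0r subrr.
  - by have := le_lt_trans (le_trans h2 h3) h1; rewrite ltxx.
  - by rewrite mulr1 subr0.
  - by rewrite mulr0 subrr.
have -> : \sum_(j < m) ((L j < Q k)%R%:R - (L j.+1 < Q k)%R%:R) = (L 0%N < Q k)%R%:R :> R.
  have Lm : (L m < Q k)%R%:R = 0 :> R.
    by rewrite (_ : (L m < Q k) = false)//; apply/negbTE; rewrite -leNgt.
  transitivity ((L 0%N < Q k)%R%:R - (L m < Q k)%R%:R : R); last by rewrite Lm subr0.
  elim: (m) => [|j IH]; first by rewrite big_ord0 subrr.
  by rewrite big_ord_recr /= IH; ring.
rewrite /L expr0 mul1r leNgt; case: ltP => _ /=; lra.
Qed.

End dyadic_levels.

(** * Splitting into compensated jumps and stopped pieces *)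

Section davis_decomposition.
Context {d : measure_display} {Om : measurableType d} {R : realType}.
Variable P : probability Om R.
Variable F : nat -> set (set Om).
Hypothesis Ffil : filtration F.
Local Notation E := (E P F).
Local Notation Eprev := (Eprev P F).
Local Notation mart := (mart P F).
Local Notation Ex := (Ex P).
Local Notation Pr := (Pr P).
Local Notation itg := (itg P).
Local Notation bdd := (bdd P).
Local Notation mF := (mF F).
Implicit Types f g : Om -> R.

Lemma E_mart_sum N (w : nat -> Om -> R) m : (forall k, bdd (w k)) -> (forall k, mF k (w k)) ->
  (forall k, {ae P, forall x, E k (w k.+1) x = 0}) ->
  {ae P, forall x, E m (fun x => \sum_(k < N.+1) w k x) x =
    \sum_(k < N.+1) (if (k <= m)%N then w k x else 0)}.
Proof.
move=> wb wm w0.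
have h : {ae P, forall x, forall k, E m (w k) x = if (k <= m)%N then w k x else 0}.
  apply/ae_foralln => k; have [km|mk] := leqP k m.
    exact: (E_id Ffil (mF_mono Ffil km (wm k)) (bdd_itg (wb k))).
  case: k mk => // k mk.
  have e : E m (E k (w k.+1)) = E m (cst 0).
    by apply: (E_ae Ffil); [exact/E_itg/bdd_itg|exact: itg_cst|exact: w0].
  apply: filterS2 (E_tower Ffil (mk : (m <= k)%N) (bdd_itg (wb k.+1))) (E_cst P Ffil m 0) => x <-.
  by rewrite e.
have hs := @E_sum _ _ _ P F Ffil m 'I_N.+1 (index_enum _) xpredT (fun k => w k)
  (fun i _ => bdd_itg (wb i)).
apply: filterS2 h hs => x h ->; apply: eq_bigr => k _; exact: h.
Qed.

Lemma dmart_sum N (w : nat -> Om -> R) m : (forall k, bdd (w k)) -> (forall k, mF k (w k)) ->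
  (forall k, {ae P, forall x, E k (w k.+1) x = 0}) -> (m < N)%N ->
  {ae P, forall x, mdiff (mart (fun x => \sum_(k < N.+1) w k x)) m.+1 x = w m.+1 x}.
Proof.
move=> wb wm w0 mN.
apply: filterS2 (E_mart_sum N m wb wm w0) (E_mart_sum N m.+1 wb wm w0) => x h1 h2.
rewrite /mdiff /Defs.mart /= h1 h2 -sumrB.
rewrite (bigD1 (Ordinal (mN : (m.+1 < N.+1)%N)))//= leqnn ltnn subr0 big1 ?addr0// => k km.
have {}km : (k : nat) != m.+1 by apply: contraNneq km => km; apply/eqP/val_inj.
by rewrite leq_eqVlt (negbTE km) ltnS subrr.
Qed.

Variables (N : nat) (g : Om -> R).
Hypotheses (gb : bdd g) (mg : mF N g).
Let gi : itg g. Proof. exact: bdd_itg. Qed.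
Let dg k : Om -> R := mdiff (mart g) k.
Let D k : Om -> R := MX dg k.
(** Davis' large jumps, more than twice all previous differences. [prev D 0 = 0], so a nonzero
    [d_0 g] is always one of them and [v 0 = 0]. *)
Let J k x := if 2 * Defs.prev D k x < `|dg k x| then dg k x else 0.
Let u k x := J k x - Eprev k (J k) x.
Let v k x := dg k x - u k x.
(** The absolute value changes nothing almost everywhere and makes [Q] increase at every point. *)
Let c k x := `|E k (fun x => v k.+1 x ^+ 2) x|.
(** The square of the conditional square function of the part [v]. [Q (k + 1)] is already
    [F_k]-measurable, so passage above a level is known one step ahead. *)
Let Q k x := \sum_(i < k) c i x.

Let bd k : bdd (dg k). Proof. exact: dmart_bdd. Qed.
Let md k : mF k (dg k). Proof. exact: mF_dmart. Qed.
Let bD k : bdd (D k). Proof. exact: MX_bdd. Qed.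
Let mD k : mF k (D k). Proof. exact: mF_MX. Qed.
Let bDp k : bdd (Defs.prev D k). Proof. exact: prev_bdd. Qed.
Let mDp k : mF k (Defs.prev D k).
Proof. by case: k => [|k] /=; [exact: mF_cst|exact: (mF_mono Ffil (leqnSn k) (@mD k))]. Qed.

Let JE k : J k = fun x => \1_[set x | 2 * Defs.prev D k x < `|dg k x|] x * dg k x.
Proof.
apply/funext => x; rewrite /J indicE; case: ifP => h.
  by rewrite mem_set// mul1r.
by rewrite memNset ?mul0r//= h.
Qed.

Let FJ k : F k [set x | 2 * Defs.prev D k x < `|dg k x|].
Proof.
apply: F_lt_set => //; last exact: mF_abs.
by apply: mFM => //; exact: mF_cst.
Qed.

Let bJ k : bdd (J k).
Proof. by rewrite JE; apply: bddM => //; apply: bdd_indic; exact: FM (FJ k). Qed.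

Let mJ k : mF k (J k).
Proof. by rewrite JE; apply: mFM => //; exact: mF_indic. Qed.

Let bu k : bdd (u k).
Proof. by apply: bddB => //; case: k => [|k]; [exact: bdd_cst|exact: E_bdd]. Qed.

Let mu k : mF k (u k).
Proof.
apply: mFB => //; case: k => [|k]; first exact: mF_cst.
by apply: (mF_mono Ffil (leqnSn k)); apply: E_meas => //; exact: bdd_itg.
Qed.

Let uE k : {ae P, forall x, Eprev k (u k) x = 0}.
Proof.
case: k => [|k]; first exact: aeW.
have iJ := bdd_itg (bJ k.+1); have iE := E_itg Ffil k iJ.
apply: filterS2 (E_sub Ffil k iJ iE) (E_tower Ffil (leqnn k) iJ) => x e1 e2.
by rewrite /Defs.Eprev /= [LHS]e1 e2 subrr.
Qed.

Let bv k : bdd (v k). Proof. exact: bddB. Qed.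
Let mv k : mF k (v k). Proof. exact: mFB. Qed.
Let bv2 k : bdd (fun x => v k x ^+ 2). Proof. exact: bddX. Qed.

Let dE k : {ae P, forall x, E k (dg k.+1) x = 0}.
Proof.
have i1 := E_itg Ffil k.+1 gi; have i2 := E_itg Ffil k gi.
apply: filterS3 (E_sub Ffil k i1 i2) (E_tower Ffil (leqnSn k) gi) (E_tower Ffil (leqnn k) gi).
by move=> x e1 e2 e3; rewrite [LHS]e1 e2 e3 subrr.
Qed.

Let vE k : {ae P, forall x, E k (v k.+1) x = 0}.
Proof.
apply: filterS3 (E_sub Ffil k (bdd_itg (bd k.+1)) (bdd_itg (bu k.+1))) (dE k) (uE k.+1).
by move=> x e1 e2 e3; rewrite [LHS]e1 e2 [X in _ - X]e3 subrr.
Qed.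

Let v0 x : v 0%N x = 0.
Proof.
rewrite /v /u /J /Defs.Eprev /= mulr0 subr0; case: ifP; first by rewrite subrr.
by rewrite subr0 normr_gt0 => /negbFE/eqP.
Qed.

(** The small part [r] of the difference is at most [2 D_k], hence so is [|E_k r|]; and
    [E_k J_(k+1) = - E_k r] because [E_k d_(k+1) g = 0]. *)
Let v_bound k : {ae P, forall x, `|v k.+1 x| <= 4 * D k x}.
Proof.
pose r x := dg k.+1 x - J k.+1 x.
have br : bdd r by exact: bddB.
have rD x : `|r x| <= 2 * D k x.
  rewrite /r /J /=; case: (ltP (2 * D k x) `|dg k.+1 x|) => h; last by rewrite subr0.
  by rewrite subrr normr0 mulr_ge0// MX_ge0.
have b2 : bdd (fun x => 2 * D k x) by exact: bddZ.
have m2 : mF k (fun x => 2 * D k x) by apply: mFM => //; exact: mF_cst.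
have e1 := E_sub Ffil k (bdd_itg (bd k.+1)) (bdd_itg (bJ k.+1)).
have e2 := E_norm Ffil k (bdd_itg br).
have e3 : {ae P, forall x, E k (fun x => `|r x|) x <= E k (fun x => 2 * D k x) x}.
  by apply: E_le => //; [exact/bdd_itg/bdd_abs|exact: bdd_itg|exact: aeW].
have e4 := E_id Ffil m2 (bdd_itg b2).
apply: filterS3 (filterI e1 e2) (filterI e3 e4) (dE k) => x [h1 h2] [h3 h4] h5.
have h6 : E k r x = - E k (J k.+1) x by rewrite [LHS]h1 h5 sub0r.
rewrite h6 normrN in h2; rewrite h4 in h3.
have -> : v k.+1 x = r x + E k (J k.+1) x by rewrite /v /u /r /Defs.Eprev /=; ring.
rewrite (le_trans (ler_normD _ _))//; have := rD x; have := le_trans h2 h3; lra.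
Qed.

(** A large jump at least doubles the maximum of the differences, so
    [|J_k| <= 2 (D_k - D_(k-1))]. *)
Let J_telescope x m : \sum_(k < m.+1) `|J k x| <= 2 * D m x.
Proof.
have step k : `|J k x| <= 2 * (D k x - Defs.prev D k x).
  have d1 : Defs.prev D k x <= D k x.
    by case: k => [|k] /=; [exact: MX_ge0|exact: rmax_leS].
  rewrite /J; case: ifP => h; last by rewrite normr0 mulr_ge0// subr_ge0.
  have := rmax_ge (dg ^~ x) k; rewrite -/(MX _ _ _) -/(D k x); lra.
elim: m => [|m IH].
  by rewrite big_ord_recl big_ord0 addr0; have := step 0%N; rewrite /= subr0.
by rewrite big_ord_recr /=; have := step m.+1; rewrite /=; lra.
Qed.

Let D_le_SQ m x : D m x <= SQ (mart g) m x.
Proof.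
apply: rmax_lub => [|j jm]; first exact: SQ_ge0.
rewrite SQE -sqrtr_sqr ler_sqrt; last by apply: sumr_ge0 => *; exact: sqr_ge0.
rewrite (bigD1 (Ordinal (jm : (j < m.+1)%N)))//= lerDl.
by apply: sumr_ge0 => *; exact: sqr_ge0.
Qed.

Let ExSQ : R := Ex (SQ (mart g) N).
Let bSQ : bdd (SQ (mart g) N). Proof. by apply: SQ_bdd => k; exact: E_bdd. Qed.

Let Ex_D : Ex (D N) <= ExSQ.
Proof. by apply: Ex_le; [exact: bdd_itg|exact: bdd_itg|apply: aeW => x; exact: D_le_SQ]. Qed.

Lemma davis_jumps : \sum_(k < N.+1) Ex (fun x => `|u k x|) <= 4 * ExSQ.
Proof.
have h k : Ex (fun x => `|u k x|) <= 2 * Ex (fun x => `|J k x|).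
  have bE : bdd (Eprev k (J k)) by case: (k) => [|j]; [exact: bdd_cst|exact: E_bdd].
  have iJ := bdd_itg (bdd_abs (bJ k)); have iE := bdd_itg (bdd_abs bE).
  apply: (@le_trans _ _ (Ex (fun x => `|J k x| + `|Eprev k (J k) x|))).
    apply: Ex_le; [exact/bdd_itg/bdd_abs|exact: itgD|].
    by apply: aeW => x; rewrite /u; exact: ler_normB.
  rewrite ExD//; suff : Ex (fun x => `|Eprev k (J k) x|) <= Ex (fun x => `|J k x|) by lra.
  case: (k) => [|j]; last exact/E_L1/bdd_itg.
  rewrite /Defs.Eprev /= normr0 Ex_cst; apply: Ex_ge0; last exact: aeW.
  exact/bdd_itg/bdd_abs.
apply: (@le_trans _ _ (\sum_(k < N.+1) 2 * Ex (fun x => `|J k x|))).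
  by apply: ler_sum => k _; exact: h.
rewrite -mulr_sumr -Ex_sum; last by move=> k _; exact/bdd_itg/bdd_abs.
have : Ex (fun x => \sum_(k < N.+1) `|J k x|) <= Ex (fun x => 2 * D N x).
  apply: Ex_le; [|exact/itgZ/bdd_itg|by apply: aeW => x; exact: J_telescope].
  by apply: itg_sum => k _; exact/bdd_itg/bdd_abs.
rewrite ExZ; last exact: bdd_itg.
by have := Ex_D; lra.
Qed.

Let S k x := Num.sqrt (\sum_(j < k.+1) v j x ^+ 2).
Let S0 k x : 0 <= S k x. Proof. exact: sqrtr_ge0. Qed.
Let S_sqr k x : S k x ^+ 2 = \sum_(j < k.+1) v j x ^+ 2.
Proof. by rewrite sqr_sqrtr//; apply: sumr_ge0 => *; exact: sqr_ge0. Qed.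
Let S_le k x : S k x <= S k.+1 x.
Proof.
by rewrite -ler_sqr ?nnegrE// !S_sqr [leRHS]big_ord_recr /= lerDl sqr_ge0.
Qed.
Let bS k : bdd (S k). Proof. by apply: bdd_sqrt; exact: bdd_sum. Qed.
Let mS k : mF k (S k).
Proof.
apply: mF_sqrt; apply: mF_sum => j _; apply: mFX.
by apply: (mF_mono Ffil _ (@mv j)); rewrite -ltnS.
Qed.

(** From [v = d g - u]: [10 = 2 (1 + 4)], with 4 from the jumps. *)
Let Ex_S : Ex (S N) <= 10 * ExSQ.
Proof.
have bs : bdd (fun x => \sum_(k < N.+1) `|u k x|) by apply: bdd_sum => *; exact: bdd_abs.
have : Ex (S N) <= Ex (fun x => 2 * (SQ (mart g) N x + \sum_(k < N.+1) `|u k x|)).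
  apply: Ex_le; [exact: bdd_itg|exact/bdd_itg/bddZ/bddD|apply: aeW => x].
  apply: (@le_trans _ _ (2 * (SQ (mart g) N x + Num.sqrt (\sum_(k < N.+1) u k x ^+ 2)))); last first.
    by rewrite ler_pM2l// lerD2l; exact: sqrt_sum_sqr_le.
  rewrite SQE /S.
  set a := \sum_(j < N.+1) mdiff (mart g) j x ^+ 2; set e := \sum_(j < N.+1) u j x ^+ 2.
  have a0 : 0 <= a by apply: sumr_ge0 => *; exact: sqr_ge0.
  have e0 : 0 <= e by apply: sumr_ge0 => *; exact: sqr_ge0.
  apply: (@le_trans _ _ (Num.sqrt (2 ^+ 2 * (a + e)))).
    rewrite ler_sqrt ?mulr_ge0 ?addr_ge0// /a /e -big_split/= mulr_sumr.
    apply: ler_sum => j _; rewrite /v -/(dg j).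
    by have := sqr_ge0 (dg j x + u j x); nra.
  by rewrite sqrtrM ?sqr_ge0// sqrtr_sqr ger0_norm// ler_pM2l// sqrtD_le.
rewrite ExZ; last exact/bdd_itg/bddD.
rewrite ExD; [|exact: bdd_itg|exact: bdd_itg].
rewrite Ex_sum; last by move=> k _; exact/bdd_itg/bdd_abs.
by have := davis_jumps; rewrite -/ExSQ; lra.
Qed.

Let c0 k x : 0 <= c k x. Proof. exact: normr_ge0. Qed.
Let bc k : bdd (c k). Proof. by apply: bdd_abs; exact: E_bdd. Qed.
Let mc k : mF k (c k). Proof. by apply: mF_abs; apply: E_meas => //; exact: bdd_itg. Qed.
Let bQ k : bdd (Q k). Proof. exact: bdd_sum. Qed.
Let mQ k : mF k (Q k.+1).
Proof. by apply: mF_sum => i _; apply: (mF_mono Ffil _ (@mc i)); rewrite -ltnS. Qed.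

(* The weights [S_k + 4 D_k + e] are [F k]-measurable and dominate [S_(k+1)]. *)
Let Ex_sqrt_Q (e : R) : 0 < e -> Ex (fun x => Num.sqrt (Q N x)) <= 17 * ExSQ + e.
Proof.
move=> e0; pose w k x := S k x + 4 * D k x + e.
have D0 k x : 0 <= D k x by exact: MX_ge0.
have we k x : e <= w k x by rewrite /w lerDr addr_ge0// mulr_ge0.
have w0 k x : 0 < w k x := lt_le_trans e0 (we k x).
have wN k x : (k <= N)%N -> w k x <= w N x.
  move=> kN; rewrite /w lerD2r lerD//; last by rewrite ler_pM2l//; exact: rmax_mono.
  by rewrite -(subnKC kN); elim: (N - k)%N => [|i IH]; rewrite ?addn0 ?addnS// (le_trans IH).
have bw k : bdd (w k) by apply: bddD; [apply: bddD => //; exact: bddZ|exact: bdd_cst].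
have mw k : mF k (w k).
  by apply: mFD; [apply: mFD => //; apply: mFM => //; exact: mF_cst|exact: mF_cst].
have miw k : mF k (fun x => (w k x)^-1) by exact: mF_inv.
have biw k : bdd (fun x => (w k x)^-1).
  split; first exact: mF_meas (miw k).
  exists e^-1; apply: aeW => x; rewrite normfV ger0_norm ?(ltW (w0 _ _))//.
  by rewrite lef_pV2 ?posrE.
pose X x := \sum_(k < N) (w k x)^-1 * c k x.
have bX : bdd X by apply: bdd_sum => k _; exact: bddM.
have X0 x : 0 <= X x by apply: sumr_ge0 => k _; rewrite mulr_ge0 ?invr_ge0 ?(ltW (w0 _ _))// c0.
(* [S_(k+1) <= w_k] gives [v_(k+1)^2 / w_k <= 2 (S_(k+1) - S_k)], since
   [v_(k+1)^2 = S_(k+1)^2 - S_k^2]; this telescopes. *)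
have ExX : Ex X <= 2 * Ex (S N).
  have -> : Ex X = Ex (fun x => \sum_(k < N) (w k x)^-1 * v k.+1 x ^+ 2).
    rewrite /X !Ex_sum; last 2 first.
    - by move=> k _; exact/bdd_itg/bddM.
    - by move=> k _; exact/bdd_itg/bddM.
    apply: eq_bigr => k _; rewrite -(Ex_pull Ffil (miw k) (biw k) (bdd_itg (bv2 k.+1))).
    apply: Ex_ae; [exact/bdd_meas/bddM|apply/bdd_meas/bddM => //; exact: E_bdd|].
    have : {ae P, forall x, 0 <= E k (fun x => v k.+1 x ^+ 2) x}.
      by apply: E_ge_cst => //; [exact: bdd_itg|apply: aeW => x; exact: sqr_ge0].
    by apply: filterS => x h; rewrite /c ger0_norm.
  rewrite -ExZ; last exact: bdd_itg.
  apply: Ex_le; [apply: itg_sum => k _; exact/bdd_itg/bddM|exact/itgZ/bdd_itg|].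
  have : {ae P, forall x, forall k, `|v k.+1 x| <= 4 * D k x} by apply/ae_foralln.
  apply: filterS => x vD; elim: (N) => [|m IH]; first by rewrite big_ord0 mulr_ge0.
  rewrite big_ord_recr /=; apply: (le_trans (lerD IH (lexx _))).
  have Sw : S m.+1 x <= w m x.
    rewrite /S big_ord_recr /=; apply: (le_trans (sqrtD_le _ _)).
    - by apply: sumr_ge0 => *; exact: sqr_ge0.
    - exact: sqr_ge0.
    by rewrite sqrtr_sqr -/(S m x) /w -addrA lerD2l ler_wpDr ?vD// ltW.
  have := S_le m x; have s0 := S0 m.+1 x; have t0 := S0 m x.
  have : v m.+1 x ^+ 2 = S m.+1 x ^+ 2 - S m x ^+ 2.
    by rewrite !S_sqr big_ord_recr /=; ring.
  move=> -> ts; have W0 := w0 m x; rewrite -lerBrDl mulrC ler_pdivrMr//.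
  have : (2 * S m.+1 x - 2 * S m x) * S m.+1 x <= (2 * S m.+1 x - 2 * S m x) * w m x.
    by rewrite ler_wpM2l//; lra.
  nra.
(* [Q <= w_N X] and the arithmetic-geometric mean. In units of [ExSQ] the three parts are 10 for
   [S], 4 for [4 D] and 20 for [X], and [17 = (10 + 4 + 20) / 2]. *)
have : Ex (fun x => Num.sqrt (Q N x)) <= Ex (fun x => 2^-1 * (w N x + X x)).
  apply: Ex_le; [exact/bdd_itg/bdd_sqrt|exact/bdd_itg/bddZ/bddD|apply: aeW => x].
  have wX : Q N x <= w N x * X x.
    rewrite /Q /X mulr_sumr; apply: ler_sum => k _; rewrite mulrA ler_peMl ?c0//.
    by rewrite ler_pdivlMr// mul1r wN// ltnW.
  have h0 : 0 <= 2^-1 * (w N x + X x) by rewrite mulr_ge0// addr_ge0// ltW.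
  rewrite -(ger0_norm h0) -sqrtr_sqr ler_sqrt ?sqr_ge0//.
  by have := sqr_ge0 (w N x - X x); lra.
rewrite ExZ; last exact/bdd_itg/bddD.
rewrite ExD; [|exact: bdd_itg|exact: bdd_itg].
have -> : Ex (w N) = Ex (S N) + 4 * Ex (D N) + e.
  rewrite /w ExD; [|exact/bdd_itg/bddD/bddZ|exact: itg_cst].
  by rewrite Ex_cst ExD ?ExZ//; [exact: bdd_itg|exact: bdd_itg|exact/bdd_itg/bddZ].
by have := Ex_D; have := Ex_S; lra.
Qed.

(** The stopping test uses [Q k], known at time [k - 1], so for [A] in [F_n] these are again
    martingale differences. *)
Let stopped n (A : set Om) L k x := \1_A x * (if (n < k)%N && (Q k x <= L ^+ 2) then v k x else 0).

Let stoppedE n A L k : stopped n A L k.+1 =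
  fun x => \1_A x * (n <= k)%N%:R * \1_[set x | Q k.+1 x <= L ^+ 2] x * v k.+1 x.
Proof.
apply/funext => x; rewrite /stopped indicE ltnS; case: (n <= k)%N => /=.
  rewrite mulr1 -mulrA; congr (_ * _); rewrite indicE; case: ifP => h.
    by rewrite mem_set// mul1r.
  by rewrite memNset ?mul0r//= h.
by rewrite !mulr0 !mul0r.
Qed.

Let atom n A L x := \sum_(k < N.+1) stopped n A L k x.

(** The cut-off [chi k] is [F_k]-measurable and multiplies [v_(k+1)], so it passes through [E k];
    the conditional square function becomes a capped sum of the [c k]. *)
Lemma stopped_pre_atom n A L : (n <= N)%N -> F n A -> 0 < L -> pre_atom P F N n A L (atom n A L).
Proof.
move=> nN FA L0; have mA := FM Ffil FA.
pose chi k x : R := \1_A x * (n <= k)%N%:R * \1_[set x | Q k.+1 x <= L ^+ 2] x.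
have FQ k : F k [set x | Q k.+1 x <= L ^+ 2] by apply: F_le_set => //; exact: mF_cst.
have bchi k : bdd (chi k).
  apply: bddM; last by apply: bdd_indic; exact: FM (FQ k).
  by apply: bddM; [exact: bdd_indic|exact: bdd_cst].
have mchi k : mF k (chi k).
  apply: mFM; last exact: mF_indic.
  have [nk|nk] := leqP n k.
    by apply: mFM; [apply: mF_indic => //; exact: F_mono FA|exact: mF_cst].
  rewrite (_ : (fun x => _) = cst 0); first exact: mF_cst.
  by apply/funext => x; rewrite mulr0.
have wE k : stopped n A L k.+1 = fun x => chi k x * v k.+1 x by exact: stoppedE.
have w0 : stopped n A L 0 = cst 0 by apply/funext => x; rewrite /stopped mulr0.
have bw k : bdd (stopped n A L k).
  by case: k => [|k]; rewrite ?w0 ?wE; [exact: bdd_cst|exact: bddM].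
have mw k : mF k (stopped n A L k).
  case: k => [|k]; rewrite ?w0 ?wE; first exact: mF_cst.
  by apply: mFM => //; exact: (mF_mono Ffil (leqnSn k) (mchi k)).
have Ew k : {ae P, forall x, E k (stopped n A L k.+1) x = 0}.
  rewrite wE; apply: filterS2 (E_pull Ffil (mchi k) (bchi k) (bdd_itg (bv k.+1))) (vE k).
  by move=> x -> ->; rewrite mulr0.
split => //; split.
- exact: bdd_sum.
- by apply: mF_sum => k _; apply: (mF_mono Ffil _ (mw k)); rewrite -ltnS.
- move=> x; rewrite /atom mulr_sumr; apply: eq_bigr => k _.
  by rewrite /stopped mulrA indicE; case: (x \in A); rewrite /= ?mulr1 ?mul0r.
- apply: filterS (E_mart_sum N n bw mw Ew) => x ->; apply: big1 => k _.
  by case: ifP => // kn; rewrite /stopped ltnNge kn mulr0.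
have h k : (k < N)%N -> {ae P, forall x, E k (fun y => mdiff (mart (atom n A L)) k.+1 y ^+ 2) x
    <= chi k x * c k x}.
  move=> kN.
  have e : E k (fun y => mdiff (mart (atom n A L)) k.+1 y ^+ 2) = E k (fun y => chi k y * v k.+1 y ^+ 2).
    apply: (E_ae Ffil); [|exact/bdd_itg/bddM|].
      by apply/bdd_itg/bddX/dmart_bdd => //; exact: bdd_sum.
    apply: filterS (dmart_sum bw mw Ew kN) => x ->; rewrite wE exprMn; congr (_ * _).
    rewrite /chi !exprMn !indicE.
    by case: (x \in A); case: (n <= k)%N; case: (x \in _); rewrite /= ?expr1n ?expr0n /= ?mulr0 ?mul0r.
  rewrite e; apply: filterS (E_pull Ffil (mchi k) (bchi k) (bdd_itg (bv2 k.+1))) => x ->.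
  by rewrite ler_wpM2l ?ler_norm// /chi !mulr_ge0.
have {}h : {ae P, forall x, forall k, (k < N)%N ->
    E k (fun y => mdiff (mart (atom n A L)) k.+1 y ^+ 2) x <= chi k x * c k x}.
  apply/ae_foralln => k; have [kN|kN] := ltnP k N; last exact: aeW.
  by apply: filterS (h _ kN) => x.
apply: filterS h => x h.
apply: (@le_trans _ _ (\sum_(k < N) chi k x * c k x)); first by apply: ler_sum => k _; exact: h.
apply: (@le_trans _ _ (\1_A x * \sum_(k < N) (if Q k.+1 x <= L ^+ 2 then c k x else 0))).
  rewrite mulr_sumr; apply: ler_sum => k _; rewrite /chi -!mulrA ler_wpM2l//.
  rewrite indicE; case: ifP => hQ; last by rewrite memNset ?mul0r ?mulr0//= hQ.
  by rewrite mem_set// mul1r; case: (n <= k)%N; rewrite ?mul1r ?mul0r.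
rewrite mulrC ler_wpM2r//; apply: (@capped_sum _ (c ^~ x)); last exact: sqr_ge0.
by move=> k; exact: normr_ge0.
Qed.

(* Jumps [a k], one atom at the bottom level [K], and for [j < m], [n < N] an atom at
   level [2 ^ (j + 1) * K] on the set where the conditional square function of the rest
   first exceeds [2 ^ j * K] at time [n + 1]. *)
Lemma davis_decomposition (K : R) : 0 < K -> Ex (SQ (mart g) N) <= K ->
  exists m (a : nat -> Om -> R) (A : nat -> nat -> set Om) (w0 : Om -> R) (w : nat -> nat -> Om -> R),
  [/\ forall k, [/\ bdd (a k), mF k (a k) & {ae P, forall x, Eprev k (a k) x = 0}],
      \sum_(k < N.+1) Ex (fun x => `|a k x|) <= 4 * K,
      pre_atom P F N 0 setT K w0 /\
        (forall j n, (n < N)%N -> pre_atom P F N n (A j n) (2 ^+ j.+1 * K) (w j n)),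
      \sum_(j < m) \sum_(n < N) 2 ^+ j.+1 * K * Pr (A j n) <= 72 * K &
      {ae P, forall x, g x = \sum_(k < N.+1) a k x +
         (w0 x + \sum_(j < m) \sum_(n < N) w j n x)}].
Proof.
rewrite -/ExSQ => K0 ExK.
pose L j : R := 2 ^+ j * K.
have L0 j : 0 < L j by rewrite mulr_gt0// exprn_gt0.
have [M QM] : exists M : R, {ae P, forall x, `|Q N x| <= M} by case: (bQ N).
(* [Q N] is bounded because [g] is, so finitely many levels suffice. *)
have [m mM] : exists m : nat, M <= (L m) ^+ 2.
  pose m := Num.truncn (`|M| / K ^+ 2); exists m.
  have K20 : 0 < K ^+ 2 by rewrite exprn_gt0.
  have h1 : `|M| / K ^+ 2 < m.+1%:R by exact: truncnS_gt.
  have h2 : m.+1%:R <= 2 ^+ m :> R by rewrite -natrX ler_nat ltn_expl.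
  have h3 : 1 <= 2 ^+ m :> R by rewrite exprn_ege1// ler1n.
  rewrite /L exprMn -ler_pdivrMr//.
  apply: (@le_trans _ _ (`|M| / K ^+ 2)); first by rewrite ler_wpM2r ?invr_ge0 ?(ltW K20)// ler_norm.
  by rewrite (le_trans (ltW h1))// (le_trans h2)// expr2 ler_peMl// (le_trans _ h3).
pose A j n := [set x | Q n x <= L j ^+ 2] `&` [set x | L j ^+ 2 < Q n.+1 x].
have FA j n : F n (A j n).
  apply: F_setI => //; last by apply: F_lt_set => //; exact: mF_cst.
  apply: F_le_set => //; last exact: mF_cst.
  case: n => [|n]; last exact: (mF_mono Ffil (leqnSn n) (@mQ n)).
  rewrite (_ : Q 0 = cst 0); first exact: mF_cst.
  by apply/funext => x; rewrite /Q big_ord0.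
exists m, u, A, (atom 0 setT K), (fun j n => atom n (A j n) (L j.+1)); split.
- by move=> k; split.
- by apply: (le_trans davis_jumps); rewrite ler_pM2l.
- split; first by apply: stopped_pre_atom => //; exact: F_setT.
  by move=> j n nN; exact: (stopped_pre_atom (ltnW nN) (FA j n) (L0 j.+1)).
- have mA j n : measurable (A j n) by exact: FM (FA j n).
  have -> : \sum_(j < m) \sum_(n < N) 2 ^+ j.+1 * K * Pr (A j n) =
      Ex (fun x => \sum_(j < m) \sum_(n < N) L j.+1 * \1_(A j n) x).
    rewrite Ex_sum; last first.
      by move=> j _; apply: itg_sum => n _; exact/itgZ/bdd_itg/bdd_indic.
    apply: eq_bigr => j _; rewrite Ex_sum; last by move=> n _; exact/itgZ/bdd_itg/bdd_indic.
    by apply: eq_bigr => n _; rewrite ExZ ?Ex_indic//; exact/bdd_itg/bdd_indic.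
  apply: (@le_trans _ _ (Ex (fun x => 4 * Num.sqrt (Q N x)))).
    apply: Ex_le.
    - by apply: itg_sum => j _; apply: itg_sum => n _; exact/itgZ/bdd_itg/bdd_indic.
    - exact/itgZ/bdd_itg/bdd_sqrt.
    apply: aeW => x; apply: le_trans (dyadic_sum_le m K0 (sqrtr_ge0 (Q N x))).
    apply: ler_sum => j _; rewrite -mulr_sumr.
    have Qm n : Q n x <= Q n.+1 x by rewrite /Q big_ord_recr /= lerDl normr_ge0.
    have Q0L : Q 0 x <= L j ^+ 2 by rewrite /Q big_ord0 sqr_ge0.
    have h := level_count Qm Q0L (leqnn N).
    have -> : \sum_(n < N) \1_(A j n) x = (L j ^+ 2 < Q N x)%R%:R :> R.
      rewrite -h; apply: eq_bigr => n _; rewrite indicE ltn_ord.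
      case: ifP => [/andP[h1 h2]|h1]; first by rewrite mem_set.
      by rewrite memNset// => -[/= h2 h3]; rewrite h2 h3 in h1.
    rewrite -/(L j) -/(L j.+1); case: (ltP (L j ^+ 2) (Q N x)) => hq; last first.
      by rewrite mulr0; case: ifP => // _; exact: ltW.
    rewrite mulr1 ifT// -(ger0_norm (ltW (L0 j))) -sqrtr_sqr ltr_sqrt//.
    by rewrite (le_lt_trans _ hq)// sqr_ge0.
  (* [Ex_sqrt_Q] with [e = K]: [4 (17 K + K) = 72 K]. *)
  rewrite ExZ; last exact/bdd_itg/bdd_sqrt.
  by have := Ex_sqrt_Q K0; lra.
apply: filterS2 (E_id Ffil mg gi) QM => x gx QMx.
have gE : g x = \sum_(k < N.+1) dg k x.
  rewrite -gx -[LHS]/(mart g N x); elim: (N) => [|i IH].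
    by rewrite big_ord_recl big_ord0 addr0 /dg /mdiff subr0.
  by rewrite big_ord_recr /= -IH /dg /mdiff /= addrC subrK.
rewrite gE (eq_bigr (fun k : 'I_N.+1 => u k x + v k x)); last first.
  by move=> k _; rewrite /v addrC subrK.
rewrite big_split/=; congr (_ + _).
rewrite /atom; under [X in _ = _ + X]eq_bigr => j _ do rewrite exchange_big/=.
rewrite exchange_big/= -big_split/=; apply: eq_bigr => k _.
case: k => -[|k] /= kN.
  rewrite v0 /stopped /= mulr0 add0r big1// => j _; rewrite big1// => n _.
  by rewrite mulr0.
have Qm n : Q n x <= Q n.+1 x by rewrite /Q big_ord_recr /= lerDl normr_ge0.
have Q00 : Q 0 x = 0 by rewrite /Q big_ord0.
have QkN : Q k.+1 x <= Q N x.
  rewrite -(subnKC (kN : (k.+1 <= N)%N)); elim: (N - k.+1)%N => [|i IH]; rewrite ?addn0 ?addnS//.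
  exact: le_trans IH (Qm _).
have QkL : Q k.+1 x <= (2 ^+ m * K) ^+ 2.
  by rewrite (le_trans QkN)// (le_trans (ler_norm _))// (le_trans QMx).
have := level_decomposition Qm Q00 K0 (kN : (k.+1 <= N)%N) QkL.
move=> H; rewrite -[LHS]mul1r -H mulrDl; congr (_ + _).
  rewrite /stopped indicE mem_set// mul1r /=.
  by case: (Q k.+1 x <= K ^+ 2); rewrite /= ?mul1r ?mul0r.
rewrite mulr_suml; apply: eq_bigr => j _; rewrite mulr_suml; apply: eq_bigr => n _.
rewrite /stopped indicE -/(L j) -/(L j.+1).
case: ifP => [/andP[h1 h2]|h1].
  rewrite mem_set// mul1r; case: ((n < k.+1)%N && _); rewrite /= ?mul1r ?mul0r//.
by rewrite memNset ?mul0r// => -[/= h2 h3]; rewrite h2 h3 in h1.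
Qed.

End davis_decomposition.

(** * Passage to the limit *)

Section convergence_in_probability.
Context {d : measure_display} {Om : measurableType d} {R : realType}.
Variable P : probability Om R.
Local Notation Ex := (Ex P).
Local Notation Pr := (Pr P).
Local Notation itg := (itg P).
Local Notation Lq := (Lq_norm P).
Implicit Types f g Y Z : Om -> R.

Lemma Pr_ae_U A C D : measurable A -> measurable C -> measurable D ->
  {ae P, forall x, A x -> C x \/ D x} -> Pr A <= Pr C + Pr D.
Proof.
move=> mA mC mD h; apply: le_trans (Pr_U P mC mD).
by apply: ae_meas_le => //; exact: measurableU.
Qed.

Lemma Lq_markov q Z (t K e : R) : 0 < q -> measurable_fun setT Z -> 0 < t -> 0 <= e ->
  (Lq q Z <= K%:E)%E -> K <= t * e `^ q^-1 -> Pr [set x | t < Z x] <= e.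
Proof.
move=> q0 mZ t0 e0 ZK Ke.
have mA : measurable [set x | t < Z x] by exact: meas_lt_set.
have mi : measurable_fun setT (\1_[set x | t < Z x] : Om -> R) by exact: measurable_indic.
have h : (Lq q (fun x => t * \1_[set x | t < Z x] x)%R <= Lq q Z)%E.
  apply: Lq_le => //; first exact: measurable_funM.
  apply: aeW => x; rewrite indicE; case: (boolP (x \in _)) => [|_].
    by rewrite inE /= => tz; rewrite mulr1 !ger0_norm ?ltW// (lt_trans t0).
  by rewrite mulr0 normr0.
rewrite Lq_scale// Lq_indic// ger0_norm ?(ltW t0)// -EFinM in h.
have := le_trans h ZK; rewrite lee_fin => h2.
have := le_trans h2 Ke; rewrite ler_pM2l// => h3.
have qV : 0 <= q by exact: ltW.
have := @ge0_ler_powR R q qV _ _ (powR_ge0 (Pr _) q^-1) (powR_ge0 e q^-1) h3.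
by rewrite -!powRrM mulVf ?gt_eqF// !powRr1// Pr_ge0.
Qed.

Lemma geometric_tail_le (n m : nat) :
  \sum_(k < m) (2 ^+ (n + k))^-1 <= 2 * (2 ^+ n)^-1 :> R.
Proof.
suff -> : \sum_(k < m) (2 ^+ (n + k))^-1 = 2 * (2 ^+ n)^-1 - 2 * (2 ^+ (n + m))^-1 :> R.
  by rewrite gerBl mulr_ge0// invr_ge0 exprn_ge0.
elim: m => [|m IH]; first by rewrite big_ord0 addn0 subrr.
rewrite big_ord_recr /= IH addnS exprS invfM.
by set a := (2 ^+ (n + m))^-1; field.
Qed.

(** The limit is the upper limit of the whole sequence. Off the union of the events with index at
    least [n], the sequence stays within a geometric tail of [h_n], and so does its upper limit. *)
Lemma cauchy_in_prob (h_ : nat -> Om -> R) : (forall k, measurable_fun setT (h_ k)) ->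
  (forall k, Pr [set x | (2 ^+ k)^-1 < `|h_ k.+1 x - h_ k x|] <= (2 ^+ k)^-1) ->
  exists2 h : Om -> R, measurable_fun setT h &
    forall n, Pr [set x | 2 * (2 ^+ n)^-1 < `|h x - h_ n x|] <= 2 * (2 ^+ n)^-1.
Proof.
move=> mh hh.
have me : measurable_fun setT (fun x => limn_esup (fun k => (h_ k x)%:E)).
  by apply: measurable_fun_limn_esup => k; exact/measurable_EFinP.
have mf : measurable_fun setT (fun x => fine (limn_esup (fun k => (h_ k x)%:E))).
  exact: (measurableT_comp (@fine_measurable R _ measurableT) me).
exists (fun x => fine (limn_esup (fun k => (h_ k x)%:E))) => // n.
set h := fun x => fine _ in mf *.
pose D k := [set x | (2 ^+ (n + k))^-1 < `|h_ (n + k).+1 x - h_ (n + k)%N x|].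
have mD k : measurable (D k).
  by apply: meas_lt_set => //; apply: measurableT_comp => //; exact: measurable_funB.
have mA : measurable [set x | 2 * (2 ^+ n)^-1 < `|h x - h_ n x|].
  by apply: meas_lt_set => //; apply: measurableT_comp => //; exact: measurable_funB.
have sub : [set x | 2 * (2 ^+ n)^-1 < `|h x - h_ n x|] `<=` \bigcup_k D k.
  move=> x /=; apply: contraPP => nD; apply/negP; rewrite -leNgt.
  have {}nD k : `|h_ (n + k).+1 x - h_ (n + k)%N x| <= (2 ^+ (n + k))^-1.
    by rewrite leNgt; apply/negP => hk; apply: nD; exists k.
  set r := 2 * (2 ^+ n)^-1.
  have near j : `|h_ (n + j)%N x - h_ n x| <= r.
    apply: le_trans (geometric_tail_le n j).
    elim: j => [|j IH]; first by rewrite addn0 subrr normr0 big_ord0.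
    rewrite addnS big_ord_recr /=.
    have := ler_distD (h_ (n + j)%N x) (h_ (n + j).+1 x) (h_ n x); have := nD j; lra.
  have near' m : (n <= m)%N -> h_ n x - r <= h_ m x /\ h_ m x <= h_ n x + r.
    by move=> /subnKC <-; have := near (m - n)%N; rewrite ler_norml; lra.
  have le : (limn_esup (fun k => (h_ k x)%:E) <= (h_ n x + r)%:E)%E.
    rewrite limn_esup_lim; apply: lime_le; [exact: is_cvg_esups|exists n => // m /= nm].
    apply: ub_ereal_sup => _ [k /= mk <-]; rewrite lee_fin.
    by have [] := near' _ (leq_trans nm mk).
  have ge : ((h_ n x - r)%:E <= limn_esup (fun k => (h_ k x)%:E))%E.
    rewrite limn_esup_lim; apply: lime_ge; [exact: is_cvg_esups|exists n => // m /= nm].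
    apply: (@le_trans _ _ (h_ m x)%:E); first by rewrite lee_fin; have [] := near' _ nm.
    by apply: ereal_sup_ubound; exists m => /=.
  rewrite /h; case: (limn_esup _) le ge => [l| |] //=; rewrite !lee_fin => l1 l2.
  by rewrite ler_norml; lra.
have := @measure_sigma_subadditive _ _ _ P _ _ mD mA sub.
rewrite -lee_fin -Pr_fin// => H; apply: (le_trans H).
apply: lime_le => [|]; first by apply: is_cvg_nneseries => k _ _; exact: measure_ge0.
apply: nearW => m; apply: (@le_trans _ _ (\sum_(0 <= k < m) ((2 ^+ (n + k))^-1)%:E)%E).
  apply: lee_sum => k _; have := hh (n + k)%N; rewrite -lee_fin; apply: le_trans.
  by rewrite -(Pr_fin P (mD k)).
by rewrite sumEFin lee_fin big_mkord; exact: geometric_tail_le.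
Qed.

Lemma itg_Lq1 f K : measurable_fun setT f -> (Lq 1 f <= K%:E)%E ->
  itg f /\ Ex (fun x => `|f x|) <= K.
Proof.
move=> mf fK; have fi : itg f.
  by apply/itgP; split => //; rewrite /Lq_norm Lnorm1 in fK; exact: le_lt_trans fK (ltry _).
by rewrite (Lq_norm1 fi) lee_fin in fK.
Qed.

(** The rate [4^-k] leaves, by Markov's inequality, [2^-k] both for the size and for the probability
    of a step; Fatou's lemma in probability then returns the [L^1] distance to the limit. *)
Lemma L1_complete (p_ : nat -> Om -> R) : (forall k, itg (p_ k)) ->
  (forall j k, (k <= j)%N -> Ex (fun x => `|p_ j x - p_ k x|) <= (4 ^+ k)^-1) ->
  exists2 p : Om -> R, itg p & forall k, Ex (fun x => `|p x - p_ k x|) <= (4 ^+ k)^-1.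
Proof.
move=> pi pp; have mp k := itg_meas (pi k).
have ip j k := itg_abs (itgB (pi j) (pi k)).
have [|p mpp hp] := cauchy_in_prob mp.
  move=> k; have a0 : 0 < (2 ^+ k)^-1 :> R by rewrite invr_gt0 exprn_gt0.
  have mm : measurable_fun setT (fun x => `|p_ k.+1 x - p_ k x|) := itg_meas (ip _ _).
  apply: (@le_trans _ _ (Pr [set x | (2 ^+ k)^-1 <= `|p_ k.+1 x - p_ k x|])).
    by apply: Pr_le; [exact: meas_lt_set|exact: meas_le_set|move=> x /ltW].
  have := markov_Ex (ip k.+1 k) (aeW _ (fun x => normr_ge0 _)) a0.
  have := pp k.+1 k (leqnSn k).
  have -> : (4 ^+ k)^-1 = (2 ^+ k)^-1 * (2 ^+ k)^-1 :> R.
    by rewrite -invfM -exprMn; congr (_ ^+ _)^-1; ring.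
  by move=> h1 h2; have := le_trans h2 h1; rewrite ler_pM2l.
have key k : (Lq 1 (fun x => `|p x - p_ k x|)%R <= ((4 ^+ k)^-1)%:E)%E.
  apply: Lq_le_in_prob => //.
  - by apply: measurableT_comp => //; exact: measurable_funB.
  move=> e e0.
  have [j [kj je]] : exists j, (k <= j)%N /\ 2 * (2 ^+ j)^-1 <= e.
    pose j0 := Num.truncn (2 / e); exists (maxn k j0); split; first exact: leq_maxl.
    have h1 : 2 / e < j0.+1%:R by exact: truncnS_gt.
    have h2 : j0.+1%:R <= 2 ^+ (maxn k j0) :> R.
      rewrite -natrX ler_nat; apply: leq_trans (ltn_expl j0 (ltnSn 1)) _.
      by rewrite leq_exp2l// leq_maxr.
    by rewrite ler_pdivrMr ?exprn_gt0// mulrC -ler_pdivrMr// (le_trans (ltW h1)).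
  exists (fun x => `|p_ j x - p_ k x|); split => //.
  - exact: itg_meas (ip _ _).
  - rewrite (Lq_norm1 (ip j k)) lee_fin; apply: (@le_trans _ _ ((4 ^+ k)^-1)); last by rewrite lerDl ltW.
    by under eq_fun do rewrite normr_id; exact: pp.
  apply: le_trans (le_trans (hp j) je); apply: Pr_le.
  - apply: meas_lt_set; last by apply: measurableT_comp => //; exact: measurable_funB.
    by apply: measurable_funD => //; exact: itg_meas (ip _ _).
  - by apply: meas_lt_set => //; apply: measurableT_comp => //; exact: measurable_funB.
  move=> x /= h; have := ler_distD (p_ j x) (p x) (p_ k x); lra.
have mk k : measurable_fun setT (fun x => `|p x - p_ k x|).
  by apply: measurableT_comp => //; exact: measurable_funB.
have pki k := itg_Lq1 (mk k) (key k).
have ppi : itg p.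
  apply: (itg_le mpp (itgD (pki 0%N).1 (itg_abs (pi 0%N)))).
  by apply: aeW => x; rewrite -{1}[p x](subrK (p_ 0%N x)) ler_normD.
exists p => // k; have [_] := pki k.
by under eq_fun do rewrite normr_id.
Qed.

End convergence_in_probability.

(** * Approximation in [H_1] *)

Section hardy_space_approximation.
Context {d : measure_display} {Om : measurableType d} {R : realType}.
Variable P : probability Om R.
Variable F : nat -> set (set Om).
Hypothesis Ffil : filtration F.
Local Notation E := (E P F).
Local Notation mart := (mart P F).
Local Notation Ex := (Ex P).
Local Notation Pr := (Pr P).
Local Notation itg := (itg P).
Local Notation bdd := (bdd P).
Local Notation L2 := (L2 P).
Local Notation mF := (mF F).
Implicit Types (f : nat -> Om -> R) (g u w : Om -> R).

Lemma SQ_opp (X : nat -> Om -> R) N x : SQ (fun k x => - X k x) N x = SQ X N x.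
Proof.
rewrite !SQE; congr Num.sqrt; apply: eq_bigr => j _.
rewrite -sqrrN; congr (_ ^+ 2); rewrite /mdiff.
by case: (j : nat) => [|k] /=; [rewrite !subr0 opprK|rewrite opprB opprK addrC].
Qed.

Lemma H1_triangle_ae (X Y Z : nat -> Om -> R) (a c : R) : (forall k, itg (X k)) ->
  (forall k, itg (Y k)) -> (forall k, itg (Z k)) ->
  {ae P, forall x, forall k, X k x = Y k x + Z k x} ->
  (H1_norm P Y <= a%:E)%E -> (H1_norm P Z <= c%:E)%E ->
  (H1_norm P X <= (2 * (a + c))%:E)%E.
Proof.
move=> Xi Yi Zi XYZ Ya Zc.
apply: H1_norm_le => // N; apply: (@le_trans _ _ (Ex (fun x => 2 * (SQ Y N x + SQ Z N x)))).
  apply: Ex_le; [exact: SQ_itg|apply: itgZ; apply: itgD; exact: SQ_itg|].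
  by apply: filterS XYZ => x; exact: SQ_quasi_triangle.
rewrite ExZ; last by apply: itgD; exact: SQ_itg.
rewrite ExD; [|exact: SQ_itg|exact: SQ_itg].
rewrite ler_pM2l// lerD// -lee_fin.
  exact: le_trans (Ex_SQ_le_H1 N Yi) _.
exact: le_trans (Ex_SQ_le_H1 N Zi) _.
Qed.

Lemma H1_opp (X : nat -> Om -> R) a : (forall k, itg (X k)) ->
  (H1_norm P X <= a%:E)%E -> (H1_norm P (fun k x => - X k x)%R <= a%:E)%E.
Proof.
move=> Xi Xa; apply: H1_norm_le => [k|N]; first exact: itgN.
rewrite (_ : SQ _ _ = SQ X N); last by apply/funext => x; exact: SQ_opp.
by rewrite -lee_fin; apply: le_trans (Ex_SQ_le_H1 N Xi) _.
Qed.

(** [f] is a martingale not presented as [mart] of a function, so the difference is taken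
    termwise. *)
Definition H1_dist f g := H1_norm P (fun n => f n \- mart g n).

Section H1_dist.
Variable f : nat -> Om -> R.
Hypothesis fi : forall k, itg (f k).

Let di g k : itg g -> itg (f k \- mart g k).
Proof. by move=> gi; apply: itgB => //; exact: E_itg. Qed.

Let sub_ae g g' : itg g -> itg g' -> {ae P, forall x, forall k,
  mart (fun x => g x - g' x) k x = mart g k x - mart g' k x}.
Proof. by move=> gi gi'; apply/ae_foralln => k; exact: mart_sub. Qed.

Lemma H1_dist_sub g g' a c : itg g -> itg g' ->
  (H1_dist f g <= a%:E)%E -> (H1_dist f g' <= c%:E)%E ->
  (H1_norm P (mart (fun x => g x - g' x)%R) <= (2 * (a + c))%:E)%E.
Proof.
move=> gi gi' ga gc; rewrite addrC.
apply: (@H1_triangle_ae _ (fun k => f k \- mart g' k) (fun k x => - (f k \- mart g k) x)) => //.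
- by move=> k; apply: E_itg => //; exact: itgB.
- by move=> k; exact: di.
- by move=> k; apply: itgN; exact: di.
- by apply: filterS (sub_ae gi gi') => x h k; rewrite h /=; ring.
- by apply: H1_opp => // k; exact: di.
Qed.

Lemma H1_dist_le g a c : itg g -> (H1_norm P f <= a%:E)%E -> (H1_dist f g <= c%:E)%E ->
  (H1_norm P (mart g) <= (2 * (a + c))%:E)%E.
Proof.
move=> gi ga gc.
apply: (@H1_triangle_ae _ f (fun k x => - (f k \- mart g k) x)) => //.
- by move=> k; exact: E_itg.
- by move=> k; apply: itgN; exact: di.
- by apply: aeW => x k /=; ring.
- by apply: H1_opp => // k; exact: di.
Qed.

Lemma H1_dist_shift g g' a c : itg g -> itg g' -> (H1_dist f g <= a%:E)%E ->
  (H1_norm P (mart (fun x => g x - g' x)%R) <= c%:E)%E ->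
  (H1_dist f g' <= (2 * (a + c))%:E)%E.
Proof.
move=> gi gi' ga gc.
apply: (@H1_triangle_ae _ (fun k => f k \- mart g k) (mart (fun x => g x - g' x))) => //.
- by move=> k; exact: di.
- by move=> k; exact: di.
- by move=> k; apply: E_itg => //; exact: itgB.
- by apply: filterS (sub_ae gi gi') => x h k; rewrite h /=; ring.
Qed.

End H1_dist.

Lemma L2_H1_bdd N u (e : R) : bdd u -> mF N u -> 0 < e -> Ex (fun x => u x ^+ 2) <= e ^+ 2 ->
  forall M, Ex (SQ (mart u) M) <= e.
Proof.
move=> ub mu e0 ue M; have ui := bdd_itg ub.
have bd k : bdd (fun y => mdiff (mart u) k y ^+ 2) by apply: bddX; exact: dmart_bdd.
have bS : bdd (SQ (mart u) M) by apply: SQ_bdd => k; exact: E_bdd.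
have h : Ex (fun x => SQ (mart u) M x ^+ 2) <= e ^+ 2.
  have -> : (fun x => SQ (mart u) M x ^+ 2) = (fun x => \sum_(k < M.+1) mdiff (mart u) k x ^+ 2).
    apply/funext => x; rewrite SQE sqr_sqrtr//; apply: sumr_ge0 => *; exact: sqr_ge0.
  apply: le_trans ue; rewrite (_ : Ex (fun x => u x ^+ 2) = Ex (fun x => E (maxn M N) u x ^+ 2)).
    rewrite (Ex_mart_sqr Ffil _ ub); apply: Ex_le.
    - by apply: bdd_itg; exact: bdd_sum.
    - by apply: bdd_itg; exact: bdd_sum.
    apply: aeW => x.
    rewrite -(big_mkord xpredT (fun k => mdiff (mart u) k x ^+ 2)).
    rewrite -[leRHS](big_mkord xpredT (fun k => mdiff (mart u) k x ^+ 2)).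
    rewrite [leRHS](@big_cat_nat _ _ _ M.+1 0 (maxn M N).+1)//= ?ltnS ?leq_maxl//.
    by rewrite lerDl; apply: sumr_ge0 => *; exact: sqr_ge0.
  have bE : bdd (E (maxn M N) u) by exact: E_bdd.
  apply: Ex_ae; [exact: bdd_meas (bddX 2 ub)|exact: bdd_meas (bddX 2 bE)|].
  by apply: filterS (E_id Ffil (mF_mono Ffil (leq_maxr M N) mu) ui) => x ->.
have := Ex_abs_le_sqr (bdd_L2 bS) e0 h.
by under eq_fun do rewrite ger0_norm ?SQ_ge0//.
Qed.

Lemma Ex_SQ_le_L1 w M : itg w ->
  Ex (SQ (mart w) M) <= 2 * M.+1%:R * Ex (fun x => `|w x|).
Proof.
move=> wi; have mi k : itg (mart w k) by exact: E_itg.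
apply: (@le_trans _ _ (Ex (fun x => \sum_(j < M.+1) `|mdiff (mart w) j x|))).
  apply: Ex_le; [exact: SQ_itg| |by apply: aeW => x; exact: SQ_le_sum].
  by apply: itg_sum => j _; apply: itg_abs; exact: mdiff_itg.
rewrite Ex_sum; last by move=> j _; apply: itg_abs; exact: mdiff_itg.
apply: (@le_trans _ _ (\sum_(j < M.+1) 2 * Ex (fun x => `|w x|))); last first.
  by rewrite sumr_const card_ord -mulr_natr le_eqVlt; apply/orP; left; apply/eqP; ring.
apply: ler_sum => j _; have w0 : 0 <= Ex (fun x => `|w x|) by apply: Ex_ge0; [exact: itg_abs|exact: aeW].
case: (j : nat) => [|k].
  rewrite (_ : (fun x => _) = (fun x => `|E 0 w x|)); last by apply/funext => x; rewrite /mdiff subr0.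
  by apply: (le_trans (E_L1 Ffil 0 wi)); lra.
apply: (@le_trans _ _ (Ex (fun x => `|E k.+1 w x| + `|E k w x|))).
  apply: Ex_le; [by apply: itg_abs; exact: mdiff_itg|by apply: itgD; apply: itg_abs; exact: mi|].
  by apply: aeW => x; exact: ler_normB.
rewrite ExD; [|exact/itg_abs/mi|exact/itg_abs/mi].
by have := E_L1 Ffil k.+1 wi; have := E_L1 Ffil k wi; lra.
Qed.

(** Orthogonality gives the bound for bounded [F_N]-measurable functions. For fixed [M], [w] is
    replaced by such a [u], so close in [L^2] that the crude [L^1] bound with factor [2 (M + 1)] on
    the remainder is harmless; [6 = 2 (2 + 1)]. *)
Lemma L2_H1 w (e : R) : L2 w -> 0 < e -> Ex (fun x => w x ^+ 2) <= e ^+ 2 ->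
  (H1_norm P (mart w) <= (6 * e)%:E)%E.
Proof.
move=> w2 e0 we; have wi := L2_itg w2.
apply: H1_norm_le => [k|M]; first exact: E_itg.
pose eta := e / (2 * M.+1%:R).
have M0 : 0 < 2 * M.+1%:R :> R by rewrite mulr_gt0.
have eta0 : 0 < eta by rewrite divr_gt0.
have eta_e : eta <= e.
  by rewrite ler_pdivrMr// ler_peMr ?(ltW e0)// -natrM ler1n.
have [_ ap] := approx_L2_all Ffil w2.
have eta20 : 0 < eta ^+ 2 by rewrite exprn_gt0.
have [N [u [ub mu wu]]] := ap _ eta20.
have ui := bdd_itg ub; have u2 := bdd_L2 ub; have wu2 := L2B w2 u2.
have wui := L2_itg wu2.
have hu : Ex (fun x => u x ^+ 2) <= (2 * e) ^+ 2.
  have wu2' : L2 (fun x => - (w x - u x)).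
    by have := L2Z (-1) wu2; under eq_fun do rewrite mulN1r.
  have := Ex_sqrD w2 wu2'.
  have -> : (fun x => (w x + - (w x - u x)) ^+ 2) = (fun x => u x ^+ 2).
    by apply/funext => x; congr (_ ^+ 2); ring.
  have -> : (fun x => (- (w x - u x)) ^+ 2) = (fun x => (w x - u x) ^+ 2).
    by apply/funext => x; rewrite sqrrN.
  have : eta ^+ 2 <= e ^+ 2 by rewrite ler_sqr ?nnegrE ?(ltW eta0) ?(ltW e0).
  have -> : (2 * e) ^+ 2 = 4 * e ^+ 2 by ring.
  by move: wu we; lra.
have e20 : 0 < 2 * e by rewrite mulr_gt0.
have h1 := L2_H1_bdd ub mu e20 hu M.
have h2 : Ex (SQ (mart (fun x => w x - u x)) M) <= e.
  apply: (le_trans (Ex_SQ_le_L1 M wui)).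
  have := Ex_abs_le_sqr wu2 eta0 wu; rewrite -(ler_pM2l M0) /eta => /le_trans; apply.
  by rewrite mulrC divfK// gt_eqF.
have mi g k : itg g -> itg (mart g k) by exact: E_itg.
have ae : {ae P, forall x, forall k, mart (fun x => w x - u x) k x = mart w k x - mart u k x}.
  by apply/ae_foralln => k; exact: mart_sub.
apply: (@le_trans _ _ (Ex (fun x => 2 * (SQ (mart u) M x + SQ (mart (fun x => w x - u x)) M x)))).
  apply: Ex_le; [by apply: SQ_itg => k; exact: mi|apply: itgZ; apply: itgD; apply: SQ_itg => k; exact: mi|].
  by apply: filterS ae => x h; apply: SQ_quasi_triangle => k; rewrite h addrC subrK.
rewrite ExZ; last by apply: itgD; apply: SQ_itg => k; exact: mi.
rewrite ExD; [|apply: SQ_itg => k; exact: mi|apply: SQ_itg => k; exact: mi].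
have -> : 6 * e = 2 * (2 * e + e) by ring.
by rewrite ler_pM2l// lerD.
Qed.

Lemma ereal_cvg0_ex (u v : nat -> \bar R) (e : R) : 0 < e ->
  u @ \oo --> 0%E -> v @ \oo --> 0%E -> exists k, (u k <= e%:E)%E /\ (v k <= e%:E)%E.
Proof.
move=> e0 cu cv.
have h (s : nat -> \bar R) : s @ \oo --> 0%E -> \forall k \near \oo, (s k <= e%:E)%E.
  move=> /fine_cvgP[sf /cvgrPdist_lt /(_ _ e0) sd]; near=> k.
  have fk : s k \is a fin_num by near: k.
  rewrite -(fineK fk) lee_fin; apply: le_trans (ler_norm _) _.
  have : `|0 - (fine \o s) k| < e by near: k.
  by rewrite sub0r normrN /= => /ltW.
have [k [uk vk]] := filter_ex (filterI (h _ cu) (h _ cv)).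
by exists k.
Unshelve. all: by end_near.
Qed.

(** A commutator of [f] comes with [L^2] functions tending to [f] in [H_1]; these are moved to
    bounded [F_N]-measurable ones. The denominator is [14 = 2 (1 + 6)]. *)
Lemma nice_dense S b f h (e : R) : (forall k, itg (f k)) -> is_abs_commutator P F S b f h -> 0 < e ->
  exists N g, [/\ bdd g, mF N g & (H1_dist f g <= e%:E)%E].
Proof.
move=> fi [_ [g [h_ [g2 gf _ _]]]] e0.
have e4 : 0 < e / 14 by rewrite divr_gt0.
have [k [k1 _]] := ereal_cvg0_ex e4 gf gf.
have gk2 : L2 (g k) by apply/Lfun2P.
have [_ ap] := approx_L2_all Ffil gk2.
have e42 : 0 < (e / 14) ^+ 2 by rewrite exprn_gt0.
have [N [u [ub mu gu]]] := ap _ e42.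
exists N, u; split => //.
have h1 := L2_H1 (L2B gk2 (bdd_L2 ub)) e4 gu.
have := H1_dist_shift fi (L2_itg gk2) (bdd_itg ub) k1 h1.
by congr (_ <= _%:E)%E; field.
Qed.

End hardy_space_approximation.

(** * Continuity of commutators from [H_1] to convergence in probability *)

Section commutator_stability.
Context {d : measure_display} {Om : measurableType d} {R : realType}.
Variable P : probability Om R.
Variable F : nat -> set (set Om).
Hypothesis Ffil : filtration F.
Local Notation E := (E P F).
Local Notation Eprev := (Eprev P F).
Local Notation mart := (mart P F).
Local Notation Ex := (Ex P).
Local Notation Pr := (Pr P).
Local Notation itg := (itg P).
Local Notation bdd := (bdd P).
Local Notation L2 := (L2 P).
Local Notation mF := (mF F).
Local Notation H1_dist := (H1_dist P F).
Implicit Types (f : nat -> Om -> R) (g u w : Om -> R).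
Variables (B : R) (b : Om -> R).
Hypotheses (B0 : 0 < B) (bi : itg b).
Hypothesis bbasic : forall n, [/\ bdd (E n b),
  {ae P, forall x, `|mdiff (mart b) n x| <= B} &
  forall A, F n A -> Ex (fun x => \1_A x * `|b x - Eprev n b x|) <= B * Pr A].
Local Notation Pi := (paraproduct P F b).
Local Notation absPi := (abs_paraproduct P F b).

Definition abs_comm (S : (Om -> R) -> Om -> R) g x := field S (fun y => b y * g y) g (b x) x.

Definition comm_small S := forall t e : R, 0 < t -> 0 < e -> exists2 dl : R, 0 < dl &
  forall N g, bdd g -> mF N g -> (H1_norm P (mart g) <= dl%:E)%E ->
    Pr [set x | t < abs_comm S g x] <= e.

Lemma comm_meas S g : operator P S -> bdd g -> measurable_fun setT (abs_comm S g).
Proof.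
move=> Sop gb; exact: (field_meas Sop (bu_itg bi gb) (bdd_itg gb) (itg_meas bi)).
Qed.

Lemma H1_mart_opp g a : itg g -> (H1_norm P (mart g) <= a%:E)%E ->
  (H1_norm P (mart (fun x => - g x)%R) <= a%:E)%E.
Proof.
move=> gi ga; have mi k : itg (mart g k) by exact: E_itg.
have mi' k : itg (mart (fun x => - g x) k) by apply: E_itg => //; exact: itgN.
apply: H1_norm_le => // M; rewrite -lee_fin; apply: le_trans (le_trans (Ex_SQ_le_H1 M mi) ga).
have h : {ae P, forall x, forall k, mart (fun x => - g x) k x = - mart g k x}.
  by apply/ae_foralln => k; exact: E_opp.
rewrite lee_fin; apply: Ex_le; [exact: SQ_itg|exact: SQ_itg|apply: filterS h => x h].
rewrite -(SQ_opp (mart g)) /SQ (_ : (mart _)^~ x = (fun k => - mart g k x))//.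
by apply/funext => k; exact: h.
Qed.

Section transfer.
Variable S : (Om -> R) -> Om -> R.
Hypotheses (Sop : operator P S) (Ssub : sublinear P S) (Smc : meas_continuous P S).
Hypothesis Ssm : comm_small S.

Lemma comm_add g w : bdd g -> bdd w ->
  {ae P, forall x, abs_comm S (fun x => g x + w x) x <= abs_comm S g x + abs_comm S w x}.
Proof.
move=> gb wb; have gi := bdd_itg gb; have wi := bdd_itg wb.
have i1 := bu_itg bi gb; have i2 := bu_itg bi wb; have i3 := bu_itg bi (bddD gb wb).
have e : {ae P, forall x, b x * (g x + w x) = b x * g x + b x * w x}.
  by apply: aeW => x; rewrite mulrDr.
have e2 : {ae P, forall x, g x + w x = g x + w x} by exact: aeW.
apply: filterS2 (field_ae Sop i3 (itgD gi wi) (itgD i1 i2) (itgD gi wi) e e2)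
  (field_add Ssub i1 gi i2 wi) => x h1 h2.
by rewrite /abs_comm h1; exact: h2.
Qed.

Lemma comm_diff g u : bdd g -> bdd u ->
  {ae P, forall x, `|abs_comm S g x - abs_comm S u x| <=
     Num.max (abs_comm S (fun x => g x - u x) x) (abs_comm S (fun x => u x - g x) x)}.
Proof.
move=> gb ub; have h1 := comm_add ub (bddB gb ub); have h2 := comm_add gb (bddB ub gb).
have e1 : (fun x => u x + (g x - u x)) = g by apply/funext => x; rewrite addrC subrK.
have e2 : (fun x => g x + (u x - g x)) = u by apply/funext => x; rewrite addrC subrK.
rewrite e1 in h1; rewrite e2 in h2; apply: filterS2 h1 h2 => x h1 h2.
by rewrite ler_norml le_max; apply/andP; split; [|apply/orP; left];
  [rewrite lerNl le_max; apply/orP; right|]; lra.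
Qed.

Lemma comm_close (t e : R) : 0 < t -> 0 < e -> exists2 dl : R, 0 < dl &
  forall N M g u, bdd g -> mF N g -> bdd u -> mF M u ->
    (H1_norm P (mart (fun x => g x - u x)%R) <= dl%:E)%E ->
    Pr [set x | t < `|abs_comm S g x - abs_comm S u x|] <= e.
Proof.
move=> t0 e0; have e2 : 0 < e / 2 by rewrite divr_gt0.
have [dl dl0 H] := Ssm t0 e2; exists dl => // N M g u gb mg ub mu gu.
have gi := bdd_itg gb; have ui := bdd_itg ub.
have bgu := bddB gb ub; have bug := bddB ub gb.
have mg' := mF_mono Ffil (leq_maxl N M) mg; have mu' := mF_mono Ffil (leq_maxr N M) mu.
have h1 := H _ _ bgu (mFB mg' mu') gu.
have ug : (H1_norm P (mart (fun x => u x - g x)%R) <= dl%:E)%E.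
  have := H1_mart_opp (bdd_itg bgu) gu.
  by rewrite (_ : (fun x => - (g x - u x)) = (fun x => u x - g x))//; apply/funext => x; rewrite opprB.
have h2 := H _ _ bug (mFB mu' mg') ug.
have -> : e = e / 2 + e / 2 by field.
have mc := comm_meas Sop; apply: le_trans (lerD h1 h2); apply: Pr_ae_U.
- by apply: meas_lt_set => //; apply: measurableT_comp => //; apply: measurable_funB; exact: mc.
- by apply: meas_lt_set => //; exact: mc.
- by apply: meas_lt_set => //; exact: mc.
by apply: filterS (comm_diff gb ub) => x h /= /lt_le_trans /(_ h); rewrite lt_max => /orP.
Qed.

Hypothesis b2 : L2 b.

(** In [field_diff], [b (g - u)] is small in [L^1] because [b] is in [L^2], and the factor [|b x|]
    of the second term is at most [M] off a small event. *)
Lemma field_L2_close (t e : R) : 0 < t -> 0 < e -> exists2 dl : R, 0 < dl &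
  forall g u, L2 g -> L2 u -> Ex (fun x => (g x - u x) ^+ 2) <= dl ^+ 2 ->
    Pr [set x | t < `|abs_comm S g x - abs_comm S u x|] <= e.
Proof.
move=> t0 e0; have e3 : 0 < e / 3 by rewrite divr_gt0.
have mb := itg_meas bi; have [M M0 bM] := tail_small P mb e3.
have t2 : 0 < t / 2 by rewrite divr_gt0.
have t2M : 0 < t / (2 * M) by rewrite divr_gt0// mulr_gt0.
have [d1 d10 H1] := Smc t2 e3; have [d2 d20 H2] := Smc t2M e3.
have Q0 : 0 <= Ex (fun x => b x ^+ 2) by apply: Ex_ge0; [exact: b2.2|apply: aeW => x; exact: sqr_ge0].
pose Q := Ex (fun x => b x ^+ 2) + 1.
have Q1 : 1 <= Q by rewrite /Q lerDr.
have Qp : 0 < Q by exact: lt_le_trans Q1.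
have dl0 : 0 < Num.min (d1 / Q) d2 by rewrite lt_min d20 divr_gt0.
exists (Num.min (d1 / Q) d2) => // g u g2 u2 gu; set dl := Num.min _ _ in dl0 gu.
have dl1 : dl <= d1 / Q by rewrite /dl ge_min lexx.
have dl2 : dl <= d2 by rewrite /dl ge_min lexx orbT.
have w2 := L2B g2 u2; have wi := L2_itg w2; have gi := L2_itg g2; have ui := L2_itg u2.
have bgi := L2_mul_itg b2 g2; have bui := L2_mul_itg b2 u2; have bwi := L2_mul_itg b2 w2.
have s1 := le_trans (Ex_abs_le_sqr w2 dl0 gu) dl2.
have s2 : Ex (fun x => `|b x * g x - b x * u x|) <= d1.
  have dQ : 0 < d1 / Q by rewrite divr_gt0.
  have : Ex (fun x => `|b x * g x - b x * u x|) <=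
     Ex (fun x => d1 / Q / 2 * b x ^+ 2 + Q / d1 / 2 * (g x - u x) ^+ 2).
    apply: Ex_le.
    - by apply/itg_abs/itgB.
    - by apply: itgD; apply: itgZ; [exact: b2.2|exact: w2.2].
    apply: aeW => x; rewrite -mulrBr normrM.
    rewrite -(real_normK (num_real (b x))) -(real_normK (num_real (g x - u x))).
    set a := `|b x|; set c := `|g x - u x|; rewrite -subr_ge0.
    have -> : d1 / Q / 2 * a ^+ 2 + Q / d1 / 2 * c ^+ 2 - a * c = (d1 * a - Q * c) ^+ 2 / (2 * d1 * Q).
      by field; rewrite !gt_eqF.
    by rewrite divr_ge0 ?sqr_ge0// ?mulr_ge0// ltW.
  rewrite ExD; [|by apply: itgZ; exact: b2.2|by apply: itgZ; exact: w2.2].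
  rewrite (ExZ _ b2.2) (ExZ _ w2.2).
  move/le_trans; apply.
  have k1 : d1 / Q / 2 * Ex (fun x => b x ^+ 2) <= d1 / Q / 2 * Q.
    by rewrite ler_wpM2l ?divr_ge0 ?(ltW d10) ?(ltW Qp)// /Q lerDl.
  have k2 : Q / d1 / 2 * Ex (fun x => (g x - u x) ^+ 2) <= Q / d1 / 2 * (d1 / Q) ^+ 2.
    rewrite ler_wpM2l ?divr_ge0 ?(ltW d10) ?(ltW Qp)// (le_trans gu)//.
    by rewrite ler_sqr ?nnegrE ?(ltW dl0) ?(ltW dQ).
  apply: (le_trans (lerD k1 k2)).
  have -> : Q / d1 / 2 * (d1 / Q) ^+ 2 = d1 / 2 * Q^-1 by field; rewrite !gt_eqF.
  have -> : d1 / Q / 2 * Q = d1 / 2 by field; rewrite !gt_eqF.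
  have : d1 / 2 * Q^-1 <= d1 / 2 by rewrite ler_piMr ?divr_ge0 ?(ltW d10)// invf_le1.
  lra.
have p1 := H1 _ (itgB bgi bui) s2; have p2 := H2 _ wi s1.
have mT w : itg w -> measurable_fun setT (fun x => `|S w x|).
  by move=> iw; apply: measurableT_comp => //; exact: (T_meas Sop iw).
have mm := mT _ (itgB bgi bui); have mw := mT _ wi.
have mab : measurable_fun setT (fun x => `|b x|) by exact: measurableT_comp.
have mg := field_meas Sop bgi gi mb; have mu := field_meas Sop bui ui mb.
have mA : measurable [set x | t < `|abs_comm S g x - abs_comm S u x|].
  by apply: meas_lt_set => //; apply: measurableT_comp => //; exact: measurable_funB.
have mA1 := meas_lt_set (measurable_cst (t / 2)) mm.
have mA2 := meas_lt_set (measurable_cst (t / (2 * M))) mw.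
have mA3 := meas_lt_set (measurable_cst M) mab.
have -> : e = e / 3 + (e / 3 + e / 3) by field.
apply: le_trans (lerD p1 (lerD bM p2)).
apply: le_trans (lerD (lexx _) (Pr_U P mA3 mA2)).
apply: Pr_ae_U => //; first exact: measurableU.
apply: filterS (field_diff Ssub bgi gi bui ui) => x /(_ (b x)) h /= th.
have [h1|h1] := ltP (t / 2) `|S (fun y => b y * g y - b y * u y) x|; [by left|right].
have [h2|h2] := ltP M `|b x|; [by left|right]; rewrite /= ltNge; apply/negP => h3.
have : `|b x| * `|S (fun y => g y - u y) x| <= M * (t / (2 * M)) by rewrite ler_pM.
have -> : M * (t / (2 * M)) = t / 2 by field; rewrite gt_eqF.
rewrite -/(abs_comm S g x) -/(abs_comm S u x) in h; move: h th h1; lra.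
Qed.

(** [h] is compared with an arbitrary [g] near [f] through a member of its approximating sequence
    and a bounded [u] near that member in [L^2]. The fractions of [dc] fit because
    [2 (1/4 + 2 (1/56 + 6/56)) = 1]. *)
Lemma commutator_transfer f h (e : R) : (forall k, itg (f k)) ->
  is_abs_commutator P F S b f h -> 0 < e -> exists2 dl : R, 0 < dl &
  forall N g, bdd g -> mF N g -> (H1_dist f g <= dl%:E)%E ->
    Pr [set x | e < `|h x - abs_comm S g x|] <= e.
Proof.
move=> fi [mh [g_ [h_ [g2 gf hg hc]]]] e0; have e3 : 0 < e / 3 by rewrite divr_gt0.
have [dc dc0 Hc] := comm_close e3 e3; have [dl dl0 Hl] := field_L2_close e3 e3.
exists (dc / 4) => [|N g gb mg fg]; first by rewrite divr_gt0.
have m0 : 0 < Num.min (dc / 56) (e / 3) by rewrite lt_min e3 divr_gt0.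
have [k [k1 k2]] := ereal_cvg0_ex m0 gf (hc _ e3).
have gk2 : L2 (g_ k) by apply/Lfun2P.
have gki := L2_itg gk2; have bgki := L2_mul_itg b2 gk2; have mb := itg_meas bi.
have n0 : 0 < Num.min (dc / 56) dl by rewrite lt_min dl0 divr_gt0.
have [_ ap] := approx_L2_all Ffil gk2.
have n20 : 0 < (Num.min (dc / 56) dl) ^+ 2 by rewrite exprn_gt0.
have [M [u [ub mu gu]]] := ap _ n20.
have ui := bdd_itg ub; have gi := bdd_itg gb.
have kd : (H1_dist f (g_ k) <= (dc / 56)%:E)%E.
  by apply: (le_trans k1); rewrite lee_fin ge_min lexx.
have ud : (H1_norm P (mart (fun x => g_ k x - u x)%R) <= (6 * (dc / 56))%:E)%E.
  apply: L2_H1 => //; [exact: L2B gk2 (bdd_L2 ub)|by rewrite divr_gt0|].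
  apply: (le_trans gu); rewrite ler_sqr ?nnegrE ?(ltW n0) ?divr_ge0 ?(ltW dc0)//.
  by rewrite ge_min lexx.
have fu := H1_dist_shift Ffil fi gki ui kd ud.
have := H1_dist_sub Ffil fi gi ui fg fu.
have -> : 2 * (dc / 4 + 2 * (dc / 56 + 6 * (dc / 56))) = dc by field.
move=> gud; have p3 := Hc _ _ _ _ gb mg ub mu gud.
have p2 : Pr [set x | e / 3 < `|abs_comm S (g_ k) x - abs_comm S u x|] <= e / 3.
  apply: Hl => //; first exact: bdd_L2.
  apply: (le_trans gu); rewrite ler_sqr ?nnegrE ?(ltW n0) ?(ltW dl0)//.
  by rewrite ge_min lexx orbT.
have [mhk hE] := abs_commutator_L2P Ssub bgki gki (hg k).
have mg' := comm_meas Sop gb; have mu' := comm_meas Sop ub.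
have mk := field_meas Sop bgki gki mb.
have mhh : measurable_fun setT (fun x => `|h_ k x - h x|).
  by apply: measurableT_comp => //; exact: measurable_funB.
have mA1 := meas_le_set (measurable_cst (e / 3)) mhh.
have p1 : Pr [set x | e / 3 <= `|h_ k x - h x|] <= e / 3.
  by rewrite -lee_fin -Pr_fin//; apply: (le_trans k2); rewrite lee_fin ge_min lexx orbT.
have mA2 : measurable [set x | e / 3 < `|abs_comm S (g_ k) x - abs_comm S u x|].
  by apply: meas_lt_set => //; apply: measurableT_comp => //; exact: measurable_funB.
have mA3 : measurable [set x | e / 3 < `|abs_comm S g x - abs_comm S u x|].
  by apply: meas_lt_set => //; apply: measurableT_comp => //; exact: measurable_funB.
have mA : measurable [set x | e < `|h x - abs_comm S g x|].
  by apply: meas_lt_set => //; apply: measurableT_comp => //; exact: measurable_funB.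
rewrite [leRHS](_ : e = e / 3 + (e / 3 + e / 3)); last by field.
apply: le_trans (lerD p1 (lerD p2 p3)).
apply: le_trans (lerD (lexx _) (Pr_U P mA2 mA3)).
apply: Pr_ae_U => //; first exact: measurableU.
apply: filterS hE => x /= hE th; rewrite -[field _ _ _ _ _]/(abs_comm S (g_ k) x) in hE.
have [h1|h1] := leP (e / 3) `|h_ k x - h x|; [by left|right].
have [h2|h2] := ltP (e / 3) `|abs_comm S (g_ k) x - abs_comm S u x|; [by left|right].
rewrite /= ltNge; apply/negP => h3; move: th; apply/negP; rewrite -leNgt.
rewrite hE distrC in h1.
have a1 := ler_distD (abs_comm S (g_ k) x) (h x) (abs_comm S g x).
have a2 := ler_distD (abs_comm S u x) (abs_comm S (g_ k) x) (abs_comm S g x).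
rewrite (distrC (abs_comm S u x)) in a2; lra.
Qed.

End transfer.

(** [E m] is linear, so [|E m (b g) - c E m g|] is itself a version continuous in [c], and
    uniqueness identifies it with the field. *)
Lemma E_comm m g : bdd g ->
  {ae P, forall x, abs_comm (E m) g x = `|E m (fun y => b y * g y) x - b x * E m g x|}.
Proof.
move=> gb; have gi := bdd_itg gb; have bgi := bu_itg bi gb.
have hE : forall c : R, {ae P, forall x, `|E m (fun y => b y * g y) x - c * E m g x| =
    `|E m (fun y => b y * g y - c * g y) x|}.
  move=> c; apply: filterS2 (E_sub Ffil m bgi (itgZ c gi)) (E_scale Ffil m c gi) => x -> ->//.
have hc : {ae P, forall x, continuous (fun c : R => `|E m (fun y => b y * g y) x - c * E m g x|)}.
  apply: aeW => x c; apply: cvg_norm; apply: cvgB; first exact: cvg_cst.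
  by apply: cvgMl; exact: cvg_id.
by apply: filterS (field_unique (E_sublinear Ffil m) bgi gi hE hc) => x ->.
Qed.

Lemma Pi_le_absPi m N u x : (m <= N)%N -> `|Pi m u x| <= absPi N u x.
Proof.
move=> mN; apply: (le_trans (Pi_le_abs _ _ _ _ _ _)); rewrite /abs_paraproduct.
rewrite -(big_mkord xpredT (fun k => `|mdiff (mart u) k x| * `|mdiff (mart b) k x|)).
rewrite -[leRHS](big_mkord xpredT (fun k => `|mdiff (mart u) k x| * `|mdiff (mart b) k x|)).
by rewrite (@big_cat_nat _ _ _ m.+1 0 N.+1)//= lerDl sumr_ge0// => *; rewrite mulr_ge0.
Qed.

Lemma Ex_Pi_le N g K : bdd g -> (H1_norm P (mart g) <= K%:E)%E ->
  Ex (fun x => `|Pi N g x|) <= 30 * B * K /\ Ex (absPi N g) <= 30 * B * K.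
Proof.
move=> gb gK; have gi := bdd_itg gb.
have h : Ex (absPi N g) <= 30 * B * K.
  apply: (le_trans (fefferman Ffil B0 bi bbasic N gb)).
  rewrite ler_wpM2l ?mulr_ge0 ?(ltW B0)// -lee_fin; apply: le_trans gK.
  by apply: Ex_SQ_le_H1 => k; exact: E_itg.
split => //; apply: le_trans h; apply: Ex_le.
- by apply/itg_abs/bdd_itg; exact: Pi_bdd bbasic _ _ gb.
- by apply: bdd_itg; exact: absPi_bdd bbasic _ _ gb.
- by apply: aeW => x; exact: Pi_le_abs.
Qed.

(** The formula for [E m (Pi N g)] is solved for the commutator; [240 = 30 + 180 + 30]. *)
Lemma E_comm_small m : comm_small (E m).
Proof.
move=> t e t0 e0; pose dl := t * e / (240 * B).
have B240 : 0 < 240 * B := mulr_gt0 (ltr0Sn R 239) B0.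
exists dl => [|N g gb mg gdl]; first by rewrite divr_gt0// mulr_gt0.
have gi := bdd_itg gb; have [pi1 pi2] := Ex_Pi_le N gb gdl.
have bPi := Pi_bdd Ffil bbasic N gb; have bab := absPi_bdd Ffil bbasic N gb.
pose Z x := MX (fun m x => (b x - E m b x) * E m g x) m x.
have Zi : itg Z.
  apply: MX_itg => k; under eq_fun do rewrite mulrC.
  by apply: itgM; [exact: E_bdd|apply: itgB => //; exact: E_itg].
have Zle : Ex Z <= 180 * B * dl.
  apply: (le_trans (max_bmo_mart Ffil B0 bi bbasic m gb)).
  rewrite ler_wpM2l ?mulr_ge0 ?(ltW B0)// -lee_fin; apply: le_trans gdl.
  by apply: Ex_SQ_le_H1 => k; exact: E_itg.
pose Y x := `|E m (Pi N g) x| + (Z x + absPi N g x).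
have iE := itg_abs (E_itg Ffil m (bdd_itg bPi)).
have iZ := itgD Zi (bdd_itg bab).
have Yi : itg Y by exact: itgD.
have YE : Ex Y <= t * e.
  rewrite /Y ExD// ExD//; last exact: bdd_itg.
  have := E_L1 Ffil m (bdd_itg bPi).
  have -> : t * e = 240 * B * dl by rewrite /dl; field; rewrite gt_eqF.
  lra.
have Y0 : {ae P, forall x, 0 <= Y x}.
  apply: aeW => x; rewrite !addr_ge0// ?MX_ge0//.
  by apply: sumr_ge0 => k _; rewrite mulr_ge0.
have mY := itg_meas Yi.
have mk := markov_Ex Yi Y0 t0; have := le_trans mk YE; rewrite ler_pM2l//.
apply: le_trans; apply: ae_meas_le.
- have mcm := comm_meas (E_operator P Ffil m) gb.
  exact: (meas_lt_set (measurable_cst t) mcm).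
- exact: meas_le_set.
have key : {ae P, forall x, `|E m (fun y => b y * g y) x - b x * E m g x| <= Y x}.
  have zz x : `|(b x - E m b x) * E m g x| <= Z x by exact: (rmax_ge (fun m => (b x - E m b x) * E m g x)).
  have [mN|Nm] := leqP m N.
    apply: filterS (E_Pi_le Ffil bi bbasic gb mg mN) => x hx.
    have -> : E m (fun y => b y * g y) x - b x * E m g x =
      E m (Pi N g) x - ((b x - E m b x) * E m g x + Pi m g x) by rewrite hx; ring.
    rewrite (le_trans (ler_normB _ _))// lerD2l (le_trans (ler_normD _ _))// lerD//.
    exact: Pi_le_absPi.
  apply: filterS (E_Pi_ge Ffil bi bbasic gb mg (ltnW Nm)) => x hx.
  have -> : E m (fun y => b y * g y) x - b x * E m g x =
    E m (Pi N g) x - ((b x - E m b x) * E m g x + Pi N g x) by rewrite hx; ring.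
  rewrite (le_trans (ler_normB _ _))// lerD2l (le_trans (ler_normD _ _))// lerD//.
  exact: Pi_le_absPi.
by apply: filterS2 key (E_comm m gb) => x h1 h2 /=; rewrite h2 => /ltW h3; exact: le_trans h1.
Qed.

End commutator_stability.

(** * The limit of the paraproducts and its [H_1] norm *)

Section paraproduct_limits.
Context {d : measure_display} {Om : measurableType d} {R : realType}.
Variable P : probability Om R.
Variable F : nat -> set (set Om).
Hypothesis Ffil : filtration F.
Local Notation E := (E P F).
Local Notation Eprev := (Eprev P F).
Local Notation mart := (mart P F).
Local Notation Ex := (Ex P).
Local Notation Pr := (Pr P).
Local Notation itg := (itg P).
Local Notation bdd := (bdd P).
Local Notation L2 := (L2 P).
Local Notation mF := (mF F).
Local Notation Lq := (Lq_norm P).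
Local Notation H1_dist := (H1_dist P F).
Implicit Types (f e : nat -> Om -> R) (g u w : Om -> R).
Variables (B : R) (b : Om -> R).
Hypotheses (B0 : 0 < B) (bi : itg b).
Hypothesis bbasic : forall n, [/\ bdd (E n b),
  {ae P, forall x, `|mdiff (mart b) n x| <= B} &
  forall A, F n A -> Ex (fun x => \1_A x * `|b x - Eprev n b x|) <= B * Pr A].
Local Notation Pi := (paraproduct P F b).
Local Notation absPi := (abs_paraproduct P F b).
Local Notation comm := (abs_comm b).

Let b2 : L2 b. Proof. exact: (bmo_L2 Ffil B0 bi bbasic). Qed.

Lemma Pi_close N M g u K : bdd g -> mF N g -> bdd u -> mF M u ->
  (H1_norm P (mart (fun x => g x - u x)%R) <= K%:E)%E ->
  Ex (fun x => `|Pi N g x - Pi M u x|) <= 30 * B * K.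
Proof.
move=> gb mg ub mu gu; have gi := bdd_itg gb; have ui := bdd_itg ub.
have bw := bddB gb ub; have wi := bdd_itg bw.
have [h _] := Ex_Pi_le Ffil B0 bi bbasic (maxn N M) bw gu.
apply: le_trans h; apply: Ex_le.
- by apply/itg_abs/itgB; apply: bdd_itg; exact: (Pi_bdd Ffil bbasic).
- by apply/itg_abs/bdd_itg; exact: (Pi_bdd Ffil bbasic).
have := Pi_add Ffil b (maxn N M) wi ui.
have -> : (fun x => g x - u x + u x) = g by apply/funext => x; rewrite subrK.
apply: filterS3 (Pi_stop Ffil b mg gi (leq_maxl N M)) (Pi_stop Ffil b mu ui (leq_maxr N M)) => x h1 h2 h3.
by rewrite -h1 -h2 h3 addrK.
Qed.

Section limits.
Variables (f : nat -> Om -> R).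
Hypothesis fi : forall k, itg (f k).
Hypothesis fdense : forall e : R, 0 < e ->
  exists N g, [/\ bdd g, mF N g & (H1_dist f g <= e%:E)%E].

(** Along approximants at distance [4^-k / (120 B)] the paraproducts are Cauchy in [L^1] at the rate
    [4^-k], the difference of two being at most [60 B] times the sum of their distances. The modulus
    [dl] is uniform in [g], so the limit does not depend on the sequence. *)
Lemma paraproduct_limit : exists2 p : Om -> R, itg p & forall e : R, 0 < e -> exists2 dl : R, 0 < dl &
  forall N g, bdd g -> mF N g -> (H1_dist f g <= dl%:E)%E -> Ex (fun x => `|p x - Pi N g x|) <= e.
Proof.
have B120 : 0 < 120 * B by rewrite mulr_gt0.
pose a k : R := (4 ^+ k)^-1 / (120 * B).
have a0 k : 0 < a k by rewrite divr_gt0// invr_gt0 exprn_gt0.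
have H k : {Ng : nat * (Om -> R) | [/\ bdd Ng.2, mF Ng.1 Ng.2 & (H1_dist f Ng.2 <= (a k)%:E)%E]}.
  by apply: cid; have [N [g h]] := fdense (a0 k); exists (N, g).
pose N k := (sval (H k)).1; pose g k := (sval (H k)).2.
have gb k : bdd (g k) by case: (svalP (H k)).
have mg k : mF (N k) (g k) by case: (svalP (H k)).
have ga k : (H1_dist f (g k) <= (a k)%:E)%E by case: (svalP (H k)).
have pb k : bdd (Pi (N k) (g k)) by exact: (Pi_bdd Ffil bbasic).
have close k M u c : bdd u -> mF M u -> (H1_dist f u <= c%:E)%E ->
    Ex (fun x => `|Pi M u x - Pi (N k) (g k) x|) <= 60 * B * (c + a k).
  move=> ub mu uc.
  have := Pi_close ub mu (gb k) (mg k) (H1_dist_sub Ffil fi (bdd_itg ub) (bdd_itg (gb k)) uc (ga k)).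
  by move/le_trans; apply; rewrite le_eqVlt; apply/orP; left; apply/eqP; ring.
have [|p pi pp] := L1_complete (fun k => bdd_itg (pb k)).
  move=> j k kj; apply: (le_trans (close k _ _ _ (gb j) (mg j) (ga j))).
  have ajk : a j <= a k.
    rewrite ler_pM2r ?invr_gt0// lef_pV2 ?posrE ?exprn_gt0//.
    by rewrite ler_weXn2l// ler1n.
  have -> : (4 ^+ k)^-1 = 120 * B * a k by rewrite /a [RHS]mulrCA divff ?gt_eqF// mulr1.
  have : 60 * B * a j <= 60 * B * a k by rewrite ler_wpM2l// mulr_ge0// ltW.
  lra.
exists p => // e e0; exists (e / (120 * B)) => [|M u ub mu uc]; first by rewrite divr_gt0.
have [k ke] : exists k, (4 ^+ k)^-1 <= e / 3 :> R.
  pose k := Num.truncn (3 / e); exists k.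
  have h1 : 3 / e < k.+1%:R by exact: truncnS_gt.
  have h2 : k.+1%:R <= 4 ^+ k :> R by rewrite -natrX ler_nat ltn_expl.
  rewrite -[leRHS]invrK invf_div lef_pV2 ?posrE ?exprn_gt0 ?divr_gt0//.
  by rewrite (le_trans (ltW h1)).
have h1 := close k _ _ _ ub mu uc.
have Pu : bdd (Pi M u) by exact: (Pi_bdd Ffil bbasic).
have i1 := itg_abs (itgB pi (bdd_itg (pb k))); have i2 := itg_abs (itgB (bdd_itg Pu) (bdd_itg (pb k))).
apply: (@le_trans _ _ (Ex (fun x => `|p x - Pi (N k) (g k) x| + `|Pi M u x - Pi (N k) (g k) x|))).
  apply: Ex_le; [exact/itg_abs/itgB/bdd_itg|exact: itgD|apply: aeW => x].
  by have := ler_distD (Pi (N k) (g k) x) (p x) (Pi M u x); rewrite (distrC (Pi (N k) (g k) x)).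
rewrite ExD//; have := pp k.
have : 60 * B * (e / (120 * B) + a k) = e / 2 + (4 ^+ k)^-1 / 2.
  by rewrite /a; set z := (4 ^+ k)^-1; field; rewrite gt_eqF.
lra.
Qed.

Variable e : nat -> Om -> R.
Hypothesis ecomm : forall n, is_abs_commutator P F (E n) b f (e n).
Variable p : Om -> R.
Hypothesis pi : itg p.
Hypothesis pE : forall e : R, 0 < e -> exists2 dl : R, 0 < dl &
  forall N g, bdd g -> mF N g -> (H1_dist f g <= dl%:E)%E -> Ex (fun x => `|p x - Pi N g x|) <= e.

Let e_meas n : measurable_fun setT (e n). Proof. by case: (ecomm n). Qed.
Let W g m x := (b x - E m b x) * E m g x.

Let W_itg g m : bdd g -> itg (W g m).
Proof.
move=> gb; rewrite /W; under eq_fun do rewrite mulrC.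
by apply: itgM; [exact: E_bdd|apply: itgB => //; exact: E_itg].
Qed.

(** In the bound on [E m (Pi N g)], the commutator is exchanged for [e m] and [Pi N g] for [p], each
    up to [t / 2] off an event of probability at most [s / 2]. *)
Lemma E_paraproduct_step m (t s : R) : 0 < t -> 0 < s -> exists2 dl : R, 0 < dl &
  forall N g, bdd g -> mF N g -> (H1_dist f g <= dl%:E)%E ->
  Pr [set x | `|e m x| + `|W g m x| + absPi N g x + t < `|E m p x|] <= s.
Proof.
move=> t0 s0; have c0 : 0 < Num.min (t / 2) (s / 2) by rewrite lt_min !divr_gt0.
have s2 : 0 < s / 2 by rewrite divr_gt0.
have t2 : 0 < t / 2 by rewrite divr_gt0.
have [d1 d10 H1] := commutator_transfer Ffil bi (E_operator P Ffil m) (E_sublinear Ffil m)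
  (E_meas_continuous P Ffil m) (E_comm_small Ffil B0 bi bbasic m) b2 fi (ecomm m) c0.
have [d2 d20 H2] := E_meas_continuous P Ffil m t2 s2.
have [d3 d30 H3] := pE d20.
exists (Num.min d1 d3) => [|N g gb mg gf]; first by rewrite lt_min d10.
have gf1 : (H1_dist f g <= d1%:E)%E by apply: (le_trans gf); rewrite lee_fin ge_min lexx.
have gf3 : (H1_dist f g <= d3%:E)%E by apply: (le_trans gf); rewrite lee_fin ge_min lexx orbT.
have bPi : bdd (Pi N g) := Pi_bdd Ffil bbasic N gb.
have q1 := H1 _ _ gb mg gf1; have q2 := H2 _ (itgB pi (bdd_itg bPi)) (H3 _ _ gb mg gf3).
have mcm := comm_meas bi (E_operator P Ffil m) gb.
have mA1 : measurable [set x | Num.min (t / 2) (s / 2) < `|e m x - comm (E m) g x|].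
  by apply: meas_lt_set => //; apply: measurableT_comp => //; exact: measurable_funB.
have ab := bdd_meas (absPi_bdd Ffil bbasic N gb).
have mp := itg_meas (E_itg Ffil m pi).
have mE := itg_meas (E_itg Ffil m (itgB pi (bdd_itg bPi))).
have mA2 : measurable [set x | t / 2 < `|E m (fun x => p x - Pi N g x) x|].
  by apply: meas_lt_set => //; exact: measurableT_comp.
have mW := itg_meas (W_itg m gb).
have mA : measurable [set x | `|e m x| + `|W g m x| + absPi N g x + t < `|E m p x|].
  apply: meas_lt_set; last exact: measurableT_comp.
  apply: measurable_funD => //; apply: measurable_funD => //.
  by apply: measurable_funD; exact: measurableT_comp.
have m2 : Num.min (t / 2) (s / 2) <= s / 2 by rewrite ge_min lexx orbT.
have m1 : Num.min (t / 2) (s / 2) <= t / 2 by rewrite ge_min lexx.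
have -> : s = s / 2 + s / 2 by field.
apply: le_trans (lerD (le_trans q1 m2) q2).
apply: Pr_ae_U => //.
apply: filterS3 (E_comm Ffil bi m gb) (E_Pi_bound Ffil bi bbasic m gb mg)
  (E_sub Ffil m pi (bdd_itg bPi)) => x h1 h2 h3 /= h4.
rewrite -/(W g m x) -h1 in h2.
have [k1|k1] := ltP (Num.min (t / 2) (s / 2)) `|e m x - comm (E m) g x|; [by left|right].
rewrite ltNge; apply/negP => k2; move: h4; apply/negP; rewrite -leNgt.
have c1 : comm (E m) g x <= `|e m x| + t / 2.
  have := ler_norm (comm (E m) g x); have := ler_distD (e m x) (comm (E m) g x) 0.
  by rewrite !subr0 (distrC _ (e m x)); lra.
have := ler_normD (E m (fun x => p x - Pi N g x) x) (E m (Pi N g) x).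
rewrite {1}h3 subrK; lra.
Qed.

(** Finitely many times are handled one by one; the tolerance is halved at each step so that the
    exceptional events add up to [t]. *)
Lemma E_paraproduct_max M (t : R) : 0 < t -> exists2 dl : R, 0 < dl &
  forall N g, bdd g -> mF N g -> (H1_dist f g <= dl%:E)%E ->
  Pr [set x | MX e M x + MX (W g) M x + absPi N g x + t < MX (mart p) M x] <= t.
Proof.
have mm N g k : bdd g -> measurable_fun setT (fun x => MX e k x + MX (W g) k x + absPi N g x).
  move=> gb; apply: measurable_funD; last exact: bdd_meas (absPi_bdd Ffil bbasic N gb).
  by apply: measurable_funD; [exact: MX_meas|apply: MX_meas => j; exact: itg_meas (W_itg j gb)].
have mA N g k (t' : R) : bdd g ->
    measurable [set x | MX e k x + MX (W g) k x + absPi N g x + t' < MX (mart p) k x].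
  move=> gb; apply: meas_lt_set; last by apply: MX_meas => j; exact: itg_meas (E_itg Ffil j pi).
  by apply: measurable_funD => //; exact: mm.
elim: M t => [|M IH] t t0.
  have [dl dl0 H] := E_paraproduct_step 0 t0 t0; exists dl => // N g gb mg gf.
  apply: le_trans (H _ _ gb mg gf); apply: Pr_le; first exact: mA.
    apply: meas_lt_set; last by apply: measurableT_comp => //; exact: itg_meas (E_itg Ffil 0 pi).
    apply: measurable_funD => //; apply: measurable_funD; last exact: bdd_meas (absPi_bdd Ffil bbasic N gb).
    by apply: measurable_funD; apply: measurableT_comp => //; exact: itg_meas (W_itg 0 gb).
  by move=> x /=; rewrite /MX !rmax0.
have t2 : 0 < t / 2 by rewrite divr_gt0.
have [d1 d10 H1] := IH _ t2; have [d2 d20 H2] := E_paraproduct_step M.+1 t2 t2.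
exists (Num.min d1 d2) => [|N g gb mg gf]; first by rewrite lt_min d10.
have gf1 : (H1_dist f g <= d1%:E)%E by apply: (le_trans gf); rewrite lee_fin ge_min lexx.
have gf2 : (H1_dist f g <= d2%:E)%E by apply: (le_trans gf); rewrite lee_fin ge_min lexx orbT.
have q1 := H1 _ _ gb mg gf1; have q2 := H2 _ _ gb mg gf2.
rewrite [leRHS](_ : t = t / 2 + t / 2); last by field.
apply: le_trans (lerD q1 q2); apply: Pr_ae_U; [exact: mA|exact: mA| |].
  apply: meas_lt_set; last by apply: measurableT_comp => //; exact: itg_meas (E_itg Ffil _ pi).
  apply: measurable_funD => //; apply: measurable_funD; last exact: bdd_meas (absPi_bdd Ffil bbasic N gb).
  by apply: measurable_funD; apply: measurableT_comp => //; exact: itg_meas (W_itg _ gb).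
apply: aeW => x /=.
have l1 : MX e M x <= MX e M.+1 x by exact: rmax_leS.
have l2 : MX (W g) M x <= MX (W g) M.+1 x by exact: rmax_leS.
have l3 : `|e M.+1 x| <= MX e M.+1 x by exact: (rmax_ge (e ^~ x)).
have l4 : `|W g M.+1 x| <= MX (W g) M.+1 x by exact: (rmax_ge ((W g) ^~ x)).
rewrite {3}/MX rmaxS lt_max -/(MX (mart p) M x) => /orP[h|h]; [left|right].
  lra.
by move: h; rewrite /Defs.mart; lra.
Qed.

(** Fatou's lemma in probability is applied to the maximal function of [p]. [W g] and [absPi]
    contribute [(180 + 30) B] times the [H_1] norm of [g], which is at most [2 beta] up to a small
    error: hence 420. *)
Lemma H1_paraproduct (beta A : R) : (H1_norm P f <= beta%:E)%E -> 0 <= A -> 0 <= beta ->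
  ('N[P]_1[commutator_max e] <= A%:E)%E ->
  (H1_norm P (mart p) <= (2 * (A + 420 * B * beta))%:E)%E.
Proof.
move=> fb A0 be0 eA.
have mi k : itg (mart p k) by exact: E_itg.
have Bb0 := mulr_ge0 (mulr_ge0 (ler0n R 420) (ltW B0)) be0.
have Kb : 0 <= A + 420 * B * beta by rewrite addr_ge0.
apply: H1_norm_le => // M; apply: (le_trans (davis_square_le_max Ffil M (mart_is_mart Ffil pi))).
rewrite ler_pM2l//.
have mMe : measurable_fun setT (MX e M) by exact: MX_meas.
have eM : (Lq 1 (MX e M) <= A%:E)%E.
  apply: le_trans eA; rewrite /Lq_norm !Lnorm1.
  have mc : measurable_fun setT (commutator_max e).
    rewrite (_ : commutator_max e = (fun x => esups (fun n => (`|e n x|)%:E) 0)).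
      by apply: measurable_fun_esups => n; apply/measurable_EFinP; exact: measurableT_comp.
    apply/funext => x; rewrite /commutator_max /esups /sdrop /=; congr ereal_sup.
    by apply/seteqP; split => _ [n _ <-]; exists n.
  apply: ge0_le_integral => //.
  - by apply: measurableT_comp => //; exact/measurable_EFinP.
  - exact: measurableT_comp.
  move=> x _ /=; rewrite ger0_norm ?MX_ge0//; apply: le_trans (lee_abs _).
  have sup n : ((`|e n x|)%:E <= commutator_max e x)%E by apply: ereal_sup_ubound; exists n.
  elim: (M) => [|k IH]; first by rewrite /MX rmax0.
  by rewrite /MX rmaxS -/(MX e k x) EFin_max ge_max IH sup.
have mX := MX_itg M mi.
suff h : (Lq 1 (MX (mart p) M) <= (A + 420 * B * beta)%:E)%E.
  have [_] := itg_Lq1 (itg_meas mX) h.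
  by under eq_fun do rewrite ger0_norm ?MX_ge0//.
apply: Lq_le_in_prob => //.
- exact: itg_meas mX.
- by move=> x; exact: MX_ge0.
move=> t t0.
have [d1 d10 H1] := E_paraproduct_max M t0.
have B420 : 0 < 420 * B by rewrite mulr_gt0 ?ltr0n ?B0.
have d0 : 0 < Num.min d1 (t / (420 * B)) by rewrite lt_min d10 divr_gt0.
have [N [g [gb mg gf]]] := fdense d0.
have gf1 : (H1_dist f g <= d1%:E)%E by apply: (le_trans gf); rewrite lee_fin ge_min lexx.
have gf2 : (H1_dist f g <= (t / (420 * B))%:E)%E by apply: (le_trans gf); rewrite lee_fin ge_min lexx orbT.
have gK := H1_dist_le Ffil fi (bdd_itg gb) fb gf2.
have [_ p2] := Ex_Pi_le Ffil B0 bi bbasic N gb gK.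
have mk k : itg (mart g k) by apply: E_itg => //; exact: bdd_itg.
have p1 : Ex (MX (W g) M) <= 180 * B * (2 * (beta + t / (420 * B))).
  apply: (le_trans (max_bmo_mart Ffil B0 bi bbasic M gb)).
  rewrite ler_wpM2l ?mulr_ge0 ?(ltW B0)// -lee_fin; apply: le_trans gK.
  exact: Ex_SQ_le_H1.
have iW := MX_itg M (fun k => W_itg k gb).
have bab := absPi_bdd Ffil bbasic N gb.
have ab0 x : 0 <= absPi N g x by apply: sumr_ge0 => k _; rewrite mulr_ge0.
have iS := itgD iW (bdd_itg bab).
exists (fun x => MX e M x + MX (W g) M x + absPi N g x); split.
- by apply: measurable_funD; [apply: measurable_funD => //; exact: itg_meas iW|exact: bdd_meas bab].
- by move=> x; rewrite !addr_ge0 ?MX_ge0.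
- under eq_fun do rewrite -addrA.
  apply: (le_trans (Lq_add P (lexx 1) mMe (itg_meas iS))).
  have -> : A + 420 * B * beta + t = A + 210 * B * (2 * (beta + t / (420 * B))).
    by field; rewrite gt_eqF.
  rewrite EFinD; apply: leeD => //; rewrite Lq_norm1// lee_fin.
  under eq_fun do rewrite ger0_norm ?addr_ge0 ?MX_ge0//.
  rewrite ExD//; last exact: bdd_itg.
  lra.
- exact: H1.
Qed.

End limits.
End paraproduct_limits.

(** * Commutators of operators of class [K_q] *)

Section class_K_commutator.
Context {d : measure_display} {Om : measurableType d} {R : realType}.
Variable P : probability Om R.
Variable F : nat -> set (set Om).
Hypothesis Ffil : filtration F.
Local Notation E := (E P F).
Local Notation Eprev := (Eprev P F).
Local Notation mart := (mart P F).
Local Notation Ex := (Ex P).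
Local Notation Pr := (Pr P).
Local Notation itg := (itg P).
Local Notation bdd := (bdd P).
Local Notation mF := (mF F).
Local Notation Lq := (Lq_norm P).
Local Notation H1_dist := (H1_dist P F).
Implicit Types (f e : nat -> Om -> R) (g u w : Om -> R).
Variables (q : R) (T : (Om -> R) -> Om -> R).
Hypotheses (q1 : 1 <= q) (Top : operator P T) (Tsub : sublinear P T).
Hypothesis Tmc : meas_continuous P T.
Variable C1 : R.
Hypothesis C10 : 0 <= C1.
Hypothesis TH1 : forall f : Om -> R, f \in Lfun P 1%E -> H1 P F (mart f) ->
    (Lq q (T f) <= C1%:E * H1_norm P (mart f))%E.
Variables (B p C2 : R) (b : Om -> R).
Hypotheses (B0 : 0 < B) (bi : itg b) (C20 : 0 <= C2).
Hypotheses (bBMO : BMO P F p b) (bB : (BMO_norm P F p b <= B%:E)%E).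
Hypothesis bbasic : forall n, [/\ bdd (E n b),
  {ae P, forall x, `|mdiff (mart b) n x| <= B} &
  forall A, F n A -> Ex (fun x => \1_A x * `|b x - Eprev n b x|) <= B * Pr A].
Hypotheses (Tatom : atom_condition P F p q T C2) (Tjump : jump_condition P F p q T C2).
Local Notation Pi := (paraproduct P F b).
Local Notation comm := (abs_comm b T).

Let q0 : 0 < q. Proof. exact: lt_le_trans q1. Qed.
Let b2 : L2 P b. Proof. exact: (bmo_L2 Ffil B0 bi bbasic). Qed.

(** [77 = 4 + 1 + 72]: jumps, bottom atom and remaining atoms of the decomposition, all charged at
    the rate [2 C2 + 120 C1] of atoms. *)
Definition comm_const : R := 77 * (2 * C2 + 120 * C1).

Lemma comm_const_ge0 : 0 <= comm_const.
Proof. by rewrite mulr_ge0// addr_ge0// mulr_ge0. Qed.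

Lemma nice_dominated N g (K : R) : bdd g -> mF N g -> 0 < K ->
  (H1_norm P (mart g) <= K%:E)%E -> dominated_comm P F q T b N g (comm_const * (B * K)).
Proof.
move=> gb mg K0 gK; have gi := bdd_itg gb.
have SK : Ex (SQ (mart g) N) <= K.
  by rewrite -lee_fin; apply: le_trans gK; apply: Ex_SQ_le_H1 => k; exact: E_itg.
have [m [a [A [w0 [w [aP aK [w0P wP] AK gE]]]]]] := davis_decomposition Ffil gb mg K0 SK.
have ab k : bdd (a k) by case: (aP k).
have w0b : bdd w0 by case: w0P => _ [].
have wb j (n : 'I_N) : bdd (w j n) by case: (wP j n (ltn_ord n)) => _ [].
pose G := fun x => \sum_(k < N.+1) a k x + (w0 x + \sum_(j < m) \sum_(n < N) w j n x).
have sb1 : bdd (fun x => \sum_(k < N.+1) a k x) by apply: bdd_sum => k _.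
have sb2 j : bdd (fun x => \sum_(n < N) w j n x) by apply: bdd_sum => n _.
have sb3 : bdd (fun x => \sum_(j < m) \sum_(n < N) w j n x) by apply: bdd_sum => j _.
have Gb : bdd G by exact: bddD sb1 (bddD w0b sb3).
apply: (@dominated_ae _ _ _ _ _ Ffil _ _ Top _ _ bi bbasic _ G) => //.
  by apply: filterS gE => x ->.
have h1 : dominated_comm P F q T b N (fun x => \sum_(k < N.+1) a k x)
    (\sum_(k < N.+1) (2 * C2 + 58 * C1) * (B * Ex (fun x => `|a k x|))).
  apply: (dominated_sum Ffil q1 Top Tsub bi bbasic) => [k|k]; first exact: ab.
  have [_ mk Ek] := aP k.
  exact: (jump_dominated Ffil q1 Top Tsub C10 TH1 B0 bi C20 bBMO bB bbasic Tjump (leq_ord k) (ab k) mk Ek).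
have h2 := atom_dominated Ffil q1 Top Tsub C10 TH1 B0 bi C20 bBMO bB bbasic Tatom w0P.
have h3 : dominated_comm P F q T b N (fun x => \sum_(j < m) \sum_(n < N) w j n x)
    (\sum_(j < m) \sum_(n < N) (2 * C2 + 120 * C1) * (B * (2 ^+ j.+1 * K * Pr (A j n)))).
  apply: (dominated_sum Ffil q1 Top Tsub bi bbasic) => [j|j]; first exact: sb2.
  apply: (dominated_sum Ffil q1 Top Tsub bi bbasic) => [n|n]; first exact: wb.
  exact: (atom_dominated Ffil q1 Top Tsub C10 TH1 B0 bi C20 bBMO bB bbasic Tatom (wP j n (ltn_ord n))).
have h := dominated_add Ffil q1 Top Tsub bi bbasic sb1 (bddD w0b sb3) h1
  (dominated_add Ffil q1 Top Tsub bi bbasic w0b sb3 h2 h3).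
apply: dominated_le h.
rewrite Pr_setT mulr1.
have -> : \sum_(k < N.+1) (2 * C2 + 58 * C1) * (B * Ex (fun x => `|a k x|)) =
    (2 * C2 + 58 * C1) * (B * \sum_(k < N.+1) Ex (fun x => `|a k x|)).
  by rewrite !mulr_sumr.
have -> : \sum_(j < m) \sum_(n < N) (2 * C2 + 120 * C1) * (B * (2 ^+ j.+1 * K * Pr (A j n))) =
    (2 * C2 + 120 * C1) * (B * \sum_(j < m) \sum_(n < N) 2 ^+ j.+1 * K * Pr (A j n)).
  by rewrite !mulr_sumr; apply: eq_bigr => j _; rewrite !mulr_sumr.
have c1 : 0 <= 2 * C2 + 58 * C1 by rewrite addr_ge0// mulr_ge0.
have c2 : 0 <= 2 * C2 + 120 * C1 by rewrite addr_ge0// mulr_ge0.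
have k1 := ler_wpM2l c1 (ler_wpM2l (ltW B0) aK).
have k2 := ler_wpM2l c2 (ler_wpM2l (ltW B0) AK).
apply: (le_trans (lerD k1 (lerD (lexx _) k2))); rewrite /comm_const.
have BK : 0 <= B * K by rewrite mulr_ge0// ltW.
have CBK : 0 <= C1 * (B * K) by rewrite mulr_ge0.
rewrite -subr_ge0.
have -> : 77 * (2 * C2 + 120 * C1) * (B * K) - ((2 * C2 + 58 * C1) * (B * (4 * K)) +
  ((2 * C2 + 120 * C1) * (B * K) + (2 * C2 + 120 * C1) * (B * (72 * K)))) = 248 * (C1 * (B * K)) by ring.
exact: mulr_ge0 (ler0n R 248) CBK.
Qed.

Lemma nice_commutator N g (K : R) : bdd g -> mF N g -> 0 < K ->
  (H1_norm P (mart g) <= K%:E)%E -> exists Rr : Om -> R,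
  [/\ measurable_fun setT Rr, forall x, 0 <= Rr x, (Lq q Rr <= (comm_const * (B * K))%:E)%E &
   {ae P, forall x, comm g x <= Rr x + `|T (Pi N g) x|}].
Proof.
move=> gb mg K0 gK; have [Rr [h1 h2 h3 h4]] := nice_dominated gb mg K0 gK.
exists Rr; split => //.
have gi := bdd_itg gb; have bgi := bu_itg bi gb.
have Pii : itg (Pi N g) by apply: bdd_itg; exact: (Pi_bdd Ffil bbasic).
have i0 := itg_cst P (0 : R); have ui := bu_Pi_itg Ffil bi bbasic N gb.
have e1 : {ae P, forall x, b x * g x = (b x * g x - Pi N g x) + Pi N g x}.
  by apply: aeW => x; rewrite subrK.
have e2 : {ae P, forall x, g x = g x + cst 0 x} by apply: aeW => x; rewrite addr0.
have z0 : {ae P, forall x, T (cst 0) x = 0} by apply: (T_zero Top Tsub i0); exact: aeW.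
apply: filterS3 (filterI h4 z0)
  (filterI (field_ae Top bgi gi (itgD ui Pii) (itgD gi i0) e1 e2) (field_add Tsub ui gi Pii i0))
  (field_bound Tsub Pii i0) => x [k1 k2] [k3 k4] k5.
rewrite /abs_comm k3 (le_trans (k4 _))// lerD//.
by have := k5 (b x); rewrite k2 normr0 mulr0 addr0.
Qed.

(** The majorant is small in [L^q], hence in probability. Fefferman's inequality makes [Pi N g]
    small in [L^1] only, and the weak-type bound turns this into smallness of [T (Pi N g)] in
    probability. *)
Lemma T_comm_small : comm_small P F b T.
Proof.
move=> t s t0 s0; have t2 : 0 < t / 2 by rewrite divr_gt0.
have s2 : 0 < s / 2 by rewrite divr_gt0.
have [d1 d10 H1] := Tmc t2 s2.
pose c := t / 2 * (s / 2) `^ q^-1.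
have c0 : 0 < c by rewrite mulr_gt0// powR_gt0.
have C0 : 0 < comm_const + 1 by rewrite ltr_wpDl// comm_const_ge0.
have k10 : 0 < c / ((comm_const + 1) * B) by rewrite divr_gt0// mulr_gt0.
have k20 : 0 < d1 / (30 * B) by rewrite divr_gt0// mulr_gt0.
pose K := Num.min (c / ((comm_const + 1) * B)) (d1 / (30 * B)).
have K0 : 0 < K by rewrite lt_min k10.
exists K => // N g gb mg gK.
have [Rr [mR R0 RK gR]] := nice_commutator gb mg K0 gK.
have [p1 _] := Ex_Pi_le Ffil B0 bi bbasic N gb gK.
have Pii : itg (Pi N g) by apply: bdd_itg; exact: (Pi_bdd Ffil bbasic).
have q2 : Pr [set x | t / 2 < `|T (Pi N g) x|] <= s / 2.
  apply: H1 => //; apply: (le_trans p1).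
  have : K <= d1 / (30 * B) by rewrite /K ge_min lexx orbT.
  by rewrite ler_pdivlMr ?mulr_gt0// mulrC.
have q3 : Pr [set x | t / 2 < Rr x] <= s / 2.
  apply: (Lq_markov q0 mR t2 (ltW s2) RK); rewrite -/c.
  have : K <= c / ((comm_const + 1) * B) by rewrite /K ge_min lexx.
  rewrite ler_pdivlMr ?mulr_gt0//; apply: le_trans.
  have -> : K * ((comm_const + 1) * B) = comm_const * (B * K) + B * K by ring.
  by rewrite lerDl mulr_ge0// ltW.
have mT : measurable_fun setT (fun x => `|T (Pi N g) x|).
  by apply: measurableT_comp => //; exact: (T_meas Top Pii).
have -> : s = s / 2 + s / 2 by field.
apply: le_trans (lerD q3 q2); apply: Pr_ae_U.
- exact: (meas_lt_set (measurable_cst t) (comm_meas bi Top gb)).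
- exact: (meas_lt_set (measurable_cst (t / 2)) mR).
- exact: (meas_lt_set (measurable_cst (t / 2)) mT).
apply: filterS gR => x h1 /= h2.
have [k1|k1] := ltP (t / 2) (Rr x); [by left|right].
rewrite ltNge; apply/negP => k2; move: h2; apply/negP; rewrite -leNgt; lra.
Qed.

Variables (f : nat -> Om -> R).
Hypothesis fi : forall k, itg (f k).

(** [T (Pi N g)] need not have an [L^q] bound uniform in [g]; it is close in probability to [T r],
    with [r] the limit of the paraproducts, and [T r] has one. Fatou's lemma in probability then
    applies to [h]. *)
Lemma commutator_bound (e : nat -> Om -> R) (h : Om -> R) (beta A : R) :
  (H1_norm P f <= beta%:E)%E -> 0 <= beta -> 0 <= A ->
  ('N[P]_1[commutator_max e] <= A%:E)%E ->
  (forall n, is_abs_commutator P F (E n) b f (e n)) ->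
  is_abs_commutator P F T b f h ->
  (Lq q h <= (comm_const * (B * (2 * beta)) + C1 * (2 * (A + 420 * B * beta)))%:E)%E.
Proof.
move=> fb be0 A0 eA ecomm hcomm.
have fdense s : 0 < s -> exists N g, [/\ bdd g, mF N g & (H1_dist f g <= s%:E)%E].
  exact: nice_dense hcomm.
have mh : measurable_fun setT h by case: hcomm.
have [r ri rE] := paraproduct_limit Ffil B0 bi bbasic fi fdense.
have rH := H1_paraproduct Ffil B0 bi bbasic fi fdense ecomm ri rE fb A0 be0 eA.
have Tr := H1_T Ffil C10 TH1 ri rH.
have cc0 := comm_const_ge0.
have K0 : 0 <= comm_const * (B * (2 * beta)) + C1 * (2 * (A + 420 * B * beta)).
  apply: addr_ge0; first exact: mulr_ge0 cc0 (mulr_ge0 (ltW B0) (mulr_ge0 (ler0n R 2) be0)).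
  have Bb0 := mulr_ge0 (mulr_ge0 (ler0n R 420) (ltW B0)) be0.
  exact: mulr_ge0 C10 (mulr_ge0 (ler0n R 2) (addr_ge0 A0 Bb0)).
have mah : measurable_fun setT (fun x => `|h x|) by exact: measurableT_comp.
apply: (@le_trans _ _ (Lq q (fun x => `|h x|%R))).
  by apply: Lq_le => //; apply: aeW => x; rewrite normr_id.
apply: Lq_le_in_prob => // t t0.
have t2 : 0 < t / 2 by rewrite divr_gt0.
have [d1 d10 H1] := commutator_transfer Ffil bi Top Tsub Tmc T_comm_small b2 fi hcomm t2.
have [d2 d20 H2] := Tmc t2 t2; have [d3 d30 H3] := rE _ d20.
have C0 : 0 < comm_const + 1 by rewrite ltr_wpDl.
pose d4 := t / (2 * B * (comm_const + 1)).
have d40 : 0 < d4 by rewrite divr_gt0// !mulr_gt0.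
pose dl := Num.min d1 (Num.min d3 d4).
have dl0 : 0 < dl by rewrite !lt_min d10 d30.
have [N [g [gb mg gf]]] := fdense _ dl0.
have le1 : dl <= d1 by rewrite /dl ge_min lexx.
have le3 : dl <= d3 by rewrite /dl !ge_min lexx orbT.
have le4 : dl <= d4 by rewrite /dl !ge_min lexx !orbT.
have gf1 : (H1_dist f g <= d1%:E)%E by apply: (le_trans gf); rewrite lee_fin.
have gf3 : (H1_dist f g <= d3%:E)%E by apply: (le_trans gf); rewrite lee_fin.
have gK := H1_dist_le Ffil fi (bdd_itg gb) fb gf.
have bd0 : 0 < 2 * (beta + dl) by rewrite mulr_gt0// ltr_wpDl.
have [Rr [mR R0 RK gR]] := nice_commutator gb mg bd0 gK.
have Pii : itg (Pi N g) by apply: bdd_itg; exact: (Pi_bdd Ffil bbasic).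
have p1 := H1 _ _ gb mg gf1; have p2 := H2 _ (itgB ri Pii) (H3 _ _ gb mg gf3).
have mTr : measurable_fun setT (fun x => `|T r x|).
  by apply: measurableT_comp => //; exact: (T_meas Top ri).
exists (fun x => Rr x + `|T r x|); split.
- exact: measurable_funD.
- by move=> x; rewrite addr_ge0.
- apply: (le_trans (Lq_add P q1 mR mTr)).
  have -> : comm_const * (B * (2 * beta)) + C1 * (2 * (A + 420 * B * beta)) + t =
     (comm_const * (B * (2 * beta)) + t) + C1 * (2 * (A + 420 * B * beta)) by ring.
  rewrite [leRHS]EFinD; apply: leeD.
    apply: (le_trans RK); rewrite lee_fin.
    have -> : comm_const * (B * (2 * (beta + dl))) =
      comm_const * (B * (2 * beta)) + comm_const * (2 * B) * dl by ring.
    rewrite lerD2l; move: le4; rewrite /d4 ler_pdivlMr ?mulr_gt0//; apply: le_trans.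
    have -> : dl * (2 * B * (comm_const + 1)) = comm_const * (2 * B) * dl + 2 * B * dl by ring.
    by rewrite lerDl !mulr_ge0// ltW.
  apply: le_trans Tr; apply: Lq_le => //; first exact: (T_meas Top ri).
  by apply: aeW => x; rewrite normr_id.
have mcm := comm_meas bi Top gb.
have mTd : measurable_fun setT (fun x => `|T (fun x => r x - Pi N g x) x|).
  by apply: measurableT_comp => //; exact: (T_meas Top (itgB ri Pii)).
have mA1 : measurable [set x | t / 2 < `|h x - comm g x|].
  by apply: meas_lt_set => //; apply: measurableT_comp => //; exact: measurable_funB.
have mA2 := meas_lt_set (measurable_cst (t / 2)) mTd.
have mA : measurable [set x | Rr x + `|T r x| + t < `|h x|].
  by apply: meas_lt_set => //; apply: measurable_funD => //; exact: measurable_funD.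
rewrite [leRHS](_ : t = t / 2 + t / 2); last by field.
apply: le_trans (lerD p1 p2); apply: Pr_ae_U => //.
have tr : {ae P, forall x, `|T (Pi N g) x| <= `|T r x| + `|T (fun x => r x - Pi N g x) x|}.
  have io : itg (fun x => - (r x - Pi N g x)) by apply: itgN; exact: itgB.
  have e1 : (fun x => r x + - (r x - Pi N g x)) = Pi N g by apply/funext => x; ring.
  have := T_add Tsub ri io; rewrite e1 => k1.
  by apply: filterS2 k1 (T_opp Tsub (itgB ri Pii)) => x k2 k3; rewrite (le_trans k2)// lerD2l.
apply: filterS2 gR tr => x h1 h2 /= h3.
have [k1|k1] := ltP (t / 2) `|h x - comm g x|; [by left|right].
rewrite ltNge; apply/negP => k2; move: h3; apply/negP; rewrite -leNgt.
have c0 : 0 <= comm g x by exact: field_ge0.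
have := ler_distD (comm g x) (h x) 0; rewrite !subr0 (ger0_norm c0); lra.
Qed.

Lemma commutator_exists : (forall s : R, 0 < s -> exists N g, [/\ bdd g, mF N g & (H1_dist f g <= s%:E)%E]) ->
  exists h, is_abs_commutator P F T b f h.
Proof.
move=> fdense.
pose r k : R := (2 ^+ k)^-1.
have r0 k : 0 < r k by rewrite invr_gt0 exprn_gt0.
have Hd k : {dl : R | 0 < dl /\ forall N M g u, bdd g -> mF N g -> bdd u -> mF M u ->
    (H1_norm P (mart (fun x => g x - u x)%R) <= dl%:E)%E ->
    Pr [set x | r k < `|comm g x - comm u x|] <= r k}.
  by apply: cid; have [dl d0 H] := comm_close Ffil bi Top Tsub T_comm_small (r0 k) (r0 k); exists dl.
pose dl k := sval (Hd k).
have dl0 k : 0 < dl k by case: (svalP (Hd k)).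
(* Nonincreasing by the first minimum and tending to 0 with [r k]; since
   [2 (dl k / 4 + dl k / 4) = dl k], consecutive approximants are close enough for the Cauchy
   criterion. *)
pose a := fix a k := if k is j.+1 then Num.min (a j) (Num.min (dl k / 4) (r k)) else Num.min (dl 0%N / 4) (r 0%N).
have a0 k : 0 < a k by elim: k => [|k IH] /=; rewrite !lt_min ?IH r0 !divr_gt0.
have adl k : a k <= dl k / 4 by case: k => [|k] /=; rewrite !ge_min lexx ?orbT.
have aS k : a k.+1 <= a k by rewrite /= ge_min lexx.
have ar k : a k <= r k by case: k => [|k] /=; rewrite !ge_min lexx !orbT.
have H k : {Ng : nat * (Om -> R) | [/\ bdd Ng.2, mF Ng.1 Ng.2 & (H1_dist f Ng.2 <= (a k)%:E)%E]}.
  by apply: cid; have [N [g h]] := fdense _ (a0 k); exists (N, g).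
pose N k := (sval (H k)).1; pose g k := (sval (H k)).2.
have gb k : bdd (g k) by case: (svalP (H k)).
have mg k : mF (N k) (g k) by case: (svalP (H k)).
have ga k : (H1_dist f (g k) <= (a k)%:E)%E by case: (svalP (H k)).
have mc k : measurable_fun setT (comm (g k)) by exact: (comm_meas bi Top (gb k)).
have [|h mh hh] := @cauchy_in_prob _ _ _ P _ mc.
  move=> k; have [_ close] := svalP (Hd k).
  apply: (close _ _ _ _ (gb k.+1) (mg k.+1) (gb k) (mg k)).
  have := H1_dist_sub Ffil fi (bdd_itg (gb k.+1)) (bdd_itg (gb k)) (ga k.+1) (ga k).
  by move/le_trans; apply; rewrite lee_fin -/(dl k); have := aS k; have := adl k; lra.
have rcv (c : R) : (fun k => (c * r k)%:E) @ \oo --> (0 : \bar R)%E.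
  apply: cvg_EFin; first exact: nearW.
  rewrite (_ : _ \o _ = geometric c 2^-1).
    by apply: cvg_geometric; rewrite ger0_norm ?invr_ge0// invf_lt1// ltr1n.
  by apply/funext => k /=; rewrite /r exprVn.
exists h; split => //; exists g, (fun k => comm (g k)); split.
- by move=> k; apply/Lfun2P; exact: bdd_L2.
- apply: (squeeze_cvge _ (cvg_cst 0%E) (rcv 1)); apply: nearW => k.
  by rewrite H1_norm_ge0/= mul1r; apply: (le_trans (ga k)); rewrite lee_fin.
- move=> k; apply: (field_abs_commutator_L2 Top Tsub (bu_itg bi (gb k)) (bdd_itg (gb k))).
  exact: itg_meas bi.
move=> s s0; apply: (squeeze_cvge _ (cvg_cst 0%E) (rcv 2)).
have : \forall k \near \oo, `|0 - 2 * r k| < s.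
  by have := rcv 2 => /fine_cvgP[_] /cvgrPdist_lt /(_ _ s0).
apply: filterS => k hk; rewrite measure_ge0/=.
have mm : measurable_fun setT (fun x => `|comm (g k) x - h x|).
  by apply: measurableT_comp => //; exact: measurable_funB.
have mA := meas_le_set (measurable_cst s) mm.
rewrite (Pr_fin P mA) lee_fin; apply: le_trans (hh k); apply: Pr_le => //.
  by apply: meas_lt_set => //; apply: measurableT_comp => //; exact: measurable_funB.
move=> x /= sx; rewrite distrC in sx; apply: lt_le_trans sx.
by move: hk; rewrite sub0r normrN; apply: le_lt_trans; exact: ler_norm.
Qed.

End class_K_commutator.

Theorem theorem1p4 (R : realType) (d : measure_display) (Om : measurableType d)
    (P : probability Om R) (F : nat -> set (set Om)) (p q : R)
    (T : (Om -> R) -> (Om -> R)) (b : Om -> R) :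
  measure_is_complete P -> filtration F ->
  1 <= p -> 1 <= q ->
  class_K P F p q T -> BMO P F p b ->
  exists2 C : R, 0 < C &
    forall f e : nat -> Om -> R, H1b P F p b f e ->
      (exists h, is_abs_commutator P F T b f h) /\
      (forall h, is_abs_commutator P F T b f h ->
         (Lq_norm P q h <= C%:E * H1b_norm P F p b f e)%E).
Proof.
move=> _ Ffil p1 q1 [[Top Tsub _] [[C1 C10 TH1] Tweak [C2 C20 [Tatom Tjump]]]] bBMO.
have Tmc := weak_meas_continuous (lt_le_trans ltr01 q1) Top Tweak.
have [/Lfun1P bi bfin] := bBMO.
have bn0 : (0 <= BMO_norm P F p b)%E.
  by apply: le_trans (poweR_ge0 _ _) (ereal_sup_ubound _); exists 0%N.
pose Bn := fine (BMO_norm P F p b).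
have bE : BMO_norm P F p b = Bn%:E by rewrite fineK// ge0_fin_numE.
have Bn0 : 0 <= Bn by rewrite -lee_fin -bE.
have basic (B : R) (B0 : 0 < B) (BnB : Bn <= B) := bmo_basic Ffil p1 B0 bi
  (eq_ind_r (fun x => (x <= B%:E)%E) (BnB : (Bn%:E <= B%:E)%E) bE).
(* [2 * comm_const + 840 C1] covers the coefficient of [B beta], [2 C1] that of [A], and 1 makes [C]
   positive. *)
pose C := 2 * comm_const C1 C2 + 842 * C1 + 1.
have cc0 := comm_const_ge0 (ltW C10) (ltW C20).
have C0 : 0 < C.
  have h1 := mulr_ge0 (ler0n R 2) cc0; have h2 := mulr_ge0 (ler0n R 842) (ltW C10).
  exact: ltr_wpDl (addr_ge0 h1 h2) ltr01.
exists C => // f e [[fm ff] ec en].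
have fi k : itg P (f k) by apply/Lfun1P; case: (fm k).
have fb0 := H1_norm_ge0 P f.
pose beta := fine (H1_norm P f).
have fE : H1_norm P f = beta%:E by rewrite fineK// ge0_fin_numE.
have beta0 : 0 <= beta by rewrite -lee_fin -fE.
have e0 : (0 <= 'N[P]_1[commutator_max e])%E by exact: Lnorm_ge0.
have efin : ('N[P]_1[commutator_max e] < +oo)%E.
  apply: le_lt_trans en; rewrite /H1b_norm leeDr// fE bE -EFinM lee_fin.
  exact: mulr_ge0.
pose A := fine ('N[P]_1[commutator_max e])%E.
have eE : ('N[P]_1[commutator_max e] = A%:E)%E by rewrite fineK// ge0_fin_numE.
have A0 : 0 <= A by rewrite -lee_fin -eE.
have Bn1 : 0 < Bn + 1 by rewrite ltr_wpDl.
have bB1 : (BMO_norm P F p b <= (Bn + 1)%:E)%E by rewrite bE lee_fin lerDl.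
split.
  (* For existence any bound of the norm does, and [Bn + 1] is positive. The approximants are read
     off the commutator of [E 0], which membership in [H_1^b] provides. *)
  apply: (commutator_exists Ffil q1 Top Tsub Tmc (ltW C10) TH1 Bn1 bi (ltW C20) bBMO bB1
    (basic _ Bn1 _) Tatom Tjump fi) => // [|s s0]; first by rewrite lerDl.
  exact: nice_dense fi (ec 0%N) s0.
move=> h hcomm.
have -> : H1b_norm P F p b f e = (beta * Bn + A)%:E by rewrite /H1b_norm fE bE eE.
rewrite -EFinM; apply/lee_addgt0Pr => t t0; rewrite -EFinD.
have Cb0 : 0 < C * (beta + 1) by rewrite mulr_gt0// ltr_wpDl.
(* [Bn] may be 0, while the estimates divide by [B]; the excess over [Bn] costs at most [t], which
   is arbitrary. *)
pose B := Bn + t / (C * (beta + 1)).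
have eta0 : 0 < t / (C * (beta + 1)) by rewrite divr_gt0.
have B0 : 0 < B by rewrite ltr_wpDl.
have BnB : Bn <= B by rewrite lerDl ltW.
have bB : (BMO_norm P F p b <= B%:E)%E by rewrite bE lee_fin.
have fb : (H1_norm P f <= beta%:E)%E by rewrite fE.
have eA : ('N[P]_1[commutator_max e] <= A%:E)%E by rewrite eE.
apply: (le_trans (commutator_bound Ffil q1 Top Tsub Tmc (ltW C10) TH1 B0 bi (ltW C20) bBMO bB
  (basic _ B0 BnB) Tatom Tjump fi fb beta0 A0 eA ec hcomm)).
rewrite lee_fin.
have BC : C * (B * beta) <= C * (beta * Bn) + t.
  have -> : C * (B * beta) = C * (beta * Bn) + t * (C * beta / (C * (beta + 1))).
    by rewrite /B; set z := (C * (beta + 1))^-1; ring.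
  by rewrite lerD2l ler_piMr ?(ltW t0)// ler_pdivrMr// mul1r ler_pM2l// lerDl.
have BB0 := mulr_ge0 (ltW B0) beta0.
have l1 : comm_const C1 C2 * (B * (2 * beta)) + C1 * (2 * (A + 420 * B * beta)) <= C * (B * beta + A).
  rewrite -subr_ge0.
  have -> : C * (B * beta + A) - (comm_const C1 C2 * (B * (2 * beta)) + C1 * (2 * (A + 420 * B * beta))) =
    (2 * C1 + 1) * (B * beta) + (2 * comm_const C1 C2 + 840 * C1 + 1) * A by rewrite /C; ring.
  have h1 := mulr_ge0 (ler0n R 2) cc0; have h2 := mulr_ge0 (ler0n R 840) (ltW C10).
  have h3 := mulr_ge0 (ler0n R 2) (ltW C10).
  exact: addr_ge0 (mulr_ge0 (addr_ge0 h3 ler01) BB0) (mulr_ge0 (addr_ge0 (addr_ge0 h1 h2) ler01) A0).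
apply: (le_trans l1); rewrite !mulrDr addrAC lerD2r; exact: BC.
Qed.
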